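(* Let $k\in\{1,\dots,\ell\}$. \begin{enumerate} \item For every $d_k\in(d^{(k)}_{\min},\gamma_X)$, $(\overline{r}^{(k)}(d_k),d^{(k)}_k(d_k),\dots,d^{(k)}_\ell(d_k))\in\mathcal{RD}_k$. \item For every $(r,d_k,\dots,d_\ell)\in\mathcal{RD}_k$ with $d_k\in(d^{(k)}_{\min},\gamma_X)$, we have $r\ge\overline{r}^{(k)}(d_k)$ provided either of the following holds: \begin{enumerate} \item[i)] $\rho_S\ge0$ and $(k-1)\lambda^2_{X,2}(\lambda^{(k)}_{S,1})^2\mu^{(k)}(\mu^{(k)}-1)+k(\lambda^{(k)}_{X,1})^2\lambda^2_{S,2}\ge0$, where \[ \mu^{(k)}=\frac{\lambda_{S,2}-\lambda_{S,2}(\lambda_{S,2}+\lambda^{(k)}_Q)^{-1}\lambda_{S,2}}{\lambda^{(k)}_{S,1}-\lambda^{(k)}_{S,1}(\lambda^{(k)}_{S,1}+\lambda^{(k)}_Q)^{-1}\lambda^{(k)}_{S,1}}; \] \item[ii)] $\rho_S\le0$ and $(\lambda^{(k)}_{X,1})^2\lambda^2_{S,2}\nu^{(k)}(\nu^{(k)}-1)+k\lambda^2_{X,2}(\lambda^{(k)}_{S,1})^2\ge0$, where \[ \nu^{(k)}=\frac{\lambda^{(k)}_{S,1}-\lambda^{(k)}_{S,1}(\lambda^{(k)}_{S,1}+\lambda^{(k)}_Q)^{-1}\lambda^{(k)}_{S,1}}{\lambda_{S,2}-\lambda_{S,2}(\lambda_{S,2}+\lambda^{(k)}_Q)^{-1}\lambda_{S,2}}.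 \] \end{enumerate} \item For every $j\in\{k,\dots,\ell\}$ and every $(r,d_k,\dots,d_\ell)\in\mathcal{RD}_k$ with $d_k\in(d^{(k)}_{\min},\gamma_X)$ and $r=\overline{r}^{(k)}(d_k)$, we have $d_j\ge d^{(k)}_j(d_k)$ provided either of the following holds: \begin{enumerate} \item[(a)] condition i) above; \item[(b)] $\rho_S\le0$, $\lambda^{(j)}_{S,1}>0$, and \[ (\nu^{(k,j)}+(k-1))(\lambda^{(k)}_{X,1})^2\lambda^2_{S,2}(\nu^{(k)})^2+(k-1)(\nu^{(k,j)}-\nu^{(k)})\lambda^2_{X,2}(\lambda^{(k)}_{S,1})^2\ge0, \] \[ (\nu^{(k,j)}-1)(\lambda^{(k)}_{X,1})^2\lambda^2_{S,2}(\nu^{(k)})^2+((k-1)\nu^{(k,j)}+\nu^{(k)})\lambda^2_{X,2}(\lambda^{(k)}_{S,1})^2\ge0, \] where $\nu^{(k)}$ is as in ii) and \[ \nu^{(k,j)}=\frac{\lambda^{(j)}_{S,1}-\lambda^{(j)}_{S,1}(\lambda^{(j)}_{S,1}+\lambda^{(k)}_Q)^{-1}\lambda^{(j)}_{S,1}}{\lambda_{S,2}-\lambda_{S,2}(\lambda_{S,2}+\lambda^{(k)}_Q)^{-1}\lambda_{S,2}}. \] \end{enumerate} \end{enumerate}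
   Context: Fix an integer $\ell\geq 2$. Let $X=(X_1,\dots,X_\ell)^T$ (target signals) and $Z=(Z_1,\dots,Z_\ell)^T$ (noises) be mutually independent zero-mean Gaussian random vectors, and $S=X+Z$ (observed sources). $\Gamma_X$ is the $\ell\times\ell$ covariance matrix of $X$ with all diagonal entries $\gamma_X$ and all off-diagonal entries $\rho_X\gamma_X$; $\Gamma_Z$ likewise with $\gamma_Z,\rho_Z$; and $\Gamma_S=\Gamma_X+\Gamma_Z$ has diagonal entries $\gamma_S$ and off-diagonal entries $\rho_S\gamma_S$. These matrices are assumed positive semidefinite, and $\gamma_X>0$. For $j\in\{1,\dots,\ell\}$ set $\lambda^{(j)}_{X,1}=(1+(j-1)\rho_X)\gamma_X$, $\lambda_{X,2}=(1-\rho_X)\gamma_X$, $\lambda^{(j)}_{Z,1}=(1+(j-1)\rho_Z)\gamma_Z$, $\lambda_{Z,2}=(1-\rho_Z)\gamma_Z$, $\lambda^{(j)}_{S,1}=(1+(j-1)\rho_S)\gamma_S$, $\lambda_{S,2}=(1-\rho_S)\gamma_S$. Let $\{(X(t),Z(t),S(t))\}_{t\ge1}$ be i.i.d. with each $(X(t),Z(t),S(t))$ distributed as $(X,Z,S)$; write $S_i^n=(S_i(1),\dots,S_i(n))$. Logarithms are natural. Achievable region: for $k\in\{1,\dots,\ell\}$, a tuple $(r,d_k,\dots,d_\ell)$ is achievable if for every $\epsilon>0$ there exist $n$ and encoding functions $\phi^{(n)}_i:\mathbb{R}^n\to\mathcal{C}^{(n)}_i$ (finite sets), $i=1,\dots,\ell$,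 such that $\frac{1}{kn}\sum_{i\in\mathcal{A}}\log|\mathcal{C}^{(n)}_i|\le r+\epsilon$ for every $\mathcal{A}\subseteq\{1,\dots,\ell\}$ with $|\mathcal{A}|=k$, and $\frac{1}{|\mathcal{A}|n}\sum_{i\in\mathcal{A}}\sum_{t=1}^n\mathbb{E}[(X_i(t)-\hat X_{i,\mathcal{A}}(t))^2]\le d_{|\mathcal{A}|}+\epsilon$ for every $\mathcal{A}\subseteq\{1,\dots,\ell\}$ with $|\mathcal{A}|\ge k$, where $\hat X_{i,\mathcal{A}}(t)=\mathbb{E}[X_i(t)\mid(\phi^{(n)}_{i'}(S^n_{i'}))_{i'\in\mathcal{A}}]$. The set of achievable tuples is $\mathcal{RD}_k$. For $j\in\{1,\dots,\ell\}$: $d^{(j)}_{\min}=\frac1j d^{(j)}_{\min,1}+\frac{j-1}{j}d_{\min,2}$, where $d^{(j)}_{\min,1}=0$ if $\lambda^{(j)}_{S,1}=0$ and $=\lambda^{(j)}_{X,1}\lambda^{(j)}_{Z,1}/\lambda^{(j)}_{S,1}$ otherwise, and $d_{\min,2}=0$ if $\lambda_{S,2}=0$ and $=\lambda_{X,2}\lambda_{Z,2}/\lambda_{S,2}$ otherwise. For $k\in\{1,\dots,\ell\}$ and $d_k\in(d^{(k)}_{\min},\gamma_X)$, $\lambda^{(k)}_Q$ is the unique positive number satisfying \[ \frac{\lambda^{(k)}_{X,1}(\lambda^{(k)}_{Z,1}+\lambda^{(k)}_Q)}{k(\lambda^{(k)}_{S,1}+\lambda^{(k)}_Q)}+\frac{(k-1)\lambda_{X,2}(\lambda_{Z,2}+\lambda^{(k)}_Q)}{k(\lambda_{S,2}+\lambda^{(k)}_Q)}=d_k,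 \] and \[ \overline{r}^{(k)}(d_k)=\frac{1}{2k}\log\frac{(\lambda^{(k)}_{S,1}+\lambda^{(k)}_Q)(\lambda_{S,2}+\lambda^{(k)}_Q)^{k-1}}{(\lambda^{(k)}_Q)^k}, \] \[ d^{(k)}_j(d_k)=\frac{\lambda^{(j)}_{X,1}(\lambda^{(j)}_{Z,1}+\lambda^{(k)}_Q)}{j(\lambda^{(j)}_{S,1}+\lambda^{(k)}_Q)}+\frac{(j-1)\lambda_{X,2}(\lambda_{Z,2}+\lambda^{(k)}_Q)}{j(\lambda_{S,2}+\lambda^{(k)}_Q)},\quad j=k,\dots,\ell. \] *)

(* Defs.v *)
From HB Require Import structures.
From mathcomp Require Import all_boot all_order all_algebra.
From mathcomp Require Import all_classical all_reals all_analysis.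
Set Implicit Arguments. Unset Strict Implicit. Unset Printing Implicit Defensive.
Import Order.TTheory GRing.Theory Num.Theory.
Local Open Scope classical_set_scope.
Local Open Scope ring_scope.

Definition eqcov (R : realType) (l : nat) (g rho : R) : 'M[R]_l :=
  \matrix_(i, j) (if i == j then g else rho * g).

Definition psd (R : realType) (l : nat) (M : 'M[R]_l) : Prop :=
  forall v : 'cV[R]_l, 0 <= (v^T *m M *m v) ord0 ord0.

Definition lam1 (R : realType) (g rho : R) (j : nat) : R := (1 + (j%:R - 1) * rho) * g.
Definition lam2 (R : realType) (g rho : R) : R := (1 - rho) * g.

Definition dmin1 (R : realType) (gX rX gZ rZ gS rS : R) (j : nat) : R :=
  if lam1 gS rS j == 0 then 0
  else lam1 gX rX j * lam1 gZ rZ j / lam1 gS rS j.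
Definition dmin2 (R : realType) (gX rX gZ rZ gS rS : R) : R :=
  if lam2 gS rS == 0 then 0
  else lam2 gX rX * lam2 gZ rZ / lam2 gS rS.
Definition dmin (R : realType) (gX rX gZ rZ gS rS : R) (j : nat) : R :=
  j%:R^-1 * dmin1 gX rX gZ rZ gS rS j + (j%:R - 1) / j%:R * dmin2 gX rX gZ rZ gS rS.

Definition dfun (R : realType) (gX rX gZ rZ gS rS : R) (j : nat) (q : R) : R :=
  lam1 gX rX j * (lam1 gZ rZ j + q) / (j%:R * (lam1 gS rS j + q))
  + (j%:R - 1) * lam2 gX rX * (lam2 gZ rZ + q) / (j%:R * (lam2 gS rS + q)).

(* lambda^{(k)}_Q : the unique positive q with dfun k q = dk *)
Definition lamQ (R : realType) (gX rX gZ rZ gS rS : R) (k : nat) (dk : R) : R :=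
  xget 0 [set q : R | 0 < q /\ dfun gX rX gZ rZ gS rS k q = dk].

Definition rbar (R : realType) (gX rX gZ rZ gS rS : R) (k : nat) (dk : R) : R :=
  let q := lamQ gX rX gZ rZ gS rS k dk in
  (2 * k%:R)^-1 * ln ((lam1 gS rS k + q) * (lam2 gS rS + q) ^+ k.-1 / q ^+ k).

Definition dkj (R : realType) (gX rX gZ rZ gS rS : R) (k j : nat) (dk : R) : R :=
  dfun gX rX gZ rZ gS rS j (lamQ gX rX gZ rZ gS rS k dk).

Definition shrink (R : realType) (a q : R) : R := a - a * (a + q)^-1 * a.

Definition mu_k (R : realType) (gX rX gZ rZ gS rS : R) (k : nat) (dk : R) : R :=
  let q := lamQ gX rX gZ rZ gS rS k dk in
  shrink (lam2 gS rS) q / shrink (lam1 gS rS k) q.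
Definition nu_k (R : realType) (gX rX gZ rZ gS rS : R) (k : nat) (dk : R) : R :=
  let q := lamQ gX rX gZ rZ gS rS k dk in
  shrink (lam1 gS rS k) q / shrink (lam2 gS rS) q.
Definition nu_kj (R : realType) (gX rX gZ rZ gS rS : R) (k j : nat) (dk : R) : R :=
  let q := lamQ gX rX gZ rZ gS rS k dk in
  shrink (lam1 gS rS j) q / shrink (lam2 gS rS) q.

Definition cond_i (R : realType) (gX rX gZ rZ gS rS : R) (k : nat) (dk : R) : Prop :=
  let mu := mu_k gX rX gZ rZ gS rS k dk in
  0 <= rS /\
  0 <= (k%:R - 1) * lam2 gX rX ^+ 2 * lam1 gS rS k ^+ 2 * mu * (mu - 1)
       + k%:R * lam1 gX rX k ^+ 2 * lam2 gS rS ^+ 2.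

Definition cond_ii (R : realType) (gX rX gZ rZ gS rS : R) (k : nat) (dk : R) : Prop :=
  let nu := nu_k gX rX gZ rZ gS rS k dk in
  rS <= 0 /\
  0 <= lam1 gX rX k ^+ 2 * lam2 gS rS ^+ 2 * nu * (nu - 1)
       + k%:R * lam2 gX rX ^+ 2 * lam1 gS rS k ^+ 2.

Definition cond_b (R : realType) (gX rX gZ rZ gS rS : R) (k j : nat) (dk : R) : Prop :=
  let nu := nu_k gX rX gZ rZ gS rS k dk in
  let nuj := nu_kj gX rX gZ rZ gS rS k j dk in
  rS <= 0 /\ 0 < lam1 gS rS j /\
  0 <= (nuj + (k%:R - 1)) * lam1 gX rX k ^+ 2 * lam2 gS rS ^+ 2 * nu ^+ 2
       + (k%:R - 1) * (nuj - nu) * lam2 gX rX ^+ 2 * lam1 gS rS k ^+ 2 /\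
  0 <= (nuj - 1) * lam1 gX rX k ^+ 2 * lam2 gS rS ^+ 2 * nu ^+ 2
       + ((k%:R - 1) * nuj + nu) * lam2 gX rX ^+ 2 * lam1 gS rS k ^+ 2.

Section Prob.
Context {dT : measure_display} {Omega : measurableType dT} {R : realType}.
Variable P : probability Omega R.

Definition sigma_of (I : Type) (V : I -> Omega -> R) : set (set Omega) :=
  <<s [set A | exists i B, measurable B /\ A = V i @^-1` B] >>.

Definition indep_family (I : eqType) (F : I -> set (set Omega)) : Prop :=
  forall (J : seq I) (E : I -> set Omega), uniq J ->
    (forall j, j \in J -> F j (E j)) ->
    P (\big[setI/setT]_(j <- J) E j) = (\prod_(j <- J) P (E j))%E.

(* V is a zero-mean Gaussian random vector with covariance G, defined through
   its characteristic function E[exp(i a.V)] = exp(-a^T G a / 2). *)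
Definition gaussian_vec (l : nat) (V : 'I_l -> Omega -> R) (G : 'M[R]_l) : Prop :=
  (forall i, measurable_fun setT (V i)) /\
  forall a : 'I_l -> R,
    (\int[P]_w (cos (\sum_i a i * V i w))%:E
       = (expR (- (\sum_i \sum_j a i * a j * G i j) / 2))%:E)%E /\
    (\int[P]_w (sin (\sum_i a i * V i w))%:E = 0)%E.

Definition borelRn (n : nat) : set (set ('I_n -> R)) :=
  <<s [set A | exists B : 'I_n -> set R,
          (forall t, measurable (B t)) /\ A = [set f | forall t, B t (f t)]] >>.

Variables (l : nat) (X Z : nat -> 'I_l -> Omega -> R).


Section Code.
Variables (n : nat) (M : 'I_l -> nat)
          (phi : forall i : 'I_l, ('I_n -> R) -> 'I_(M i)).

(* S_i^n(w) = (X_i(t) w + Z_i(t) w)_{t < n} (time indices start at 0).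
   the event "the codewords of the encoders in A coincide with those at w" *)
Definition code_event (A : {set 'I_l}) (w : Omega) : set Omega :=
  [set w' | forall i', i' \in A -> phi i' (fun t : 'I_n => X t i' w' + Z t i' w')
                             = phi i' (fun t : 'I_n => X t i' w + Z t i' w)].

(* \hat X_{i,A}(t) = E[X_i(t) | (phi_i'(S_i'^n))_{i' in A}]; the conditioning
   variable is discrete (finitely many values), so this is the elementary
   conditional expectation E[X 1_{C = c}] / P(C = c) evaluated at c = C(w). *)
Definition Xhat (A : {set 'I_l}) (i : 'I_l) (t : nat) (w : Omega) : R :=
  fine (\int[P]_(w' in code_event A w) (X t i w')%:E)%E
  / fine (P (code_event A w)).

Definition mse (A : {set 'I_l}) (i : 'I_l) (t : nat) : \bar R :=
  (\int[P]_w ((X t i w - Xhat A i t w) ^+ 2)%:E)%E.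
End Code.

(* (r, d_k, ..., d_l) \in RD_k ; only d j for k <= j <= l is used *)
Definition RD (k : nat) (r : R) (d : nat -> R) : Prop :=
  forall eps : R, 0 < eps ->
  exists (n : nat) (M : 'I_l -> nat)
         (phi : forall i : 'I_l, ('I_n -> R) -> 'I_(M i)),
    (0 < n)%N /\
    (forall i c, borelRn (phi i @^-1` [set c])) /\
    (forall A : {set 'I_l}, #|A| = k ->
       (k * n)%:R^-1 * (\sum_(i in A) ln (M i)%:R) <= r + eps) /\
    (forall A : {set 'I_l}, (k <= #|A|)%N ->
       ((#|A| * n)%:R^-1)%:E *
         (\sum_(i in A) \sum_(t < n) mse phi A i t)%E
       <= (d #|A| + eps)%:E)%E.

End Prob.

(* Main.v *)
(** Achievability. The quantised sources are passed through the test channel V_i = S_i + N(0, lambda_Q)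
    by a likelihood encoder acting on a random codebook whose words carry random colours (binning);
    only colours are sent.  A decoder looks for the unique tuple of codewords that is typical and has
    the right colours; the rate of a subset of b encoders among k is governed by a sum of b conditional
    differential entropies, and exchangeability makes b = k the worst case.

    Converse. For theta not larger than the eigenvalues of Gamma_S, write S = Y + N with N white of
    variance theta independent of Y.  Given Y the codewords are independent, so the log-cardinalities
    dominate an information term for Y plus a sum of single-encoder terms for the N_i.  Gaussian test
    densities bound these from below by the energies E1, E2 of the estimates of S (along the all-ones
    vector and its complement) and by the energies e_i of the estimates of N_i, while a correlation
    inequality bounds e_i below by E1 and E2.  Conditions i), ii) and (b) say exactly that suitable
    nonnegative weights combine these inequalities, with theta = lambda_{S,2}, lambda_{S,1}^(k) and
    lambda_{S,1}^(j) respectively.  At the minimal rate the e_i are nearly determined; averaging over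
    cyclic windows of k encoders among j and using the correlation inequality for all j encoders bounds
    d_j.  If lambda_{S,2} = 0 no theta > 0 is available for j > 1: all encoders then see the same source,
    the codeword entropies given Y are compared by Shearer's inequality, and theta tends to 0. *)

Require Import Defs.
From HB Require Import structures.
From mathcomp Require Import all_boot all_order all_algebra.
From mathcomp Require Import all_classical all_reals all_analysis.
From mathcomp Require Import measurable_realfun lebesgue_integral_under.
From mathcomp Require Import ring lra.
Set Implicit Arguments. Unset Strict Implicit. Unset Printing Implicit Defensive.
Import Order.TTheory GRing.Theory Num.Theory.
Import numFieldNormedType.Exports.
Local Open Scope classical_set_scope.
Local Open Scope ring_scope.

(** Gaussian vectors are given only by characteristic functions, so no density, conditional law or
    differential entropy of the sources is ever formed. Equality of weighted cosine moments yields
    equality of means [E[h; V in E]], and conditioning on codewords becomes a finite family of such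
    numbers. The split S = Y + N is never realised next to S: Y is a linear image of S on one copy
    of the probability space, N is made on a second copy from values of one signal component at
    distinct times, and only the law of Y + N is compared with that of S. Information terms come
    from Young's inequality for [x ln x], tested with Gaussian densities whose parameters give
    equality for the test channel. One of them carries an extra factor x; letting x tend to 1 after
    the coding slack has vanished is what pins down the e_i at the minimal rate. For achievability,
    source and test channel are quantised with mesh 1/(N+1); the divergent [- ln (mesh N)] occurs
    both in the entropy of the kernel and in the prediction cross-entropies, and cancels in the rate
    conditions. *)

Local Notation indep_signal_noise P X Z := (forall t : nat, indep_family P
  (fun b : bool => if b then sigma_of (X t) else sigma_of (Z t))).
Local Notation indep_times P X Z := (indep_family P
  (fun t : nat => sigma_of (fun p : (_ + _)%type => match p with inl i => X t i | inr i => Z t i end))).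

Lemma le_of_eq (disp : Order.disp_t) (T : porderType disp) (x y : T) : x = y -> (x <= y)%O.
Proof. by move=> ->. Qed.

(** * Means and uniqueness of laws from trigonometric moments *)

Section Mean.
Context {R : realType} {d : measure_display} {T : measurableType d}.
Variable P : probability T R.
Implicit Types (f g h : T -> R).

Definition mean f : R := \int[P]_x f x.
Definition L1 f := P.-integrable setT (EFin \o f).

Lemma L1_meas f : L1 f -> measurable_fun setT f.
Proof. by case/integrableP => /measurable_EFinP. Qed.

Lemma L1_le f g : measurable_fun setT f -> L1 g -> (forall w, `|f w| <= g w) -> L1 f.
Proof.
move=> mf ig fg; apply: (le_integrable _ _ _ ig) => //.
  exact/measurable_EFinP.
move=> w _ /=; rewrite lee_fin; apply: (le_trans (fg w)); exact: ler_norm.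
Qed.

Lemma L1_cst c : L1 (fun=> c).
Proof. exact: finite_measure_integrable_cst. Qed.

Lemma L1_bnd c f : measurable_fun setT f -> (forall w, `|f w| <= c) -> L1 f.
Proof. by move=> mf fc; apply: (L1_le mf (L1_cst c)). Qed.

Lemma L1D f g : L1 f -> L1 g -> L1 (fun w => f w + g w).
Proof. by move=> i j; apply: eq_integrable (integrableD measurableT i j). Qed.

Lemma L1N f : L1 f -> L1 (fun w => - f w).
Proof. by move=> i; apply: eq_integrable (integrableN i). Qed.

Lemma L1B f g : L1 f -> L1 g -> L1 (fun w => f w - g w).
Proof. by move=> i j; apply: L1D => //; apply: L1N. Qed.

Lemma L1Z c f : L1 f -> L1 (fun w => c * f w).
Proof. by move=> i; apply: eq_integrable (integrableZl measurableT c i). Qed.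

Lemma L1Zr c f : L1 f -> L1 (fun w => f w * c).
Proof. by move=> i; under eq_fun do rewrite mulrC; exact: L1Z. Qed.

Lemma L1_sum (I : Type) (s : seq I) (Q : pred I) (F : I -> T -> R) :
  (forall i, Q i -> L1 (F i)) -> L1 (fun w => \sum_(i <- s | Q i) F i w).
Proof.
move=> h; elim: s => [|i s ih].
  have -> : (fun w => \sum_(i <- [::] | Q i) F i w) = fun=> 0 by apply/funext => w; rewrite big_nil.
  exact: L1_cst.
have -> : (fun w => \sum_(j <- i :: s | Q j) F j w) =
    fun w => (if Q i then F i w else 0) + \sum_(j <- s | Q j) F j w.
  by apply/funext => w; rewrite big_cons; case: ifP; rewrite ?add0r.
apply: L1D => //; have [Qi|_] := boolP (Q i); [exact: h | exact: L1_cst].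
Qed.

Lemma L1_abs f : L1 f -> L1 (fun w => `|f w|).
Proof. by move=> i; apply: eq_integrable (integrable_norm i). Qed.

Lemma L1_Mb c f g : L1 f -> measurable_fun setT g -> (forall w, `|g w| <= c) ->
  L1 (fun w => f w * g w).
Proof.
move=> i mg gc; apply: (L1_le (g := fun w => `|f w| * c)).
- by apply: measurable_funM => //; exact: L1_meas.
- by apply: L1Zr; apply: L1_abs.
- by move=> w; rewrite normrM ler_wpM2l.
Qed.

Lemma L1_sq f g : measurable_fun setT f -> measurable_fun setT g ->
  L1 (fun w => f w ^+ 2) -> L1 (fun w => g w ^+ 2) -> L1 (fun w => f w * g w).
Proof.
move=> mf mg i j; apply: (L1_le (g := fun w => f w ^+ 2 + g w ^+ 2)).
- exact: measurable_funM.
- exact: L1D.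
- move=> w; rewrite normrM -[f w ^+ 2]real_normK ?num_real// -[g w ^+ 2]real_normK ?num_real//.
  by set a := `|f w|; set b := `|g w|; nra.
Qed.

Lemma L1_sq1 f : measurable_fun setT f -> L1 (fun w => f w ^+ 2) -> L1 f.
Proof.
move=> mf i; have := L1_sq mf (measurable_cst (1 : R)) i.
under [X in L1 X -> _]eq_fun do rewrite expr1n.
by move=> /(_ (L1_cst 1)); under [X in L1 X -> _]eq_fun do rewrite mulr1.
Qed.

Lemma eq_mean f g : f =1 g -> mean f = mean g.
Proof. by move=> fg; congr mean; apply/funext. Qed.

Lemma EFin_mean f : L1 f -> (mean f)%:E = (\int[P]_w (f w)%:E)%E.
Proof. by move=> i; rewrite /mean /Rintegral fineK//; exact: integrable_fin_num. Qed.

Lemma mean_cst c : mean (fun=> c) = c.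
Proof. by rewrite /mean Rintegral_cst//= probability_setT/= mulr1. Qed.

Lemma meanD f g : L1 f -> L1 g -> mean (fun w => f w + g w) = mean f + mean g.
Proof. by move=> i j; rewrite /mean RintegralD. Qed.

Lemma meanB f g : L1 f -> L1 g -> mean (fun w => f w - g w) = mean f - mean g.
Proof. by move=> i j; rewrite /mean RintegralB. Qed.

Lemma meanZ c f : L1 f -> mean (fun w => c * f w) = c * mean f.
Proof. by move=> i; rewrite /mean RintegralZl. Qed.

Lemma meanZr c f : L1 f -> mean (fun w => f w * c) = mean f * c.
Proof. by move=> i; rewrite /mean RintegralZr. Qed.

Lemma mean_sum (I : Type) (s : seq I) (Q : pred I) (F : I -> T -> R) :
  (forall i, Q i -> L1 (F i)) ->
  mean (fun w => \sum_(i <- s | Q i) F i w) = \sum_(i <- s | Q i) mean (F i).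
Proof.
move=> h; elim: s => [|i s ih].
  by under eq_mean do rewrite big_nil; rewrite mean_cst big_nil.
under eq_mean do rewrite big_cons; rewrite big_cons; case: ifP => Qi //.
by rewrite meanD ?ih//; [exact: h|exact: L1_sum].
Qed.

Lemma le_mean f g : L1 f -> L1 g -> (forall w, f w <= g w) -> mean f <= mean g.
Proof. by move=> i j fg; apply: le_Rintegral. Qed.

Lemma mean_ge0 f : (forall w, 0 <= f w) -> 0 <= mean f.
Proof. by move=> f0; apply: Rintegral_ge0. Qed.

Lemma mean_indic (A : set T) : measurable A -> mean \1_A = fine (P A).
Proof. by move=> mA; rewrite /mean /Rintegral integral_indic// setIT. Qed.

Lemma L1_indic (A : set T) : measurable A -> L1 \1_A.
Proof. by move=> mA; apply: integrable_indic. Qed.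

Lemma mean_dct (F : nat -> T -> R) f g : (forall n, measurable_fun setT (F n)) ->
  L1 g -> (forall n w, `|F n w| <= g w) ->
  (forall w, (fun n => F n w) @ \oo --> f w) ->
  L1 f /\ (fun n => mean (F n)) @ \oo --> mean f.
Proof.
move=> mF ig Fg Ff.
have mf : measurable_fun setT f.
  by apply: (measurable_fun_cvg (h := F)) => // w _; exact: Ff.
have [] := @dominated_convergence _ _ _ P _ measurableT (fun n => EFin \o F n)
   (EFin \o f) (EFin \o g).
- by move=> n; apply/measurable_EFinP.
- exact/measurable_EFinP.
- by apply/aeW => w _; apply/fine_cvgP; split; [exact: nearW | exact: Ff].
- exact: ig.
- by apply/aeW => w n _; rewrite /= lee_fin.
move=> i _ c; split=> //; apply: fine_cvg.
by rewrite fineK //; exact: integrable_fin_num.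
Qed.

End Mean.

Lemma eq_mean_law (R : realType) d1 d2 (T1 : measurableType d1) (T2 : measurableType d2)
  (P1 : probability T1 R) (P2 : probability T2 R) (f : T1 -> R) (g : T2 -> R) :
  measurable_fun setT f -> measurable_fun setT g ->
  (forall B, measurable B -> P1 (f @^-1` B) = P2 (g @^-1` B)) ->
  (L1 P1 f -> L1 P2 g) /\ (L1 P1 f -> mean P1 f = mean P2 g).
Proof.
move=> mf mg fg.
have key (h : R -> \bar R) : measurable_fun setT h -> (forall x, 0 <= h x)%E ->
    (\int[P1]_x h (f x) = \int[P2]_x h (g x))%E.
  move=> mh h0.
  have := ge0_integral_pushforward mf P1 measurableT mh (fun x _ => h0 x).
  have := ge0_integral_pushforward mg P2 measurableT mh (fun x _ => h0 x).
  rewrite !preimage_setT /= => <- <-.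
  by apply: eq_measure_integral => A mA _ /=; rewrite /pushforward; exact: fg.
have i12 : L1 P1 f -> L1 P2 g.
  move=> /integrableP[_ i]; apply/integrableP; split; first exact/measurable_EFinP.
  move: i; rewrite /= -(key (fun x => `|x%:E|%E))//.
  by apply: measurableT_comp => //; exact: measurableT_comp.
split=> // i; have j := i12 i; rewrite /mean /Rintegral.
rewrite [X in fine X = _]integralE [X in _ = fine X]integralE.
have Ep (U : Type) (h : U -> R) : (fun x => (h x)%:E)^\+%E = (fun x => maxe (h x)%:E 0)%E.
  by apply/funext => x; rewrite funeposE.
have En (U : Type) (h : U -> R) : (fun x => (h x)%:E)^\-%E = (fun x => maxe (- (h x)%:E) 0)%E.
  by apply/funext => x; rewrite funenegE.
rewrite !Ep !En (key (fun x => maxe x%:E 0)%E) ?(key (fun x => maxe (- x%:E) 0)%E)//.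
- by apply: measurable_maxe => //; exact: measurableT_comp.
- by move=> x; rewrite le_max lexx orbT.
- exact: measurable_maxe.
- by move=> x; rewrite le_max lexx orbT.
Qed.

Section MeanProd.
Context {R : realType} {d1 d2 : measure_display}.
Context {T1 : measurableType d1} {T2 : measurableType d2}.
Variables (P1 : probability T1 R) (P2 : probability T2 R).
Local Notation Q := ((P1 \x P2)%E : probability (T1 * T2)%type R).

Lemma L1_fst f : L1 P1 f -> L1 Q (fun z => f z.1) /\ mean Q (fun z => f z.1) = mean P1 f.
Proof.
move=> i; have mf := L1_meas i.
have m : measurable_fun setT (fun z : T1 * T2 => f z.1) by apply: measurableT_comp.
have h B : measurable B -> P1 (f @^-1` B) = Q ((fun z => f z.1) @^-1` B).
  move=> mB; have -> : (fun z : T1 * T2 => f z.1) @^-1` B = (f @^-1` B) `*` setT.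
    by apply/seteqP; split => [z|z []].
  rewrite /= product_measure1E//; last by rewrite -[X in measurable X]setTI; exact: mf.
  by rewrite -[LHS]mule1; congr (_ * _)%E; exact/esym/probability_setT.
by have [h1 h2] := eq_mean_law mf m h; split; [exact: h1|rewrite h2].
Qed.

Lemma L1_snd f : L1 P2 f -> L1 Q (fun z => f z.2) /\ mean Q (fun z => f z.2) = mean P2 f.
Proof.
move=> i; have mf := L1_meas i.
have m : measurable_fun setT (fun z : T1 * T2 => f z.2) by apply: measurableT_comp.
have h B : measurable B -> P2 (f @^-1` B) = Q ((fun z => f z.2) @^-1` B).
  move=> mB; have -> : (fun z : T1 * T2 => f z.2) @^-1` B = setT `*` (f @^-1` B).
    by apply/seteqP; split => [z|z []].
  rewrite /= product_measure1E//; last by rewrite -[X in measurable X]setTI; exact: mf.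
  by rewrite -[LHS]mul1e; congr (_ * _)%E; exact/esym/probability_setT.
by have [h1 h2] := eq_mean_law mf m h; split; [exact: h1|rewrite h2].
Qed.

Lemma mean_prod f g : L1 P1 f -> L1 P2 g ->
  L1 Q (fun z => f z.1 * g z.2) /\
  mean Q (fun z => f z.1 * g z.2) = mean P1 f * mean P2 g.
Proof.
move=> i j; have mf := L1_meas i; have mg := L1_meas j.
have m : measurable_fun setT (fun z : T1 * T2 => f z.1 * g z.2).
  by apply: measurable_funM; apply: measurableT_comp.
have iQ : L1 Q (fun z => f z.1 * g z.2).
  apply/integrable12ltyP; first exact/measurable_EFinP.
  have -> : (fun x => \int[P2]_y `|(EFin \o (fun z : T1 * T2 => f z.1 * g z.2)%R) (x, y)|)%E
    = (fun x => ((`|f x| * mean P2 (fun y => `|g y|))%:E))%R.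
    apply/funext => x; rewrite -meanZ ?EFin_mean//; last exact: L1_abs.
      by apply: eq_integral => y _; rewrite /= normrM.
    by apply: L1Z; exact: L1_abs.
  have k : L1 P1 (fun x => `|f x| * mean P2 (fun y => `|g y|)).
    by apply: L1Zr; exact: L1_abs.
  by rewrite -EFin_mean// ltry.
split=> //; rewrite {1}/mean /Rintegral -(integral12_prod_meas1 iQ).
rewrite -meanZr// /mean /Rintegral; congr fine; apply: eq_integral => x _.
by rewrite /fubini_F /= -EFin_mean ?meanZ//; exact: L1Z.
Qed.

End MeanProd.

Section SharpenPowers.
Variable R : realType.

Lemma cvg_natrMexpr (z : R) : 0 <= z < 1 -> (fun n => n%:R * z ^+ n) @ \oo --> (0 : R).
Proof.
move=> /andP[z0 z1]; pose w := Num.sqrt z.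
have w0 : 0 <= w by exact: sqrtr_ge0.
have w1 : w < 1 by rewrite -sqrtr1 ltr_sqrt.
have wz : z = w * w by rewrite -expr2 sqr_sqrtr.
(* One factor [w ^+ n] of [z ^+ n] absorbs n, because each of the first n terms of the geometric
   series is at least [w ^+ n]; the other factor tends to zero. *)
have b n : n%:R * w ^+ n * (1 - w) <= 1.
  suff : n%:R * w ^+ n * (1 - w) <= 1 - w ^+ n.
    by move/le_trans; apply; rewrite lerBlDr lerDl exprn_ge0.
  elim: n => [|n ih]; first by rewrite expr0 !mul0r subrr.
  rewrite -[n.+1%:R]natr1 exprS.
  have h1 : w * (n%:R * w ^+ n * (1 - w)) <= w * (1 - w ^+ n) by apply: ler_wpM2l.
  have h2 : w ^+ n.+1 <= 1 by rewrite exprn_ile1// ltW.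
  have h3 : 0 <= (1 - w) * (1 - w * w ^+ n) by rewrite mulr_ge0 ?subr_ge0 -?exprS// ltW.
  lra.
have c0 : (fun n => (1 - w)^-1 * w ^+ n) @ \oo --> (0 : R).
  rewrite -[X in _ --> X](mulr0 (1 - w)^-1); apply: cvgM; first exact: cvg_cst.
  by apply: cvg_expr; rewrite ger0_norm.
apply: (squeeze_cvgr _ (cvg_cst 0) c0).
apply: nearW => n; rewrite mulr_ge0 ?exprn_ge0//= wz exprMn mulrA.
rewrite ler_wpM2r ?exprn_ge0// -[leRHS]mul1r ler_pdivlMr ?subr_gt0//.
Qed.

(* With [y = (1 + cos x) / 2] this turns trigonometric polynomials into indicators of half-lines. *)
Lemma cvg_sharpen (th y : R) : 0 < th < 1 -> 0 <= y <= 1 ->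
  (fun n => (1 - y ^+ n) ^+ (Num.truncn (n%:R / th ^+ n)).+1) @ \oo --> ((y < th)%R%:R : R).
Proof.
(* The exponent lies between the scales of the two cases: [N n * y ^+ n] tends to 0 if y < th, where
   Bernoulli's inequality applies, and is at least n if y >= th, where the power is below
   [expR (- n)]. *)
move=> /andP[th0 th1] /andP[y0 y1]; pose N (n : nat) := (Num.truncn (n%:R / th ^+ n)).+1;
rewrite (_ : (fun n => _) = fun n => (1 - y ^+ n) ^+ N n)//.
have yn n : 0 <= y ^+ n <= 1 by rewrite exprn_ge0// exprn_ile1.
have N1 n : n%:R / th ^+ n <= (N n)%:R by apply/ltW/truncnS_gt.
have N2 n : (N n)%:R <= n%:R / th ^+ n + 1.
  rewrite /N -natr1 lerD2r; have := truncn_le (n%:R / th ^+ n).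
  by rewrite divr_ge0// exprn_ge0// ltW.
have [yth|thy] := ltP y th.
- have c1 : (fun n => 1 - (n%:R * (y / th) ^+ n + y ^+ n)) @ \oo --> (1 : R).
    rewrite -[X in _ --> X](subr0 1) -[X in 1 - X](addr0 0).
    apply: cvgB; first exact: cvg_cst.
    apply: cvgD; last by apply: cvg_expr; rewrite ger0_norm// (lt_trans yth).
    by apply: cvg_natrMexpr; rewrite divr_ge0 ?(ltW th0)//= ltr_pdivrMr// mul1r.
  rewrite [X in _ --> X](_ : _ = 1)//; apply: (squeeze_cvgr _ c1 (cvg_cst (1 : R))); apply: nearW => n.
  have /andP[a0 a1] := yn n; apply/andP; split; last by apply: exprn_ile1; lra.
  apply: (@le_trans _ _ (1 - (N n)%:R * y ^+ n)).
    rewrite lerD2l lerN2 expr_div_n.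
    by apply: le_trans (ler_wpM2r a0 (N2 n)) _; rewrite mulrDl mul1r lerD2r mulrA mulrAC.
  elim: (N n) => [|m ih]; first by rewrite expr0 mul0r subr0.
  rewrite exprS -natr1.
  have : (1 - y ^+ n) * (1 - m%:R * y ^+ n) <= (1 - y ^+ n) * (1 - y ^+ n) ^+ m.
    by apply: ler_wpM2l => //; lra.
  have : 0 <= m%:R * y ^+ n * y ^+ n by rewrite !mulr_ge0.
  lra.
- have c0 : (fun n => expR (1 *- n)) @ \oo --> (0 : R) by exact: cvgn_expR.
  rewrite [X in _ --> X](_ : _ = 0)//; apply: (squeeze_cvgr _ (cvg_cst (0 : R)) c0); apply: nearW => n.
  have /andP[a0 a1] := yn n.
  rewrite exprn_ge0 ?subr_ge0//=; apply: (@le_trans _ _ (expR (- y ^+ n) ^+ N n)).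
    rewrite lerXn2r ?nnegrE ?subr_ge0 ?expR_ge0//.
    by have := expR_ge1Dx (- y ^+ n).
  rewrite -expRM_natl ler_expR mulrN lerN2.
  apply: (@le_trans _ _ (n%:R / th ^+ n * y ^+ n)).
    rewrite -mulrA ler_peMr// mulrC -expr_div_n exprn_ege1// ler_pdivlMr// mul1r//.
  by rewrite ler_wpM2r.
Qed.

End SharpenPowers.

(** The difference of cosines is a product of two sines; the half-sum angle stays below pi/2, so
    only the sign of [r - y] matters. This reads off [y <= r] from cosines of a low frequency. *)
Lemma cos_small_le (R : realType) (r y g : R) : 0 < r -> 0 <= y -> 0 < g -> g * (r + y) < pi ->
  (cos (g * r) <= cos (g * y)) = (y <= r).
Proof.
move=> r0 y0 g0 gpi; rewrite -subr_ge0.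
have -> : cos (g * y) - cos (g * r) =
   2 * (sin (g * (r + y) / 2) * sin (g * (r - y) / 2)).
  have -> : g * y = g * (r + y) / 2 - g * (r - y) / 2 by field.
  have -> : g * r = g * (r + y) / 2 + g * (r - y) / 2 by field.
  by rewrite cosB cosD; ring.
have pi0 := pi_gt0 R.
have s1 : 0 < sin (g * (r + y) / 2).
  by apply: sin_gt0_pi; apply/andP; split; nra.
rewrite pmulr_rge0// pmulr_rge0//.
have [yr|yr|->] := ltgtP y r.
- by apply/ltW/sin_gt0_pi; apply/andP; split; nra.
- apply/negbTE; rewrite -ltNge -oppr_gt0 -sinN; apply: sin_gt0_pi.
  by apply/andP; split; nra.
- by rewrite subrr mulr0 mul0r sin0 lexx.
Qed.

Lemma cvg_indic_nd (R : realType) (U : Type) (F : nat -> set U) x : nondecreasing_seq F ->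
  (fun n => \1_(F n) x) @ \oo --> (\1_(\bigcup_n F n) x : R).
Proof.
move=> ndF; apply: cvg_near_cst.
have [[N _ FN]|nF] := pselect ((\bigcup_n F n) x).
  exists N => // n /= Nn; rewrite !indicE !mem_set//; first by exists N.
  by move: (ndF _ _ Nn) => /subsetPset; apply.
apply: nearW => n; rewrite !indicE !memNset// => Fn; apply: nF; by exists n.
Qed.

Definition rectangles (R : realType) (I : Type) : set (set (I -> R)) :=
  [set E | exists B : I -> set R, (forall i, measurable (B i)) /\
           E = [set f | forall i, B i (f i)]].

Lemma measurable_rectangles (R : realType) (I : finType) (d : measure_display)
  (T : measurableType d) (U : I -> T -> R) E : (forall i, measurable_fun setT (U i)) ->
  <<s @rectangles R I >> E -> measurable [set x | E (fun i => U i x)].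
Proof.
move=> mU; move: E; apply: smallest_sub; first split => /=.
- by rewrite (_ : [set x | _] = set0)//; apply/seteqP; split.
- move=> A mA; rewrite (_ : [set x | _] = ~` [set x | A (fun i => U i x)]).
    exact: measurableC.
  by apply/seteqP; split => x //= [].
- move=> F mF; rewrite (_ : [set x | _] = \bigcup_n [set x | F n (fun i => U i x)]).
    exact: bigcupT_measurable.
  by apply/seteqP; split => x [n _ ?]; exists n.
- move=> _ [B [mB ->]] /=.
  rewrite (_ : [set x | _] = \bigcap_(i in [set: I]) (U i @^-1` B i)).
    apply: fin_bigcap_measurable => // i _.
    by rewrite -[X in measurable X]setTI; exact: mU.
  by apply/seteqP; split => x /= h i; [move=> _; exact: h|exact: h].
Qed.

Section SameTrig.
Context {R : realType} {d1 d2 : measure_display}.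
Context {T1 : measurableType d1} {T2 : measurableType d2}.
Variables (P1 : probability T1 R) (P2 : probability T2 R).
Variables (I : finType) (V : I -> T1 -> R) (W : I -> T2 -> R).
Hypothesis mV : forall i, measurable_fun setT (V i).
Hypothesis mW : forall i, measurable_fun setT (W i).

(** Equality of characteristic functions, with weights. The weights serve twice: they absorb the
    indicators of coordinates already treated, and later they carry a signal or noise variable whose
    correlation with an event of the sources is wanted. *)
Definition same_trig (h1 : T1 -> R) (h2 : T2 -> R) := forall (b : I -> R) phi,
  mean P1 (fun x => h1 x * cos (phi + \sum_i b i * V i x)) =
  mean P2 (fun x => h2 x * cos (phi + \sum_i b i * W i x)).

Lemma measurable_lin (d : measure_display) (T : measurableType d) (U : I -> T -> R) (b : I -> R) :
  (forall i, measurable_fun setT (U i)) ->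
  measurable_fun setT (fun x => \sum_i b i * U i x).
Proof.
by move=> mU; apply: measurable_sum => i; apply: measurable_funM.
Qed.

Lemma measurable_coslin (d : measure_display) (T : measurableType d) (U : I -> T -> R) (b : I -> R) phi :
  (forall i, measurable_fun setT (U i)) ->
  measurable_fun setT (fun x => cos (phi + \sum_i b i * U i x)).
Proof.
move=> mU; apply: measurableT_comp; first by apply: continuous_measurable_fun; exact: continuous_cos.
by apply: measurable_funD => //; exact: measurable_lin.
Qed.

Section Step.
Variables (h1 : T1 -> R) (h2 : T2 -> R) (i0 : I).
Hypotheses (i1 : L1 P1 h1) (i2 : L1 P2 h2) (h12 : same_trig h1 h2).

(** The functions of coordinate [i0] that can be absorbed into the weights. The class contains 1 and
    is stable under differences bounded by 1, under pointwise limits, and under multiplication by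
    raised cosines, which only shift frequency and phase of the test cosine. Sharpened powers of
    raised cosines then lead to indicators. *)
Let G (u : R -> R) := [/\ measurable_fun setT u, forall x, `|u x| <= 1 &
  same_trig (fun x => h1 x * u (V i0 x)) (fun x => h2 x * u (W i0 x))].

Let Li1 (u : R -> R) : measurable_fun setT u -> (forall x, `|u x| <= 1) ->
  L1 P1 (fun x => h1 x * u (V i0 x)).
Proof. by move=> mu u1; apply: (L1_Mb (c := 1)) => //; apply: measurableT_comp. Qed.

Let Li2 (u : R -> R) : measurable_fun setT u -> (forall x, `|u x| <= 1) ->
  L1 P2 (fun x => h2 x * u (W i0 x)).
Proof. by move=> mu u1; apply: (L1_Mb (c := 1)) => //; apply: measurableT_comp. Qed.

Let Lc1 h b phi : L1 P1 h -> L1 P1 (fun x => h x * cos (phi + \sum_i b i * V i x)).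
Proof.
by move=> ih; apply: (L1_Mb (c := 1)) => //; [exact: measurable_coslin|move=> w; exact: cos_max].
Qed.

Let Lc2 h b phi : L1 P2 h -> L1 P2 (fun x => h x * cos (phi + \sum_i b i * W i x)).
Proof.
by move=> ih; apply: (L1_Mb (c := 1)) => //; [exact: measurable_coslin|move=> w; exact: cos_max].
Qed.

Let G1 : G (fun=> 1).
Proof.
split => // [x|b phi]; first by rewrite normr1.
by under eq_mean do rewrite mulr1; under [RHS]eq_mean do rewrite mulr1.
Qed.

Let GB u v : G u -> G v -> (forall x, `|u x - v x| <= 1) -> G (fun x => u x - v x).
Proof.
move=> [mu u1 eu] [mv v1 ev] uv1; split=> //; first exact: measurable_funB.
move=> b phi.
under eq_mean do rewrite mulrBr mulrBl; under [RHS]eq_mean do rewrite mulrBr mulrBl.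
by rewrite !meanB ?eu ?ev//; apply: Lc1 || apply: Lc2; apply: Li1 || apply: Li2.
Qed.

Let GM u g psi : G u -> G (fun x => u x * ((1 + cos (g * x + psi)) / 2)).
Proof.
move=> [mu u1 eu]; split.
- apply: measurable_funM => //; apply: measurable_funM => //; apply: measurable_funD => //.
  apply: measurableT_comp; first by apply: continuous_measurable_fun; exact: continuous_cos.
  by apply: measurable_funD => //; exact: measurable_funM.
- move=> x; rewrite normrM -[leRHS]mulr1 ler_pM//.
  by have := cos_geN1 (g * x + psi); have := cos_le1 (g * x + psi); rewrite ler_norml; lra.
- move=> b phi; pose bp s i := b i + s * g * (i == i0)%:R.
  have E (T : Type) (U : I -> T -> R) s x : \sum_i bp s i * U i x = \sum_i b i * U i x + s * g * U i0 x.
    under eq_bigr do rewrite mulrDl; rewrite big_split /=; congr (_ + _).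
    rewrite (bigD1 i0)//= eqxx mulr1 big1 ?addr0// => i /negPf ->.
    by rewrite mulr0 mul0r.
  have F (T : Type) (U : I -> T -> R) (h : T -> R) x :
    h x * (u (U i0 x) * ((1 + cos (g * U i0 x + psi)) / 2)) * cos (phi + \sum_i b i * U i x) =
    2^-1 * (h x * u (U i0 x) * cos (phi + \sum_i b i * U i x)) +
    (4^-1 * (h x * u (U i0 x) * cos ((phi + psi) + \sum_i bp 1 i * U i x)) +
    4^-1 * (h x * u (U i0 x) * cos ((phi - psi) + \sum_i bp (-1) i * U i x))).
    rewrite !E; set S := \sum_i _.
    have -> : phi + psi + (S + 1 * g * U i0 x) = (phi + S) + (g * U i0 x + psi) by ring.
    have -> : phi - psi + (S + -1 * g * U i0 x) = (phi + S) - (g * U i0 x + psi) by ring.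
    by move: (phi + S) (g * _ + psi) => A C; rewrite (cosD A C) (cosB A C); field.
  under eq_mean do rewrite F; under [RHS]eq_mean do rewrite F.
  have J1 a c s : L1 P1 (fun x => a * (h1 x * u (V i0 x) * cos (s + \sum_i c i * V i x))).
    by apply: L1Z; apply: Lc1; exact: Li1.
  have J2 a c s : L1 P2 (fun x => a * (h2 x * u (W i0 x) * cos (s + \sum_i c i * W i x))).
    by apply: L1Z; apply: Lc2; exact: Li2.
  do 2 (rewrite ?meanD//; try exact: L1D).
  by rewrite !meanZ ?eu//; (apply: Lc1; exact: Li1) || (apply: Lc2; exact: Li2).
Qed.

Let Glim (u : nat -> R -> R) (v : R -> R) : (forall n, G (u n)) ->
  (forall x, (fun n => u n x) @ \oo --> v x) -> G v.
Proof.
move=> Gu uv; have v1 x : `|v x| <= 1.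
  have cu : (fun n => `|u n x|) @ \oo --> `|v x| by apply: cvg_norm; exact: uv.
  by rewrite -(cvg_lim _ cu)//; apply: limr_le; [exact: cvgP cu|apply: nearW => n; have [] := Gu n].
have mv : measurable_fun setT v.
  apply: (measurable_fun_cvg (h := u)); first by move=> n; have [] := Gu n.
  by move=> x _; exact: uv.
split => // b phi.
have c1 : (fun n => mean P1 (fun x => h1 x * u n (V i0 x) * cos (phi + \sum_i b i * V i x))) @ \oo -->
  mean P1 (fun x => h1 x * v (V i0 x) * cos (phi + \sum_i b i * V i x)).
  apply: (mean_dct _ (L1_abs i1) _ _).2.
  - move=> n; have [mu u1 _] := Gu n; apply: L1_meas (Lc1 _ _ (Li1 mu u1)).
  - move=> n x; have [_ u1 _] := Gu n; rewrite !normrM -mulrA ler_piMr//.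
    by rewrite -[leRHS]mulr1 ler_pM// cos_max.
  - move=> x; apply: cvgM; last exact: cvg_cst.
    by apply: cvgM; [exact: cvg_cst|exact: uv].
have c2 : (fun n => mean P2 (fun x => h2 x * u n (W i0 x) * cos (phi + \sum_i b i * W i x))) @ \oo -->
  mean P2 (fun x => h2 x * v (W i0 x) * cos (phi + \sum_i b i * W i x)).
  apply: (mean_dct _ (L1_abs i2) _ _).2.
  - move=> n; have [mu u1 _] := Gu n; apply: L1_meas (Lc2 _ _ (Li2 mu u1)).
  - move=> n x; have [_ u1 _] := Gu n; rewrite !normrM -mulrA ler_piMr//.
    by rewrite -[leRHS]mulr1 ler_pM// cos_max.
  - move=> x; apply: cvgM; last exact: cvg_cst.
    by apply: cvgM; [exact: cvg_cst|exact: uv].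
have e n : mean P1 (fun x => h1 x * u n (V i0 x) * cos (phi + \sum_i b i * V i x)) =
  mean P2 (fun x => h2 x * u n (W i0 x) * cos (phi + \sum_i b i * W i x)).
  by have [_ _ ->] := Gu n.
by rewrite (funext e) in c1; exact: cvg_unique c1 c2.
Qed.

Let Gwave (g psi th : R) : 0 < th < 1 -> G (fun x => (th <= (1 + cos (g * x + psi)) / 2)%R%:R).
Proof.
move=> th01; pose f x := (1 + cos (g * x + psi)) / 2.
have f01 x : 0 <= f x <= 1.
  by have := cos_geN1 (g * x + psi); have := cos_le1 (g * x + psi); rewrite /f; lra.
have Gf u n : G u -> G (fun x => u x * f x ^+ n).
  move=> Gu; elim: n => [|n ih].
    by rewrite (_ : (fun x => _) = u)//; apply/funext => x; rewrite expr0 mulr1.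
  rewrite (_ : (fun x => _) = (fun x => u x * f x ^+ n * f x)); first exact: GM.
  by apply/funext => x; rewrite exprSr mulrA.
have GN n N : G (fun x => (1 - f x ^+ n) ^+ N).
  elim: N => [|N ih]; first by rewrite (_ : (fun x => _) = (fun=> 1)).
  rewrite (_ : (fun x => _) =
    fun x => (1 - f x ^+ n) ^+ N - (1 - f x ^+ n) ^+ N * f x ^+ n); last first.
    by apply/funext => x; rewrite exprSr mulrBr mulr1.
  apply: GB => //; first exact: Gf.
  move=> x; have /andP[f0 f1] := f01 x.
  have a : 0 <= f x ^+ n <= 1 by rewrite exprn_ge0// exprn_ile1.
  rewrite -{1}[X in X - _]mulr1 -mulrBr -exprSr ger0_norm.
    by apply: exprn_ile1; lra.
  by apply: exprn_ge0; lra.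
have GL : G (fun x => (f x < th)%R%:R).
  apply: (Glim (u := fun n x => (1 - f x ^+ n) ^+ (Num.truncn (n%:R / th ^+ n)).+1)) => [n|x].
    exact: GN.
  exact: cvg_sharpen.
rewrite (_ : (fun x => _) = (fun x => 1 - (f x < th)%R%:R)); last first.
  by apply/funext => x; rewrite -/(f x) leNgt; case: (f x < th); rewrite ?subrr ?subr0.
apply: GB => // x; by case: (f x < th); rewrite ?subrr ?subr0 ?normr0 ?normr1.
Qed.

(** A level set of a raised cosine is a periodic union of intervals. When the frequency [g n] tends
    to 0 and the level is kept at distance r from the centre m, all periods but the central one move
    off to infinity and one interval remains. *)
Let Gint (m r : R) : 0 < r -> G (fun x => (`|x - m| <= r)%R%:R).
Proof.
move=> r0; pose g n : R := 1 / (r + 1) / n.+1%:R.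
have g0 n : 0 < g n by rewrite !divr_gt0//; lra.
have gr n : g n * r < 1.
  have n1 : 1 <= n.+1%:R :> R by rewrite ler1n.
  have gle : g n <= 1 / (r + 1) by rewrite /g ler_pdivrMr ?ltr0n// ler_peMr// divr_ge0; lra.
  have e : (r + 1) * (1 / (r + 1)) = 1 by field; lra.
  nra.
pose th n := (1 + cos (g n * r)) / 2.
have th01 n : 0 < th n < 1.
  have pi2 : 2 <= pi :> R by apply: pi_ge2.
  have a := gr n; have b := g0 n.
  have c0 : 0 < cos (g n * r) by apply: cos_gt0_pihalf; apply/andP; split; nra.
  have c1 : cos (g n * r) < 1.
    rewrite lt_neqAle cos_le1 andbT; apply/eqP => e.
    have : sin (g n * r) = 0 by apply: cos1sin0; rewrite e normr1.
    have : 0 < sin (g n * r) by apply: sin_gt0_pi; apply/andP; split; nra.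
    by move=> /[swap] ->; rewrite ltxx.
  by rewrite /th; lra.
apply: (Glim (u := fun n x => (th n <= (1 + cos (g n * x + - g n * m)) / 2)%R%:R)) => [n|x].
  exact: Gwave.
apply: cvg_near_cst; near=> n.
have -> : (th n <= (1 + cos (g n * x + - g n * m)) / 2) = (cos (g n * r) <= cos (g n * `|x - m|)).
  rewrite -(cos_norm (g n * x + - g n * m)) mulNr -mulrBr normrM (gtr0_norm (g0 n)) /th.
  by rewrite ler_pM2r ?invr_gt0// lerD2l.
rewrite cos_small_le//.
have pi2 : 2 <= pi :> R by apply: pi_ge2.
apply: (@lt_le_trans _ _ 2) => //.
rewrite /g mulrAC ltr_pdivrMr ?ltr0n// -natr1; set K := 1 / _ * _.
have Kn : K < n%:R by near: n; apply: nbhs_infty_gtr.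
by have := ler0n R n; lra.
Unshelve. all: by end_near. Qed.

Let Gray (lo : R) : G (fun x => (lo <= x)%R%:R).
Proof.
apply: (Glim (u := fun n x => (`|x - (lo + n.+1%:R)| <= n.+1%:R)%R%:R)) => [n|x].
  by apply: Gint; rewrite ltr0n.
apply: cvg_near_cst; near=> n; congr ((_ : bool)%:R).
have xn : x < lo + n.+1%:R.
  rewrite -ltrBlDl (@lt_trans _ _ n%:R)// ?ltr_nat//.
  by near: n; apply: nbhs_infty_gtr.
by rewrite ltr0_norm ?subr_lt0// opprB; apply/idP/idP; lra.
Unshelve. all: by end_near. Qed.

Lemma same_trig_indic B : measurable B ->
  same_trig (fun x => h1 x * \1_B (V i0 x)) (fun x => h2 x * \1_B (W i0 x)).
Proof.
move=> mB.
suff sub : <<s @RGenCInfty.G R >> `<=` [set B | measurable B /\ G \1_B].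
  have : (@ocitv R).-sigma.-measurable B := mB.
  by rewrite RGenCInfty.measurableE => /sub[_ []].
apply: lambda_system_subset.
- move=> _ _ [a ->] [b ->]; exists (Num.max a b).
  by apply/seteqP; split => x /=; rewrite !in_itv/= !andbT ge_max; [move=> [-> ->]|move=> /andP[]].
- split => //.
  + by split=> //; rewrite indicT.
  + move=> A C CA [mA GA] [mC GC]; split; first exact: measurableD.
    rewrite (_ : \1_(A `\` C) = fun x => \1_A x - \1_C x).
      apply: GB => // x; rewrite !indicE.
      by case: (x \in A); case: (x \in C); rewrite ?subrr ?subr0 ?sub0r ?normrN ?normr0 ?normr1.
    apply/funext => x; rewrite !indicE in_setD.
    case: (boolP (x \in C)) => [xC|xC]; rewrite ?andbT ?andbF ?subr0//.
    by rewrite (_ : x \in A) ?subrr//; apply/mem_set/CA/set_mem.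
  + move=> F ndF hF; split; first by apply: bigcupT_measurable => n; have [] := hF n.
    apply: (Glim (u := fun n => \1_(F n))) => [n|x]; first by have [] := hF n.
    exact: cvg_indic_nd.
- move=> _ [a ->]; split; first exact: measurable_itv.
  rewrite (_ : \1_ _ = fun x => (a <= x)%R%:R)//; apply/funext => x.
  by rewrite indicE mem_setE in_itv/= andbT.
- by move=> X _.
Qed.

End Step.

(** Coordinates are treated one at a time. Each indicator becomes part of the weight, and the
    equality of moments in all coordinates stays available for the next one. *)
Lemma same_trig_rect h1 h2 (B : I -> set R) (s : seq I) : L1 P1 h1 -> L1 P2 h2 ->
  same_trig h1 h2 -> (forall i, measurable (B i)) ->
  same_trig (fun x => h1 x * \prod_(i <- s) \1_(B i) (V i x))
            (fun x => h2 x * \prod_(i <- s) \1_(B i) (W i x)).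
Proof.
move=> i1 i2 h12 mB.
have L (d : measure_display) (T : measurableType d) (Q : probability T R) U h :
    L1 Q h -> (forall i, measurable_fun setT (U i)) ->
    L1 Q (fun x => h x * \prod_(i <- s) \1_(B i) (U i x : R)).
  move=> ih mU; apply: (L1_Mb (c := 1)) => //.
    by apply: measurable_prod => i _; apply: measurableT_comp.
  move=> x; rewrite ger0_norm; last by apply: prodr_ge0.
  by apply: prodr_ile1 => i; rewrite indicE; case: (_ \in _); rewrite ?ler01 ?lexx.
elim: s L => [|j s ih] L.
  move=> b phi; under eq_mean do rewrite big_nil mulr1.
  by under [RHS]eq_mean do rewrite big_nil mulr1.
have Ls (d : measure_display) (T : measurableType d) (Q : probability T R) U h :
    L1 Q h -> (forall i, measurable_fun setT (U i)) ->
    L1 Q (fun x => h x * \prod_(i <- s) \1_(B i) (U i x : R)).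
  move=> ih' mU; apply: (L1_Mb (c := 1)) => //.
    by apply: measurable_prod => i _; apply: measurableT_comp.
  move=> x; rewrite ger0_norm; last by apply: prodr_ge0.
  by apply: prodr_ile1 => i; rewrite indicE; case: (_ \in _); rewrite ?ler01 ?lexx.
have := same_trig_indic j (Ls _ _ _ _ _ i1 mV) (Ls _ _ _ _ _ i2 mW) (ih Ls) (mB j).
move=> h b phi; under eq_mean do rewrite big_cons (mulrC (\1_ _ _)) mulrA.
by under [RHS]eq_mean do rewrite big_cons (mulrC (\1_ _ _)) mulrA.
Qed.

(** A Cramer-Wold theorem with weights: rectangles are extended by the pi-lambda argument. The
    weights may be signed, so the argument runs on means of integrable functions and uses dominated
    convergence in place of continuity of a measure. *)
Lemma same_trig_law h1 h2 E : L1 P1 h1 -> L1 P2 h2 -> same_trig h1 h2 ->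
  <<s @rectangles R I >> E ->
  mean P1 (fun x => h1 x * \1_E (fun i => V i x)) = mean P2 (fun x => h2 x * \1_E (fun i => W i x)).
Proof.
move=> i1 i2 h12.
pose H : set (set (I -> R)) := [set E | <<s @rectangles R I >> E /\
   mean P1 (fun x => h1 x * \1_E (fun i => V i x)) = mean P2 (fun x => h2 x * \1_E (fun i => W i x))].
have mI (d : measure_display) (T : measurableType d) (U : I -> T -> R) A :
    (forall i, measurable_fun setT (U i)) -> <<s @rectangles R I >> A ->
    measurable_fun setT (fun x => \1_A (fun i => U i x) : R).
  move=> mU sA; rewrite (_ : (fun x => _) = \1_[set x | A (fun i => U i x)]).
    by apply: measurable_indic; exact: measurable_rectangles.
  apply/funext => x; rewrite !indicE.
  by have [h|h] := pselect (A (fun i => U i x)); [rewrite !mem_set|rewrite !memNset].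
have b1 (U : Type) (A : set U) x : `|\1_A x : R| <= 1.
  by rewrite indicE; case: (_ \in _); rewrite ?normr1 ?normr0.
have LI (d : measure_display) (T : measurableType d) (Q : probability T R) (U : I -> T -> R) h A :
    (forall i, measurable_fun setT (U i)) -> L1 Q h -> <<s @rectangles R I >> A ->
    L1 Q (fun x => h x * \1_A (fun i => U i x)).
  by move=> mU ih sA; apply: (L1_Mb (c := 1)) => //; exact: mI.
suff : <<s @rectangles R I >> `<=` H by move=> sH /sH[].
have [_ sD sU] := @smallest_sigma_algebra _ setT (@rectangles R I).
have sT : <<s @rectangles R I >> setT.
  by apply: sub_sigma_algebra; exists (fun=> setT); split => //; apply/seteqP; split.
have rectE A : @rectangles R I A -> H A.
  move=> rA; split; first exact: sub_sigma_algebra.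
  move: rA => [B [mB ->]].
  have := same_trig_rect (enum I) i1 i2 h12 mB (fun=> 0) 0.
  have E0 (T : Type) (U : I -> T -> R) x : cos (0 + \sum_i 0 * U i x) = 1.
    by rewrite big1 ?addr0 ?cos0// => i _; rewrite mul0r.
  have Er (T : Type) (U : I -> T -> R) x : \prod_(i <- enum I) \1_(B i) (U i x) =
      \1_[set f : I -> R | forall i, B i (f i)] (fun i => U i x) :> R.
    rewrite [in RHS]indicE; have [h|nh] := pselect (forall i, B i (U i x)).
      by rewrite mem_set//= big1// => i _; rewrite indicE mem_set.
    rewrite memNset//=; move/existsNP: nh => [i ni].
    rewrite big_enum/= (bigD1 i)//= indicE memNset//= mul0r//.
  under eq_mean do rewrite E0 mulr1 Er.
  by under [X in _ = X]eq_mean do rewrite E0 mulr1 Er.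
apply: (@lambda_system_subset _ _ _ setT) => //.
- move=> _ _ [B [mB ->]] [C [mC ->]]; exists (fun i => B i `&` C i); split.
    by move=> i; exact: measurableI.
  by apply/seteqP; split => f /=; [move=> [b c] i|move=> h; split=> i; have [] := h i].
- split=> //; first by apply: rectE; exists (fun=> setT); split => //; apply/seteqP; split.
  + move=> A C CA [sA eA] [sC eC].
    have sAC : <<s @rectangles R I >> (A `\` C).
      rewrite setDE -(setCK A) -setCU; rewrite -[X in _ X]setTD; apply: (sD _).
      rewrite -bigcup2E; apply: (sU _) => -[|[|n]] //=; first by rewrite -setTD; exact: sD.
      by have := sD _ sT; rewrite setDv.
    split => //.
    have ED (T : Type) (U : I -> T -> R) (h : T -> R) x : h x * \1_(A `\` C) (fun i => U i x) =
        h x * \1_A (fun i => U i x) - h x * \1_C (fun i => U i x).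
      rewrite -mulrBr !indicE in_setD; congr (_ * _).
      case: (boolP (_ \in C)) => xC; rewrite ?andbT ?andbF ?subr0//.
      by rewrite (_ : _ \in A) ?subrr//; apply/mem_set/CA/set_mem.
    under eq_mean do rewrite ED; under [RHS]eq_mean do rewrite ED.
    by rewrite !meanB ?eA ?eC//; exact: LI.
  + move=> F ndF hF; have sF : <<s @rectangles R I >> (\bigcup_n F n).
      by apply: sU => n; have [] := hF n.
    split => //.
    have c1 : (fun n => mean P1 (fun x => h1 x * \1_(F n) (fun i => V i x))) @ \oo -->
      mean P1 (fun x => h1 x * \1_(\bigcup_n F n) (fun i => V i x)).
      apply: (mean_dct _ (L1_abs i1) _ _).2.
      * by move=> n; apply: L1_meas (LI _ _ P1 _ _ _ mV i1 _); have [] := hF n.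
      * by move=> n x; rewrite normrM ler_piMr.
      * by move=> x; apply: cvgM; [exact: cvg_cst|exact: cvg_indic_nd].
    have c2 : (fun n => mean P2 (fun x => h2 x * \1_(F n) (fun i => W i x))) @ \oo -->
      mean P2 (fun x => h2 x * \1_(\bigcup_n F n) (fun i => W i x)).
      apply: (mean_dct _ (L1_abs i2) _ _).2.
      * by move=> n; apply: L1_meas (LI _ _ P2 _ _ _ mW i2 _); have [] := hF n.
      * by move=> n x; rewrite normrM ler_piMr.
      * by move=> x; apply: cvgM; [exact: cvg_cst|exact: cvg_indic_nd].
    have e n : mean P1 (fun x => h1 x * \1_(F n) (fun i => V i x)) =
      mean P2 (fun x => h2 x * \1_(F n) (fun i => W i x)) by have [_ ->] := hF n.
    by rewrite (funext e) in c1; exact: cvg_unique c1 c2.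
Qed.

End SameTrig.

Lemma eq_mean_prod_law (R : realType) (d1 d2 : measure_display) (T1 : measurableType d1)
  (T2 : measurableType d2) (P1 : probability T1 R) (P2 : probability T2 R)
  (f1 f2 : T1 -> R) (g1 g2 : T2 -> R) :
  measurable_fun setT f1 -> measurable_fun setT f2 ->
  measurable_fun setT g1 -> measurable_fun setT g2 ->
  (forall A B, measurable A -> measurable B ->
    P1 (f1 @^-1` A `&` f2 @^-1` B) = P1 (f1 @^-1` A) * P1 (f2 @^-1` B))%E ->
  (forall A B, measurable A -> measurable B ->
    P2 (g1 @^-1` A `&` g2 @^-1` B) = P1 (f1 @^-1` A) * P1 (f2 @^-1` B))%E ->
  forall B, measurable B ->
  P1 ((fun x => f1 x * f2 x) @^-1` B) = P2 ((fun x => g1 x * g2 x) @^-1` B).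
Proof.
move=> mf1 mf2 mg1 mg2 fE gE B mB.
pose F1 : {mfun T1 >-> R} := HB.pack f1 (isMeasurableFun.Build _ _ _ _ f1 mf1).
pose F2 : {mfun T1 >-> R} := HB.pack f2 (isMeasurableFun.Build _ _ _ _ f2 mf2).
have mF : measurable_fun setT (fun x => (f1 x, f2 x)) by apply/measurable_fun_pairP.
have mG : measurable_fun setT (fun x => (g1 x, g2 x)) by apply/measurable_fun_pairP.
pose F : {mfun T1 >-> (R * R)%type} := HB.pack (fun x => (f1 x, f2 x)) (isMeasurableFun.Build _ _ _ _ _ mF).
pose G : {mfun T2 >-> (R * R)%type} := HB.pack (fun x => (g1 x, g2 x)) (isMeasurableFun.Build _ _ _ _ _ mG).
pose X := [set z : R * R | B (z.1 * z.2)].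
have mX : measurable X.
  have m : measurable_fun setT (fun z : R * R => z.1 * z.2) by exact: measurable_funM.
  by rewrite -[X in measurable X]setTI; exact: m.
have -> : P1 ((fun x => f1 x * f2 x) @^-1` B) = pushforward P1 F X by [].
have -> : P2 ((fun x => g1 x * g2 x) @^-1` B) = pushforward P2 G X by [].
rewrite -(@product_measure_unique _ _ _ _ _ (distribution P1 F1) (distribution P1 F2) (pushforward P1 F))//.
by apply: product_measure_unique => // A C mA mC; rewrite /distribution /pushforward -gE.
Qed.

(** Under independence the pair has the product law, so [f * g] is distributed as on the product
    space, where Fubini computes the mean. *)
Lemma mean_indep (R : realType) (d : measure_display) (T : measurableType d)
  (P : probability T R) (f g : T -> R) : L1 P f -> L1 P g ->
  (forall A B, measurable A -> measurable B ->
    P (f @^-1` A `&` g @^-1` B) = P (f @^-1` A) * P (g @^-1` B))%E ->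
  L1 P (fun x => f x * g x) /\ mean P (fun x => f x * g x) = mean P f * mean P g.
Proof.
move=> i j fg; have mf := L1_meas i; have mg := L1_meas j.
have [k <-] := mean_prod i j.
have m1 : measurable_fun setT (fun z : T * T => f z.1) by apply: measurableT_comp.
have m2 : measurable_fun setT (fun z : T * T => g z.2) by apply: measurableT_comp.
have gE A B : measurable A -> measurable B ->
    ((P \x P) ((fun z : T * T => f z.1) @^-1` A `&` (fun z => g z.2) @^-1` B) =
    P (f @^-1` A) * P (g @^-1` B))%E.
  move=> mA mB; have -> : (fun z : T * T => f z.1) @^-1` A `&` (fun z => g z.2) @^-1` B =
    (f @^-1` A) `*` (g @^-1` B) by [].
  by rewrite product_measure1E//; rewrite -[X in measurable X]setTI; [exact: mf|exact: mg].
have e := eq_mean_prod_law mf mg m1 m2 fg gE.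
have [a b] := eq_mean_law (measurable_funM m1 m2) (measurable_funM mf mg) (fun B mB => esym (e B mB)).
by split; [exact: a|exact/esym/b].
Qed.

(** * Independence and Gaussian variables *)

Section IndepSigma.
Context {R : realType} {d : measure_display} {T : measurableType d}.
Variable P : probability T R.

(** The sets on which the weighted mean is proportional to the probability form a lambda-system.
    With an indicator for h this carries independence from finite intersections to generated
    sigma-algebras, one side at a time. *)
Lemma mean_lambda (G : set (set T)) (h : T -> R) (kappa : R) : L1 P h ->
  setI_closed G -> (forall E, G E -> measurable E) ->
  mean P h = kappa ->
  (forall E, G E -> mean P (fun x => h x * \1_E x) = kappa * mean P \1_E) ->
  forall E, <<s G >> E -> measurable E /\ mean P (fun x => h x * \1_E x) = kappa * mean P \1_E.
Proof.
move=> ih GI Gm hk hG.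
pose H : set (set T) := [set E | measurable E /\
   mean P (fun x => h x * \1_E x) = kappa * mean P \1_E].
suff sub : <<s G >> `<=` H by move=> E /sub.
have b1 (A : set T) x : `|\1_A x : R| <= 1.
  by rewrite indicE; case: (_ \in _); rewrite ?normr1 ?normr0.
have LI A : measurable A -> L1 P (fun x => h x * \1_A x).
  by move=> mA; apply: (L1_Mb (c := 1)) => //.
apply: lambda_system_subset => //.
- split=> //.
  + split=> //; rewrite -[mean P \1__]/(mean P (\1_[set: T])) indicT mean_cst mulr1 -hk.
    by apply: eq_mean => x; rewrite mulr1.
  + move=> A C CA [mA eA] [mC eC]; split; first exact: measurableD.
    have E x : \1_(A `\` C) x = \1_A x - \1_C x :> R.
      rewrite !indicE in_setD; case: (boolP (_ \in C)) => xC; rewrite ?andbT ?andbF ?subr0//.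
      by rewrite (_ : _ \in A) ?subrr//; apply/mem_set/CA/set_mem.
    under eq_mean do rewrite E mulrBr; under [in RHS]eq_mean do rewrite E.
    by rewrite !meanB ?eA ?eC ?mulrBr//; solve [exact: LI|exact: L1_indic].
  + move=> F ndF hF; have mF n : measurable (F n) by have [] := hF n.
    have mU : measurable (\bigcup_n F n) by apply: bigcupT_measurable.
    split => //.
    have c1 : (fun n => mean P (fun x => h x * \1_(F n) x)) @ \oo -->
      mean P (fun x => h x * \1_(\bigcup_n F n) x).
      apply: (mean_dct _ (L1_abs ih) _ _).2.
      * by move=> n; exact: L1_meas (LI _ (mF n)).
      * by move=> n x; rewrite normrM ler_piMr.
      * by move=> x; apply: cvgM; [exact: cvg_cst|exact: cvg_indic_nd].
    have c2 : (fun n => kappa * mean P \1_(F n)) @ \oo --> kappa * mean P \1_(\bigcup_n F n).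
      apply: cvgM; first exact: cvg_cst.
      apply: (mean_dct _ (L1_cst P 1) _ _).2 => //.
      by move=> x; exact: cvg_indic_nd.
    have e n : mean P (fun x => h x * \1_(F n) x) = kappa * mean P \1_(F n).
      by have [_ ->] := hF n.
    by rewrite (funext e) in c1; exact: cvg_unique c1 c2.
- by move=> E GE; split; [exact: Gm|exact: hG].
Qed.

Variables (K : eqType) (F : K -> set (set T)).
Hypothesis Find : indep_family P F.
Hypothesis Fm : forall t E, F t E -> measurable E.
Hypothesis FT : forall t, F t setT.
Hypothesis FI : forall t, setI_closed (F t).

Definition sigI (I : pred K) : set (set T) := <<s \bigcup_(t in [set t | I t]) F t >>.

Definition pis (I : pred K) : set (set T) := [set E | exists (s : seq K) (A : K -> set T),
  [/\ uniq s, forall t, t \in s -> I t, forall t, F t (A t) & E = \big[setI/setT]_(t <- s) A t]].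

Lemma mem_bigsetI (s : seq K) (A : K -> set T) x :
  (\big[setI/setT]_(t <- s) A t) x <-> (forall t, t \in s -> A t x).
Proof.
elim: s => [|u s ih]; first by rewrite big_nil; split.
rewrite big_cons; split => [[Au /ih h] t|h].
  by rewrite in_cons => /predU1P[->|/h].
by split; [apply: h; rewrite mem_head|apply/ih => t ts; apply: h; rewrite in_cons ts orbT].
Qed.

Lemma pis_setI I : setI_closed (pis I).
Proof.
move=> _ _ [s [A [us sI FA ->]]] [u [B [uu uI FB ->]]].
exists (undup (s ++ u)), (fun t => (if t \in s then A t else setT) `&` (if t \in u then B t else setT)).
split; first exact: undup_uniq.
- by move=> t; rewrite mem_undup mem_cat => /orP[/sI|/uI].
- by move=> t; apply: FI; case: ifP.
- apply/seteqP; split=> x.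
    move=> [/mem_bigsetI a /mem_bigsetI b]; apply/mem_bigsetI => t _.
    by split; case: ifP => // ?; [exact: a|exact: b].
  move/mem_bigsetI => h; split; apply/mem_bigsetI => t ts.
    by have [] := h t; rewrite ?mem_undup ?mem_cat ?ts.
  by have [] := h t; rewrite ?mem_undup ?mem_cat ?ts ?orbT.
Qed.

Lemma measurable_bigI (s : seq K) (A : K -> set T) : (forall t, F t (A t)) ->
  measurable (\big[setI/setT]_(t <- s) A t).
Proof. by move=> FA; elim/big_ind: _ => // *; [exact: measurableI|exact: Fm]. Qed.

Lemma pis_meas I E : pis I E -> measurable E.
Proof.
by move=> [s [A [_ _ FA ->]]]; exact: measurable_bigI.
Qed.

Lemma sigI_pis I : sigI I `<=` <<s pis I >>.
Proof.
apply: smallest_sub; first exact: smallest_sigma_algebra.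
move=> E [t It FE]; apply: sub_sigma_algebra; exists [:: t], (fun u => if u == t then E else setT).
split=> //; first by move=> u; rewrite inE => /eqP ->.
- by move=> u; case: eqP => [->|].
- by rewrite big_seq1 eqxx.
Qed.

Lemma sigI_meas I E : sigI I E -> measurable E.
Proof.
apply: smallest_sub E; first exact: sigma_algebra_measurable.
by move=> E [t _ /Fm].
Qed.

Lemma mean_indicI (A B : set T) : measurable A -> measurable B ->
  mean P (fun x => \1_A x * \1_B x) = fine (P (A `&` B)).
Proof.
move=> mA mB; rewrite -mean_indic; last exact: measurableI.
by rewrite indicI.
Qed.

Lemma sigI_indep (I1 I2 : pred K) E1 E2 : (forall t, I1 t -> ~~ I2 t) -> sigI I1 E1 -> sigI I2 E2 ->
  P (E1 `&` E2) = (P E1 * P E2)%E.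
Proof.
move=> dis s1 s2.
have key : mean P (fun x => \1_E1 x * \1_E2 x) = mean P \1_E1 * mean P \1_E2.
  have m1 := sigI_meas s1.
  have [] := @mean_lambda (pis I2) \1_E1 (mean P \1_E1) (L1_indic P m1) (@pis_setI I2) (@pis_meas I2) erefl _ E2 (sigI_pis s2); last by [].
  move=> B pB; have mB := pis_meas pB.
  have [] := @mean_lambda (pis I1) \1_B (mean P \1_B) (L1_indic P mB) (@pis_setI I1) (@pis_meas I1) erefl _ E1 (sigI_pis s1).
    move=> A pA; have mA := pis_meas pA.
    rewrite mean_indicI// !mean_indic//.
    move: pA pB => [s [a [us sI Fa ->]]] [u [b [uu uI Fb ->]]].
    (* The two index lists are disjoint, so one family of events serves both and independence
       applies to their concatenation. *)
    pose c t := if t \in s then a t else b t.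
    have cs : \big[setI/setT]_(t <- s) c t = \big[setI/setT]_(t <- s) a t.
      by apply: eq_big_seq => t ts; rewrite /c ts.
    have cu : \big[setI/setT]_(t <- u) c t = \big[setI/setT]_(t <- u) b t.
      apply: eq_big_seq => t tu; rewrite /c ifN//.
      by apply/negP => /sI /dis /negP; apply; exact: uI.
    have Fc t : F t (c t) by rewrite /c; case: ifP.
    have us' : uniq (u ++ s).
      rewrite cat_uniq us uu andbT /=; apply/hasPn => t /sI /dis.
      by apply: contra; exact: uI.
    have := Find us' (fun t _ => Fc t); rewrite !big_cat/= cs cu => ->.
    have := Find us (fun t _ => Fc t); rewrite cs => <-.
    have := Find uu (fun t _ => Fc t); rewrite cu => <-.
    by rewrite fineM// fin_num_measure//; apply: measurable_bigI.
  move=> _; rewrite mulrC => <-; by apply: eq_mean => x; rewrite mulrC.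
have m1 := sigI_meas s1; have m2 := sigI_meas s2; have m12 := measurableI _ _ m1 m2.
move: key; rewrite mean_indicI// !mean_indic// -fineM ?fin_num_measure//.
move/(congr1 (@EFin R)); rewrite !fineK ?fin_numM ?fin_num_measure//.
Qed.

Definition smeas (I : pred K) (f : T -> R) :=
  forall B, measurable B -> sigI I (f @^-1` B).

Lemma smeasP I f : smeas I f <->
  measurable_fun [set: g_sigma_algebraType (\bigcup_(t in [set t | I t]) F t)]
    (f : g_sigma_algebraType (\bigcup_(t in [set t | I t]) F t) -> R).
Proof.
split; first by move=> sf _ B mB; rewrite setTI; exact: sf.
by move=> mf B mB; rewrite -[X in sigI I X]setTI; exact: mf.
Qed.

Lemma sigI_sub (I J : pred K) : (forall t, I t -> J t) -> sigI I `<=` sigI J.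
Proof.
move=> IJ; apply: smallest_sub; first exact: smallest_sigma_algebra.
by move=> E [t /IJ Jt FE]; apply: sub_sigma_algebra; exists t.
Qed.

Lemma mean_smeas2 (I1 I2 : pred K) f g : (forall t, I1 t -> ~~ I2 t) -> smeas I1 f -> smeas I2 g ->
  L1 P f -> L1 P g ->
  L1 P (fun x => f x * g x) /\ mean P (fun x => f x * g x) = mean P f * mean P g.
Proof.
move=> dis sf sg i j; apply: mean_indep => // A B mA mB.
by apply: (sigI_indep dis); [exact: sf|exact: sg].
Qed.

Lemma smeas_prod (J : eqType) (s : seq J) (I : pred K) (f : J -> T -> R) :
  (forall i, i \in s -> smeas I (f i)) -> smeas I (fun x => \prod_(i <- s) f i x).
Proof.
move=> h; apply/smeasP; elim: s h => [|i s ih] h.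
  rewrite (_ : (fun x => _) = fun=> 1); first exact: measurable_cst.
  by apply/funext => x; rewrite big_nil.
rewrite (_ : (fun x => _) = (fun x => f i x * \prod_(j <- s) f j x)); last first.
  by apply/funext => x; rewrite big_cons.
apply: measurable_funM.
  by apply/smeasP; apply: h; rewrite mem_head.
by apply: ih => j js; apply: h; rewrite in_cons js orbT.
Qed.

Lemma mean_smeas_prod (J : eqType) (s : seq J) (g : J -> pred K) (f : J -> T -> R) : uniq s ->
  (forall i j, i \in s -> j \in s -> i != j -> forall t, g i t -> ~~ g j t) ->
  (forall i, i \in s -> smeas (g i) (f i)) -> (forall i, i \in s -> L1 P (f i)) ->
  L1 P (fun x => \prod_(i <- s) f i x) /\
  mean P (fun x => \prod_(i <- s) f i x) = \prod_(i <- s) mean P (f i).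
Proof.
elim: s => [|i s ih] us dis sf lf.
  have -> : (fun x => \prod_(i <- [::]) f i x) = fun=> 1 by apply/funext => x; rewrite big_nil.
  by rewrite mean_cst big_nil; split; [exact: L1_cst|].
have -> : (fun x => \prod_(j <- i :: s) f j x) = fun x => f i x * \prod_(j <- s) f j x.
  by apply/funext => x; rewrite big_cons.
move: us => /=/andP[nis us].
have [] := ih us.
- by move=> j k js ks; apply: dis; rewrite in_cons ?js ?ks orbT.
- by move=> j js; apply: sf; rewrite in_cons js orbT.
- by move=> j js; apply: lf; rewrite in_cons js orbT.
move=> l e; rewrite big_cons -e; apply: (@mean_smeas2 (g i) [pred t | has (g^~ t) s]) => //.
- move=> t git /=; apply/hasPn => j js; apply: (dis i) => //; rewrite ?mem_head// ?in_cons ?js ?orbT//.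
  by apply: contraNneq nis => ->.
- by apply: sf; rewrite mem_head.
- apply: smeas_prod => j js B mB; have sj : smeas (g j) (f j) by apply: sf; rewrite in_cons js orbT.
  by apply: (sigI_sub _ (sj _ mB)) => t gjt /=; apply/hasP; exists j.
- by apply: lf; rewrite mem_head.
Qed.

End IndepSigma.

Section SigmaOf.
Context {R : realType} {d : measure_display} {T : measurableType d}.
Variables (I : Type) (V : I -> T -> R).

Lemma sigma_of_meas : (forall i, measurable_fun setT (V i)) -> forall E, sigma_of V E -> measurable E.
Proof.
move=> mV E; apply: smallest_sub E; first exact: sigma_algebra_measurable.
by move=> _ [i [B [mB ->]]]; rewrite -[X in measurable X]setTI; exact: mV.
Qed.

Lemma sigma_ofT : sigma_of V setT.
Proof.
have [s0 sD _] := @smallest_sigma_algebra _ setT [set A | exists i B, measurable B /\ A = V i @^-1` B].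
by have := sD _ s0; rewrite setD0.
Qed.

Lemma sigma_ofI : setI_closed (sigma_of V).
Proof.
have [s0 sD sU] := @smallest_sigma_algebra _ setT [set A | exists i B, measurable B /\ A = V i @^-1` B].
move=> A B sA sB; rewrite -(setCK (A `&` B)) setCI -setTD; apply: (sD _).
rewrite -bigcup2E; apply: (sU _) => -[|[|n]] //=; by rewrite -setTD; exact: sD.
Qed.

Lemma sigma_of_gen i B : measurable B -> sigma_of V (V i @^-1` B).
Proof. by move=> mB; apply: sub_sigma_algebra; exists i, B. Qed.

End SigmaOf.

Lemma abs_sin_le (R : realType) (y : R) : `|sin y| <= `|y|.
Proof.
wlog y0 : y / 0 <= y.
  move=> h; have [/h//|/ltW y0] := leP 0 y.
  by rewrite -normrN -sinN -[`|y|]normrN; apply: h; rewrite oppr_ge0.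
have [c _] := @MVT_segment R sin cos 0 y y0 (fun x _ => is_derive_sin x)
  (continuous_subspaceT (@continuous_sin R)).
by rewrite sin0 !subr0 => ->; rewrite normrM ler_piMl// cos_max.
Qed.

Lemma seq_derive (R : realType) (f : R -> R) (df : R) (s : nat -> R) :
  is_derive (0 : R) (1 : R) f df -> (forall n, s n != 0) -> s @ \oo --> (0 : R) ->
  (fun n => (f (s n) - f 0) / s n) @ \oo --> df.
Proof.
move=> [/cvg_ex [l fl] <-] s0 sc.
have := fl; move/cvgr_dnbhsP => /(_ s (conj s0 sc)).
rewrite (_ : 'D_1 f 0 = l); last by apply/cvg_lim.
apply: cvg_trans; apply: near_eq_cvg; apply: nearW => n /=.
by rewrite /GRing.scale/= mulr1 addr0 mulrC.
Qed.

Section Gauss1.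
Context {R : realType} {d : measure_display} {T : measurableType d}.
Variable P : probability T R.
Implicit Types (u w : T -> R) (v : R).

Definition gauss1 u v := measurable_fun setT u /\ forall a,
  mean P (fun x => cos (a * u x)) = expR (- (a ^+ 2 * v) / 2) /\
  mean P (fun x => sin (a * u x)) = 0.

Lemma measurable_cosf u : measurable_fun setT u -> measurable_fun setT (fun x => cos (u x)).
Proof.
by move=> mu; apply: measurableT_comp => //; apply: continuous_measurable_fun; exact: continuous_cos.
Qed.

Lemma measurable_sinf u : measurable_fun setT u -> measurable_fun setT (fun x => sin (u x)).
Proof.
by move=> mu; apply: measurableT_comp => //; apply: continuous_measurable_fun; exact: continuous_sin.
Qed.

Lemma L1_cos u : measurable_fun setT u -> L1 P (fun x => cos (u x)).
Proof. by move=> mu; apply: (@L1_bnd _ _ _ P 1) => [|x]; [exact: measurable_cosf|exact: cos_max]. Qed.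

Lemma L1_sin u : measurable_fun setT u -> L1 P (fun x => sin (u x)).
Proof. by move=> mu; apply: (@L1_bnd _ _ _ P 1) => [|x]; [exact: measurable_sinf|exact: sin_max]. Qed.

Lemma gauss1_sinphi u v phi a : gauss1 u v ->
  mean P (fun x => sin (phi + a * u x)) = sin phi * expR (- (a ^+ 2 * v) / 2).
Proof.
move=> [mu /(_ a)[ec es]].
have mau : measurable_fun setT (fun x => a * u x) by exact: measurable_funM.
under eq_mean do rewrite sinD.
rewrite meanD ?meanZ ?ec ?es ?mulr0 ?addr0//; try apply: L1Z; solve [exact: L1_cos|exact: L1_sin].
Qed.

Lemma gauss1_cosphi u v phi a : gauss1 u v ->
  mean P (fun x => cos (phi + a * u x)) = cos phi * expR (- (a ^+ 2 * v) / 2).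
Proof.
move=> [mu /(_ a)[ec es]].
have mau : measurable_fun setT (fun x => a * u x) by exact: measurable_funM.
under eq_mean do rewrite cosD.
rewrite meanB ?meanZ ?ec ?es ?mulr0 ?subr0//; try apply: L1Z; solve [exact: L1_cos|exact: L1_sin].
Qed.

Lemma gauss1Z u v c : gauss1 u v -> gauss1 (fun x => c * u x) (c ^+ 2 * v).
Proof.
move=> [mu h]; split; first exact: measurable_funM.
move=> a; have [e1 e2] := h (a * c).
rewrite mulrA -exprMn -e1 -e2; split; by apply: eq_mean => x; rewrite mulrA.
Qed.

Lemma gauss1_indepD u w v1 v2 : gauss1 u v1 -> gauss1 w v2 ->
  (forall A B, measurable A -> measurable B ->
    P (u @^-1` A `&` w @^-1` B) = P (u @^-1` A) * P (w @^-1` B))%E ->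
  gauss1 (fun x => u x + w x) (v1 + v2).
Proof.
move=> [mu hu] [mw hw] uw; split; first exact: measurable_funD.
have I (f g : R -> R) a : measurable_fun setT f -> measurable_fun setT g ->
    (forall x, `|f x| <= 1) -> (forall x, `|g x| <= 1) ->
    L1 P (fun x => f (a * u x) * g (a * w x)) /\
    mean P (fun x => f (a * u x) * g (a * w x)) =
    mean P (fun x => f (a * u x)) * mean P (fun x => g (a * w x)).
  move=> mf mg f1 g1.
  have mfa : measurable_fun setT (fun y => f (a * y)).
    by apply: measurableT_comp => //; exact: measurable_funM.
  have mga : measurable_fun setT (fun y => g (a * y)).
    by apply: measurableT_comp => //; exact: measurable_funM.
  apply: mean_indep.
  - by apply: (@L1_bnd _ _ _ P 1) => //; exact: (measurableT_comp mfa mu).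
  - by apply: (@L1_bnd _ _ _ P 1) => //; exact: (measurableT_comp mga mw).
  - move=> A B mA mB; apply: (uw ((fun y => f (a * y)) @^-1` A) ((fun y => g (a * y)) @^-1` B)).
      by rewrite -[X in measurable X]setTI; exact: mfa.
    by rewrite -[X in measurable X]setTI; exact: mga.
move=> a; have [cu su] := hu a; have [cw sw] := hw a.
have mc : measurable_fun setT (@cos R) by apply: continuous_measurable_fun; exact: continuous_cos.
have ms : measurable_fun setT (@sin R) by apply: continuous_measurable_fun; exact: continuous_sin.
have cb := @cos_max R; have sb := @sin_max R.
have [lcc ecc] := I cos cos a mc mc cb cb; have [lss ess] := I sin sin a ms ms sb sb.
have [lsc esc] := I sin cos a ms mc sb cb; have [lcs ecs] := I cos sin a mc ms cb sb.
split.
- under eq_mean do rewrite mulrDr cosD.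
  rewrite meanB// ecc ess cu su cw sw mul0r subr0 -expRD; congr expR; ring.
- under eq_mean do rewrite mulrDr sinD.
  by rewrite meanD// esc ecs cu su cw sw mul0r mulr0 addr0.
Qed.

(** The second difference [2 / s ^+ 2 * (1 - cos (s * u x))] stays below [u x ^+ 2] and tends to it
    as s tends to 0. Its mean is explicit, so Fatou gives integrability of the square and dominated
    convergence its value. *)
Lemma gauss1_sq u v : gauss1 u v -> L1 P (fun x => u x ^+ 2) /\ mean P (fun x => u x ^+ 2) = v.
Proof.
move=> gu; have [mu _] := gu.
pose s n : R := n.+1%:R^-1.
have s0 n : s n != 0 by rewrite invr_eq0 pnatr_eq0.
have sc : s @ \oo --> (0 : R) by exact: cvg_harmonic.
pose F n x := (2 * (sin (s n * (u x / 2)) / s n)) ^+ 2.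
have mF n : measurable_fun setT (F n).
  apply: measurable_funX; apply: measurable_funM => //; apply: measurable_funM => //.
  by apply: measurable_sinf; apply: measurable_funM => //; exact: measurable_funM.
have Fu x : (fun n => F n x) @ \oo --> u x ^+ 2.
  have e : u x = 2 * (u x / 2) by field.
  rewrite e; apply: (continuous_cvg _ (@exprn_continuous R 2 _)).
  apply: cvgM; first exact: cvg_cst.
  have dsin : is_derive (0 : R) (1 : R) (fun y => sin (y * (u x / 2))) (u x / 2).
    by apply: is_derive_eq; rewrite mul0r cos0 /GRing.scale/=; ring.
  have := seq_derive dsin s0 sc.
  by under eq_fun do rewrite mul0r sin0 subr0.
have Fle n x : F n x <= u x ^+ 2.
  rewrite /F -(real_normK (num_real (2 * _))) -(real_normK (num_real (u x))).
  rewrite lerXn2r ?nnegrE// !normrM normfV ger0_norm//.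
  have h := abs_sin_le (s n * (u x / 2)).
  have e2 : `|(2 : R)^-1| = 2^-1 by rewrite ger0_norm.
  rewrite !normrM e2 in h; rewrite mulrA ler_pdivrMr ?normr_gt0//.
  by move: h; set A := `|_|; set B := `|_|; set C := `|_|; lra.
have F0 n x : 0 <= F n x by exact: sqr_ge0.
have FE n x : F n x = (2 / s n ^+ 2) * (1 - cos (s n * u x)).
  have -> : s n * u x = (s n * (u x / 2)) *+ 2 by rewrite -mulr_natr; field.
  by rewrite cos_mulr2n cos2sin2 /F; field.
have mcu n : measurable_fun setT (fun x => s n * u x) by exact: measurable_funM.
have LF n : L1 P (F n).
  rewrite (_ : F n = fun x => (2 / s n ^+ 2) * (1 - cos (s n * u x))); last exact/funext.
  by apply: L1Z; apply: L1B; [exact: L1_cst|exact: L1_cos].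
have meanF n : mean P (F n) = (2 / s n ^+ 2) * (1 - expR (- (s n ^+ 2 * v) / 2)).
  under eq_mean do rewrite FE.
  rewrite meanZ; last by apply: L1B; [exact: L1_cst|exact: L1_cos].
  by rewrite meanB ?mean_cst; [have [_ /(_ (s n))[-> _]] := gu|exact: L1_cst|exact: L1_cos].
have cF : (fun n => mean P (F n)) @ \oo --> v.
  have dexp : is_derive (0 : R) (1 : R) (fun y => expR (- (y * v) / 2)) (- v / 2).
    apply: is_derive_eq; rewrite mul0r oppr0 mul0r expR0 /GRing.scale/=; ring.
  have s20 n : s n ^+ 2 != 0 by rewrite expf_neq0.
  have s2c : (fun n => s n ^+ 2) @ \oo --> (0 : R).
    rewrite -[X in _ --> X](expr0n R 2); exact: (continuous_cvg _ (@exprn_continuous R 2 _) sc).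
  have := seq_derive dexp s20 s2c.
  move=> h; rewrite [X in _ --> X](_ : v = - v / 2 * -2); last by field.
  rewrite (_ : (fun n => mean P (F n)) =
      fun n => (expR (- (s n ^+ 2 * v) / 2) - expR (- (0 * v) / 2)) / s n ^+ 2 * -2).
    by apply: cvgM => //; exact: cvg_cst.
  by apply/funext => n; rewrite meanF mul0r oppr0 mul0r expR0; field.
have Lu : L1 P (fun x => u x ^+ 2).
  apply/integrableP; split; first by apply/measurable_EFinP; exact: measurable_funX.
  have einfE (h : nat -> R) (l : R) : h @ \oo --> l -> limn_einf (fun n => (h n)%:E) = l%:E.
    move=> hl; have c : (fun n => (h n)%:E) @ \oo --> l%:E.
      by apply/fine_cvgP; split; [exact: nearW|exact: hl].
    by rewrite is_cvg_limn_einfE; [exact/cvg_lim|apply/cvg_ex; exists l%:E].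
  have h1 := @fatou _ _ _ P _ measurableT (fun n x => (F n x)%:E).
  have e1 x : limn_einf (fun n => (F n x)%:E) = (u x ^+ 2)%:E by exact: einfE.
  have e2 : limn_einf (fun n => \int[P]_x (F n x)%:E)%E = v%:E.
    rewrite (_ : (fun n => _) = fun n => (mean P (F n))%:E); first exact: einfE.
    by apply/funext => n; rewrite EFin_mean.
  rewrite (eq_integral (fun x => (u x ^+ 2)%:E)); last first.
    by move=> x _ /=; rewrite ger0_norm ?sqr_ge0.
  rewrite (funext e1) e2 in h1; apply: le_lt_trans (h1 _ _) (ltry _).
  - by move=> n; apply/measurable_EFinP.
  - by move=> n x _; rewrite lee_fin.
split => //.
have [|_ c2] := mean_dct mF Lu _ Fu; first by move=> n x; rewrite ger0_norm.
exact: cvg_unique c2 cF.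
Qed.

Lemma gauss1_L1 u v : gauss1 u v -> L1 P u.
Proof. by move=> gu; have [mu _] := gu; apply: L1_sq1 => //; have [] := gauss1_sq gu. Qed.

Lemma gauss1_mean u v : gauss1 u v -> mean P u = 0.
Proof.
move=> gu; have [mu h] := gu; have lu := gauss1_L1 gu.
pose s n : R := n.+1%:R^-1.
have s0 n : s n != 0 by rewrite invr_eq0 pnatr_eq0.
have sc : s @ \oo --> (0 : R) by exact: cvg_harmonic.
have msu n : measurable_fun setT (fun x => s n * u x) by exact: measurable_funM.
have [] := @mean_dct _ _ _ P (fun n x => sin (s n * u x) / s n) u _ _ (L1_abs lu).
- by move=> n; apply: measurable_funM => //; exact: measurable_sinf.
- move=> n x; rewrite normrM normfV ler_pdivrMr ?normr_gt0//.
  by apply: le_trans (abs_sin_le _) _; rewrite normrM mulrC.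
- move=> x; have dsin : is_derive (0 : R) (1 : R) (fun y => sin (y * u x)) (u x).
    by apply: is_derive_eq; rewrite mul0r cos0 /GRing.scale/=; ring.
  have := seq_derive dsin s0 sc.
  by under eq_fun do rewrite mul0r sin0 subr0.
move=> _; rewrite (_ : (fun n => _) = fun=> 0); last first.
  apply/funext => n; rewrite meanZr; last exact: L1_sin.
  by have [_ ->] := h (s n); rewrite mul0r.
by move=> c; exact: (cvg_unique _ c (cvg_cst (0 : R))).
Qed.

End Gauss1.

Lemma abs_sinB_le (R : realType) (a b : R) : `|sin a - sin b| <= `|a - b|.
Proof.
have key (m e : R) : `|sin (m + e) - sin (m - e)| <= `|2 * e|.
  rewrite sinD sinB (_ : _ - _ = 2 * (cos m * sin e)); last by ring.
  rewrite !normrM; apply: ler_wpM2l => //; apply: (le_trans _ (abs_sin_le e)).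
  by rewrite ler_piMl// cos_max.
have := key ((a + b) / 2) ((a - b) / 2).
rewrite (_ : (a + b) / 2 + (a - b) / 2 = a); last by field.
rewrite (_ : (a + b) / 2 - (a - b) / 2 = b); last by field.
by rewrite (_ : 2 * _ = a - b)//; field.
Qed.

Section GaussProd.
Context {R : realType} {d1 d2 : measure_display}.
Context {T1 : measurableType d1} {T2 : measurableType d2}.
Variables (P1 : probability T1 R) (P2 : probability T2 R).
Local Notation Q := ((P1 \x P2)%E : probability (T1 * T2)%type R).

Lemma gauss1_prodD u w (v1 v2 : R) : gauss1 P1 u v1 -> gauss1 P2 w v2 ->
  gauss1 Q (fun z => u z.1 + w z.2) (v1 + v2).
Proof.
move=> gu gw; have [mu hu] := gu; have [mw hw] := gw.
apply: gauss1_indepD.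
- split; first by apply: measurableT_comp.
  move=> a; have [<- <-] := hu a.
  have ma : measurable_fun setT (fun x => a * u x) by exact: measurable_funM.
  by split; [apply: (L1_fst P2 (L1_cos P1 ma)).2|apply: (L1_fst P2 (L1_sin P1 ma)).2].
- split; first by apply: measurableT_comp.
  move=> a; have [<- <-] := hw a.
  have ma : measurable_fun setT (fun x => a * w x) by exact: measurable_funM.
  by split; [apply: (L1_snd P1 (L1_cos P2 ma)).2|apply: (L1_snd P1 (L1_sin P2 ma)).2].
- move=> A B mA mB.
  have mUA : measurable (u @^-1` A) by rewrite -[X in measurable X]setTI; exact: mu.
  have mWB : measurable (w @^-1` B) by rewrite -[X in measurable X]setTI; exact: mw.
  have -> : (fun z : T1 * T2 => u z.1) @^-1` A = (u @^-1` A) `*` setT.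
    by apply/seteqP; split => [z|z []].
  have -> : (fun z : T1 * T2 => w z.2) @^-1` B = setT `*` (w @^-1` B).
    by apply/seteqP; split => [z|z []].
  rewrite -setXI setTI setIT /= !product_measure1E//.
  congr (_ * _)%E; [rewrite -[LHS]mule1|rewrite -[LHS]mul1e];
    congr (_ * _)%E; exact/esym/probability_setT.
Qed.

End GaussProd.

(** The mean of [sin (phi + a * h + B)] is explicit and is differentiated in a at 0. Here s, c, q
    are the variance of h, its covariance with B and the variance of B; the derivative at 0 does not
    see s. *)
Lemma gauss_cos_w (R : realType) (d : measure_display) (T : measurableType d)
  (P : probability T R) (h B : T -> R) (s c q phi : R) :
  (forall a, gauss1 P (fun x => a * h x + B x) (a ^+ 2 * s + 2 * a * c + q)) ->
  L1 P h /\ mean P (fun x => h x * cos (phi + B x)) = - sin phi * c * expR (- q / 2).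
Proof.
move=> g.
have lh : L1 P h.
  have := L1B (gauss1_L1 (g 1)) (gauss1_L1 (g 0)).
  by rewrite (_ : (fun w => _) = h)//; apply/funext => x; ring.
have mh := L1_meas lh.
have mB : measurable_fun setT B.
  have [m _] := g 0; rewrite (_ : B = fun x => 0 * h x + B x)//.
  by apply/funext => x; ring.
split=> //.
pose e n : R := n.+1%:R^-1.
have e0 n : e n != 0 by rewrite invr_eq0 pnatr_eq0.
have ec : e @ \oo --> (0 : R) by exact: cvg_harmonic.
have m n : measurable_fun setT (fun x => phi + (e n * h x + B x)).
  by apply: measurable_funD => //; apply: measurable_funD => //; exact: measurable_funM.
have mB' : measurable_fun setT (fun x => phi + B x) by exact: measurable_funD.
have [] := @mean_dct _ _ _ P (fun n x => (sin (phi + (e n * h x + B x)) - sin (phi + B x)) / e n)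
    (fun x => h x * cos (phi + B x)) _ _ (L1_abs lh).
- by move=> n; apply: measurable_funM => //; apply: measurable_funB; exact: measurable_sinf.
- move=> n x; rewrite normrM normfV ler_pdivrMr ?normr_gt0//.
  apply: le_trans (abs_sinB_le _ _) _; rewrite -normrM.
  by rewrite (_ : _ - _ = h x * e n)//; ring.
- move=> x; have dsin : is_derive (0 : R) (1 : R) (fun y => sin (phi + (y * h x + B x))) (h x * cos (phi + B x)).
    by apply: is_derive_eq; rewrite mul0r add0r /GRing.scale/=; ring.
  by have := seq_derive dsin e0 ec; under eq_fun do rewrite mul0r add0r.
move=> _ c1.
have dexp : is_derive (0 : R) (1 : R) (fun y => sin phi * expR (- (y ^+ 2 * s + 2 * y * c + q) / 2))
    (- sin phi * c * expR (- q / 2)).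
  apply: is_derive_eq; rewrite /GRing.scale/= !(mulr0, mul0r, add0r, addr0, expr0n, expr1)/=.
  by field.
have c2 := seq_derive dexp e0 ec.
have E n : mean P (fun x => (sin (phi + (e n * h x + B x)) - sin (phi + B x)) / e n) =
   (sin phi * expR (- (e n ^+ 2 * s + 2 * e n * c + q) / 2) -
    sin phi * expR (- (0 ^+ 2 * s + 2 * 0 * c + q) / 2)) / e n.
  rewrite meanZr; last by apply: L1B; exact: L1_sin.
  rewrite meanB; [|exact: L1_sin..]; congr ((_ - _) / _).
    have := gauss1_sinphi phi 1 (g (e n)); rewrite expr1n mul1r => <-.
    by apply: eq_mean => x; rewrite mul1r.
  have := gauss1_sinphi phi 1 (g 0); rewrite expr1n mul1r => <-.
  by apply: eq_mean => x; rewrite mul1r mul0r add0r.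
by rewrite (funext E) in c1; exact: cvg_unique c1 c2.
Qed.

Section Transfer.
Context {R : realType} {d1 d2 : measure_display}.
Context {T1 : measurableType d1} {T2 : measurableType d2}.
Variables (P1 : probability T1 R) (P2 : probability T2 R).
Variables (I : finType) (V : I -> T1 -> R) (W : I -> T2 -> R) (q : (I -> R) -> R).
Hypothesis mV : forall i, measurable_fun setT (V i).
Hypothesis mW : forall i, measurable_fun setT (W i).

Lemma gauss_law E :
  (forall b, gauss1 P1 (fun x => \sum_i b i * V i x) (q b)) ->
  (forall b, gauss1 P2 (fun x => \sum_i b i * W i x) (q b)) ->
  <<s @rectangles R I >> E ->
  P1 [set x | E (fun i => V i x)] = P2 [set x | E (fun i => W i x)].
Proof.
move=> gV gW sE.
have := @same_trig_law _ _ _ _ _ P1 P2 I V W mV mW (fun=> 1) (fun=> 1) E (L1_cst P1 1) (L1_cst P2 1) _ sE.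
have mI (d : measure_display) (T : measurableType d) (P : probability T R) (U : I -> T -> R) :
    (forall i, measurable_fun setT (U i)) ->
    mean P (fun x => 1 * \1_E (fun i => U i x)) = fine (P [set x | E (fun i => U i x)]).
  move=> mU; rewrite -mean_indic; last exact: measurable_rectangles.
  apply: eq_mean => x; rewrite mul1r !indicE.
  by have [h|h] := pselect (E (fun i => U i x)); [rewrite !mem_set|rewrite !memNset].
rewrite !mI// => h; rewrite -[LHS]fineK ?fin_num_measure//; last exact: measurable_rectangles.
rewrite -[RHS]fineK ?fin_num_measure//; last exact: measurable_rectangles.
rewrite h// => b phi.
under eq_mean do rewrite mul1r -[\sum_i _]mul1r.
under [RHS]eq_mean do rewrite mul1r -[\sum_i _]mul1r.
by rewrite (gauss1_cosphi _ _ (gV b)) (gauss1_cosphi _ _ (gW b)).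
Qed.

Lemma gauss_law_fun F :
  (forall b, gauss1 P1 (fun x => \sum_i b i * V i x) (q b)) ->
  (forall b, gauss1 P2 (fun x => \sum_i b i * W i x) (q b)) ->
  (forall B, measurable B -> <<s @rectangles R I >> (F @^-1` B)) ->
  measurable_fun setT (fun x => F (fun i => V i x)) /\
  (L1 P1 (fun x => F (fun i => V i x)) -> L1 P2 (fun x => F (fun i => W i x))) /\
  (L1 P1 (fun x => F (fun i => V i x)) ->
   mean P1 (fun x => F (fun i => V i x)) = mean P2 (fun x => F (fun i => W i x))).
Proof.
move=> gV gW mF.
have mFU (d : measure_display) (T : measurableType d) (U : I -> T -> R) :
    (forall i, measurable_fun setT (U i)) -> measurable_fun setT (fun x => F (fun i => U i x)).
  by move=> mU _ B mB; rewrite setTI; apply: (measurable_rectangles mU (mF _ mB)).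
split; first exact: mFU.
apply: eq_mean_law => [||B mB]; [exact: mFU|exact: mFU|].
exact: (gauss_law gV gW (mF _ mB)).
Qed.

(** For jointly Gaussian h and V, the mean of h on an event of V depends only on the law of V and on
    the covariances of h with V. This does the work of conditional expectations: h can be traded for
    any variable with the same covariances, on any other space. *)
Lemma gauss_law_w h1 h2 s1 s2 (c : (I -> R) -> R) E :
  (forall a b, gauss1 P1 (fun x => a * h1 x + \sum_i b i * V i x) (a ^+ 2 * s1 + 2 * a * c b + q b)) ->
  (forall a b, gauss1 P2 (fun x => a * h2 x + \sum_i b i * W i x) (a ^+ 2 * s2 + 2 * a * c b + q b)) ->
  <<s @rectangles R I >> E ->
  mean P1 (fun x => h1 x * \1_E (fun i => V i x)) = mean P2 (fun x => h2 x * \1_E (fun i => W i x)).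
Proof.
move=> g1 g2; apply: same_trig_law => //.
- exact: (gauss_cos_w 0 (fun a => g1 a (fun=> 0))).1.
- exact: (gauss_cos_w 0 (fun a => g2 a (fun=> 0))).1.
- move=> b phi.
  rewrite (gauss_cos_w phi (fun a => g1 a b)).2.
  by rewrite (gauss_cos_w phi (fun a => g2 a b)).2.
Qed.

End Transfer.

(** * Characteristic function and exponential moments of the normal law *)

Section NormalChar.
Context {R : realType}.
Local Notation mu := (@lebesgue_measure R).
Let phi : R -> R := normal_pdf 0 1.

Lemma normal_pdf01E (x : R) : phi x = normal_peak 1 * expR (- (x ^+ 2) / 2).
Proof. by rewrite /phi normal_pdfE// /normal_fun subr0 expr1n. Qed.

Let iphi : mu.-integrable setT (EFin \o phi).
Proof. exact: integrable_normal_pdf. Qed.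

Let phi0 x : 0 <= phi x. Proof. exact: normal_pdf_ge0. Qed.
Let mphi : measurable_fun setT phi. Proof. exact: measurable_normal_pdf. Qed.

Let dphi (x : R) : is_derive x (1 : R) phi (- x * phi x).
Proof.
rewrite (_ : phi = fun x => normal_peak 1 * expR (- (x ^+ 2) / 2)); last first.
  by apply/funext => y; exact: normal_pdf01E.
by apply: is_derive_eq; rewrite /GRing.scale/=; field.
Qed.

Let e4 (y : R) : `|y| <= expR (y ^+ 2 / 4).
Proof.
apply: le_trans (expR_ge1Dx _); rewrite -(real_normK (num_real y)).
have : 0 <= (`|y| / 2 - 1) ^+ 2 by exact: sqr_ge0.
lra.
Qed.

Let e5 (y : R) : `|y| * expR (- y ^+ 2 / 2) <= expR (- y ^+ 2 / (2 *+ 2)).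
Proof.
apply: le_trans (ler_wpM2r (expR_ge0 _) (e4 y)) _.
rewrite -expRD ler_expR (_ : y ^+ 2 / 4 + - y ^+ 2 / 2 = - y ^+ 2 / (2 *+ 2))//.
by rewrite -mulr_natr; field.
Qed.

(** The factor [|x|] is absorbed by half of the Gaussian exponent; what is left is the normal
    density of variance 2 up to a constant. *)
Let ixphi : mu.-integrable setT (EFin \o (fun x => `|x| * phi x)).
Proof.
have s2 : Num.sqrt 2 != 0 :> R by rewrite gt_eqF// sqrtr_gt0.
have i := @integrable_normal_pdf R 0 (Num.sqrt 2).
pose C := normal_peak 1 / normal_peak (Num.sqrt 2) : R.
have i2 : mu.-integrable setT (EFin \o (fun x => C * normal_pdf 0 (Num.sqrt 2) x)).
  by apply: eq_integrable (integrableZl measurableT C i).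
apply: (le_integrable _ _ _ i2) => //.
  by apply/measurable_EFinP; apply: measurable_funM => //; exact: measurable_normr.
move=> x _ /=; have C0 : 0 <= C * normal_pdf 0 (Num.sqrt 2) x.
  by rewrite mulr_ge0 ?normal_pdf_ge0// divr_ge0 ?normal_peak_ge0.
rewrite lee_fin normrM normr_id (ger0_norm (phi0 x)) (ger0_norm C0).
rewrite normal_pdf01E normal_pdfE// /C /normal_fun subr0 sqr_sqrtr//.
have -> : normal_peak 1 / normal_peak (Num.sqrt 2) * (normal_peak (Num.sqrt 2) * expR (- x ^+ 2 / (2 *+ 2))) =
    normal_peak 1 * expR (- x ^+ 2 / (2 *+ 2)) by field; rewrite gt_eqF ?normal_peak_gt0.
rewrite mulrCA; apply: ler_wpM2l; first exact: normal_peak_ge0.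
exact: e5.
Qed.

Let ib (f : R -> R) (c : R) : measurable_fun setT f -> (forall x, `|f x| <= c) ->
  mu.-integrable setT (EFin \o (fun x => f x * phi x)).
Proof.
move=> mf fc; have i : mu.-integrable setT (EFin \o (fun x => c * phi x)).
  by apply: eq_integrable (integrableZl measurableT c iphi).
apply: (le_integrable _ _ _ i) => //.
  by apply/measurable_EFinP; apply: measurable_funM.
move=> x _ /=; rewrite lee_fin !normrM (ger0_norm (phi0 x)) ler_wpM2r//.
by apply: (le_trans (fc x)); exact: ler_norm.
Qed.

Let mcos (t psi : R) : measurable_fun setT (fun x : R => cos (t * x + psi)).
Proof. by apply: measurable_cosf; apply: measurable_funD => //; exact: measurable_funM. Qed.
Let msin (t psi : R) : measurable_fun setT (fun x : R => sin (t * x + psi)).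
Proof. by apply: measurable_sinf; apply: measurable_funD => //; exact: measurable_funM. Qed.

Let ixsin (t psi : R) : mu.-integrable setT (EFin \o (fun x => x * sin (t * x + psi) * phi x)).
Proof.
apply: (le_integrable _ _ _ ixphi) => //.
  apply/measurable_EFinP; apply: measurable_funM => //.
  by apply: measurable_funM; [exact: measurable_id|exact: msin].
move=> x _ /=; rewrite lee_fin !normrM normr_id ler_wpM2r// ler_piMr// sin_max//.
Qed.

(** Integration by parts: the difference of the two integrands is the derivative of
    [sin (t * x + psi) * phi x] up to sign, and the boundary values vanish at infinity. *)
Let stein (t psi : R) : \int[mu]_x (x * sin (t * x + psi) * phi x) = t * \int[mu]_x (cos (t * x + psi) * phi x).
Proof.
pose f x := t * (cos (t * x + psi) * phi x) - x * sin (t * x + psi) * phi x.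
pose F x := sin (t * x + psi) * phi x.
have ic := ib (mcos t psi) (fun x => cos_max (t * x + psi)).
have itc : mu.-integrable setT (EFin \o (fun x => t * (cos (t * x + psi) * phi x))).
  by apply: eq_integrable (integrableZl measurableT t ic).
have i_f : mu.-integrable setT (EFin \o f).
  by apply: eq_integrable (integrableB measurableT itc (ixsin t psi)).
suff f0 : \int[mu]_x f x = 0.
  by move: f0; rewrite /f RintegralB// (@RintegralZl _ _ _ mu setT _ t)// => /eqP; rewrite subr_eq0 => /eqP.
have dF (x : R) : is_derive x (1 : R) F (f x).
  have := dphi x => d1; rewrite /F /f.
  apply: is_derive_eq; rewrite /GRing.scale/= mulr1; ring.
have cphi : continuous phi by exact: continuous_normal_pdf.
have cf : continuous f.
  move=> x; rewrite /f; apply: (@cvgB _ R^o).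
    apply: (@cvgM _ R); first exact: cvg_cst.
    apply: (@cvgM _ R); last exact: cphi.
    apply: (cvg_comp (fun y => t * y + psi) cos); last exact: continuous_cos.
    apply: (@cvgD _ R^o); last exact: cvg_cst.
    by apply: (@cvgM _ R); [exact: cvg_cst|exact: cvg_id].
  apply: (@cvgM _ R); last exact: cphi.
  apply: (@cvgM _ R); first exact: cvg_id.
  apply: (cvg_comp (fun y => t * y + psi) sin); last exact: continuous_sin.
  apply: (@cvgD _ R^o); last exact: cvg_cst.
  by apply: (@cvgM _ R); [exact: cvg_cst|exact: cvg_id].
have FTC n : \int[mu]_x (f x * \1_`[- n.+1%:R, n.+1%:R] x) = F n.+1%:R - F (- n.+1%:R).
  have ab : - n.+1%:R < n.+1%:R :> R by rewrite -subr_gt0 opprK ltr_wpDl.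
  have := @continuous_FTC2 R f F _ _ ab (continuous_subspaceT cf).
  rewrite -EFinB => h; rewrite /Rintegral -[RHS]/(fine (_)%:E) -h.
  - congr fine; rewrite [RHS]integral_mkcond; apply: eq_integral => x _; rewrite /restrict indicE.
    by case: (x \in _); rewrite ?mulr1 ?mulr0.
  - split.
    + by move=> x _; have [] := dF x.
    + apply: cvg_at_right_filter; have [d _] := dF (- n.+1%:R).
      by apply: differentiable_continuous; apply/derivable1_diffP.
    + apply: cvg_at_left_filter; have [d _] := dF (n.+1%:R).
      by apply: differentiable_continuous; apply/derivable1_diffP.
  - by move=> x _; have [_ <-] := dF x; rewrite derive1E.
have c1 : (fun n => \int[mu]_x (f x * \1_`[- n.+1%:R, n.+1%:R] x)) @ \oo --> \int[mu]_x f x.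
  have mf : measurable_fun setT f by case/integrableP: i_f => /measurable_EFinP.
  have [] := @dominated_convergence _ _ _ mu _ measurableT
    (fun n => EFin \o (fun x => f x * \1_`[- n.+1%:R, n.+1%:R] x)) (EFin \o f) (EFin \o (fun x => `|f x|)).
  - by move=> n; apply/measurable_EFinP; apply: measurable_funM.
  - by case/integrableP: i_f.
  - apply/aeW => x _; apply: cvg_near_cst; near=> n; rewrite /= indicE mem_set ?mulr1//=.
    rewrite in_itv/= -ler_norml (@le_trans _ _ n%:R)// ?ler_nat//.
    by apply/ltW; near: n; exact: nbhs_infty_gtr.
  - exact: integrable_norm.
  - apply/aeW => x n _ /=; rewrite lee_fin normrM ler_piMr// indicE.
    by case: (_ \in _); rewrite ?normr1 ?normr0.
  move=> _ _ c; apply: fine_cvg; rewrite fineK//; exact: integrable_fin_num.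
have c2 : (fun n => F n.+1%:R - F (- n.+1%:R)) @ \oo --> (0 : R).
  have b (x : R) : `|F x| <= phi x by rewrite normrM (ger0_norm (phi0 x)) ler_piMl// sin_max.
  have phiN (x : R) : phi (- x) = phi x by rewrite !normal_pdf01E sqrrN.
  have phie (n : nat) : phi n.+1%:R <= normal_peak 1 * expR 2^-1 * expR (1 *- n).
    rewrite normal_pdf01E -mulrA ler_wpM2l ?normal_peak_ge0// -expRD ler_expR.
    have : 0 <= (n.+1%:R - 1) ^+ 2 :> R by exact: sqr_ge0.
    rewrite -natr1; lra.
  have c0 : (fun n => 2 * (normal_peak 1 * expR 2^-1) * expR (1 *- n)) @ \oo --> (0 : R).
    rewrite -[X in _ --> X](mulr0 (2 * (normal_peak 1 * expR 2^-1))).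
    by apply: cvgM; [exact: cvg_cst|exact: cvgn_expR].
  apply/norm_cvg0P; apply: (squeeze_cvgr _ (cvg_cst (0 : R)) c0); apply: nearW => n.
  rewrite normr_ge0/=; apply: le_trans (ler_normB _ _) _.
  have := b n.+1%:R; have := b (- n.+1%:R); rewrite phiN; have := phie n.
  set e := expR (1 *- n); lra.
rewrite (funext FTC) in c1; exact: cvg_unique c1 c2.
Unshelve. all: by end_near. Qed.

(** By the preceding identity the integral solves [G' s = - s * G s], so [G s * expR (s ^+ 2 / 2)]
    is constant. The phase psi treats cosine and sine together. *)
Lemma normal_char_pdf (t psi : R) : \int[mu]_x (cos (t * x + psi) * phi x) = cos psi * expR (- t ^+ 2 / 2).
Proof.
pose G s := \int[mu]_x (cos (s * x + psi) * phi x).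
have dG (s : R) : is_derive s (1 : R) G (- (s * G s)).
  have st : `]s - 1, s + 1[%classic s by rewrite /= in_itv/=; apply/andP; split; lra.
  have dc (y x : R) : is_derive y (1 : R) (fun z => cos (z * x + psi) * phi x) (- (x * sin (y * x + psi) * phi x)).
    by apply: is_derive_eq; rewrite /GRing.scale/=; ring.
  have i1 (x : R) : `]s - 1, s + 1[%classic x -> mu.-integrable setT (EFin \o (fun y => cos (x * y + psi) * phi y)).
    by move=> _; exact: ib (mcos x psi) (fun y => cos_max _).
  have i2 (x y : R) : `]s - 1, s + 1[%classic x -> setT y -> derivable ((fun z w => cos (z * w + psi) * phi w) ^~ y) x 1.
    by move=> _ _; have [] := dc x y.
  have pE x y : partial1of2 (fun z w => cos (z * w + psi) * phi w) x y = - (y * sin (x * y + psi) * phi y).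
    by rewrite partial1of2E; have [_ ->] := dc x y.
  have i3 (x y : R) : `]s - 1, s + 1[%classic x -> setT y ->
      `|partial1of2 (fun z w => cos (z * w + psi) * phi w) x y| <= `|y| * phi y.
    move=> _ _; rewrite pE normrN !normrM (ger0_norm (phi0 y)) ler_wpM2r//.
    by rewrite ler_piMr// sin_max.
  have h1 := @derivable_under_integral R _ _ mu _ setT measurableT s _ _ st i1 i2 _ (fun y => mulr_ge0 (normr_ge0 y) (phi0 y)) ixphi i3.
  have h2 := @differentiation_under_integral R _ _ mu _ setT measurableT s _ _ st i1 i2 _ (fun y => mulr_ge0 (normr_ge0 y) (phi0 y)) ixphi i3.
  split; first exact: h1.
  rewrite -derive1E h2 -stein.
  under eq_Rintegral do rewrite pE -mulN1r.
  by rewrite RintegralZl ?mulN1r//; exact: ixsin.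
have G0 : G 0 = cos psi.
  rewrite /G; under eq_Rintegral do rewrite mul0r add0r.
  by rewrite RintegralZl// /Rintegral integral_normal_pdf mulr1.
have : G t * expR (t ^+ 2 / 2) = G 0 * expR (0 ^+ 2 / 2).
  apply: (@is_derive_0_is_cst R (fun s => G s * expR (s ^+ 2 / 2))) => s.
  have d := dG s; by apply: is_derive_eq; rewrite /GRing.scale/=; field.
rewrite G0 expr0n/= mul0r expR0 mulr1 => h.
by rewrite -[LHS](mulfK (lt0r_neq0 (expR_gt0 (t ^+ 2 / 2)))) h -expRN mulNr.
Qed.

Lemma normal_pdf_density (A : set R) : measurable A ->
  normal_prob (0 : R) 1 A = (\int[mu]_(x in A) (phi x)%:E)%E.
Proof. by []. Qed.

Definition std_normal : probability (g_sigma_algebraType (R.-ocitv.-measurable)) R := @normal_prob R 0 1.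

Lemma mean_std_normal (c : R) (f : R -> R) : measurable_fun setT f -> (forall x, `|f x| <= c) ->
  mean std_normal f = \int[mu]_x (f x * phi x).
Proof.
move=> mf fc; have lf : L1 std_normal f by exact: (@L1_bnd _ _ _ std_normal c).
have dom : std_normal `<< mu by exact: normal_prob_dominates.
rewrite /mean /Rintegral -(Radon_Nikodym_change_of_variables dom measurableT lf); congr fine.
pose RNd := Radon_Nikodym (charge_of_finite_measure std_normal) mu.
have ae : ae_eq mu setT (RNd) (EFin \o phi).
  apply: integral_ae_eq => //.
  - by apply: Radon_Nikodym_integrable.
  - by case/integrableP: iphi.
  - by move=> A AT mA; rewrite -Radon_Nikodym_integral.
have mRN : measurable_fun setT (RNd).
  by apply: measurable_int; exact: Radon_Nikodym_integrable.
apply: ae_eq_integral => //.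
- by apply: emeasurable_funM => //; exact/measurable_EFinP.
- by apply/measurable_EFinP; apply: measurable_funM => //; case/integrableP: iphi => /measurable_EFinP.
- by apply: filterS ae => x h _; rewrite /= EFinM; congr (_ * _)%E; exact: h.
Qed.

Lemma gauss1_normal : gauss1 std_normal id 1.
Proof.
split; first exact: measurable_id.
move=> a; have := normal_char_pdf a; split.
  rewrite (@mean_std_normal 1)//.
  - by have := normal_char_pdf a 0; rewrite cos0 mul1r mulr1 => <-; apply: eq_Rintegral => x _; rewrite addr0.
  - by have := mcos a 0; under eq_fun do rewrite addr0.
  - by move=> x; exact: cos_max.
rewrite (@mean_std_normal 1)//.
- have := normal_char_pdf a (- (pi / 2)); rewrite cosN cos_pihalf mul0r => <-.
  by apply: eq_Rintegral => x _; rewrite cosBpihalf.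
- by have := msin a 0; under eq_fun do rewrite addr0.
- by move=> x; exact: sin_max.
Qed.

End NormalChar.

(** For [b > 0] the exponential is bounded, hence integrable for every Gaussian u, degenerate or
    not. Its mean depends on the law only, so u is replaced by [Num.sqrt v] times a standard normal
    and the square is completed. *)
Lemma gauss1_exp (R : realType) (d : measure_display) (T : measurableType d)
  (P : probability T R) (u : T -> R) (v b kap : R) : gauss1 P u v -> 0 < b ->
  L1 P (fun x => expR (- (b / 2) * u x ^+ 2 + kap * u x)) /\
  mean P (fun x => expR (- (b / 2) * u x ^+ 2 + kap * u x)) =
    (Num.sqrt (1 + b * v))^-1 * expR (kap ^+ 2 * v / (2 * (1 + b * v))).
Proof.
move=> gu b0; have [mu_ _] := gu.
have v0 : 0 <= v by rewrite -(gauss1_sq gu).2; apply: mean_ge0 => x; exact: sqr_ge0.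
pose G (y : R) := expR (- (b / 2) * y ^+ 2 + kap * y).
have mG : measurable_fun setT G.
  by apply: measurableT_comp => //; apply: measurable_funD; apply: measurable_funM => //; exact: measurable_funX.
have Gb y : `|G y| <= expR (kap ^+ 2 / (2 * b)).
  rewrite ger0_norm ?expR_ge0// ler_expR -subr_ge0.
  rewrite (_ : _ - _ = b / 2 * (y - kap / b) ^+ 2); first by rewrite mulr_ge0 ?sqr_ge0// divr_ge0// ltW.
  by field; rewrite gt_eqF.
have lG : L1 P (fun x => G (u x)) by apply: (L1_bnd P _ (fun x => Gb (u x))); exact: measurableT_comp.
split; first exact: lG.
have gW : gauss1 (@std_normal R) (fun x => Num.sqrt v * x) v.
  have := gauss1Z (Num.sqrt v) (@gauss1_normal R).
  by rewrite sqr_sqrtr// mulr1.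
have [mW _] := gW.
have U1 (T' : Type) (h : T' -> R) (c : unit -> R) : (fun x => \sum_(i : unit) c i * h x) = (fun x => c tt * h x).
  by apply/funext => x; rewrite (bigD1 tt)//= big1 ?addr0// => -[].
have h1 c : gauss1 P (fun x => \sum_(i : unit) c i * u x) (c tt ^+ 2 * v).
  by rewrite U1; exact: gauss1Z.
have h2 c : gauss1 (@std_normal R) (fun x => \sum_(i : unit) c i * (Num.sqrt v * x)) (c tt ^+ 2 * v).
  by rewrite U1; exact: gauss1Z.
have h3 B : measurable B -> <<s @rectangles R unit >> ((fun f : unit -> R => G (f tt)) @^-1` B).
  move=> mB; apply: sub_sigma_algebra; exists (fun=> G @^-1` B); split.
    by move=> _; rewrite -[X in measurable X]setTI; exact: mG.
  by apply/seteqP; split => [f h []|f h] //; exact: (h tt).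
have [_ [_ /(_ lG) eG]] := @gauss_law_fun R _ _ _ _ P (@std_normal R) unit (fun _ => u)
  (fun _ x => Num.sqrt v * x) (fun c => c tt ^+ 2 * v) (fun _ => mu_) (fun _ => mW)
  (fun f => G (f tt)) h1 h2 h3.
rewrite [LHS]eG.
pose B := b * v; pose K := kap * Num.sqrt v.
have B1 : 0 < 1 + B by rewrite /B ltr_pwDl// mulr_ge0// ltW.
(* Standard deviation and mean of the normal density that remains once the square is completed. *)
pose s := (Num.sqrt (1 + B))^-1; pose m := K / (1 + B).
have s0 : 0 < s by rewrite invr_gt0 sqrtr_gt0.
have s2 : s ^+ 2 = (1 + B)^-1 by rewrite exprVn sqr_sqrtr// ltW.
rewrite (@mean_std_normal R (expR (kap ^+ 2 / (2 * b))) (fun x => G (Num.sqrt v * x)))//; last first.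
  exact: measurableT_comp.
have vv : Num.sqrt v ^+ 2 = v by rewrite sqr_sqrtr.
have peak : normal_peak 1 = s * normal_peak s :> R.
  rewrite /normal_peak expr1n mul1r -mulrnAr sqrtrM ?sqr_ge0// sqrtr_sqr gtr0_norm//.
  by field; rewrite !gt_eqF// sqrtr_gt0 mulrn_wgt0// pi_gt0.
have E x : G (Num.sqrt v * x) * normal_pdf 0 1 x =
    (s * expR (kap ^+ 2 * v / (2 * (1 + B)))) * normal_pdf m s x.
  rewrite normal_pdf01E normal_pdfE ?gt_eqF// /normal_fun s2 peak /G.
  rewrite mulrCA -[RHS]mulrA -!mulrA; congr (_ * _).
  rewrite [RHS]mulrCA; congr (_ * _); rewrite -!expRD; congr expR.
  have id w : 1 + b * w ^+ 2 != 0 -> - (b / 2) * (w * x) ^+ 2 + kap * (w * x) + - x ^+ 2 / 2 =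
      kap * (kap * (w ^+ 2 / (2 * (1 + b * w ^+ 2)))) +
      - (x - kap * w / (1 + b * w ^+ 2)) ^+ 2 / ((1 + b * w ^+ 2)^-1 *+ 2).
    by move=> w0; rewrite -mulr_natr; field; rewrite ?w0.
  by have := id (Num.sqrt v); rewrite vv; apply; rewrite gt_eqF.
under eq_Rintegral do rewrite E.
rewrite RintegralZl//; last exact: integrable_normal_pdf.
by rewrite {1}/Rintegral integral_normal_pdf/= mulr1.
Qed.

Definition RV (R : realType) (I : Type) := g_sigma_algebraType (@rectangles R I).

Lemma measurable_coord (R : realType) (I : eqType) (i : I) : measurable_fun setT (fun f : RV R I => f i).
Proof.
move=> _ B mB; rewrite setTI; apply: sub_sigma_algebra.
exists (fun j => if j == i then B else setT); split; first by move=> j; case: ifP.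
apply/seteqP; split => [f /= fB j|f /= /(_ i)]; last by rewrite eqxx.
by case: eqP => [->|].
Qed.

Lemma measurable_RV (R : realType) (I : finType) (d d' : measure_display) (T : measurableType d)
  (T' : measurableType d') (U : I -> T -> R) (F : RV R I -> T') :
  (forall i, measurable_fun setT (U i)) -> measurable_fun setT F ->
  measurable_fun setT (fun x => F (fun i => U i x)).
Proof.
move=> mU mF _ B mB; rewrite setTI; apply: (measurable_rectangles mU (E := F @^-1` B)).
by have := mF measurableT B mB; rewrite setTI.
Qed.

Lemma rectangles_pre (R : realType) (I J : finType) (g : J -> I) (E : set (J -> R)) :
  <<s @rectangles R J >> E -> <<s @rectangles R I >> [set f | E (fun j => f (g j))].
Proof.
move=> sE; apply: (@measurable_rectangles R J _ (RV R I) (fun j f => f (g j))) => // j.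
exact: measurable_coord.
Qed.

Definition qform (R : realType) (l : nat) (g r : R) (a : 'I_l -> R) : R :=
  lam2 g r * (\sum_i a i ^+ 2) + r * g * (\sum_i a i) ^+ 2.

Lemma qformE (R : realType) (l : nat) (g r : R) (a : 'I_l -> R) :
  \sum_i \sum_j a i * a j * eqcov l g r i j = qform g r a.
Proof.
rewrite /qform expr2 mulr_suml !mulr_sumr -big_split/=; apply: eq_bigr => i _.
rewrite (mulrC (r * g)) mulrA mulr_sumr mulr_suml.
rewrite (bigD1 i)//= mxE eqxx [X in _ = _ + X](bigD1 i)//=.
rewrite (eq_bigr (fun j => a i * a j * (r * g))); first by rewrite /lam2; ring.
by move=> j ji; rewrite mxE eq_sym (negbTE ji).
Qed.

(** * The memoryless Gaussian process: joint laws and independence over time *)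

Section Process.
Context {R : realType} {dT : measure_display} {Omega : measurableType dT}.
Variables (P : probability Omega R) (l : nat) (gX rX gZ rZ : R).
Variables (X Z : nat -> 'I_l -> Omega -> R).
Hypothesis hX : forall t, gaussian_vec P (X t) (eqcov l gX rX).
Hypothesis hZ : forall t, gaussian_vec P (Z t) (eqcov l gZ rZ).
Hypothesis hXZ : indep_signal_noise P X Z.
Let F t := sigma_of (fun p : 'I_l + 'I_l => match p with inl i => X t i | inr i => Z t i end).
Hypothesis hiid : indep_family P F.

Let gvec (V : 'I_l -> Omega -> R) g r : gaussian_vec P V (eqcov l g r) ->
  forall a, gauss1 P (fun w => \sum_i a i * V i w) (qform g r a).
Proof.
move=> [mV hV] a; split.
  by apply: measurable_sum => i; exact: measurable_funM.
move=> c; have [h1 h2] := hV (fun i => c * a i).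
have e w : \sum_i c * a i * V i w = c * \sum_i a i * V i w.
  by rewrite mulr_sumr; apply: eq_bigr => i _; rewrite mulrA.
have q : \sum_i \sum_j c * a i * (c * a j) * eqcov l g r i j = c ^+ 2 * qform g r a.
  rewrite -qformE mulr_sumr; apply: eq_bigr => i _; rewrite mulr_sumr; apply: eq_bigr => j _.
  by ring.
split; rewrite /mean /Rintegral.
- by under eq_integral do rewrite -e; rewrite h1/= q mulNr.
- by under eq_integral do rewrite -e; rewrite h2.
Qed.

Let mX t i : measurable_fun setT (X t i). Proof. by have [] := hX t. Qed.
Let mZ t i : measurable_fun setT (Z t i). Proof. by have [] := hZ t. Qed.
Let Fm t E : F t E -> measurable E.
Proof. by apply: sigma_of_meas => -[]. Qed.
Let FT t : F t setT. Proof. exact: sigma_ofT. Qed.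
Let FI t : setI_closed (F t). Proof. exact: sigma_ofI. Qed.

Let sX t i : smeas F (pred1 t) (X t i).
Proof.
move=> B mB; apply: sub_sigma_algebra; exists t => /=; first exact: eqxx.
exact: (@sigma_of_gen _ _ _ _ _ (inl i)).
Qed.
Let sZ t i : smeas F (pred1 t) (Z t i).
Proof.
move=> B mB; apply: sub_sigma_algebra; exists t => /=; first exact: eqxx.
exact: (@sigma_of_gen _ _ _ _ _ (inr i)).
Qed.

Let lin_t t a b : gauss1 P (fun w => \sum_i a i * X t i w + \sum_i b i * Z t i w)
  (qform gX rX a + qform gZ rZ b).
Proof.
apply: gauss1_indepD; [exact: gvec|exact: gvec|move=> A B mA mB].
pose G (b : bool) := if b then sigma_of (X t) else sigma_of (Z t).
have sl (V : 'I_l -> Omega -> R) (c : 'I_l -> R) (b0 : bool) : sigma_of V = G b0 ->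
    smeas G (pred1 b0) (fun w => \sum_i c i * V i w).
  move=> VG; apply/smeasP; apply: measurable_sum => i; apply: measurable_funM => //.
  apply/smeasP => C mC; apply: sub_sigma_algebra; exists b0 => /=; first exact: eqxx.
  by rewrite -VG; exact: sigma_of_gen.
have := @sigI_indep _ _ _ P bool G (@hXZ t) _ _ _ (pred1 true) (pred1 false); apply.
- by case; apply: sigma_of_meas.
- by case; exact: sigma_ofT.
- by case; exact: sigma_ofI.
- by case.
- exact: sl.
- exact: sl.
Qed.

Let slin (I : pred nat) (s : seq nat) (a b : nat -> 'I_l -> R) : (forall t, t \in s -> I t) ->
  smeas F I (fun w => \sum_(t <- s) (\sum_i a t i * X t i w + \sum_i b t i * Z t i w)).
Proof.
move=> sI; have m (t : nat) (c : R) (V : Omega -> R) : t \in s -> smeas F (pred1 t) V ->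
    smeas F I (fun w => c * V w).
  move=> ts sV; apply/smeasP; apply: measurable_funM => //; apply/smeasP => B mB.
  by apply: (sigI_sub _ (sV _ mB)) => u /= /eqP ->; exact: sI.
apply/smeasP; elim: s sI m => [|u s ih] sI m.
  by rewrite (_ : (fun w => _) = fun=> 0); [exact: measurable_cst|apply/funext => w; rewrite big_nil].
rewrite (_ : (fun w => _) = (fun w => (\sum_i a u i * X u i w + \sum_i b u i * Z u i w) +
  \sum_(t <- s) (\sum_i a t i * X t i w + \sum_i b t i * Z t i w))); last first.
  by apply/funext => w; rewrite big_cons.
apply: measurable_funD.
  apply: measurable_funD; apply: measurable_sum => i; apply/smeasP.
    by apply: (m u); [rewrite mem_head|exact: sX].
  by apply: (m u); [rewrite mem_head|exact: sZ].
apply: ih => [t ts|t c V ts]; first by apply: sI; rewrite in_cons ts orbT.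
by apply: m; rewrite in_cons ts orbT.
Qed.

Lemma proc_lin (s : seq nat) (a b : nat -> 'I_l -> R) : uniq s ->
  gauss1 P (fun w => \sum_(t <- s) (\sum_i a t i * X t i w + \sum_i b t i * Z t i w))
    (\sum_(t <- s) (qform gX rX (a t) + qform gZ rZ (b t))).
Proof.
elim: s => [|t s ih] us.
  rewrite big_nil; rewrite (_ : (fun w => _) = fun=> 0); last by apply/funext => w; rewrite big_nil.
  split=> [|c]; first exact: measurable_cst.
  by rewrite mulr0 cos0 sin0 !mean_cst mulr0 oppr0 mul0r expR0.
rewrite big_cons (_ : (fun w => _) = (fun w => (\sum_i a t i * X t i w + \sum_i b t i * Z t i w) +
  \sum_(t <- s) (\sum_i a t i * X t i w + \sum_i b t i * Z t i w))); last first.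
  by apply/funext => w; rewrite big_cons.
move: us => /=/andP[ts us]; apply: gauss1_indepD; [exact: lin_t|exact: ih|move=> A B mA mB].
apply: (@sigI_indep _ _ _ P _ F hiid Fm FT FI (pred1 t) (mem s)).
- by move=> u /= /eqP ->.
- have := @slin (pred1 t) [:: t] a b _ A mA; under eq_fun do rewrite big_seq1; apply.
  by move=> u; rewrite inE.
- exact: slin.
Qed.

Lemma proc_smeas t i : smeas F (pred1 t) (X t i). Proof. exact: sX. Qed.

Lemma proc_prod (J : finType) (g : J -> pred nat) (f : J -> Omega -> R) :
  (forall i j t, g i t -> g j t -> i = j) -> (forall i, smeas F (g i) (f i)) ->
  (forall i, L1 P (f i)) ->
  L1 P (fun x => \prod_i f i x) /\ mean P (fun x => \prod_i f i x) = \prod_i mean P (f i).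
Proof.
move=> dis sf lf; have := @mean_smeas_prod _ _ _ P _ F hiid Fm FT FI J (index_enum J) g f; apply=> //.
- exact: index_enum_uniq.
- by move=> i j _ _ ij t gi; apply/negP => gj; move: ij; rewrite (dis _ _ _ gi gj) eqxx.
Qed.

Lemma smeas_RV (I : finType) (tau : I -> nat) (V : nat -> Omega -> R) (f : RV R I -> R) (g : pred nat) :
  (forall t, smeas F (pred1 t) (V t)) -> (forall i, g (tau i)) -> measurable_fun setT f ->
  smeas F g (fun x => f (fun i => V (tau i) x)).
Proof.
move=> sV gt mf; apply/smeasP.
apply: (@measurable_RV R I _ _ (g_sigma_algebraType (\bigcup_(t in [set t | g t]) F t)) _
  (fun i => V (tau i)) f _ mf) => i.
apply/smeasP => B mB; apply: (sigI_sub _ (sV _ _ mB)) => t /= /eqP ->; exact: gt.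
Qed.

End Process.

Lemma big_if_eq (R : comPzRingType) (I : finType) (i : I) (a b : I -> R) :
  (forall j, j != i -> b j = 1) -> \prod_j (if j == i then a j else b j) = a i.
Proof.
by move=> b1; rewrite (bigD1 i)//= eqxx big1 ?mulr1// => j ne; rewrite (negbTE ne) b1.
Qed.

(** Under the product law of the [q i], the functions [m i / q i] of separate coordinates are
    centred, hence orthogonal. Pointwise [2 h M - h ^+ 2 <= M ^+ 2], and in the second moment of M
    only diagonal terms survive. With m the first moments of independent noises, all codewords
    together estimate a combination of the noises no better than the separate ones do. *)
Lemma prod_projection (R : realFieldType) (I K : finType) (q m : I -> K -> R) (o : I -> R)
  (h : {ffun I -> K} -> R) : (forall i k, 0 <= q i k) -> (forall i, \sum_k q i k = 1) ->
  (forall i, \sum_k m i k = 0) -> (forall i k, q i k = 0 -> m i k = 0) ->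
  \sum_c (2 * h c * (\sum_i o i * \prod_j (if j == i then m j (c j) else q j (c j)))
     - h c ^+ 2 * \prod_j q j (c j)) <= \sum_i o i ^+ 2 * \sum_k m i k ^+ 2 / q i k.
Proof.
move=> q0 q1 m0 qm.
pose mu i k := m i k / q i k.
have mE i k : m i k = mu i k * q i k.
  have [e|e] := eqVneq (q i k) 0; first by rewrite e mulr0 qm.
  by rewrite /mu divfK.
have E c i : \prod_j (if j == i then m j (c j) else q j (c j)) = mu i (c i) * \prod_j q j (c j).
  rewrite (bigD1 i)//= eqxx [in RHS](bigD1 i)//= mulrA -mE; congr (_ * _).
  by apply: eq_bigr => j /negbTE ->.
pose M (c : {ffun I -> K}) := \sum_i o i * mu i (c i).
apply: (@le_trans _ _ (\sum_(c : {ffun I -> K}) M c ^+ 2 * \prod_j q j (c j))).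
  apply: ler_sum => c _.
  have -> : \sum_i o i * \prod_j (if j == i then m j (c j) else q j (c j)) = M c * \prod_j q j (c j).
    by rewrite mulr_suml; apply: eq_bigr => i _; rewrite E mulrA.
  have p0 : 0 <= \prod_j q j (c j) by apply: prodr_ge0.
  rewrite -subr_ge0; have : 0 <= (M c - h c) ^+ 2 * \prod_j q j (c j) by rewrite mulr_ge0// sqr_ge0.
  by move: (\prod_j _) => p; rewrite (_ : (M c - h c) ^+ 2 * p = M c ^+ 2 * p - (2 * h c * (M c * p) - h c ^+ 2 * p))//; ring.
have F i i' : \sum_(c : {ffun I -> K}) mu i (c i) * mu i' (c i') * \prod_j q j (c j) =
    if i' == i then \sum_k m i k ^+ 2 / q i k else 0.
  transitivity (\sum_(c : {ffun I -> K}) \prod_j ((if j == i then mu j (c j) else 1) *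
      ((if j == i' then mu j (c j) else 1) * q j (c j)))).
    apply: eq_bigr => c _; rewrite !big_split/= !big_if_eq ?mulrA//.
  rewrite -(bigA_distr_bigA (fun j k => (if j == i then mu j k else 1) * ((if j == i' then mu j k else 1) * q j k))).
  rewrite (bigD1 i)//= eqxx; case: ifPn => [/eqP ->|ne].
    rewrite eqxx [X in _ * X]big1 ?mulr1; last first.
      by move=> j ne; rewrite (negbTE ne) -[RHS](q1 j); apply: eq_bigr => k _; rewrite !mul1r.
    by apply: eq_bigr => k _; rewrite -mE /mu expr2 mulrAC.
  rewrite eq_sym (negbTE ne) (eq_bigr (m i)) ?m0 ?mul0r// => k _.
  by rewrite mul1r -mE.
have -> : \sum_(c : {ffun I -> K}) M c ^+ 2 * \prod_j q j (c j) =
   \sum_i \sum_i' o i * o i' * \sum_(c : {ffun I -> K}) mu i (c i) * mu i' (c i') * \prod_j q j (c j).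
  under eq_bigr do rewrite expr2 mulr_suml mulr_suml.
  rewrite exchange_big/=; apply: eq_bigr => i _.
  under eq_bigr do rewrite mulr_sumr mulr_suml.
  rewrite exchange_big/=; apply: eq_bigr => i' _.
  by rewrite mulr_sumr; apply: eq_bigr => c _; ring.
apply: ler_sum => i _; rewrite (bigD1 i)//= F eqxx -expr2 [X in _ + X]big1 ?addr0// => i' ne.
by rewrite F (negbTE ne) mulr0.
Qed.

Section Fubini.
Context {R : realType} {d1 d2 : measure_display}.
Context {T1 : measurableType d1} {T2 : measurableType d2}.
Variables (P1 : probability T1 R) (P2 : probability T2 R).
Local Notation Q := ((P1 \x P2)%E : probability (T1 * T2)%type R).

Lemma mean_fubini (f : T1 * T2 -> R) : L1 Q f -> (forall x, L1 P2 (fun y => f (x, y))) ->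
  L1 P1 (fun x => mean P2 (fun y => f (x, y))) /\
  mean Q f = mean P1 (fun x => mean P2 (fun y => f (x, y))).
Proof.
move=> iQ i2; have E : (EFin \o fun x => mean P2 (fun y => f (x, y))) = fubini_F P2 (EFin \o f).
  by apply/funext => x /=; rewrite EFin_mean.
have i1 : L1 P1 (fun x => mean P2 (fun y => f (x, y))).
  by rewrite /L1 E; exact: integrable_fubini_F iQ.
split=> //; rewrite /mean /Rintegral -(integral12_prod_meas1 iQ).
by congr fine; apply: eq_integral => x _; rewrite -[LHS]/(fubini_F P2 (EFin \o f) x) -E.
Qed.

End Fubini.

(* Log-density of a Gaussian law relative to N(0, u): [a] governs its variance and [s] its mean, so
   [expR (tilt ...)] has mean one under N(0, u). *)
Definition tilt (R : realType) (a u lam s y : R) : R :=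
  2^-1 * ln (1 + a * u) - a / 2 * y ^+ 2 + (1 + a * u) * (y * s / lam - u * s ^+ 2 / (2 * lam ^+ 2)).

Lemma expR_halfln (R : realType) (x : R) : 0 < x -> expR (2^-1 * ln x) = Num.sqrt x.
Proof.
move=> x0; have e : (expR (2^-1 * ln x)) ^+ 2 = x.
  by rewrite expr2 -expRD -mulrDl -[X in (X + X) * _]mul1r -mulrDl divff ?mul1r ?lnK ?posrE// pnatr_eq0.
by rewrite -[in RHS]e sqrtr_sqr ger0_norm// expR_ge0.
Qed.

Lemma mean_tilt (R : realType) (d : measure_display) (T : measurableType d) (P : probability T R)
  (y : T -> R) (a u lam s : R) : gauss1 P y u -> 0 < a ->
  L1 P (fun x => expR (tilt a u lam s (y x))) /\ mean P (fun x => expR (tilt a u lam s (y x))) = 1.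
Proof.
move=> gy a0; have u0 : 0 <= u by rewrite -(gauss1_sq gy).2; apply: mean_ge0 => x; exact: sqr_ge0.
have au0 : 0 < 1 + a * u by rewrite ltr_pwDl// mulr_ge0// ltW.
pose kap := (1 + a * u) * s / lam.
have [l e] := gauss1_exp kap gy a0.
have E x : expR (tilt a u lam s (y x)) = Num.sqrt (1 + a * u) * expR (- ((1 + a * u) * (u * s ^+ 2 / (2 * lam ^+ 2))))
    * expR (- (a / 2) * y x ^+ 2 + kap * y x).
  rewrite -expR_halfln// -!expRD; congr expR; rewrite /tilt /kap; ring.
split; first by under eq_fun do rewrite E; exact: L1Z.
under eq_mean do rewrite E.
rewrite meanZ// e mulrACA divff ?gt_eqF ?sqrtr_gt0// mul1r -expRD.
rewrite [X in expR X](_ : _ = 0) ?expR0// /kap.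
have [->|l0] := eqVneq lam 0; first by rewrite expr0n/= !(mulr0, invr0, mul0r, oppr0, expr0n, add0r).
by field; rewrite l0 gt_eqF.
Qed.

(** Mean log-density when the centre of the test law is selected by a message c; [g c] is the
    indicator of c or its conditional probability. As the [g c] sum to one, the terms free of s keep
    their unconditional means. *)
Lemma mean_tilt_sel (R : realType) (d : measure_display) (T : measurableType d) (P : probability T R)
  (C : finType) (y : T -> R) (g : C -> T -> R) (a u lam : R) (s : C -> R) :
  gauss1 P y u -> (forall x, \sum_c g c x = 1) -> (forall c, L1 P (g c)) ->
  (forall c, L1 P (fun x => y x * g c x)) ->
  L1 P (fun x => \sum_c tilt a u lam (s c) (y x) * g c x) /\
  mean P (fun x => \sum_c tilt a u lam (s c) (y x) * g c x) =
    2^-1 * ln (1 + a * u) - a / 2 * u + (1 + a * u) * \sum_c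
      (s c / lam * mean P (fun x => y x * g c x) - u * s c ^+ 2 / (2 * lam ^+ 2) * mean P (g c)).
Proof.
move=> gy g1 lg lyg; have [l2 m2] := gauss1_sq gy.
pose f c x := (1 + a * u) * (s c / lam * (y x * g c x) - u * s c ^+ 2 / (2 * lam ^+ 2) * g c x).
have lf c : L1 P (f c) by apply: L1Z; apply: L1B; exact: L1Z.
have E : (fun x => \sum_c tilt a u lam (s c) (y x) * g c x) =
    (fun x => (2^-1 * ln (1 + a * u) - a / 2 * y x ^+ 2) + \sum_c f c x).
  apply/funext => x; have e (z : R) : z = \sum_c z * g c x by rewrite -mulr_sumr g1 mulr1.
  rewrite [X in _ = X + _]e -big_split/=.
  by apply: eq_bigr => c _; rewrite /tilt /f; ring.
have l0 : L1 P (fun x => 2^-1 * ln (1 + a * u) - a / 2 * y x ^+ 2).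
  by apply: L1B; [exact: L1_cst|exact: L1Z].
rewrite E; split; first by apply: L1D => //; apply: L1_sum => c _; exact: lf.
rewrite meanD//; last by apply: L1_sum => c _; exact: lf.
rewrite meanB; [|exact: L1_cst|exact: L1Z].
rewrite mean_cst meanZ// m2 mean_sum; last by move=> c _; exact: lf.
congr (_ + _); rewrite mulr_sumr; apply: eq_bigr => c _.
by rewrite meanZ ?meanB ?meanZ//; [exact: L1Z..|apply: L1B; exact: L1Z].
Qed.

Lemma ln_prod (R : realType) (I : Type) (s : seq I) (F : I -> R) : (forall i, 0 < F i) ->
  ln (\prod_(i <- s) F i) = \sum_(i <- s) ln (F i).
Proof.
move=> F0; elim: s => [|i s ih]; first by rewrite !big_nil ln1.
by rewrite !big_cons lnM ?posrE ?ih// prodr_gt0.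
Qed.

(** * Converse *)

Section Code.
Context {R : realType} {d1 d2 : measure_display}.
Context {T1 : measurableType d1} {T2 : measurableType d2}.
Variables (P1 : probability T1 R) (P2 : probability T2 R).
Local Notation Q := ((P1 \x P2)%E : probability (T1 * T2)%type R).
Variables (n m : nat) (K : finType) (enc : 'I_m -> RV R 'I_n -> K).
Hypothesis menc : forall i k, <<s @rectangles R 'I_n >> (enc i @^-1` [set k]).
Variables (Y : 'I_n -> 'I_m -> T1 -> R) (N : 'I_n -> 'I_m -> T2 -> R) (th : R).
Hypothesis mY : forall t i, measurable_fun setT (Y t i).
Hypothesis gN : forall t i, gauss1 P2 (N t i) th.
Hypothesis Ngrp : forall g : 'I_m -> RV R 'I_n -> R, (forall i, measurable_fun setT (g i)) ->
  (forall i, L1 P2 (fun x => g i (fun t => N t i x))) ->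
  L1 P2 (fun x => \prod_i g i (fun t => N t i x)) /\
  mean P2 (fun x => \prod_i g i (fun t => N t i x)) = \prod_i mean P2 (fun x => g i (fun t => N t i x)).

(* The sources are [Y + N] on the product space; [nois t i w] is the energy of the estimate of [N t i]
   from the codeword of encoder [i] when [Y] is known to be [Y w]. *)
Definition cword (z : T1 * T2) : {ffun 'I_m -> K} := [ffun i => enc i (fun t => Y t i z.1 + N t i z.2)].
Definition qcond i k (w : T1) : R := mean P2 (fun x => (cword (w, x) i == k)%:R).
Definition mcond t i k (w : T1) : R := mean P2 (fun x => N t i x * (cword (w, x) i == k)%:R).
Definition pcond c (w : T1) : R := mean P2 (fun x => (cword (w, x) == c)%:R).
Definition nois t i (w : T1) : R := \sum_k mcond t i k w ^+ 2 / qcond i k w.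

Let mN t i : measurable_fun setT (N t i). Proof. by have [] := gN t i. Qed.

Lemma mind (d : measure_display) (T : measurableType d) (V : 'I_n -> T -> R) i k :
  (forall t, measurable_fun setT (V t)) ->
  measurable_fun setT (fun x => (enc i (fun t => V t x) == k)%:R : R).
Proof.
move=> mV; rewrite (_ : (fun x => _) = \1_[set x | (enc i @^-1` [set k]) (fun t => V t x)]).
  exact/measurable_indic/measurable_rectangles.
apply/funext => x; rewrite indicE.
by case: eqP => h; [rewrite mem_set|rewrite memNset].
Qed.

Lemma L1_bool (d : measure_display) (T : measurableType d) (P : probability T R) (b : T -> bool) :
  measurable_fun setT (fun x => (b x)%:R : R) -> L1 P (fun x => (b x)%:R).
Proof. by move=> mb; apply: (@L1_bnd _ _ _ P 1) => // x; case: (b x); rewrite ?normr1 ?normr0. Qed.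

Lemma L1_Mbool (d : measure_display) (T : measurableType d) (P : probability T R) f (b : T -> bool) :
  measurable_fun setT (fun x => (b x)%:R : R) -> L1 P f -> L1 P (fun x => f x * (b x)%:R).
Proof.
move=> mb lf; apply: (@L1_Mb _ _ _ P 1) => // x.
by case: (b x); rewrite ?normr1 ?normr0.
Qed.

Let mQ t i : measurable_fun setT (fun z : T1 * T2 => Y t i z.1 + N t i z.2).
Proof. by apply: measurable_funD; apply: measurableT_comp. Qed.

Lemma mcw1 i k : measurable_fun setT (fun z => (cword z i == k)%:R : R).
Proof.
rewrite (_ : (fun z => _) = (fun z : T1 * T2 => (enc i (fun t => Y t i z.1 + N t i z.2) == k)%:R)); last first.
  by apply/funext => z; rewrite /cword ffunE.
exact: (mind (V := fun t (z : T1 * T2) => Y t i z.1 + N t i z.2)).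
Qed.

Lemma cwordE z c : (cword z == c)%:R = \prod_i (cword z i == c i)%:R :> R.
Proof.
have [->|ne] := eqVneq (cword z) c; first by rewrite big1// => i _; rewrite eqxx.
have : ~~ [forall i, cword z i == c i].
  by apply: contraNN ne => /forallP h; apply/eqP/ffunP => i; exact/eqP.
rewrite negb_forall => /existsP[i /negbTE h].
by rewrite (bigD1 i)//= h mul0r.
Qed.

Lemma mcw c : measurable_fun setT (fun z => (cword z == c)%:R : R).
Proof.
rewrite (_ : (fun z => _) = (fun z => \prod_i (cword z i == c i)%:R)); last by apply/funext => z; exact: cwordE.
by apply: measurable_prod => i _; exact: mcw1.
Qed.

Lemma mslice (f : T1 * T2 -> R) w : measurable_fun setT f -> measurable_fun setT (fun x => f (w, x)).
Proof. by move=> mf; apply: (measurableT_comp mf); exact: pair1_measurable. Qed.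

Let sl1 i k w : measurable_fun setT (fun x => (cword (w, x) i == k)%:R : R).
Proof. exact: (mslice w (mcw1 i k)). Qed.
Let sl c w : measurable_fun setT (fun x => (cword (w, x) == c)%:R : R).
Proof. exact: (mslice w (mcw c)). Qed.

Lemma sum_eqb (C : finType) (k0 : C) (f : C -> R) : \sum_k f k * (k0 == k)%:R = f k0.
Proof.
rewrite (bigD1 k0)//= eqxx mulr1 big1 ?addr0// => k ne.
by rewrite eq_sym (negbTE ne) mulr0.
Qed.

Lemma qcond_ge0 i k w : 0 <= qcond i k w. Proof. by apply: mean_ge0. Qed.

Lemma sum_qcond i w : \sum_k qcond i k w = 1.
Proof.
rewrite -mean_sum; last by move=> k _; apply: L1_bool; exact: sl1.
under eq_mean do under eq_bigr do rewrite -[_%:R]mul1r.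
by under eq_mean do rewrite sum_eqb; rewrite mean_cst.
Qed.

Let lN t i : L1 P2 (N t i). Proof. exact: gauss1_L1 (gN t i). Qed.

Lemma sum_mcond t i w : \sum_k mcond t i k w = 0.
Proof.
rewrite -mean_sum; last by move=> k _; apply: L1_Mbool => //; exact: sl1.
by under eq_mean do rewrite sum_eqb; rewrite (gauss1_mean (gN t i)).
Qed.

(** This is the nonnegativity of the mean of the squared error of an estimate g of the noise.
    Varying g shows that a codeword of probability zero has zero first moment and that the estimate
    energy is at most th. *)
Lemma cond_test t i w (g : K -> R) : 2 * (\sum_k g k * mcond t i k w) - \sum_k g k ^+ 2 * qcond i k w <= th.
Proof.
have [l2 e2] := gauss1_sq (gN t i).
have li k : L1 P2 (fun x => (cword (w, x) i == k)%:R) by apply: L1_bool; exact: sl1.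
have lNi k : L1 P2 (fun x => N t i x * (cword (w, x) i == k)%:R) by apply: L1_Mbool => //; exact: sl1.
have -> : \sum_k g k * mcond t i k w = mean P2 (fun x => \sum_k g k * (N t i x * (cword (w, x) i == k)%:R)).
  by rewrite mean_sum => [|k _]; [apply: eq_bigr => k _; rewrite meanZ|exact: L1Z].
have -> : \sum_k g k ^+ 2 * qcond i k w = mean P2 (fun x => \sum_k g k ^+ 2 * (cword (w, x) i == k)%:R).
  by rewrite mean_sum => [|k _]; [apply: eq_bigr => k _; rewrite meanZ|exact: L1Z].
have l3 : L1 P2 (fun x => \sum_k g k * (N t i x * (cword (w, x) i == k)%:R)) by apply: L1_sum => k _; exact: L1Z.
have l4 : L1 P2 (fun x => \sum_k g k ^+ 2 * (cword (w, x) i == k)%:R) by apply: L1_sum => k _; exact: L1Z.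
rewrite -e2 -meanZ// -meanB//; last exact: L1Z.
apply: le_mean => //; first by apply: L1B => //; exact: L1Z.
move=> x; rewrite sum_eqb.
under eq_bigr do rewrite mulrA; rewrite (sum_eqb _ (fun k => g k * N t i x)).
have : 0 <= (N t i x - g (cword (w, x) i)) ^+ 2 by exact: sqr_ge0.
by move: (N t i x) (g _) => a b; rewrite sqrrB => h; rewrite -subr_ge0 (le_trans h)// le_eqVlt; apply/orP; left; apply/eqP; rewrite -mulr_natr; ring.
Qed.

Lemma qcond_eq0 t i k w : qcond i k w = 0 -> mcond t i k w = 0.
Proof.
move=> q0; pose a := mcond t i k w; apply/eqP/negPn/negP => a0.
(* Probability zero removes the quadratic term, so this multiple of the moment would give th + 1 <=
   th. *)
have := cond_test t i w (fun k' => if k' == k then (th + 1) / (2 * a) else 0).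
rewrite (bigD1 k)//= eqxx big1 ?addr0; last by move=> k' /negbTE ->; rewrite mul0r.
rewrite (bigD1 k)//= eqxx q0 mulr0 add0r big1 ?subr0; last by move=> k' /negbTE ->; rewrite expr0n/= mul0r.
rewrite -/a [X in X <= _](_ : _ = th + 1); first by rewrite leNgt ltrDl ltr01.
by field.
Qed.

Lemma nois_ge0 t i w : 0 <= nois t i w.
Proof. by apply: sumr_ge0 => k _; rewrite divr_ge0// ?sqr_ge0// qcond_ge0. Qed.

Lemma nois_le t i w : nois t i w <= th.
Proof.
have := cond_test t i w (fun k => mcond t i k w / qcond i k w).
apply: le_trans; rewrite mulr_sumr -sumrB; apply: ler_sum => k _.
have [e|e] := eqVneq (qcond i k w) 0; first by rewrite (qcond_eq0 t e) e invr0 !mulr0 subr0.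
by apply: le_of_eq; field.
Qed.

Lemma L1_mY_q c (f : T1 -> R) : L1 P1 f -> L1 P1 (fun w => f w * pcond c w) /\
  mean P1 (fun w => f w * pcond c w) = mean Q (fun z => f z.1 * (cword z == c)%:R).
Proof.
move=> lf; have [l1 _] := L1_fst P2 lf.
have lQ : L1 Q (fun z => f z.1 * (cword z == c)%:R) by apply: L1_Mbool => //; exact: mcw.
have [] := mean_fubini lQ.
  by move=> w; apply: (L1Z (f w)); apply: L1_bool; exact: sl.
move=> l ->; have E w : mean P2 (fun x => f (w, x).1 * (cword (w, x) == c)%:R) = f w * pcond c w.
  by rewrite /= meanZ//; apply: L1_bool; exact: sl.
by split; [rewrite -(funext E)|apply: eq_mean => w; rewrite E].
Qed.

Definition mpcond t i c (w : T1) : R := mean P2 (fun x => N t i x * (cword (w, x) == c)%:R).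

Lemma L1_mpcond t i c : L1 P1 (mpcond t i c) /\
  mean P1 (mpcond t i c) = mean Q (fun z => N t i z.2 * (cword z == c)%:R).
Proof.
have [l1 _] := L1_snd P1 (lN t i).
have lQ : L1 Q (fun z => N t i z.2 * (cword z == c)%:R) by apply: L1_Mbool => //; exact: mcw.
have [] := mean_fubini lQ.
  by move=> w; apply: L1_Mbool => //; exact: sl.
by move=> l ->.
Qed.

Let slice_prod (w : T1) (g : 'I_m -> RV R 'I_n -> R) (c : {ffun 'I_m -> K}) :
  (forall i, measurable_fun setT (g i)) -> (forall i, L1 P2 (fun x => g i (fun t => N t i x))) ->
  mean P2 (fun x => \prod_i (g i (fun t => N t i x) * (cword (w, x) i == c i)%:R)) =
  \prod_i mean P2 (fun x => g i (fun t => N t i x) * (cword (w, x) i == c i)%:R).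
Proof.
move=> mg lg.
pose G i (f : RV R 'I_n) : R := g i f * (enc i (fun t => Y t i w + f t) == c i)%:R.
have mb i : measurable_fun setT (fun f : RV R 'I_n => (enc i (fun t => Y t i w + f t) == c i)%:R : R).
  apply: (@mind _ (RV R 'I_n) (fun t f => Y t i w + f t)) => t.
  by apply: measurable_funD => //; exact: measurable_coord.
have mG i : measurable_fun setT (G i) by apply: measurable_funM.
have GE i x : g i (fun t => N t i x) * (cword (w, x) i == c i)%:R = G i (fun t => N t i x).
  by rewrite /G /cword ffunE.
have lG i : L1 P2 (fun x => G i (fun t => N t i x)).
  have := L1_Mbool (b := fun x => cword (w, x) i == c i) (mslice w (mcw1 i (c i))) (lg i).
  by under eq_fun do rewrite GE.
under eq_mean do under eq_bigr do rewrite GE.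
by have [_ ->] := Ngrp mG lG; apply: eq_bigr => i _; apply: eq_mean => x; rewrite GE.
Qed.

Lemma pcondE c w : pcond c w = \prod_i qcond i (c i) w.
Proof.
rewrite /pcond; under eq_mean do rewrite cwordE.
under eq_mean do under eq_bigr do rewrite -[_%:R]mul1r.
rewrite (@slice_prod w (fun _ _ => 1) c) => [|//|i]; last exact: L1_cst.
by apply: eq_bigr => i _; apply: eq_mean => x; rewrite mul1r.
Qed.

Lemma mpcondE t i c w : mpcond t i c w = \prod_j (if j == i then mcond t j (c j) w else qcond j (c j) w).
Proof.
have E x : N t i x * (cword (w, x) == c)%:R =
    \prod_j ((if j == i then N t j x else 1) * (cword (w, x) j == c j)%:R).
  by rewrite cwordE big_split/= (@big_if_eq _ _ i (fun j => N t j x) (fun=> 1)).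
rewrite /mpcond; under eq_mean do rewrite E.
rewrite (@slice_prod w (fun j f => if j == i then f t else 1) c).
- by apply: eq_bigr => j _; case: eqP => // _; apply: eq_mean => x; rewrite mul1r.
- by move=> j; case: eqP => // _; exact: measurable_coord.
- by move=> j; case: eqP => // _; exact: L1_cst.
Qed.

Lemma nois_lower t (o : 'I_m -> R) (h : {ffun 'I_m -> K} -> R) w :
  \sum_c (2 * h c * (\sum_i o i * mpcond t i c w) - h c ^+ 2 * pcond c w) <= \sum_i o i ^+ 2 * nois t i w.
Proof.
have := @prod_projection R 'I_m K (fun i k => qcond i k w) (fun i k => mcond t i k w) o h
  (fun i k => qcond_ge0 i k w) (fun i => sum_qcond i w) (fun i => sum_mcond t i w)
  (fun i k => @qcond_eq0 t i k w).
apply: le_trans; apply: ler_sum => c _; rewrite pcondE.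
by rewrite (eq_bigr _ (fun i _ => congr1 ( *%R (o i)) (mpcondE t i c w))).
Qed.

Lemma L1_qcond i k : L1 P1 (qcond i k).
Proof.
have lQ : L1 Q (fun z => (cword z i == k)%:R) by apply: L1_bool; exact: mcw1.
by have [] := mean_fubini lQ (fun w => L1_bool P2 (b := fun x => cword (w, x) i == k) (sl1 i k w)).
Qed.

Lemma L1_mcond t i k : L1 P1 (mcond t i k).
Proof.
have [l1 _] := L1_snd P1 (lN t i).
have lQ : L1 Q (fun z => N t i z.2 * (cword z i == k)%:R) by apply: L1_Mbool => //; exact: mcw1.
have [] := mean_fubini lQ.
  by move=> w; apply: L1_Mbool => //; exact: sl1.
by [].
Qed.

Lemma L1_nois t i : L1 P1 (nois t i).
Proof.
apply: (@L1_bnd _ _ _ P1 th) => [|w]; last by rewrite ger0_norm ?nois_ge0// nois_le.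
(* The reciprocal is the power with exponent -1 on nonnegative reals, zero included, and powers are
   measurable on all of R. *)
apply: measurable_sum => k; rewrite (_ : (fun w => _) = (fun w => mcond t i k w ^+ 2 * qcond i k w `^ (- 1))).
  apply: measurable_funM; first by apply: measurable_funX; exact: L1_meas (L1_mcond t i k).
  apply: (measurableT_comp (measurable_powR (- 1))); exact: L1_meas (L1_qcond i k).
by apply/funext => w; rewrite powR_inv1// qcond_ge0.
Qed.

Lemma sum_pcond w : \sum_c pcond c w = 1.
Proof.
rewrite -mean_sum; last by move=> c _; apply: L1_bool; exact: sl.
under eq_mean do under eq_bigr do rewrite -[_%:R]mul1r.
by under eq_mean do rewrite sum_eqb; rewrite mean_cst.
Qed.

Lemma sum_mpcond t i w : \sum_c mpcond t i c w = 0.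
Proof.
rewrite -mean_sum; last by move=> c _; apply: L1_Mbool => //; exact: sl.
by under eq_mean do rewrite sum_eqb; rewrite (gauss1_mean (gN t i)).
Qed.

Lemma mean_pcond c : L1 P1 (pcond c) /\ mean P1 (pcond c) = mean Q (fun z => (cword z == c)%:R).
Proof.
have [] := L1_mY_q c (L1_cst P1 1).
rewrite (_ : (fun w => 1 * pcond c w) = pcond c); last by apply/funext => w; rewrite mul1r.
by move=> l ->; split=> //; apply: eq_mean => z; rewrite mul1r.
Qed.

(** Given Y, the noise combination is tested with [al * s c - be * Yo], an estimate built from the
    source estimate and from Y. Its correlation with the noise comes from the joint law, while its
    benefit is capped by the separate noise energies. So good source estimates force the single
    encoders to reveal their noises. *)
Lemma nois_correlation t (o : 'I_m -> R) (s : {ffun 'I_m -> K} -> R) (u lam al be : R) :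
  let p c := mean Q (fun z => (cword z == c)%:R) in
  let Yo w := \sum_i o i * Y t i w in
  gauss1 P1 Yo (u * \sum_i o i ^+ 2) ->
  (forall c, mean Q (fun z => Yo z.1 * (cword z == c)%:R) = u / lam * (p c * s c)) ->
  (forall c, mean Q (fun z => (\sum_i o i * N t i z.2) * (cword z == c)%:R) = th / lam * (p c * s c)) ->
  (2 * al * (th / lam) - al ^+ 2 + 2 * al * be * (u / lam)) * (\sum_c p c * s c ^+ 2) -
    be ^+ 2 * (u * \sum_i o i ^+ 2) <= \sum_i o i ^+ 2 * mean P1 (nois t i).
Proof.
move=> p Yo gY hY hN.
pose A c w := \sum_i o i * mpcond t i c w.
have lA c : L1 P1 (A c) by apply: L1_sum => i _; apply: L1Z; have [] := L1_mpcond t i c.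
have mA c : mean P1 (A c) = th / lam * (p c * s c).
  rewrite -hN /A mean_sum; last by move=> i _; apply: L1Z; have [] := L1_mpcond t i c.
  under [RHS]eq_mean do rewrite mulr_suml.
  rewrite mean_sum => [|i _]; last first.
    apply: L1_Mbool; first exact: mcw.
    by apply: L1Z; have [] := L1_snd P1 (lN t i).
  apply: eq_bigr => i _; rewrite meanZ; last by have [] := L1_mpcond t i c.
  have [_ ->] := L1_mpcond t i c; rewrite -meanZ; first by apply: eq_mean => z; rewrite mulrA.
  by apply: L1_Mbool; [exact: mcw|have [] := L1_snd P1 (lN t i)].
have A0 w : \sum_c A c w = 0.
  by rewrite exchange_big/= big1// => i _; rewrite -mulr_sumr sum_mpcond mulr0.
have [lY2 mY2] := gauss1_sq gY; have lY := gauss1_L1 gY.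
have lp c : L1 P1 (pcond c) by have [] := mean_pcond c.
have lYp c : L1 P1 (fun w => Yo w * pcond c w) by have [] := L1_mY_q c lY.
pose G w := \sum_c ((2 * al * s c * A c w - al ^+ 2 * s c ^+ 2 * pcond c w) + 2 * al * be * s c * (Yo w * pcond c w))
  - be ^+ 2 * Yo w ^+ 2.
have G1 w : G w <= \sum_i o i ^+ 2 * nois t i w.
  apply: le_trans (nois_lower t o (fun c => al * s c - be * Yo w) w).
  (* The cross term between Y and the noise moments vanishes because the noise is centred given
     Y. *)
  rewrite -[X in X <= _]addr0 -[X in _ + X](_ : - (2 * be * Yo w * \sum_c A c w) = 0); last by rewrite A0 mulr0 oppr0.
  have e1 : be ^+ 2 * Yo w ^+ 2 = \sum_c be ^+ 2 * Yo w ^+ 2 * pcond c w by rewrite -mulr_sumr sum_pcond mulr1.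
  have e2 : 2 * be * Yo w * \sum_c A c w = \sum_c 2 * be * Yo w * A c w by rewrite mulr_sumr.
  rewrite /G e1 e2 -!sumrB; apply: ler_sum => c _; rewrite -/(A c w).
  move: (Yo w) (A c w) (pcond c w) => y a b.
  by apply: le_of_eq; ring.
have l1 c : L1 P1 (fun w => (2 * al * s c * A c w - al ^+ 2 * s c ^+ 2 * pcond c w) + 2 * al * be * s c * (Yo w * pcond c w)).
  by apply: L1D; [apply: L1B; exact: L1Z|exact: L1Z].
have lG : L1 P1 G by apply: L1B; [apply: L1_sum => c _; exact: l1|exact: L1Z].
have ln i : L1 P1 (nois t i) by exact: L1_nois.
have -> : \sum_i o i ^+ 2 * mean P1 (nois t i) = mean P1 (fun w => \sum_i o i ^+ 2 * nois t i w).
  by rewrite mean_sum => [|i _]; [apply: eq_bigr => i _; rewrite meanZ|exact: L1Z].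
apply: le_trans (le_mean lG _ G1); last by apply: L1_sum => i _; exact: L1Z.
rewrite /G meanB; [|by apply: L1_sum => c _; exact: l1|exact: L1Z].
rewrite meanZ// mY2 mean_sum => [|c _]; last exact: l1.
rewrite lerD2r mulr_sumr; apply: ler_sum => c _.
rewrite meanD; [|by apply: L1B; exact: L1Z|exact: L1Z].
rewrite meanB; [|exact: L1Z|exact: L1Z].
rewrite !meanZ// mA (mean_pcond c).2 (L1_mY_q c lY).2 hY -/(p c).
by apply: le_of_eq; ring.
Qed.

Definition ent (w : T1) : R := \sum_c pcond c w * - ln (pcond c w).

Lemma pcond_ge0 c w : 0 <= pcond c w. Proof. by apply: mean_ge0 => x; exact: ler0n. Qed.

Lemma pcond_le1 c w : pcond c w <= 1.
Proof. by rewrite -(sum_pcond w) (bigD1 c)//= lerDl; apply: sumr_ge0 => c' _; exact: pcond_ge0. Qed.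

(** Young's inequality for the conjugate pair [x ln x] and [exp], with 0 ln 0 = 0. It bounds the
    entropy integrand and drives the rate bound. *)
Lemma xln_le (p y : R) : 0 <= p -> p * (y - ln p) <= expR y - p.
Proof.
rewrite le_eqVlt => /orP[/eqP <-|p0]; first by rewrite mul0r subr0 expR_ge0.
have h := expR_ge1Dx (y - ln p); rewrite expRB lnK ?posrE// in h.
have := ler_wpM2l (ltW p0) h; rewrite [p * (_ / _)]mulrC divfK ?gt_eqF//; lra.
Qed.

Lemma L1_ent : L1 P1 ent.
Proof.
apply: L1_sum => c _; have [lp _] := mean_pcond c; have mp := L1_meas lp.
apply: (@L1_bnd _ _ _ P1 1) => [|w].
  apply: measurable_funM => //; apply: measurableT_comp => //.
  by apply: measurableT_comp mp; exact: measurable_ln.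
have p0 := pcond_ge0 c w; have p1 := pcond_le1 c w.
rewrite ger0_norm; last by rewrite mulr_ge0// oppr_ge0 ln_le0.
by have := xln_le 0 p0; rewrite sub0r expR0; lra.
Qed.

(** The entropy of the codewords given Y is at least their information about the noises. That is
    bounded below by the mean of a Gaussian log-density centred, for each encoder, at the estimate
    [mu t i] of its noise; the hypothesis says that the test densities have mass one. *)
Lemma ent_lower (b : R) w :
  (forall mu : 'I_n -> 'I_m -> R,
     L1 P2 (fun x => expR (\sum_t \sum_i tilt b th th (mu t i) (N t i x))) /\
     mean P2 (fun x => expR (\sum_t \sum_i tilt b th th (mu t i) (N t i x))) = 1) ->
  \sum_(t < n) \sum_i (2^-1 * ln (1 + b * th) - b / 2 * th + (1 + b * th) / (2 * th) * nois t i w) <= ent w.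
Proof.
move=> HN; pose mu t i k := mcond t i k w / qcond i k w.
pose BB (c : {ffun 'I_m -> K}) x := \sum_t \sum_i tilt b th th (mu t i (c i)) (N t i x).
pose L x := BB (cword (w, x)) x.
have LE x : L x = \sum_t \sum_i \sum_k tilt b th th (mu t i k) (N t i x) * (cword (w, x) i == k)%:R.
  apply: eq_bigr => t _; apply: eq_bigr => i _.
  by rewrite (sum_eqb _ (fun k => tilt b th th (mu t i k) (N t i x))).
have lT t i := @mean_tilt_sel R _ T2 P2 K (N t i) (fun k x => (cword (w, x) i == k)%:R) b th th (mu t i) (gN t i).
have lB t i : L1 P2 (fun x => \sum_k tilt b th th (mu t i k) (N t i x) * (cword (w, x) i == k)%:R) /\
    mean P2 (fun x => \sum_k tilt b th th (mu t i k) (N t i x) * (cword (w, x) i == k)%:R) =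
    2^-1 * ln (1 + b * th) - b / 2 * th + (1 + b * th) / (2 * th) * nois t i w.
  have [] := lT t i.
  - move=> x; under eq_bigr do rewrite -[_%:R]mul1r; exact: sum_eqb.
  - by move=> k; apply: L1_bool; exact: sl1.
  - by move=> k; apply: L1_Mbool => //; exact: sl1.
  move=> l ->; split=> //; congr (_ + _); rewrite -mulrA; congr (_ * _).
  rewrite /nois mulr_sumr; apply: eq_bigr => k _; rewrite -/(mcond t i k w) -/(qcond i k w) /mu.
  have [e|e] := eqVneq (qcond i k w) 0; first by rewrite e (qcond_eq0 t e) invr0 expr0n/= !(mulr0, mul0r) subr0.
  have [->|t0] := eqVneq th 0; first by rewrite mulr0 invr0 !(mulr0, mul0r) subr0.
  by field; rewrite t0 e.
have -> : \sum_(t < n) \sum_i (2^-1 * ln (1 + b * th) - b / 2 * th + (1 + b * th) / (2 * th) * nois t i w) = mean P2 L.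
  rewrite (funext LE) mean_sum => [|t _]; last by apply: L1_sum => i _; have [] := lB t i.
  apply: eq_bigr => t _; rewrite mean_sum => [|i _]; last by have [] := lB t i.
  by apply: eq_bigr => i _; have [_ ->] := lB t i.
have lBB c : L1 P2 (BB c).
  apply: L1_sum => t _; apply: L1_sum => i _; rewrite /tilt.
  apply: L1D; first by apply: L1B; [exact: L1_cst|apply: L1Z; exact: (gauss1_sq (gN t i)).1].
  by apply: L1Z; apply: L1B; [apply: L1Zr; apply: L1Zr|exact: L1_cst].
have lBc c : L1 P2 (fun x => BB c x * (cword (w, x) == c)%:R) by apply: L1_Mbool => //; exact: sl.
rewrite (_ : L = fun x => \sum_c BB c x * (cword (w, x) == c)%:R); last first.
  by apply/funext => x; rewrite (sum_eqb _ (fun c => BB c x)).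
rewrite mean_sum => [|c _]; last exact: lBc.
apply: ler_sum => c _; have [lE mE] := HN (fun t i => mu t i (c i)).
have lb : L1 P2 (fun x => (cword (w, x) == c)%:R) by apply: L1_bool; exact: sl.
(* A Legendre form with t free: [t = ln (pcond c w)] produces the entropy term, and for a codeword
   of probability zero [t = ln (v / 2)] rules out v > 0. *)
set v := mean P2 _; have bt t : v + t * pcond c w <= expR t - pcond c w.
  have -> : v + t * pcond c w = mean P2 (fun x => BB c x * (cword (w, x) == c)%:R + t * (cword (w, x) == c)%:R).
    by rewrite meanD ?meanZ//; exact: L1Z.
  have -> : expR t - pcond c w = mean P2 (fun x => expR t * expR (BB c x) - (cword (w, x) == c)%:R).
    by rewrite meanB ?meanZ ?mE ?mulr1//; exact: L1Z.
  apply: le_mean; [by apply: L1D => //; exact: L1Z|by apply: L1B => //; exact: L1Z|move=> x].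
  rewrite -expRD; case: (_ == c) => /=; last by rewrite !mulr0 addr0 subr0 expR_ge0.
  by have := expR_ge1Dx (t + BB c x); lra.
have [e|e] := eqVneq (pcond c w) 0; last first.
  have p0 : 0 < pcond c w by rewrite lt_neqAle eq_sym e pcond_ge0.
  by have := bt (ln (pcond c w)); rewrite lnK ?posrE// subrr mulrC; lra.
rewrite e mul0r leNgt; apply/negP => v0.
by have := bt (ln (v / 2)); rewrite e mulr0 addr0 subr0 lnK ?posrE ?divr_gt0//; lra.
Qed.

(** The joint law of Y and the codewords is compared with the uniform law on the admissible
    codewords times a Gaussian test density of Y given the codeword. Nonnegativity of this
    divergence is the claim. Along direction r the test density is centred at [u r / lam r] times
    the source estimate. *)
Lemma rate_ent (V : 'I_m -> pred K) (Yo : 'I_n -> 'I_m -> T1 -> R) (u lam a : 'I_m -> R)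
  (s : {ffun 'I_m -> K} -> 'I_n -> 'I_m -> R) :
  let p c := mean Q (fun z => (cword z == c)%:R) in
  (forall i f, enc i f \in V i) -> (forall t r, gauss1 P1 (Yo t r) (u r)) ->
  (forall c, L1 P1 (fun w => expR (\sum_t \sum_r tilt (a r) (u r) (lam r) (s c t r) (Yo t r w))) /\
     mean P1 (fun w => expR (\sum_t \sum_r tilt (a r) (u r) (lam r) (s c t r) (Yo t r w))) = 1) ->
  (forall c t r, mean Q (fun z => Yo t r z.1 * (cword z == c)%:R) = u r / lam r * (p c * s c t r)) ->
  \sum_(t < n) \sum_r (2^-1 * ln (1 + a r * u r) - a r / 2 * u r +
      (1 + a r * u r) * (u r / (2 * lam r ^+ 2)) * \sum_c p c * s c t r ^+ 2) + mean P1 ent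
   <= \sum_i ln (#|V i|%:R).
Proof.
move=> p Ven gYo HT hY.
have n0 i : (0 < #|V i|)%N by apply/card_gt0P; exists (enc i (fun=> 0)); exact: Ven.
pose kap : R := \prod_i #|V i|%:R.
have kap0 : 0 < kap by apply: prodr_gt0 => i _; rewrite ltr0n.
have -> : \sum_i ln (#|V i|%:R) = ln kap by rewrite ln_prod// => i; rewrite ltr0n.
pose AA c w := \sum_t \sum_r tilt (a r) (u r) (lam r) (s c t r) (Yo t r w).
pose Lm w := \sum_c AA c w * pcond c w + ent w.
pose valid c := c \in family V.
have cv z : valid (cword z) by apply/familyP => i; rewrite ffunE; exact: Ven.
have step w : Lm w <= kap^-1 * \sum_(c | valid c) expR (AA c w) - 1 + ln kap.
  rewrite -lerBlDr (_ : Lm w - ln kap = \sum_c pcond c w * (AA c w - ln kap - ln (pcond c w))); last first.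
    have e : ln kap = \sum_c pcond c w * ln kap by rewrite -mulr_suml sum_pcond mul1r.
    by rewrite {1}e /Lm /ent -big_split/= -sumrB; apply: eq_bigr => c _; ring.
  rewrite -[X in _ <= _ - X](sum_pcond w) mulr_sumr [X in _ <= X - _]big_mkcond/= -sumrB; apply: ler_sum => c _.
  case: ifPn => vc.
    by apply: le_trans (xln_le _ (pcond_ge0 c w)) _; rewrite expRB lnK ?posrE// mulrC.
  rewrite (_ : pcond c w = 0) ?mul0r ?subr0//.
  rewrite /pcond -[RHS](mean_cst P2); apply: eq_mean => x.
  by case: eqP => // e; rewrite -e cv in vc.
have lS : L1 P1 (fun w => \sum_(c | valid c) expR (AA c w)).
  by apply: L1_sum => c _; have [] := HT c.
have mS : mean P1 (fun w => \sum_(c | valid c) expR (AA c w)) = kap.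
  rewrite mean_sum => [|c _]; last by have [] := HT c.
  rewrite (eq_bigr (fun c => \prod_(i < m) (1 : R))) => [|c _]; last by rewrite big1//; have [] := HT c.
  rewrite -(bigA_distr_big_dep _ (fun _ _ => 1 : R)).
  by apply: eq_bigr => i _; rewrite sumr_const.
have lY t r c : L1 P1 (fun w => Yo t r w * pcond c w) by have [] := L1_mY_q c (gauss1_L1 (gYo t r)).
have lp c : L1 P1 (pcond c) by have [] := mean_pcond c.
have lTT t r := @mean_tilt_sel R _ T1 P1 _ (Yo t r) pcond (a r) (u r) (lam r) (fun c => s c t r) (gYo t r) sum_pcond lp (lY t r).
have LmE : Lm = (fun w => \sum_t \sum_r \sum_c tilt (a r) (u r) (lam r) (s c t r) (Yo t r w) * pcond c w + ent w).
  apply/funext => w; congr (_ + _); rewrite /AA.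
  under eq_bigr do rewrite mulr_suml; rewrite exchange_big/=; apply: eq_bigr => t _.
  by under eq_bigr do rewrite mulr_suml; rewrite exchange_big/=.
have l1 t : L1 P1 (fun w => \sum_r \sum_c tilt (a r) (u r) (lam r) (s c t r) (Yo t r w) * pcond c w).
  by apply: L1_sum => r _; have [] := lTT t r.
have l1' : L1 P1 (fun w => \sum_t \sum_r \sum_c tilt (a r) (u r) (lam r) (s c t r) (Yo t r w) * pcond c w).
  by apply: L1_sum => t _; exact: l1.
have lLm : L1 P1 Lm by rewrite LmE; apply: L1D => //; exact: L1_ent.
have lR : L1 P1 (fun w => kap^-1 * \sum_(c | valid c) expR (AA c w) - 1 + ln kap).
  by apply: L1D; [apply: L1B; [exact: L1Z|exact: L1_cst]|exact: L1_cst].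
have mR : mean P1 (fun w => kap^-1 * \sum_(c | valid c) expR (AA c w) - 1 + ln kap) = ln kap.
  rewrite meanD; [|by apply: L1B; [exact: L1Z|exact: L1_cst]|exact: L1_cst].
  rewrite meanB; [|exact: L1Z|exact: L1_cst].
  by rewrite !mean_cst meanZ// mS mulVf ?gt_eqF// subrr add0r.
have := le_mean lLm lR step; rewrite mR.
apply: le_trans; rewrite LmE meanD//; last exact: L1_ent.
rewrite lerD2r mean_sum => [|t _]; last exact: l1.
apply: ler_sum => t _; rewrite mean_sum => [|r _]; last by have [] := lTT t r.
apply: ler_sum => r _; have [_ ->] := lTT t r; rewrite lerD2l -mulrA.
apply: le_of_eq; congr (_ * _); rewrite mulr_sumr.
apply: eq_bigr => c _; rewrite (L1_mY_q c (gauss1_L1 (gYo t r))).2 hY (mean_pcond c).2 -/(p c).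
have [->|l0] := eqVneq (lam r) 0; first by rewrite expr0n/= mulr0 invr0 !(mulr0, mul0r) subr0.
by field.
Qed.

Lemma mean_ent_lower (b : R) :
  (forall mu : 'I_n -> 'I_m -> R,
     L1 P2 (fun x => expR (\sum_t \sum_i tilt b th th (mu t i) (N t i x))) /\
     mean P2 (fun x => expR (\sum_t \sum_i tilt b th th (mu t i) (N t i x))) = 1) ->
  \sum_(t < n) \sum_i (2^-1 * ln (1 + b * th) - b / 2 * th +
      (1 + b * th) / (2 * th) * mean P1 (nois t i)) <= mean P1 ent.
Proof.
move=> HN.
have l2 t i : L1 P1 (fun w => 2^-1 * ln (1 + b * th) - b / 2 * th + (1 + b * th) / (2 * th) * nois t i w).
  by apply: L1D; [exact: L1_cst|apply: L1Z; exact: L1_nois].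
have l2' : L1 P1 (fun w => \sum_(t < n) \sum_i (2^-1 * ln (1 + b * th) - b / 2 * th + (1 + b * th) / (2 * th) * nois t i w)).
  by apply: L1_sum => t _; apply: L1_sum => i _; exact: l2.
apply: le_trans (le_mean l2' L1_ent (fun w => ent_lower w HN)).
rewrite mean_sum => [|t _]; last by apply: L1_sum => i _; exact: l2.
apply: ler_sum => t _; rewrite mean_sum => [|i _]; last exact: l2.
apply: ler_sum => i _; rewrite meanD; [|exact: L1_cst|by apply: L1Z; exact: L1_nois].
by rewrite mean_cst meanZ//; exact: L1_nois.
Qed.

End Code.

(** * Exchangeable Gaussian families and their diagonalisation *)

Definition qAB (R : realType) (m : nat) (A B : R) (b : 'I_m -> R) : R :=
  A * (\sum_i b i ^+ 2) + B * (\sum_i b i) ^+ 2.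

(* Independent in [t]; covariance [A * I + B * J] in [i], with [J] the all-ones matrix. *)
Definition gfam (R : realType) (d : measure_display) (T : measurableType d) (P : probability T R)
  (n m : nat) (V : 'I_n -> 'I_m -> T -> R) (A B : R) :=
  forall b : 'I_n * 'I_m -> R, gauss1 P (fun x => \sum_p b p * V p.1 p.2 x)
    (\sum_t qAB A B (fun i => b (t, i))).

(** o is an eigenvector, with eigenvalue e, of B times the all-ones matrix, tested against all
    vectors b. Then [A + e] is the matching eigenvalue of the covariance of a [gfam]. *)
Definition eigen (R : realType) (m : nat) (B e : R) (o : 'I_m -> R) :=
  forall b : 'I_m -> R, B * ((\sum_i o i) * \sum_i b i) = e * \sum_i o i * b i.

Lemma qAB_pert (R : realType) (m : nat) (A B e a : R) (o b : 'I_m -> R) : eigen B e o ->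
  qAB A B (fun i => b i + a * o i) =
  a ^+ 2 * ((A + e) * \sum_i o i ^+ 2) + 2 * a * ((A + e) * \sum_i o i * b i) + qAB A B b.
Proof.
move=> eo; have h1 := eo o; have h2 := eo b; rewrite /qAB.
have -> : \sum_i (b i + a * o i) = \sum_i b i + a * \sum_i o i by rewrite big_split/= -mulr_sumr.
have -> : \sum_i (b i + a * o i) ^+ 2 = \sum_i b i ^+ 2 + 2 * a * (\sum_i o i * b i) + a ^+ 2 * \sum_i o i ^+ 2.
  by rewrite !mulr_sumr -!big_split/=; apply: eq_bigr => i _; ring.
have e1 : \sum_i o i * o i = \sum_i o i ^+ 2 by apply: eq_bigr => i _.
rewrite e1 in h1; move: h1 h2.
move: (\sum_i o i) (\sum_i b i) (\sum_i o i * b i) (\sum_i o i ^+ 2) (\sum_i b i ^+ 2) => so sb ob oo bb h1 h2.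
transitivity (A * (bb + 2 * a * ob + a ^+ 2 * oo) + (B * sb ^+ 2 + 2 * a * (B * (so * sb)) + a ^+ 2 * (B * (so * so)))).
  by ring.
by rewrite h1 h2; ring.
Qed.

Lemma sum_pair (R : realType) (n m : nat) (f : 'I_n * 'I_m -> R) : \sum_p f p = \sum_t \sum_i f (t, i).
Proof. by rewrite pair_bigA; apply: eq_bigr => -[]. Qed.

Lemma sum_at (R : realType) (n : nat) (t0 : 'I_n) (F G : 'I_n -> R) (x : R) :
  F t0 = x + G t0 -> (forall t, t != t0 -> F t = G t) -> \sum_t F t = x + \sum_t G t.
Proof.
move=> h0 h; rewrite (bigD1 t0)//= [in RHS](bigD1 t0)//= h0 addrA; congr (_ + _).
by apply: eq_bigr => t /h.
Qed.

Section Gfam.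
Context {R : realType} {d : measure_display} {T : measurableType d}.
Variables (P : probability T R) (n m : nat) (V : 'I_n -> 'I_m -> T -> R) (A B : R).
Hypothesis hV : gfam P V A B.

Definition dir (o : 'I_m -> R) (t : 'I_n) (x : T) : R := \sum_i o i * V t i x.

(** Joint law of one direction at one time with all coordinates. For an eigenvector the covariances
    are again proportional to o, which is the form in which [gauss_law_w] takes them. *)
Lemma gfam_pert (e a : R) (o : 'I_m -> R) (t0 : 'I_n) (b : 'I_n * 'I_m -> R) : eigen B e o ->
  gauss1 P (fun x => a * dir o t0 x + \sum_p b p * V p.1 p.2 x)
    (a ^+ 2 * ((A + e) * \sum_i o i ^+ 2) + 2 * a * ((A + e) * \sum_i o i * b (t0, i)) +
     \sum_t qAB A B (fun i => b (t, i))).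
Proof.
move=> eo; pose b' (p : 'I_n * 'I_m) := b p + (if p.1 == t0 then a * o p.2 else 0).
have := hV b'; rewrite (_ : (fun x => \sum_p b' p * V p.1 p.2 x) = (fun x => a * dir o t0 x + \sum_p b p * V p.1 p.2 x)).
  rewrite (sum_at (t0 := t0) (x := a ^+ 2 * ((A + e) * \sum_i o i ^+ 2) + 2 * a * ((A + e) * \sum_i o i * b (t0, i)))
     (G := fun t => qAB A B (fun i => b (t, i))))//.
    rewrite -(qAB_pert A a (fun i => b (t0, i)) eo); congr qAB.
    by apply/funext => i; rewrite /b' eqxx.
  move=> t ne; congr qAB; apply/funext => i; by rewrite /b' /= (negbTE ne) addr0.
apply/funext => x; rewrite !sum_pair; apply: (sum_at (t0 := t0)) => [|t ne].
  by rewrite /dir mulr_sumr -big_split/=; apply: eq_bigr => i _; rewrite /b' eqxx; ring.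
by apply: eq_bigr => i _; rewrite /b' /= (negbTE ne) addr0.
Qed.

Lemma gfam_dir (e : R) (o : 'I_m -> R) (t0 : 'I_n) : eigen B e o ->
  gauss1 P (dir o t0) ((A + e) * \sum_i o i ^+ 2).
Proof.
move=> eo; have := gfam_pert 1 t0 (fun=> 0) eo.
rewrite (_ : (fun x => _) = dir o t0); last first.
  by apply/funext => x; rewrite mul1r big1 ?addr0// => p _; rewrite mul0r.
have z : \sum_i o i * 0 = 0 by rewrite big1// => i _; rewrite mulr0.
rewrite expr1n mul1r z !mulr0 addr0 [X in _ + X]big1 ?addr0// => t _.
rewrite /qAB (eq_bigr (fun=> 0)) => [|i _]; last by rewrite expr0n.
by rewrite !big1_eq expr0n !mulr0 addr0.
Qed.

Lemma gfam1 t i : gauss1 P (V t i) (A + B).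
Proof.
have := hV (fun p => (p == (t, i))%:R).
rewrite (_ : (fun x => _) = V t i); last first.
  apply/funext => x; rewrite (bigD1 (t, i))//= eqxx mul1r big1 ?addr0// => p /negbTE ->.
  by rewrite mul0r.
rewrite (bigD1 t)//= big1 ?addr0; last first.
  move=> u ne; rewrite /qAB !big1 ?expr0n/= ?mulr0 ?addr0//.
    by move=> j _; rewrite xpair_eqE (negbTE ne).
  by move=> j _; rewrite xpair_eqE (negbTE ne) expr0n.
rewrite /qAB (bigD1 i)//= eqxx expr1n big1 ?addr0 => [|j ne]; last first.
  by rewrite xpair_eqE (negbTE ne) andbF expr0n.
rewrite (bigD1 i)//= eqxx big1 ?addr0 => [|j ne]; last first.
  by rewrite xpair_eqE (negbTE ne) andbF.
by rewrite expr1n !mulr1.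
Qed.

Lemma gfam_meas t i : measurable_fun setT (V t i). Proof. by have [] := gfam1 t i. Qed.

(** In an orthonormal eigenbasis the covariance is diagonal, so the rotated family has the law of
    independent normals of variances [A + e r]. *)
Lemma gfam_rot (o : 'I_m -> 'I_m -> R) (e : 'I_m -> R) : (forall r, eigen B (e r) (o r)) ->
  (forall r r', \sum_i o r i * o r' i = (r == r')%:R) ->
  forall b : 'I_n * 'I_m -> R, gauss1 P (fun x => \sum_p b p * dir (o p.2) p.1 x)
    (\sum_p (A + e p.2) * b p ^+ 2).
Proof.
move=> eo on b; pose b' (p : 'I_n * 'I_m) := \sum_r b (p.1, r) * o r p.2.
have := hV b'; rewrite (_ : (fun x => \sum_p b' p * V p.1 p.2 x) = (fun x => \sum_p b p * dir (o p.2) p.1 x)); last first.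
  apply/funext => x; rewrite !sum_pair; apply: eq_bigr => t _.
  under eq_bigr do rewrite /b' mulr_suml; rewrite exchange_big/=; apply: eq_bigr => r _.
  by rewrite /dir mulr_sumr; apply: eq_bigr => i _; rewrite mulrA.
congr (gauss1 P _ _); rewrite sum_pair; apply: eq_bigr => t _; rewrite /qAB /=.
have ob r : \sum_i o r i * b' (t, i) = b (t, r).
  under eq_bigr do rewrite mulr_sumr; rewrite exchange_big/= (bigD1 r)//=.
  rewrite (eq_bigr (fun i => b (t, r) * (o r i * o r i))) => [|i _]; last by ring.
  rewrite -mulr_sumr on eqxx mulr1 big1 ?addr0// => r' ne.
  rewrite (eq_bigr (fun i => b (t, r') * (o r i * o r' i))) => [|i _]; last by ring.
  by rewrite -mulr_sumr on eq_sym (negbTE ne) mulr0.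
have bb (f : 'I_m -> R) : \sum_i f i * b' (t, i) = \sum_r b (t, r) * \sum_i o r i * f i.
  under eq_bigr do rewrite mulr_sumr; rewrite exchange_big/=; apply: eq_bigr => r _.
  by rewrite mulr_sumr; apply: eq_bigr => i _; ring.
have -> : \sum_i b' (t, i) ^+ 2 = \sum_r b (t, r) ^+ 2.
  by under eq_bigr do rewrite expr2; rewrite bb; apply: eq_bigr => r _; rewrite ob expr2.
have s1 : \sum_i b' (t, i) = \sum_r b (t, r) * \sum_i o r i.
  have := bb (fun=> 1); under eq_bigr do rewrite mul1r; move=> ->.
  by apply: eq_bigr => r _; congr (_ * _); apply: eq_bigr => i _; rewrite mulr1.
rewrite expr2 {1}s1 mulr_suml !mulr_sumr -big_split/=; apply: eq_bigr => r _.
have := eo r (fun i => b' (t, i)); rewrite ob => h.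
by rewrite -(mulrA (b _)) (mulrCA B) h; ring.
Qed.

End Gfam.

Section Householder.
Variables (R : realType) (m : nat).

Let c : R := (Num.sqrt m.+1%:R)^-1.

(* Reflection exchanging the first basis vector with the normalised all-ones vector; on the
   remaining coordinates it is [I - c^2/(1-c)], and [c^2/(1-c)] is harmlessly [1/0] for [m = 0]. *)
Definition house (r i : 'I_m.+1) : R :=
  if (r == ord0) || (i == ord0) then c else (r == i)%:R - c ^+ 2 / (1 - c).

Lemma house0 i : house ord0 i = c. Proof. by rewrite /house eqxx. Qed.

Lemma houseC r i : house r i = house i r.
Proof. by rewrite /house orbC (eq_sym r i). Qed.

Let c2 : c ^+ 2 * m.+1%:R = 1.
Proof. by rewrite /c exprVn sqr_sqrtr// mulVf ?pnatr_eq0. Qed.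

Let c1 : (0 < m)%N -> 1 - c != 0.
Proof.
move=> m0; rewrite subr_eq0 eq_sym; apply/eqP => e; move: c2; rewrite e expr1n mul1r => /eqP.
by rewrite pnatr_eq1 eqSS => /eqP m00; rewrite m00 in m0.
Qed.

Let sum_hl (r : 'I_m.+1) : r != ord0 -> \sum_(i < m.+1 | i != ord0) house r i = - c.
Proof.
move=> r0; have m0 : (0 < m)%N by case: (m) r r0 => // -[[]].
rewrite (eq_bigr (fun i => (r == i)%:R - c ^+ 2 / (1 - c))); last first.
  by move=> i /negbTE i0; rewrite /house i0 (negbTE r0).
rewrite sumrB (bigD1 r)//= eqxx big1 ?addr0; last by move=> i /andP[_ /negbTE]; rewrite eq_sym => ->.
rewrite sumr_const cardC1 card_ord -[X in _ - X]mulr_natr /=.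
have : m%:R = (1 - c ^+ 2) / c ^+ 2 :> R.
  have := c2; rewrite -natr1 => h; have c0 : c ^+ 2 != 0.
    by apply: contra_eq_neq h => ->; rewrite mul0r eq_sym oner_neq0.
  by apply: (mulIf c0); rewrite divfK// -[X in X - _]h; ring.
move=> ->; have c0 : c != 0 by rewrite invr_eq0 gt_eqF// sqrtr_gt0.
by field; rewrite ?c0 ?c1.
Qed.

Lemma sum_house r : r != ord0 -> \sum_i house r i = 0.
Proof. by move=> r0; rewrite (bigD1 ord0)//= sum_hl// houseC house0 subrr. Qed.

Lemma house_orth r r' : \sum_i house r i * house r' i = (r == r')%:R.
Proof.
have h0 r1 : \sum_i house ord0 i * house r1 i = (ord0 == r1)%:R.
  under eq_bigr do rewrite house0; rewrite -mulr_sumr; have [<-|ne] := eqVneq ord0 r1.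
    under eq_bigr do rewrite house0.
    by rewrite sumr_const card_ord -(mulr_natr c) mulrA -expr2 c2.
  by rewrite sum_house ?mulr0// eq_sym.
have [->|r0] := eqVneq r ord0; first exact: h0.
have [->|r0'] := eqVneq r' ord0.
  by under eq_bigr do rewrite mulrC; rewrite h0 eq_sym.
have m0 : (0 < m)%N by case: (m) r r0 {r' r0' h0} => // -[[]].
rewrite (bigD1 ord0)//= {1}houseC house0 houseC house0.
rewrite (eq_bigr (fun i => (r == i)%:R * house r' i - c ^+ 2 / (1 - c) * house r' i)); last first.
  by move=> i /negbTE i0; rewrite {1}/house i0 (negbTE r0)/= mulrBl.
rewrite sumrB -mulr_sumr sum_hl// (bigD1 r)//= eqxx mul1r big1 ?addr0; last first.
  by move=> i /andP[_ /negbTE]; rewrite eq_sym => ->; rewrite mul0r.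
rewrite /house (negbTE r0) (negbTE r0')/= eq_sym.
by move: (_ %:R) => x; field; rewrite c1.
Qed.

Lemma house_eigen (B : R) r : eigen B (if r == ord0 then m.+1%:R * B else 0) (house r).
Proof.
move=> b; case: eqP => [->|/eqP ne]; last by rewrite sum_house// !mul0r mulr0.
under eq_bigr do rewrite house0; under [in RHS]eq_bigr do rewrite house0.
by rewrite -mulr_sumr sumr_const card_ord -mulr_natr; ring.
Qed.

Lemma house_parseval (v : 'I_m.+1 -> R) : \sum_r (\sum_i house r i * v i) ^+ 2 = \sum_i v i ^+ 2.
Proof.
under eq_bigr do rewrite expr2 mulr_suml; rewrite exchange_big/=; apply: eq_bigr => i _.
under eq_bigr do rewrite mulr_sumr; rewrite exchange_big/= (bigD1 i)//=.
rewrite [X in _ + X]big1 ?addr0 => [|i' ne].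
  rewrite (eq_bigr (fun r => v i ^+ 2 * (house i r * house i r))) => [|r _]; last by rewrite (houseC r); ring.
  by rewrite -mulr_sumr house_orth eqxx mulr1.
rewrite (eq_bigr (fun r => v i * v i' * (house i r * house i' r))) => [|r _]; last by rewrite !(houseC r); ring.
by rewrite -mulr_sumr house_orth eq_sym (negbTE ne) mulr0.
Qed.

End Householder.

(** With b the indicator, [2 g f b <= f ^+ 2 + g ^+ 2 b] for every g, and the last term has mean
    zero; a large multiple g then forces the mean of [f b] to vanish. *)
Lemma mean_bool0 (R : realType) (d : measure_display) (T : measurableType d) (P : probability T R)
  (f : T -> R) (b : T -> bool) : measurable_fun setT f -> L1 P (fun x => f x ^+ 2) ->
  measurable_fun setT (fun x => (b x)%:R : R) ->
  mean P (fun x => (b x)%:R) = 0 -> mean P (fun x => f x * (b x)%:R) = 0.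
Proof.
move=> mf l2 mb b0; have lf := L1_sq1 mf l2.
have lb : L1 P (fun x => (b x)%:R) by exact: L1_bool.
have lfb : L1 P (fun x => f x * (b x)%:R) by exact: L1_Mbool.
have key g : 2 * g * mean P (fun x => f x * (b x)%:R) <= mean P (fun x => f x ^+ 2).
  rewrite -[X in _ <= X]addr0 -(mulr0 (g ^+ 2)) -b0 -!meanZ// -meanD//; last exact: L1Z.
  apply: le_mean; [exact: L1Z|by apply: L1D => //; exact: L1Z|move=> x].
  have : 0 <= (f x - g * (b x)%:R) ^+ 2 by exact: sqr_ge0.
  case: (b x) => /=; last by rewrite !mulr0 addr0 subr0.
  rewrite !mulr1; lra.
move: (mean P (fun x => f x * _)) key => y key; apply/eqP/negPn/negP => y0.
have := key ((mean P (fun x => f x ^+ 2) + 1) / (2 * y)).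
rewrite [X in X <= _](_ : _ = mean P (fun x => f x ^+ 2) + 1); last by field.
by rewrite leNgt ltrDl ltr01.
Qed.

(** * Codeword statistics of S carried over to the decomposition Y + N *)

Section Sel.
Context {R : realType} {d d1 d2 : measure_display}.
Context {T : measurableType d} {T1 : measurableType d1} {T2 : measurableType d2}.
Variables (P : probability T R) (P1 : probability T1 R) (P2 : probability T2 R).
Local Notation Q := ((P1 \x P2)%E : probability (T1 * T2)%type R).
Variables (n m : nat) (S X : 'I_n -> 'I_m -> T -> R) (Y : 'I_n -> 'I_m -> T1 -> R).
Variables (xi : 'I_n -> 'I_m -> T2 -> R) (AS AX B BX th cth : R).
Hypothesis cthE : cth ^+ 2 = th.
Hypothesis hS : gfam P S AS B.
Hypothesis hY : gfam P1 Y (AS - th) B.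
Hypothesis hxi : gfam P2 xi 1 0.
Hypothesis xi_prod : forall f : 'I_n * 'I_m -> R -> R, (forall p, measurable_fun setT (f p)) ->
  (forall p, L1 P2 (fun x => f p (xi p.1 p.2 x))) ->
  L1 P2 (fun x => \prod_p f p (xi p.1 p.2 x)) /\
  mean P2 (fun x => \prod_p f p (xi p.1 p.2 x)) = \prod_p mean P2 (fun x => f p (xi p.1 p.2 x)).
Hypothesis xi_grp : forall g : 'I_m -> RV R 'I_n -> R, (forall i, measurable_fun setT (g i)) ->
  (forall i, L1 P2 (fun x => g i (fun t => xi t i x))) ->
  L1 P2 (fun x => \prod_i g i (fun t => xi t i x)) /\
  mean P2 (fun x => \prod_i g i (fun t => xi t i x)) = \prod_i mean P2 (fun x => g i (fun t => xi t i x)).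
Hypothesis hXS : forall a b : 'I_n * 'I_m -> R,
  gauss1 P (fun w => \sum_p a p * X p.1 p.2 w + \sum_p b p * S p.1 p.2 w)
  (\sum_t (qAB AX BX (fun i => a (t, i)) + 2 * (AX * (\sum_i a (t, i) * b (t, i)) +
     BX * ((\sum_i a (t, i)) * \sum_i b (t, i))) + qAB AS B (fun i => b (t, i)))).
Variables (K : finType) (enc : 'I_m -> RV R 'I_n -> K).
Hypothesis menc : forall i k, <<s @rectangles R 'I_n >> (enc i @^-1` [set k]).

Definition scaled t i x := cth * xi t i x.
Definition codew w : {ffun 'I_m -> K} := [ffun i => enc i (fun t => S t i w)].
Definition pS c := mean P (fun w => (codew w == c)%:R).
(* [E[E[V | codewords]^2]]; codewords of probability zero contribute [0 / 0 = 0]. *)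
Definition corr (V : T -> R) := \sum_c mean P (fun w => V w * (codew w == c)%:R) ^+ 2 / pS c.
Definition errN t i := mean P1 (nois P2 enc Y scaled t i).

Lemma gfam_scaled : gfam P2 scaled th 0.
Proof.
move=> b; have := hxi (fun p => cth * b p).
rewrite (_ : (fun x => _) = (fun x => \sum_p b p * scaled p.1 p.2 x)); last first.
  by apply/funext => x; apply: eq_bigr => p _; rewrite /scaled; ring.
congr (gauss1 P2 _ _); apply: eq_bigr => t _; rewrite /qAB !mul0r !addr0 mul1r -cthE mulr_sumr.
by apply: eq_bigr => i _; rewrite exprMn.
Qed.

Let gN t i : gauss1 P2 (scaled t i) th.
Proof. by have := gfam1 gfam_scaled t i; rewrite addr0. Qed.
Let mY t i : measurable_fun setT (Y t i). Proof. exact: gfam_meas hY t i. Qed.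
Let mS t i : measurable_fun setT (S t i). Proof. exact: gfam_meas hS t i. Qed.
Let mN t i : measurable_fun setT (scaled t i). Proof. exact: gfam_meas gfam_scaled t i. Qed.

Let th0 : 0 <= th. Proof. by rewrite -cthE sqr_ge0. Qed.

Let Ngrp : forall g : 'I_m -> RV R 'I_n -> R, (forall i, measurable_fun setT (g i)) ->
  (forall i, L1 P2 (fun x => g i (fun t => scaled t i x))) ->
  L1 P2 (fun x => \prod_i g i (fun t => scaled t i x)) /\
  mean P2 (fun x => \prod_i g i (fun t => scaled t i x)) = \prod_i mean P2 (fun x => g i (fun t => scaled t i x)).
Proof.
move=> g mg lg; apply: (xi_grp (g := fun i f => g i (fun t => cth * f t))) => // i.
apply: (@measurable_RV _ _ _ _ (RV R 'I_n) _ (fun t f => cth * f t)) => // t.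
by apply: measurable_funM => //; exact: measurable_coord.
Qed.

Let E (c : {ffun 'I_m -> K}) : set ('I_n * 'I_m -> R) :=
  [set f | forall i, enc i (fun t => f (t, i)) = c i].

Lemma rect_code c : <<s @rectangles R _ >> (E c).
Proof.
have -> : E c = \big[setI/setT]_(i < m) [set f | (enc i @^-1` [set c i]) (fun t => f (t, i))].
  apply/seteqP; split => f.
    by move=> h; elim/big_ind: _ => // i _; exact: h.
  move=> h i; move: h; rewrite (bigD1 i)//= => -[].
  by [].
apply: (@bigsetI_measurable _ (RV R ('I_n * 'I_m)%type)) => i _.
exact: (rectangles_pre (fun t => (t, i)) (menc i (c i))).
Qed.

Let codeE (d' : measure_display) (T' : measurableType d') (W : 'I_n -> 'I_m -> T' -> R) c x :
  ([ffun i => enc i (fun t => W t i x)] == c)%:R = \1_(E c) (fun p => W p.1 p.2 x) :> R.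
Proof.
rewrite indicE; case: eqP => h; [rewrite mem_set//|rewrite memNset//].
  by move=> i; rewrite -h ffunE.
by move=> h'; apply: h; apply/ffunP => i; rewrite ffunE; exact: h'.
Qed.

Let W t i (z : T1 * T2) := Y t i z.1 + scaled t i z.2.

Let hW : gfam Q W AS B.
Proof.
move=> b; have := gauss1_prodD (hY b) (gfam_scaled b).
rewrite (_ : (fun z => _) = (fun z => \sum_p b p * W p.1 p.2 z)); last first.
  by apply/funext => z; rewrite -big_split/=; apply: eq_bigr => p _; rewrite /W mulrDr.
congr (gauss1 _ _ _); rewrite -big_split/=; apply: eq_bigr => t _; rewrite /qAB; ring.
Qed.

Let meas_code (d' : measure_display) (T' : measurableType d') (V : 'I_n -> 'I_m -> T' -> R) c :
  (forall t i, measurable_fun setT (V t i)) -> measurable [set x | E c (fun p => V p.1 p.2 x)].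
Proof. by move=> mV; apply: measurable_rectangles (rect_code c) => p; exact: mV. Qed.

Let mb c : measurable_fun setT (fun w => (codew w == c)%:R : R).
Proof.
rewrite (_ : (fun w => _) = \1_[set w | E c (fun p => S p.1 p.2 w)]).
  exact/measurable_indic/meas_code.
by apply/funext => w; rewrite (codeE S).
Qed.

Let pW c : mean Q (fun z => (cword enc Y scaled z == c)%:R) = pS c.
Proof.
have e (d' : measure_display) (T' : measurableType d') (P' : probability T' R) (V : 'I_n -> 'I_m -> T' -> R) :
    (forall t i, measurable_fun setT (V t i)) ->
    mean P' (fun x => ([ffun i => enc i (fun t => V t i x)] == c)%:R) = fine (P' [set x | E c (fun p => V p.1 p.2 x)]).
  move=> mV; rewrite -mean_indic; last exact: meas_code.
  by apply: eq_mean => x; rewrite codeE.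
rewrite /pS (e _ _ P S mS).
rewrite [LHS](e _ _ Q W); last by move=> t i; exact: gfam_meas hW t i.
congr fine; apply: (@gauss_law _ _ _ _ _ Q P _ (fun p => W p.1 p.2) (fun p => S p.1 p.2) _ _ _ _ hW hS (rect_code c)).
  by move=> p; exact: gfam_meas hW _ _.
by move=> p; exact: mS.
Qed.

(** If h has covariances [x * o] with the sources at time t, it is exchanged for its regression,
    [x / (AS + e)] times the source direction, as both have the same covariances with all sources.
    For [AS + e = 0] the quotient is 0 by convention, which is right because x = 0 is then
    required. *)
Lemma eigen_transfer (d' : measure_display) (T' : measurableType d') (P' : probability T' R)
  (V : 'I_n -> 'I_m -> T' -> R) (h : T' -> R) (s x e : R) (o : 'I_m -> R) t c :
  (forall u i, measurable_fun setT (V u i)) -> eigen B e o -> (AS + e = 0 -> x = 0) ->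
  (forall a b, gauss1 P' (fun z => a * h z + \sum_p b p * V p.1 p.2 z)
     (a ^+ 2 * s + 2 * a * (x * \sum_i o i * b (t, i)) + \sum_t qAB AS B (fun i => b (t, i)))) ->
  mean P' (fun z => h z * ([ffun i => enc i (fun t => V t i z)] == c)%:R) =
  x / (AS + e) * mean P (fun w => dir S o t w * (codew w == c)%:R).
Proof.
move=> mV eo x0 gh; have lS := gauss1_L1 (gfam_dir hS t eo).
rewrite -meanZ; last by apply: L1_Mbool.
under eq_mean do rewrite codeE.
under [RHS]eq_mean do rewrite (codeE S) mulrA.
apply: (@gauss_law_w _ _ _ _ _ P' P _ (fun p => V p.1 p.2) (fun p => S p.1 p.2)
  (fun b => \sum_t qAB AS B (fun i => b (t, i))) _ _ h (fun w => x / (AS + e) * dir S o t w)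
  s ((x / (AS + e)) ^+ 2 * ((AS + e) * \sum_i o i ^+ 2)) (fun b => x * \sum_i o i * b (t, i)) _ gh _ (rect_code c)).
- by move=> p; exact: mV.
- by move=> p; exact: mS.
move=> a b; have := gfam_pert hS (a * (x / (AS + e))) t b eo.
rewrite (_ : (fun w => _) = (fun w => a * (x / (AS + e) * dir S o t w) + \sum_p b p * S p.1 p.2 w)); last first.
  by apply/funext => w; congr (_ + _); ring.
congr (gauss1 P _ _); congr (_ + _ + _); first by ring.
move: x0; move: (AS + e) (\sum_i o i * b (t, i)) => l y x0.
have [l0|l0] := eqVneq l 0; last by field.
by rewrite (x0 l0) !(mul0r, mulr0).
Qed.

Let transY e o t c : eigen B e o -> (AS + e = 0 -> th = 0) ->
  mean Q (fun z => dir Y o t z.1 * (cword enc Y scaled z == c)%:R) =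
  (AS - th + e) / (AS + e) * mean P (fun w => dir S o t w * (codew w == c)%:R).
Proof.
move=> eo t0; apply: (@eigen_transfer _ _ Q W (fun z => dir Y o t z.1) ((AS - th + e) * \sum_i o i ^+ 2)) => //.
- by move=> u i; exact: gfam_meas hW u i.
- by move=> h; rewrite addrAC h t0 ?subr0.
move=> a b; have := gauss1_prodD (gfam_pert hY a t b eo) (gfam_scaled b).
rewrite (_ : (fun z => _) = (fun z => a * dir Y o t z.1 + \sum_p b p * W p.1 p.2 z)); last first.
  by apply/funext => z; rewrite -addrA -big_split/=; congr (_ + _); apply: eq_bigr => p _; rewrite /W mulrDr.
congr (gauss1 _ _ _); rewrite -addrA -big_split/=; congr (_ + _); apply: eq_bigr => u _; rewrite /qAB; ring.
Qed.

Let transN e o t c : eigen B e o -> (AS + e = 0 -> th = 0) ->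
  mean Q (fun z => dir scaled o t z.2 * (cword enc Y scaled z == c)%:R) =
  th / (AS + e) * mean P (fun w => dir S o t w * (codew w == c)%:R).
Proof.
move=> eo t0; apply: (@eigen_transfer _ _ Q W (fun z => dir scaled o t z.2) (th * \sum_i o i ^+ 2)) => //.
  by move=> u i; exact: gfam_meas hW u i.
have e0 : eigen (0 : R) 0 o by move=> b; rewrite !mul0r.
move=> a b; have := gauss1_prodD (hY b) (gfam_pert gfam_scaled a t b e0).
rewrite (_ : (fun z => _) = (fun z => a * dir scaled o t z.2 + \sum_p b p * W p.1 p.2 z)); last first.
  by apply/funext => z; rewrite addrCA -big_split/=; congr (_ + _); apply: eq_bigr => p _; rewrite /W mulrDr.
congr (gauss1 _ _ _); rewrite addr0 addrCA -big_split/=; congr (_ + _); apply: eq_bigr => u _; rewrite /qAB; ring.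
Qed.

Let sq_dir e o t : eigen B e o -> L1 P (fun w => dir S o t w ^+ 2).
Proof. by move=> eo; have [] := gauss1_sq (gfam_dir hS t eo). Qed.

Let psE e o t c : eigen B e o -> pS c * (mean P (fun w => dir S o t w * (codew w == c)%:R) / pS c) =
  mean P (fun w => dir S o t w * (codew w == c)%:R).
Proof.
move=> eo; have [p0|p0] := eqVneq (pS c) 0; last by field.
rewrite p0 mul0r; apply/esym/mean_bool0 => //; last exact: sq_dir eo.
by have [] := gfam_dir hS t eo.
Qed.

Let ps2E o t : \sum_c pS c * (mean P (fun w => dir S o t w * (codew w == c)%:R) / pS c) ^+ 2 = corr (dir S o t).
Proof.
apply: eq_bigr => c _; have [->|p0] := eqVneq (pS c) 0; last by field.
by rewrite invr0 mul0r !mulr0.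
Qed.

Lemma errN_correlation t o e al be : eigen B e o -> (AS + e = 0 -> th = 0) ->
  (2 * al * (th / (AS + e)) - al ^+ 2 + 2 * al * be * ((AS - th + e) / (AS + e))) * corr (dir S o t) -
    be ^+ 2 * ((AS - th + e) * \sum_i o i ^+ 2) <= \sum_i o i ^+ 2 * errN t i.
Proof.
move=> eo e0; rewrite -ps2E; under eq_bigr do rewrite -pW.
apply: (nois_correlation menc mY gN Ngrp) => [|c|c].
- exact: (gfam_dir hY t eo).
- by rewrite (transY t c eo)// pW (psE t c eo).
- by rewrite (transN t c eo)// pW (psE t c eo).
Qed.

Lemma xi_expR (F : 'I_n -> 'I_m -> R -> R) : (forall t i, measurable_fun setT (F t i)) ->
  (forall t i, L1 P2 (fun x => expR (F t i (xi t i x)))) ->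
  L1 P2 (fun x => expR (\sum_t \sum_i F t i (xi t i x))) /\
  mean P2 (fun x => expR (\sum_t \sum_i F t i (xi t i x))) = \prod_p mean P2 (fun x => expR (F p.1 p.2 (xi p.1 p.2 x))).
Proof.
move=> mF lF; have := @xi_prod (fun p y => expR (F p.1 p.2 y)) _ (fun p => lF p.1 p.2).
rewrite (_ : (fun x => _) = (fun x => expR (\sum_t \sum_i F t i (xi t i x)))); last first.
  by apply/funext => x; rewrite pair_bigA expR_sum.
by apply=> p; apply: measurableT_comp.
Qed.

Lemma measurable_tilt (a u lam s c : R) : measurable_fun setT (fun y : R => tilt a u lam s (c * y)).
Proof.
have mc : measurable_fun setT (fun y : R => c * y) by exact: measurable_funM.
apply: measurable_funD.
  apply: measurable_funB => //; apply: measurable_funM => //; exact: measurable_funX.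
apply: measurable_funM => //; apply: measurable_funB => //; apply: measurable_funM => //; exact: measurable_funM.
Qed.

Lemma code_ent (V : 'I_m -> pred K) (o : 'I_m -> 'I_m -> R) (e a : 'I_m -> R) :
  (forall r, eigen B (e r) (o r)) -> (forall r r', \sum_i o r i * o r' i = (r == r')%:R) ->
  (forall r, AS + e r = 0 -> th = 0) -> (forall r, 0 <= AS - th + e r) -> (forall r, 0 < a r) ->
  (forall i f, enc i f \in V i) ->
  \sum_(t < n) \sum_r (2^-1 * ln (1 + a r * (AS - th + e r)) - a r / 2 * (AS - th + e r) +
      (1 + a r * (AS - th + e r)) * ((AS - th + e r) / (2 * (AS + e r) ^+ 2)) * corr (dir S (o r) t))
  + mean P1 (ent P2 enc Y scaled) <= \sum_i ln (#|V i|%:R).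
Proof.
move=> eo on e0 u0 a0 Ven.
pose u r := AS - th + e r.
have gYo t r : gauss1 P1 (dir Y (o r) t) (u r).
  have := gfam_dir hY t (eo r); rewrite (_ : \sum_i _ = 1) ?mulr1//.
  by transitivity (\sum_i o r i * o r i); [apply: eq_bigr => i _; rewrite expr2|rewrite on eqxx].
have gxi t i : gauss1 P2 (xi t i) 1 by have := gfam1 hxi t i; rewrite addr0.
have scl (v : R) t i : 0 <= v -> gauss1 P2 (fun x => Num.sqrt v * xi t i x) v.
  by move=> v0; have := gauss1Z (Num.sqrt v) (gxi t i); rewrite sqr_sqrtr// mulr1.
have := @rate_ent _ _ _ _ _ P1 P2 n m K enc menc Y scaled th mY gN V (fun t r => dir Y (o r) t) u
  (fun r => AS + e r) a (fun c t r => mean P (fun w => dir S (o r) t w * (codew w == c)%:R) / pS c) Ven gYo.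
move=> /(_ _ _) h; apply: le_trans (h _ _).
- rewrite lerD2r; apply: ler_sum => t _; apply: ler_sum => r _; rewrite -ps2E.
  rewrite lerD2l le_eqVlt; apply/orP; left; apply/eqP; congr (_ * _).
  by apply: eq_bigr => c _; rewrite pW.
(* Along the eigenbasis the components of Y have the joint law of rescaled independent normals; the
   mass of the test density is computed there as a product and carried back. *)
- move=> c; pose s t r := mean P (fun w => dir S (o r) t w * (codew w == c)%:R) / pS c.
  have [l m1] := @xi_expR (fun t r y => tilt (a r) (u r) (AS + e r) (s t r) (Num.sqrt (u r) * y))
    (fun t r => measurable_tilt _ _ _ _ _) (fun t r => (mean_tilt _ _ (scl _ t r (u0 r)) (a0 r)).1).
  pose F (f : 'I_n * 'I_m -> R) := expR (\sum_t \sum_r tilt (a r) (u r) (AS + e r) (s t r) (f (t, r))).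
  have mF : measurable_fun setT (F : RV R ('I_n * 'I_m)%type -> R).
    apply: measurableT_comp => //; apply: measurable_sum => t; apply: measurable_sum => r.
    have := measurable_tilt (a r) (u r) (AS + e r) (s t r) 1; under eq_fun do rewrite mul1r.
    move=> mt; apply: (measurableT_comp mt); exact: measurable_coord.
  have h1 (b1 : 'I_n * 'I_m -> R) : gauss1 P2 (fun x => \sum_p b1 p * (Num.sqrt (u p.2) * xi p.1 p.2 x))
      (\sum_p (AS - th + e p.2) * b1 p ^+ 2).
    have := hxi (fun p => b1 p * Num.sqrt (u p.2)).
    rewrite (_ : (fun x => _) = (fun x => \sum_p b1 p * (Num.sqrt (u p.2) * xi p.1 p.2 x))); last first.
      by apply/funext => x; apply: eq_bigr => p _; rewrite mulrA.
    congr (gauss1 P2 _ _); rewrite [RHS]sum_pair; apply: eq_bigr => t _; rewrite /qAB mul0r addr0 mul1r.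
    by apply: eq_bigr => i _; rewrite exprMn sqr_sqrtr; [rewrite mulrC|exact: u0].
  have h3 (D : set R) : measurable D -> <<s @rectangles R ('I_n * 'I_m)%type >> (F @^-1` D).
    by move=> mD; have := mF measurableT D mD; rewrite setTI.
  have m1' (p : 'I_n * 'I_m) : measurable_fun setT (fun x => Num.sqrt (u p.2) * xi p.1 p.2 x).
    by have [] := scl _ p.1 p.2 (u0 p.2).
  have m2' (p : 'I_n * 'I_m) : measurable_fun setT (dir Y (o p.2) p.1) by have [] := gYo p.1 p.2.
  have h2 := gfam_rot hY eo on.
  have := @gauss_law_fun _ _ _ _ _ P2 P1 _ _ _ _ m1' m2' F h1 h2 h3.
  rewrite /F; move=> [_ [tl te]].
  split; first by apply: tl; exact: l.
  rewrite -[LHS]te//; rewrite [LHS]m1 big1// => p _.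
  exact: (mean_tilt _ _ (scl _ p.1 p.2 (u0 p.2)) (a0 p.2)).2.
- by move=> c t r; rewrite (transY t c (eo r) (e0 r)) pW (psE t c (eo r)).
Qed.

Lemma ent_errN (b : R) : 0 < b ->
  \sum_(t < n) \sum_i (2^-1 * ln (1 + b * th) - b / 2 * th + (1 + b * th) / (2 * th) * errN t i) <= mean P1 (ent P2 enc Y scaled).
Proof.
move=> b0; apply: mean_ent_lower => // mu; have [] := @xi_expR (fun t i y => tilt b th th (mu t i) (cth * y))
    (fun t r => measurable_tilt _ _ _ _ _) (fun t r => (mean_tilt _ _ (gN t r) b0).1).
move=> l ->; split=> //; apply: big1 => p _; exact: (mean_tilt _ _ (gN p.1 p.2) b0).2.
Qed.

Lemma code_rate (V : 'I_m -> pred K) (o : 'I_m -> 'I_m -> R) (e a : 'I_m -> R) (b : R) :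
  (forall r, eigen B (e r) (o r)) -> (forall r r', \sum_i o r i * o r' i = (r == r')%:R) ->
  (forall r, AS + e r = 0 -> th = 0) -> (forall r, 0 <= AS - th + e r) -> (forall r, 0 < a r) -> 0 < b ->
  (forall i f, enc i f \in V i) ->
  \sum_(t < n) \sum_r (2^-1 * ln (1 + a r * (AS - th + e r)) - a r / 2 * (AS - th + e r) +
      (1 + a r * (AS - th + e r)) * ((AS - th + e r) / (2 * (AS + e r) ^+ 2)) * corr (dir S (o r) t)) +
  \sum_(t < n) \sum_i (2^-1 * ln (1 + b * th) - b / 2 * th + (1 + b * th) / (2 * th) * errN t i)
    <= \sum_i ln (#|V i|%:R).
Proof.
by move=> eo on e0 u0 a0 b0 Ven; apply: le_trans (code_ent eo on e0 u0 a0 Ven); rewrite lerD2l ent_errN.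
Qed.

(** The covariances share their eigenvectors, so regression of X on the sources acts along o as the
    scalar [(AX + eX) / (AS + e)], and the energy scales with its square. *)
Lemma corr_dirX o e eX t : eigen B e o -> eigen BX eX o -> (AS + e = 0 -> AX + eX = 0) ->
  corr (dir X o t) = ((AX + eX) / (AS + e)) ^+ 2 * corr (dir S o t).
Proof.
move=> eo eoX e0; rewrite mulr_sumr; apply: eq_bigr => c _.
rewrite (@eigen_transfer _ _ P S (dir X o t) ((AX + eX) * \sum_i o i ^+ 2) (AX + eX) e o t c mS eo e0).
  by rewrite exprMn; ring.
move=> a b; have := hXS (fun p => if p.1 == t then a * o p.2 else 0) b.
congr (gauss1 P _ _).
  apply/funext => w; congr (_ + _); rewrite sum_pair (bigD1 t)//= eqxx [X in _ + X]big1 ?addr0.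
    by rewrite /dir mulr_sumr; apply: eq_bigr => i _; rewrite mulrA.
  by move=> u /negbTE ->; rewrite big1// => i _; rewrite mul0r.
apply: (sum_at (t0 := t)) => [|u ne] /=.
  rewrite eqxx; congr (_ + _).
  have -> : qAB AX BX (fun i => a * o i) = a ^+ 2 * ((AX + eX) * \sum_i o i ^+ 2).
    have := qAB_pert AX a (fun=> 0) eoX; under eq_fun do rewrite add0r.
    have z : \sum_i o i * 0 = 0 by rewrite big1// => i _; rewrite mulr0.
    have z2 : \sum_(i < m) (0 : R) ^+ 2 = 0 by rewrite big1// => i _; rewrite expr0n.
    by move=> ->; rewrite /qAB z z2 big1_eq expr0n/= !mulr0 !addr0.
  have -> : \sum_i a * o i * b (t, i) = a * \sum_i o i * b (t, i).
    by rewrite mulr_sumr; apply: eq_bigr => i _; rewrite mulrA.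
  by rewrite -mulr_sumr -(mulrA a) (mulrCA BX) eoX; ring.
rewrite (negbTE ne) /qAB; rewrite [X in AX * X + _ + _]big1 => [|i _]; last by rewrite expr0n.
rewrite [X in BX * X ^+ 2]big1//.
rewrite [X in 2 * (AX * X + _)]big1 => [|i _]; last by rewrite mul0r.
by rewrite big1// expr0n !(mul0r, mulr0, add0r).
Qed.

Lemma corr_coordX (o : 'I_m -> 'I_m -> R) t :
  (forall v : 'I_m -> R, \sum_r (\sum_i o r i * v i) ^+ 2 = \sum_i v i ^+ 2) ->
  \sum_i corr (X t i) = \sum_r corr (dir X (o r) t).
Proof.
move=> pv; rewrite exchange_big/= [RHS]exchange_big/=; apply: eq_bigr => c _.
rewrite -!mulr_suml -pv; congr (_ / _); apply: eq_bigr => r _; congr (_ ^+ 2).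
have gX i : gauss1 P (X t i) (AX + BX).
  suff : gfam P X AX BX by move=> /gfam1; exact.
  move=> a; have := hXS a (fun=> 0); congr (gauss1 P _ _).
    by apply/funext => w; rewrite [X in _ + X]big1 ?addr0// => p _; rewrite mul0r.
  apply: eq_bigr => u _; rewrite /qAB !(big1_eq, big1 _ _ (fun i _ => mulr0 _)).
  have z2 : \sum_(i < m) (0 : R) ^+ 2 = 0 by rewrite big1// => j _; rewrite expr0n.
  have z : \sum_j a (u, j) * 0 = 0 by rewrite big1// => j _; rewrite mulr0.
  by rewrite z z2 expr0n/= !(mulr0, addr0).
rewrite /dir; under [RHS]eq_mean do rewrite mulr_suml.
have l i : L1 P (fun w => X t i w * (codew w == c)%:R) by apply: L1_Mbool => //; exact: gauss1_L1 (gX i).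
under [RHS]eq_mean do under eq_bigr do rewrite -mulrA.
by rewrite mean_sum => [|i _]; [apply: eq_bigr => i _; rewrite meanZ|exact: L1Z].
Qed.

End Sel.

(** * Choice of the test parameters in the converse *)

Section ConverseAlgebra.
Variables (R : realType) (l1 l2 th q K1 V b1 b2 Y1 Y2 : R).
Hypotheses (q0 : 0 < q) (th0 : 0 <= th) (l1th : th <= l1) (l2th : th <= l2).
Hypotheses (K10 : 0 <= K1) (Y10 : 0 <= Y1) (Y20 : 0 <= Y2) (YE : Y1 + K1 * Y2 = K1 + 1).
Let tau := th + q.
Let u1 := l1 - th.
Let u2 := l2 - th.
Hypothesis HC1 : V * b1 = (l1 + q) / (tau * l1 ^+ 2) * (u1 + th / q * (l1 + q) * Y1).
Hypothesis HC2 : K1 != 0 -> V * b2 = (l2 + q) / (tau * l2 ^+ 2) * (u2 + th / q * (l2 + q) * Y2).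
Variables (L E1 E2 N : R).
Hypothesis E2K : K1 = 0 -> E2 = 0.

Let be := th / tau.
Let al (l : R) := be * (l + q) / l.

Hypothesis rate : forall a b, 0 < a -> 0 < b ->
  ln (1 + a * u1) - a * u1 + (1 + a * u1) * (u1 / l1 ^+ 2) * E1 +
  (K1 * (ln (1 + a * u2) - a * u2) + (1 + a * u2) * (u2 / l2 ^+ 2) * E2) +
  ((K1 + 1) * (ln (1 + b * th) - b * th) + (1 + b * th) / th * N) <= L.
Hypothesis cor1 : th != 0 ->
  (2 * al l1 * (th / l1) - al l1 ^+ 2 + 2 * al l1 * be * (u1 / l1)) * E1 - be ^+ 2 * u1 <= N / (K1 + 1).
Hypothesis cor2 : th != 0 ->
  (2 * al l2 * (th / l2) - al l2 ^+ 2 + 2 * al l2 * be * (u2 / l2)) * E2 - K1 * (be ^+ 2 * u2) <= K1 * (N / (K1 + 1)).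

Let tau0 : 0 < tau. Proof. by rewrite /tau ltr_wpDl. Qed.

Let lnq (l : R) : th <= l -> 1 + tau^-1 * (l - th) = (l + q) / tau /\ 0 < l + q.
Proof.
move=> hl; split; last by rewrite ltr_wpDl// (le_trans th0).
by rewrite /tau; field; rewrite gt_eqF.
Qed.

(** By [HC1] and [HC2], once the correlation inequalities are weighted with Y1 and Y2, the
    coefficients of E1 and E2 are V times those in the distortion: V is the Lagrange multiplier of
    the distortion constraint. At x = 1 all inequalities are tight for the test channel. A smaller x
    tests the noises with x times their conditional variance there; to first order in 1 - x the
    extra term is a multiple of the excess of N over its test-channel value. *)
Lemma converse_algebra x : 0 < x <= 1 ->
  ln (l1 + q) + K1 * ln (l2 + q) - (K1 + 1) * ln q
  + V * (b1 * (E1 - l1 ^+ 2 / (l1 + q)) + b2 * (E2 - K1 * (l2 ^+ 2 / (l2 + q))))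
  + (th != 0)%:R * ((x^-1 - 1) * (tau / q) * (N / th - (K1 + 1)) - (K1 + 1) * ln x) <= L.
Proof.
move=> /andP[x0 x1]; have K10' : K1 + 1 != 0 by rewrite gt_eqF// ltr_wpDl.
have [h1 p1] := lnq l1th; have [h2 p2] := lnq l2th.
(* With a = 1/tau the test variance [u / (1 + a * u)] is the conditional variance of a component of
   Y given the output of the test channel, in which Y is disturbed by noise of variance th + q. *)
have a0 : 0 < tau^-1 by rewrite invr_gt0.
have [t0|t0] := eqVneq th 0.
  (* For th = 0 the convention 0^-1 = 0 makes the noise term of [rate] vanish, so b = 1 will do. *)
  have ->: (false : nat)%:R = 0 :> R by []. rewrite mul0r addr0.
  apply: le_trans (rate a0 ltr01).
  rewrite h1 h2 !lnM ?posrE ?invr_gt0// lnV ?posrE//.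
  have e1 : V * b1 * E1 = (l1 + q) / tau * (u1 / l1 ^+ 2) * E1.
    rewrite HC1 t0 !mul0r addr0; congr (_ * _); rewrite invfM; ring.
  have e2 : V * b2 * E2 = (l2 + q) / tau * (u2 / l2 ^+ 2) * E2.
    have [k0|k0] := eqVneq K1 0; first by rewrite (E2K k0) !mulr0.
    rewrite (HC2 k0) t0 !mul0r addr0; congr (_ * _); rewrite invfM; ring.
  have f1 : V * b1 * (l1 ^+ 2 / (l1 + q)) = tau^-1 * u1.
    rewrite HC1 t0 !mul0r addr0; have [e|e] := eqVneq l1 0.
      by rewrite e /u1 e t0 subr0 expr0n/= !(mul0r, mulr0).
    by field; rewrite e !gt_eqF.
  have f2 : K1 * (V * b2 * (l2 ^+ 2 / (l2 + q))) = K1 * (tau^-1 * u2).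
    have [->|k0] := eqVneq K1 0; first by rewrite !mul0r.
    congr (_ * _); rewrite (HC2 k0) t0 !mul0r addr0; have [e|e] := eqVneq l2 0.
      by rewrite e /u2 e t0 subr0 expr0n/= !(mul0r, mulr0).
    by field; rewrite e !gt_eqF.
  have tq : tau = q by rewrite /tau t0 add0r.
  have -> : (K1 + 1) * (ln (1 + 1 * th) - 1 * th) + (1 + 1 * th) / th * N = 0.
    by rewrite t0 invr0 !mulr0 !addr0 ln1 subr0 mulr0 mul0r addr0.
  have -> : V * (b1 * (E1 - l1 ^+ 2 / (l1 + q)) + b2 * (E2 - K1 * (l2 ^+ 2 / (l2 + q)))) =
     V * b1 * E1 + V * b2 * E2 - V * b1 * (l1 ^+ 2 / (l1 + q)) - K1 * (V * b2 * (l2 ^+ 2 / (l2 + q))) by ring.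
  rewrite f1 f2 e1 e2 tq.
  by apply: le_of_eq; ring.
have ->: (~~ false)%:R = 1 :> R by [].
have thp : 0 < th by rewrite lt_neqAle eq_sym t0.
have l10 : 0 < l1 by exact: lt_le_trans l1th.
have l20 : 0 < l2 by exact: lt_le_trans l2th.
(* The solution b of [1 + b * th = tau / (x * q)]; for x = 1 it is 1/q. *)
have b0 : 0 < (tau / (x * q) - 1) / th.
  rewrite divr_gt0// subr_gt0 ltr_pdivlMr ?mulr_gt0// mul1r /tau.
  by rewrite (@le_lt_trans _ _ q)// ?ltrDr// ler_piMl// ltW.
have hb : 1 + (tau / (x * q) - 1) / th * th = tau / (x * q) by rewrite divfK// addrC subrK.
have := rate a0 b0; rewrite hb divfK// h1 h2.
apply: le_trans.
rewrite !lnM ?posrE ?invr_gt0 ?mulr_gt0// !lnV ?posrE ?mulr_gt0// lnM ?posrE//.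
rewrite mul1r.
have c1 := cor1 t0; have c2 := cor2 t0.
(* With these [al] and [be] the test estimate is the optimal estimate of the noise under the test
   channel, so the quadratic expression collapses to a square. *)
have al1 : 2 * al l1 * (th / l1) - al l1 ^+ 2 + 2 * al l1 * be * (u1 / l1) = al l1 ^+ 2.
  by rewrite /al /be /u1 /tau; field; rewrite !gt_eqF.
have al2 : 2 * al l2 * (th / l2) - al l2 ^+ 2 + 2 * al l2 * be * (u2 / l2) = al l2 ^+ 2.
  by rewrite /al /be /u2 /tau; field; rewrite !gt_eqF.
rewrite al1 in c1; rewrite al2 in c2.
have NE : Y1 * (N / (K1 + 1)) + Y2 * (K1 * (N / (K1 + 1))) = N.
  transitivity ((Y1 + K1 * Y2) * (N / (K1 + 1))); first by ring.
  by rewrite YE mulrC divfK.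
have Nb : Y1 * (al l1 ^+ 2 * E1 - be ^+ 2 * u1) + Y2 * (al l2 ^+ 2 * E2 - K1 * (be ^+ 2 * u2)) <= N.
  by rewrite -[X in _ <= X]NE; apply: lerD; exact: ler_wpM2l.
have e1 : V * b1 * E1 = (l1 + q) / tau * (u1 / l1 ^+ 2) * E1 + tau / (q * th) * (Y1 * (al l1 ^+ 2 * E1)).
  by rewrite HC1 /al /be; field; rewrite !gt_eqF.
have e2 : V * b2 * E2 = (l2 + q) / tau * (u2 / l2 ^+ 2) * E2 + tau / (q * th) * (Y2 * (al l2 ^+ 2 * E2)).
  have [k0|k0] := eqVneq K1 0; first by rewrite (E2K k0) !mulr0 addr0.
  by rewrite (HC2 k0) /al /be; field; rewrite !gt_eqF.
have f1 : V * b1 * (l1 ^+ 2 / (l1 + q)) = tau^-1 * u1 + th / (q * tau) * (l1 + q) * Y1.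
  by rewrite HC1; field; rewrite !gt_eqF.
have f2 : K1 * (V * b2 * (l2 ^+ 2 / (l2 + q))) = K1 * (tau^-1 * u2 + th / (q * tau) * (l2 + q) * Y2).
  have [->|k0] := eqVneq K1 0; first by rewrite !mul0r.
  by congr (_ * _); rewrite (HC2 k0); field; rewrite !gt_eqF.
have Nb2 : tau / (q * th) * (Y1 * (al l1 ^+ 2 * E1 - be ^+ 2 * u1) + Y2 * (al l2 ^+ 2 * E2 - K1 * (be ^+ 2 * u2))) <=
    tau / (q * th) * N.
  by rewrite ler_wpM2l// ltW// divr_gt0// mulr_gt0.
have -> : V * (b1 * (E1 - l1 ^+ 2 / (l1 + q)) + b2 * (E2 - K1 * (l2 ^+ 2 / (l2 + q)))) =
  V * b1 * E1 + V * b2 * E2 - V * b1 * (l1 ^+ 2 / (l1 + q)) - K1 * (V * b2 * (l2 ^+ 2 / (l2 + q))) by ring.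
rewrite e1 e2 f1 f2.
have g1 : th / (q * tau) * (l1 + q) * Y1 + K1 * (th / (q * tau) * (l2 + q) * Y2) =
   tau / (q * th) * (Y1 * (be ^+ 2 * u1) + Y2 * (K1 * (be ^+ 2 * u2))) + th / q * (K1 + 1).
  rewrite -YE /be /u1 /u2 /tau; field; rewrite !gt_eqF//.
have g2 : tau / (x * q) / th * N = tau / (q * th) * N + (x^-1 - 1) * (tau / q) * (N / th).
  by field; rewrite !gt_eqF.
have g3 : tau / (x * q) - 1 = th / q + (x^-1 - 1) * (tau / q).
  by rewrite /tau; field; rewrite !gt_eqF.
rewrite g2 g3.
rewrite -subr_ge0 in Nb2; rewrite -subr_ge0.
apply: le_trans Nb2 _; apply: le_of_eq.
have -> : tau^-1 * u1 + th / (q * tau) * (l1 + q) * Y1 = tau^-1 * u1 + (th / (q * tau) * (l1 + q) * Y1 +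
  K1 * (th / (q * tau) * (l2 + q) * Y2)) - K1 * (th / (q * tau) * (l2 + q) * Y2) by ring.
rewrite g1.
move: (ln _) (ln _) (ln _) (ln _) (ln _) => A1 A2 A3 A4 A5.
move: (tau / (q * th)) (th / (q * tau)) (x^-1 - 1) (tau^-1) (th / q) (tau / q) => B1 B2 B3 B4 B5 B6.
ring.
Qed.

End ConverseAlgebra.

(** Adjoint of restriction along f: pairing a vector with the selected coordinates equals pairing
    its push with all coordinates. *)
Definition push (R : realType) (m l : nat) (f : 'I_m -> 'I_l) (a : 'I_m -> R) (j : 'I_l) : R :=
  \sum_(i | f i == j) a i.

Lemma sum_pushM (R : realType) (m l : nat) (f : 'I_m -> 'I_l) (a : 'I_m -> R) (v : 'I_l -> R) :
  \sum_j push f a j * v j = \sum_i a i * v (f i).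
Proof.
under eq_bigr do rewrite mulr_suml; rewrite (exchange_big_dep predT)//=; apply: eq_bigr => i _.
by rewrite (big_pred1 (f i))// => j; rewrite eq_sym.
Qed.

Lemma sum_push (R : realType) (m l : nat) (f : 'I_m -> 'I_l) (a : 'I_m -> R) :
  \sum_j push f a j = \sum_i a i.
Proof.
have := sum_pushM f a (fun=> 1); under eq_bigr do rewrite mulr1; move=> ->.
by apply: eq_bigr => i _; rewrite mulr1.
Qed.

Lemma push_at (R : realType) (m l : nat) (f : 'I_m -> 'I_l) (a : 'I_m -> R) i : injective f ->
  push f a (f i) = a i.
Proof. by move=> fi; rewrite /push (big_pred1 i)// => j; rewrite inj_eq. Qed.

Lemma qAB_push (R : realType) (m l : nat) (f : 'I_m -> 'I_l) (a : 'I_m -> R) A B : injective f ->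
  qAB A B (push f a) = qAB A B a.
Proof.
move=> fi; rewrite /qAB sum_push; congr (_ * _ + _).
under eq_bigr do rewrite expr2; rewrite sum_pushM; apply: eq_bigr => i _.
by rewrite push_at// expr2.
Qed.

Lemma gfam_sel (R : realType) (d : measure_display) (T : measurableType d) (P : probability T R)
  (n m l : nat) (V : 'I_n -> 'I_l -> T -> R) A B (f : 'I_m -> 'I_l) : injective f ->
  gfam P V A B -> gfam P (fun t i => V t (f i)) A B.
Proof.
move=> fi gV b; have := gV (fun p => push f (fun i => b (p.1, i)) p.2).
rewrite (_ : (fun x => _) = (fun x => \sum_p b p * V p.1 (f p.2) x)); last first.
  apply/funext => x; rewrite !sum_pair; apply: eq_bigr => t _.
  exact: (sum_pushM f (fun i => b (t, i)) (fun j => V t j x)).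
by congr (gauss1 P _ _); apply: eq_bigr => t _; exact: (qAB_push (fun i => b (t, i))).
Qed.

(** The map scales the all-ones direction by p1 and its complement by p2, so chosen that each
    eigenvalue of the covariance drops by th; hence only A changes. This manufactures Y from the
    sources. *)
Lemma gfam_lin (R : realType) (d : measure_display) (T : measurableType d) (P : probability T R)
  (n m : nat) (V : 'I_n -> 'I_m -> T -> R) A B th p1 p2 : (0 < m)%N ->
  p2 ^+ 2 * A = A - th -> p1 ^+ 2 * (A + m%:R * B) = A + m%:R * B - th ->
  gfam P V A B -> gfam P (fun t i x => p2 * V t i x + (p1 - p2) / m%:R * \sum_j V t j x) (A - th) B.
Proof.
move=> m0 h2 h1 gV b; have m0' : m%:R != 0 :> R by rewrite pnatr_eq0 -lt0n.
have := gV (fun p => p2 * b p + (p1 - p2) / m%:R * \sum_i b (p.1, i)).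
rewrite (_ : (fun x => _) = (fun x => \sum_p b p * (p2 * V p.1 p.2 x + (p1 - p2) / m%:R * \sum_j V p.1 j x))); last first.
  apply/funext => x; rewrite !sum_pair; apply: eq_bigr => t _ /=.
  under eq_bigr do rewrite mulrDl; rewrite big_split/= -[X in _ + X]mulr_sumr.
  under [RHS]eq_bigr do rewrite mulrDr; rewrite [in RHS]big_split/= -[X in _ = _ + X]mulr_suml.
  congr (_ + _); last by ring.
  by apply: eq_bigr => i _; ring.
congr (gauss1 P _ _); apply: eq_bigr => t _; rewrite /qAB.
set sb := \sum_i b (t, i); set y := (p1 - p2) / m%:R * sb.
have -> : \sum_i (p2 * b (t, i) + y) = p1 * sb.
  by rewrite big_split/= sumr_const card_ord -mulr_sumr -/sb -mulr_natr /y; field.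
have -> : \sum_i (p2 * b (t, i) + y) ^+ 2 = p2 ^+ 2 * (\sum_i b (t, i) ^+ 2) + 2 * p2 * y * sb + y ^+ 2 * m%:R.
  rewrite mulr_natr (_ : y ^+ 2 *+ m = \sum_(i < m) y ^+ 2); last by rewrite sumr_const card_ord.
  rewrite /sb !mulr_sumr -!big_split/=.
  by apply: eq_bigr => i _; ring.
rewrite -h2 /y; move: (\sum_i b (t, i) ^+ 2) (sb) => bb s.
transitivity (p2 ^+ 2 * A * bb + s ^+ 2 / m%:R * (p1 ^+ 2 * (A + m%:R * B) - p2 ^+ 2 * A)).
  by field.
by rewrite h1 h2; field.
Qed.

(** * Sources and fresh noise obtained from the process *)

Section ProcInst.
Context {R : realType} {dT : measure_display} {Omega : measurableType dT}.
Variables (P : probability Omega R) (l : nat) (gX rX gZ rZ : R).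
Variables (X Z : nat -> 'I_l -> Omega -> R).
Hypothesis hX : forall t, gaussian_vec P (X t) (eqcov l gX rX).
Hypothesis hZ : forall t, gaussian_vec P (Z t) (eqcov l gZ rZ).
Hypothesis hXZ : indep_signal_noise P X Z.
Hypothesis hiid : indep_times P X Z.
Variable (gS rS : R).
Hypotheses (hgS : gS = gX + gZ) (hrS : rS * gS = rX * gX + rZ * gZ) (hgX : 0 < gX).

Lemma proc_gauss (n : nat) (a b : 'I_n * 'I_l -> R) :
  gauss1 P (fun w => \sum_p a p * X p.1 p.2 w + \sum_p b p * Z p.1 p.2 w)
   (\sum_t (qAB (lam2 gX rX) (rX * gX) (fun i => a (t, i)) + qAB (lam2 gZ rZ) (rZ * gZ) (fun i => b (t, i)))).
Proof.
pose ext (c : 'I_n * 'I_l -> R) (t : nat) i : R := if insub t is Some t' then c (t', i) else 0.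
have extE c (t : 'I_n) i : ext c t i = c (t, i) by rewrite /ext valK.
have := proc_lin hX hZ hXZ hiid (ext a) (ext b) (iota_uniq 0 n).
rewrite (_ : (fun w => _) = (fun w => \sum_p a p * X p.1 p.2 w + \sum_p b p * Z p.1 p.2 w)); last first.
  apply/funext => w; rewrite -[n in iota 0 n]subn0 big_mkord !sum_pair -big_split/=.
  by apply: eq_bigr => t _; congr (_ + _); apply: eq_bigr => i _; rewrite extE.
congr (gauss1 P _ _); rewrite -[n in iota 0 n]subn0 big_mkord.
have e c (t : 'I_n) : ext c t = fun i => c (t, i) by apply/funext => i; exact: extE.
by apply: eq_bigr => t _; rewrite !e.
Qed.

Definition src (n : nat) (t : 'I_n) (i : 'I_l) (w : Omega) : R := X t i w + Z t i w.

Lemma lam2S : lam2 gS rS = lam2 gX rX + lam2 gZ rZ.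
Proof. by rewrite /lam2 !mulrBl !mul1r hrS hgS; ring. Qed.

Lemma proc_joint (n m : nat) (f : 'I_m -> 'I_l) : injective f -> forall a b : 'I_n * 'I_m -> R,
  gauss1 P (fun w => \sum_p a p * X p.1 (f p.2) w + \sum_p b p * src p.1 (f p.2) w)
  (\sum_t (qAB (lam2 gX rX) (rX * gX) (fun i => a (t, i)) + 2 * (lam2 gX rX * (\sum_i a (t, i) * b (t, i)) +
     rX * gX * ((\sum_i a (t, i)) * \sum_i b (t, i))) + qAB (lam2 gS rS) (rS * gS) (fun i => b (t, i)))).
Proof.
move=> fi a b.
have := @proc_gauss n (fun p => push f (fun i => a (p.1, i) + b (p.1, i)) p.2) (fun p => push f (fun i => b (p.1, i)) p.2).
rewrite (_ : (fun w => _) = (fun w => \sum_p a p * X p.1 (f p.2) w + \sum_p b p * src p.1 (f p.2) w)); last first.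
  apply/funext => w; rewrite !sum_pair -!big_split/=; apply: eq_bigr => t _.
  rewrite !sum_pushM -!big_split/=; apply: eq_bigr => i _; rewrite /src; ring.
congr (gauss1 P _ _); apply: eq_bigr => t _ /=; rewrite !qAB_push// /qAB lam2S hrS big_split/=.
have -> : \sum_i (a (t, i) + b (t, i)) ^+ 2 = \sum_i a (t, i) ^+ 2 + 2 * (\sum_i a (t, i) * b (t, i)) + \sum_i b (t, i) ^+ 2.
  by rewrite mulr_sumr -!big_split/=; apply: eq_bigr => i _; ring.
ring.
Qed.

Lemma proc_src (n m : nat) (f : 'I_m -> 'I_l) : injective f ->
  gfam P (fun (t : 'I_n) i => src t (f i)) (lam2 gS rS) (rS * gS).
Proof.
move=> fi b; have := proc_joint fi (fun=> 0) b.
rewrite (_ : (fun w => _) = (fun w => \sum_p b p * src p.1 (f p.2) w)); last first.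
  by apply/funext => w; rewrite [X in X + _]big1 ?add0r// => p _; rewrite mul0r.
congr (gauss1 P _ _); apply: eq_bigr => t _; rewrite /qAB.
have z : \sum_i 0 * b (t, i) = 0 by rewrite big1// => i _; rewrite mul0r.
have z2 : \sum_(i < m) (0 : R) ^+ 2 = 0 by rewrite big1// => i _; rewrite expr0n.
by rewrite z z2 big1_eq expr0n/= mul0r !mulr0 !addr0 mulr0 !add0r.
Qed.

Variables (i0 : 'I_l) (n m : nat) (tau : 'I_n * 'I_m -> nat).
Hypothesis tau_inj : injective tau.

(* White noise on a copy of the probability space, built from distinct times of one component of [X]. *)
Definition fresh (t : 'I_n) (i : 'I_m) (w : Omega) : R := (Num.sqrt gX)^-1 * X (tau (t, i)) i0 w.

Lemma fresh_gauss : gfam P fresh 1 0.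
Proof.
move=> b; pose s := [seq tau p | p <- index_enum ('I_n * 'I_m)%type].
pose a (t : nat) (i : 'I_l) : R := if i == i0 then \sum_(p | tau p == t) (Num.sqrt gX)^-1 * b p else 0.
have aE p : a (tau p) i0 = (Num.sqrt gX)^-1 * b p.
  by rewrite /a eqxx (big_pred1 p)// => p'; rewrite (inj_eq tau_inj).
have us : uniq s by rewrite map_inj_uniq// index_enum_uniq.
have := proc_lin hX hZ hXZ hiid a (fun _ _ => 0) us.
rewrite (_ : (fun w => _) = (fun w => \sum_p b p * fresh p.1 p.2 w)); last first.
  apply/funext => w; rewrite big_map; apply: eq_bigr => -[t i] _.
  rewrite [X in _ + X]big1 ?addr0 => [|j _]; last by rewrite mul0r.
  rewrite (bigD1 i0)//= big1 ?addr0 => [|j ne]; last by rewrite /a (negbTE ne) mul0r.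
  by rewrite aE /fresh; ring.
congr (gauss1 P _ _); rewrite big_map.
transitivity (\sum_p b p ^+ 2).
  apply: eq_bigr => p _; rewrite /qform.
  have z2 : \sum_(i < l) (0 : R) ^+ 2 = 0 by rewrite big1// => i _; rewrite expr0n.
  rewrite z2 big1_eq expr0n/= !mulr0 !addr0.
  rewrite (bigD1 i0)//= big1 ?addr0 => [|j ne]; last by rewrite /a (negbTE ne) expr0n.
  rewrite (bigD1 i0)//= big1 ?addr0 => [|j ne]; last by rewrite /a (negbTE ne).
  rewrite aE exprMn exprVn sqr_sqrtr ?(ltW hgX)// /lam2; field; by rewrite gt_eqF.
by rewrite sum_pair; apply: eq_bigr => t _; rewrite /qAB mul0r addr0 mul1r.
Qed.

Let F t := sigma_of (fun p : 'I_l + 'I_l => match p with inl i => X t i | inr i => Z t i end).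
Let V (t : nat) (w : Omega) := (Num.sqrt gX)^-1 * X t i0 w.
Let sV t : smeas F (pred1 t) (V t).
Proof.
apply/smeasP; apply: measurable_funM => //; apply/smeasP; exact: proc_smeas.
Qed.

Lemma fresh_prod (f : 'I_n * 'I_m -> R -> R) : (forall p, measurable_fun setT (f p)) ->
  (forall p, L1 P (fun x => f p (fresh p.1 p.2 x))) ->
  L1 P (fun x => \prod_p f p (fresh p.1 p.2 x)) /\
  mean P (fun x => \prod_p f p (fresh p.1 p.2 x)) = \prod_p mean P (fun x => f p (fresh p.1 p.2 x)).
Proof.
move=> mf lf; apply: (proc_prod hX hZ hiid (g := fun p => pred1 (tau p))) => //.
  by move=> p p' t /= /eqP -> /eqP /tau_inj.
move=> [t i]; apply/smeasP; apply: (measurableT_comp (mf (t, i))); apply/smeasP; exact: sV.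
Qed.

Lemma fresh_grp (g : 'I_m -> RV R 'I_n -> R) : (forall i, measurable_fun setT (g i)) ->
  (forall i, L1 P (fun x => g i (fun t => fresh t i x))) ->
  L1 P (fun x => \prod_i g i (fun t => fresh t i x)) /\
  mean P (fun x => \prod_i g i (fun t => fresh t i x)) = \prod_i mean P (fun x => g i (fun t => fresh t i x)).
Proof.
move=> mg lg; apply: (proc_prod hX hZ hiid (g := fun i t => [exists u, tau (u, i) == t])) => //.
  by move=> i j t /existsP[u /eqP <-] /existsP[v /eqP] /tau_inj [].
move=> i; apply: (smeas_RV (tau := fun u => tau (u, i)) (V := V)) => //.
by move=> u; apply/existsP; exists u.
Qed.

End ProcInst.

Lemma nois_sel (R : realType) (d1 d2 : measure_display) (T1 : measurableType d1) (T2 : measurableType d2)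
  (P2 : probability T2 R) (n m l : nat) (K : finType) (enc : 'I_l -> RV R 'I_n -> K)
  (Y : 'I_n -> 'I_l -> T1 -> R) (N : 'I_n -> 'I_l -> T2 -> R) (f : 'I_m -> 'I_l) t i w :
  nois P2 (fun i => enc (f i)) (fun t i => Y t (f i)) (fun t i => N t (f i)) t i w = nois P2 enc Y N t (f i) w.
Proof.
have cE x k : (cword (fun i => enc (f i)) (fun t i => Y t (f i)) (fun t i => N t (f i)) (w, x) i == k) =
    (cword enc Y N (w, x) (f i) == k) by rewrite /cword !ffunE.
apply: eq_bigr => k _; rewrite /mcond /qcond.
by under eq_mean do rewrite cE; under [in X in _ / X]eq_mean do rewrite cE.
Qed.

Section Bridge.
Context {R : realType} {dT : measure_display} {Omega : measurableType dT}.
Variables (P : probability Omega R) (l : nat) (X Z : nat -> 'I_l -> Omega -> R).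
Hypothesis mX : forall t i, measurable_fun setT (X t i).
Hypothesis mZ : forall t i, measurable_fun setT (Z t i).
Hypothesis sqX : forall t i, L1 P (fun w => X t i w ^+ 2).
Variables (n : nat) (M : 'I_l -> nat) (phi : forall i : 'I_l, ('I_n -> R) -> 'I_(M i)).
Hypothesis mphi : forall i c, borelRn (phi i @^-1` [set c]).

(** The alphabets are embedded in a common one, so that the codewords of any block of encoders form
    a finite function space. *)
Definition encK (i : 'I_l) (f : RV R 'I_n) : 'I_(\max_i M i).+1 := inord (phi i f).

Let leM i : (M i <= (\max_i M i).+1)%N.
Proof. by apply: leqW; exact: leq_bigmax. Qed.

Lemma encK_val i f : encK i f = phi i f :> nat.
Proof. by rewrite /encK inordK// (leq_trans (ltn_ord _))// leM. Qed.

Lemma encK_meas i k : <<s @rectangles R 'I_n >> (encK i @^-1` [set k]).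
Proof.
have [kM|kM] := ltnP k (M i).
  rewrite (_ : encK i @^-1` [set k] = phi i @^-1` [set Ordinal kM]); first exact: mphi.
  apply/seteqP; split => f /= h; apply/val_inj; first by rewrite /= -h encK_val.
  by rewrite /= encK_val h.
rewrite (_ : encK i @^-1` [set k] = set0).
  exact: (@measurable0 _ (RV R 'I_n)).
by apply/seteqP; split => f //= h; move: kM; rewrite -h encK_val leqNgt ltn_ord.
Qed.

Variables (m : nat) (f : 'I_m -> 'I_l).
Hypothesis fi : injective f.
Let A : {set 'I_l} := [set f i | i : 'I_m].
Let Sf (t : 'I_n) (i : 'I_m) := src X Z t (f i).
Let encf (i : 'I_m) := encK (f i).

Let code_eventE w : code_event X Z phi A w = [set w' | codew Sf encf w' = codew Sf encf w].
Proof.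
apply/seteqP; split => w' /= h.
  apply/ffunP => i; rewrite !ffunE; apply/val_inj; rewrite /= !encK_val.
  by congr (nat_of_ord _); apply: h; apply/imsetP; exists i.
move=> i' /imsetP[i _ ->]; apply/val_inj; rewrite /= -!encK_val.
by have /ffunP /(_ i) := h; rewrite !ffunE => /(congr1 val).
Qed.

Let mS t i : measurable_fun setT (Sf t i). Proof. exact: measurable_funD. Qed.

Let mb c : measurable_fun setT (fun w => (codew Sf encf w == c)%:R : R).
Proof.
rewrite (_ : (fun w => _) = (fun w => \prod_i (codew Sf encf w i == c i)%:R)); last first.
  apply/funext => w; have [->|ne] := eqVneq (codew Sf encf w) c.
    by rewrite big1// => i _; rewrite eqxx.
  have : ~~ [forall i, codew Sf encf w i == c i].
    by apply: contraNN ne => /forallP h; apply/eqP/ffunP => i; exact/eqP.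
  rewrite negb_forall => /existsP[i /negbTE h].
  by rewrite (bigD1 i)//= h mul0r.
apply: measurable_prod => i _; under eq_fun do rewrite ffunE.
by apply: (mind (enc := encf)) => [i' k|t]; [exact: encK_meas|exact: mS].
Qed.

(** The estimate is the orthogonal projection onto functions of the codewords, so its error is the
    second moment minus its energy. Codewords of probability zero are harmless by [mean_bool0]. *)
Lemma mse_corr (i : 'I_l) (t : nat) :
  mse P X Z phi A i t = (mean P (fun w => X t i w ^+ 2) - corr P Sf encf (X t i))%:E.
Proof.
pose g c := mean P (fun w => X t i w * (codew Sf encf w == c)%:R) / pS P Sf encf c.
have lX : L1 P (X t i) by exact: L1_sq1.
have lXb c : L1 P (fun w => X t i w * (codew Sf encf w == c)%:R) by exact: L1_Mbool.
have lb c : L1 P (fun w => (codew Sf encf w == c)%:R) by exact: L1_bool.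
have me w : measurable (code_event X Z phi A w).
  rewrite code_eventE; have := mb (codew Sf encf w) measurableT (measurable_set1 1); rewrite setTI.
  congr measurable; apply/seteqP; split => w' /=; first by case: eqP => // _ /eqP; rewrite eq_sym oner_eq0.
  by move=> ->; rewrite eqxx.
have XhE w : Xhat P X Z phi A i t w = g (codew Sf encf w).
  rewrite /Xhat /g; congr (_ / _).
    rewrite /mean /Rintegral [in LHS]integral_mkcond; congr fine; apply: eq_integral => w' _.
    rewrite /patch code_eventE; case: (eqVneq (codew Sf encf w') (codew Sf encf w)) => h.
      by rewrite mem_set//= mulr1.
    by rewrite memNset/= ?(negbTE h) ?mulr0// => e; rewrite e eqxx in h.
  rewrite -mean_indic//; apply: eq_mean => w'; rewrite indicE code_eventE.
  case: eqP => h; first by rewrite mem_set.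
  by rewrite memNset.
have E w : (X t i w - Xhat P X Z phi A i t w) ^+ 2 = X t i w ^+ 2 -
    \sum_c (2 * g c * (X t i w * (codew Sf encf w == c)%:R) - g c ^+ 2 * (codew Sf encf w == c)%:R).
  rewrite XhE sumrB (sum_eqb _ (fun c => g c ^+ 2)).
  have -> : \sum_c 2 * g c * (X t i w * (codew Sf encf w == c)%:R) = 2 * g (codew Sf encf w) * X t i w.
    rewrite -(sum_eqb _ (fun c => 2 * g c * X t i w)).
    by apply: eq_bigr => c _; rewrite mulrA.
  by ring.
rewrite /mse; under eq_integral do rewrite E.
have l1 c : L1 P (fun w => 2 * g c * (X t i w * (codew Sf encf w == c)%:R) - g c ^+ 2 * (codew Sf encf w == c)%:R).
  by apply: L1B; exact: L1Z.
rewrite -EFin_mean; last by apply: L1B => //; apply: L1_sum => c _; exact: l1.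
congr EFin; rewrite meanB//; last by apply: L1_sum => c _; exact: l1.
congr (_ - _); rewrite mean_sum => [|c _]; last exact: l1.
apply: eq_bigr => c _; rewrite meanB; [|exact: L1Z|exact: L1Z].
rewrite !meanZ// -/(pS P Sf encf c) /g.
have [p0|p0] := eqVneq (pS P Sf encf c) 0; last by field.
rewrite (mean_bool0 (mX t i) (sqX t i) (mb c) p0) p0.
by rewrite expr0n/= !(mul0r, mulr0) subr0.
Qed.

Lemma sum_image (F : 'I_l -> R) : \sum_(i in A) F i = \sum_i F (f i).
Proof. by rewrite big_imset//=; apply: in2W. Qed.

Lemma card_imset_ord : #|A| = m. Proof. by rewrite card_imset// card_ord. Qed.

End Bridge.

Lemma card_ord_lt (N M : nat) : (M <= N)%N -> #|[pred c : 'I_N | (c < M)%N]| = M.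
Proof.
move=> MN; rewrite -sum1_card (eq_bigl (fun c : 'I_N => (c < M)%N))//.
by rewrite (big_ord_narrow MN) sum1_card card_ord.
Qed.

Lemma lam1_eig (R : realType) (g r : R) (m : nat) : lam2 g r + m%:R * (r * g) = lam1 g r m.
Proof. rewrite /lam1 /lam2; ring. Qed.

(** * Inequalities for a block of encoders and its sub-blocks *)

Section Block.
Context {R : realType} {dT : measure_display} {Omega : measurableType dT}.
Variables (P : probability Omega R) (l : nat) (gX rX gZ rZ : R).
Variables (X Z : nat -> 'I_l -> Omega -> R).
Hypothesis hX : forall t, gaussian_vec P (X t) (eqcov l gX rX).
Hypothesis hZ : forall t, gaussian_vec P (Z t) (eqcov l gZ rZ).
Hypothesis hXZ : indep_signal_noise P X Z.
Hypothesis hiid : indep_times P X Z.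
Variable (gS rS : R).
Hypotheses (hgS : gS = gX + gZ) (hrS : rS * gS = rX * gX + rZ * gZ) (hgX : 0 < gX).
Variables (j' : nat) (iJ : 'I_j'.+1 -> 'I_l).
Hypothesis iJ_inj : injective iJ.
Let j := j'.+1.
Variables (n : nat) (n0 : (0 < n)%N) (th : R) (th0 : 0 <= th).
Hypotheses (th1 : th <= lam1 gS rS j) (th2 : th <= lam2 gS rS).
Hypothesis hX0 : forall m, (m <= l)%N -> lam1 gS rS m = 0 -> lam1 gX rX m = 0.
Hypothesis hX2 : lam2 gS rS = 0 -> lam2 gX rX = 0.
Variables (M : 'I_l -> nat) (phi : forall i : 'I_l, ('I_n -> R) -> 'I_(M i)).
Hypothesis mphi : forall i c, borelRn (phi i @^-1` [set c]).

Let cth := Num.sqrt th.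
Let cthE : cth ^+ 2 = th. Proof. exact: sqr_sqrtr. Qed.

(** Mixed-radix numbering: distinct pairs use distinct times, which makes the noises independent. *)
Let tau (p : 'I_n * 'I_j) : nat := p.1 * j + p.2.
Let tau_inj : injective tau.
Proof.
move=> [t i] [u v]; rewrite /tau /= => e.
have e1 : t = u :> nat by have := congr1 (divn^~ j) e; rewrite !divnMDl// !divn_small// !addn0.
congr pair; apply/val_inj => //=; move: e; rewrite e1 => /eqP; rewrite eqn_add2l => /eqP; exact.
Qed.

Let xi t i := fresh gX X (iJ ord0) tau t i.
Let S (t : 'I_n) (i : 'I_j) := src X Z t (iJ i).
(** Contraction factors that lower the two eigenvalues by th; if an eigenvalue is 0 then so is th,
    and the quotient is 0. *)
Let p1 := Num.sqrt ((lam1 gS rS j - th) / lam1 gS rS j).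
Let p2 := Num.sqrt ((lam2 gS rS - th) / lam2 gS rS).
Let Y t i x := p2 * S t i x + (p1 - p2) / j%:R * \sum_v S t v x.

Let gS_ : gfam P S (lam2 gS rS) (rS * gS).
Proof. exact: proc_src hX hZ hXZ hiid _ _ hgS hrS _ _ _ iJ_inj. Qed.

Let sq (a : R) : th <= a -> Num.sqrt ((a - th) / a) ^+ 2 * a = a - th.
Proof.
move=> ha; have [a0|a0] := eqVneq a 0.
  have t0 : th = 0 by apply/eqP; rewrite eq_le th0 andbT -a0.
  by rewrite t0 a0 mulr0 subrr.
rewrite sqr_sqrtr ?divfK// divr_ge0 ?subr_ge0//; exact: le_trans ha.
Qed.

Let gY : gfam P Y (lam2 gS rS - th) (rS * gS).
Proof.
apply: gfam_lin => //; first exact: sq.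
by rewrite lam1_eig; exact: sq.
Qed.

Let enc (i : 'I_j) := encK phi (iJ i).
(** This energy depends on the codeword of encoder i and on Y, not on the encoders grouped with it.
    The same numbers therefore enter the inequalities of every sub-block f, which is what allows
    averaging over windows. *)
Definition block_noise (i : 'I_j) : R := n%:R^-1 * \sum_t errN P P Y xi cth enc t i.
Let e := block_noise.

Variables (m' : nat) (f : 'I_m'.+1 -> 'I_j).
Hypothesis fi : injective f.
Let m := m'.+1.
Hypothesis th1m : th <= lam1 gS rS m.

Let Sf (t : 'I_n) i := S t (f i).
Let Xf (t : 'I_n) i := X t (iJ (f i)).
Let encf i := enc (f i).
Let E (r : 'I_m) : R := n%:R^-1 * \sum_t corr P Sf encf (dir Sf (house R r) t).
Let E1 := E ord0.
Let E2 := \sum_(r | r != ord0) E r.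
Let N := \sum_i e (f i).
Let nn : n%:R != 0 :> R. Proof. by rewrite pnatr_eq0 -lt0n. Qed.

Let gSf : gfam P Sf (lam2 gS rS) (rS * gS). Proof. exact: gfam_sel. Qed.
Let gYf : gfam P (fun t i => Y t (f i)) (lam2 gS rS - th) (rS * gS). Proof. exact: gfam_sel. Qed.
Let tauf_inj : injective (fun p : 'I_n * 'I_m => tau (p.1, f p.2)).
Proof. by move=> [t i] [u v] /= /tau_inj [-> /fi ->]. Qed.
Let gxif : gfam P (fun t i => xi t (f i)) 1 0.
Proof. exact: (fresh_gauss hX hZ hXZ hiid hgX (iJ ord0) tauf_inj). Qed.
Let menc i k : <<s @rectangles R 'I_n >> (encf i @^-1` [set k]).
Proof. exact: encK_meas. Qed.

Let errf t i : errN P P (fun t i => Y t (f i)) (fun t i => xi t (f i)) cth encf t i = errN P P Y xi cth enc t (f i).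
Proof.
apply: eq_mean => w.
exact: (nois_sel P enc Y (scaled xi cth) f t i w).
Qed.

Let efE i : e (f i) = n%:R^-1 * \sum_t errN P P (fun t i => Y t (f i)) (fun t i => xi t (f i)) cth encf t i.
Proof.
apply: (congr1 (fun s => n%:R^-1 * s)); apply: eq_bigr => t _; exact: (esym (errf t i)).
Qed.

Let eig (r : 'I_m) : R := if r == ord0 then m%:R * (rS * gS) else 0.
Let eigE r : eigen (rS * gS) (eig r) (house R r). Proof. exact: house_eigen. Qed.
Let lamE r : lam2 gS rS + eig r = if r == ord0 then lam1 gS rS m else lam2 gS rS.
Proof. by rewrite /eig; case: ifP => _; rewrite ?lam1_eig ?addr0. Qed.
Let lamth r : th <= lam2 gS rS + eig r. Proof. by rewrite lamE; case: ifP. Qed.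
Let lam0 r : lam2 gS rS + eig r = 0 -> th = 0.
Proof. by move=> h; apply/eqP; rewrite eq_le th0 andbT -h. Qed.

Let nsum (G : 'I_n -> 'I_m -> R) : n%:R^-1 * (\sum_t \sum_r G t r) = \sum_r n%:R^-1 * \sum_t G t r.
Proof. by rewrite exchange_big/= mulr_sumr. Qed.

Let split0 (G : 'I_m -> R) : \sum_r G r = G ord0 + \sum_(r | r != ord0) G r.
Proof. by rewrite (bigD1 ord0). Qed.

Lemma block_rate a b : 0 < a -> 0 < b ->
  ln (1 + a * (lam1 gS rS m - th)) - a * (lam1 gS rS m - th) +
    (1 + a * (lam1 gS rS m - th)) * ((lam1 gS rS m - th) / lam1 gS rS m ^+ 2) * E1 +
  (m'%:R * (ln (1 + a * (lam2 gS rS - th)) - a * (lam2 gS rS - th)) +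
    (1 + a * (lam2 gS rS - th)) * ((lam2 gS rS - th) / lam2 gS rS ^+ 2) * E2) +
  ((m'%:R + 1) * (ln (1 + b * th) - b * th) + (1 + b * th) / th * N)
  <= 2 / n%:R * \sum_i ln (M (iJ (f i)))%:R.
Proof.
move=> a0 b0; pose V (i : 'I_m) := [pred c : 'I_(\max_i M i).+1 | (c < M (iJ (f i)))%N].
have cV i : #|V i| = M (iJ (f i)).
  by rewrite card_ord_lt//; apply: leqW; exact: leq_bigmax.
have u0 r : 0 <= lam2 gS rS - th + eig r by rewrite addrAC subr_ge0.
have Ven i g : encf i g \in V i by rewrite inE encK_val.
have := code_rate cthE gSf gYf gxif (fresh_prod hX hZ hiid tauf_inj)
  menc (V := V) (o := @house R m') (e := eig) (a := fun=> a) (b := b)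
  eigE (@house_orth R m') lam0 u0 (fun=> a0) b0 Ven.
under [X in _ <= X]eq_bigr do rewrite cV.
move=> h; have n2 : 0 <= 2 / n%:R :> R by rewrite divr_ge0.
have := ler_wpM2l n2 h; apply: le_trans.
rewrite [X in _ <= X]mulrDr; apply: le_of_eq; congr (_ + _).
  pose H x y := ln (1 + a * (x - th)) - a * (x - th) + (1 + a * (x - th)) * ((x - th) / x ^+ 2) * y.
  have h1 r : 2 * (n%:R^-1 * \sum_(t < n) (2^-1 * ln (1 + a * (lam2 gS rS - th + eig r)) - a / 2 * (lam2 gS rS - th + eig r) +
      (1 + a * (lam2 gS rS - th + eig r)) * ((lam2 gS rS - th + eig r) / (2 * (lam2 gS rS + eig r) ^+ 2)) *
      corr P Sf encf (dir Sf (house R r) t))) = H (lam2 gS rS + eig r) (E r).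
    rewrite big_split/= sumr_const card_ord -mulr_sumr -[X in n%:R^-1 * (X + _)]mulr_natr !(addrAC _ (- th)) /E /H.
    rewrite [(2 * (lam2 gS rS + eig r) ^+ 2)^-1]invfM.
    by move: (\sum_t _) (((lam2 gS rS + eig r) ^+ 2)^-1) => s z; field.
  rewrite -[RHS]mulrA nsum [RHS]mulr_sumr (eq_bigr _ (fun r _ => h1 r)) split0 lamE eqxx.
  have -> : \sum_(r | r != ord0) H (lam2 gS rS + eig r) (E r) =
      m'%:R * (ln (1 + a * (lam2 gS rS - th)) - a * (lam2 gS rS - th)) +
      (1 + a * (lam2 gS rS - th)) * ((lam2 gS rS - th) / lam2 gS rS ^+ 2) * E2.
    rewrite (eq_bigr (fun r => H (lam2 gS rS) (E r))) => [|r /negbTE r0]; last by rewrite lamE r0.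
    by rewrite big_split/= sumr_const cardC1 card_ord -mulr_sumr -[X in X + _ = _]mulr_natl.
  by [].
rewrite -[RHS]mulrA nsum [RHS]mulr_sumr.
transitivity (\sum_i ((ln (1 + b * th) - b * th) + (1 + b * th) / th * e (f i))).
  by rewrite big_split/= sumr_const card_ord -mulr_sumr -[X in _ = X + _]mulr_natl -natr1.
apply: eq_bigr => i _; rewrite big_split/= sumr_const card_ord -[X in n%:R^-1 * (X + _)]mulr_natr -mulr_sumr efE.
rewrite [(2 * th)^-1]invfM.
move: (\sum_t _) (th^-1) => s t'; field.
by rewrite nn.
Qed.

Let corr_t r al be : (2 * al * (th / (lam2 gS rS + eig r)) - al ^+ 2 + 2 * al * be * ((lam2 gS rS + eig r - th) / (lam2 gS rS + eig r))) * E r -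
   be ^+ 2 * (lam2 gS rS + eig r - th) <= \sum_i house R r i ^+ 2 * e (f i).
Proof.
have o1 : \sum_i house R r i ^+ 2 = 1.
  by rewrite (eq_bigr (fun i => house R r i * house R r i))// house_orth eqxx.
have h t := errN_correlation cthE gSf gYf gxif (fresh_grp hX hZ hiid tauf_inj) menc t al be (eigE r) (@lam0 r).
have n1 : 0 <= n%:R^-1 :> R by rewrite invr_ge0.
have := ler_wpM2l n1 (ler_sum (index_enum 'I_n) (P := xpredT) (fun t _ => h t)).
rewrite sumrB sumr_const card_ord -mulr_sumr o1 mulr1.
move=> h2; apply: (le_trans _ (le_trans h2 _)); last first.
  rewrite exchange_big/= mulr_sumr le_eqVlt; apply/orP; left; apply/eqP; apply: eq_bigr => i _.
  by rewrite efE -mulr_sumr mulrCA.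
rewrite /E -(mulr_natr (be ^+ 2 * _)) !(addrAC _ (- th)); move: (\sum_t _) => s.
move: (th / (lam2 gS rS + eig r)) ((lam2 gS rS + eig r - th) / (lam2 gS rS + eig r)) => x y.
by apply: le_of_eq; field.
Qed.

Lemma block_cor1 al be :
  (2 * al * (th / lam1 gS rS m) - al ^+ 2 + 2 * al * be * ((lam1 gS rS m - th) / lam1 gS rS m)) * E1 -
   be ^+ 2 * (lam1 gS rS m - th) <= N / (m'%:R + 1).
Proof.
have := corr_t ord0 al be; rewrite lamE eqxx => /le_trans; apply.
under eq_bigr do rewrite house0; rewrite -mulr_sumr exprVn sqr_sqrtr// -/N natr1 mulrC.
exact: lexx.
Qed.

Lemma block_cor2 al be :
  (2 * al * (th / lam2 gS rS) - al ^+ 2 + 2 * al * be * ((lam2 gS rS - th) / lam2 gS rS)) * E2 -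
   m'%:R * (be ^+ 2 * (lam2 gS rS - th)) <= m'%:R * (N / (m'%:R + 1)).
Proof.
have h2 : \sum_(r | r != ord0) \sum_i house R r i ^+ 2 * e (f i) = m'%:R * (N / (m'%:R + 1)).
  rewrite exchange_big/= /N mulr_suml mulr_sumr; apply: eq_bigr => i _.
  (* Column i of the orthogonal matrix has norm one and its first entry has square 1/(m'+1), so the
     complement weighs all energies equally. *)
  have oi : \sum_(r | r != ord0) house R r i ^+ 2 = m'%:R / (m'%:R + 1).
    have : \sum_r house R r i ^+ 2 = 1.
      by rewrite (eq_bigr (fun r => house R i r * house R i r)) => [|r _]; [rewrite house_orth eqxx|rewrite (houseC R r)].
    rewrite split0 house0 exprVn sqr_sqrtr// => h; apply: (addrI (m'.+1%:R^-1)); rewrite h -natr1; field.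
    by rewrite natr1 pnatr_eq0.
  by rewrite -mulr_suml oi mulrAC mulrA.
rewrite -h2; have h r : r != ord0 -> (2 * al * (th / lam2 gS rS) - al ^+ 2 + 2 * al * be * ((lam2 gS rS - th) / lam2 gS rS)) * E r -
   be ^+ 2 * (lam2 gS rS - th) <= \sum_i house R r i ^+ 2 * e (f i).
  by move=> /negbTE r0; have := corr_t r al be; rewrite lamE r0.
apply: le_trans (ler_sum _ h); rewrite sumrB sumr_const cardC1 card_ord -mulr_sumr -/E2.
by rewrite -[X in _ <= _ - X]mulr_natl.
Qed.

Lemma block_E2 : m'%:R = 0 :> R -> E2 = 0.
Proof.
move=> /eqP; rewrite pnatr_eq0 => /eqP m0; rewrite /E2 big1// => r ne.
have h : (r <= 0)%N := leq_trans (ltn_ord r : (r <= m')%N) (eq_leq m0).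
by move: ne; rewrite -val_eqE /= -leqn0 h.
Qed.

Lemma block_dist : n%:R^-1 * \sum_i \sum_t corr P Sf encf (Xf t i) =
  (lam1 gX rX m / lam1 gS rS m) ^+ 2 * E1 + (lam2 gX rX / lam2 gS rS) ^+ 2 * E2.
Proof.
have hj := @proc_joint _ _ _ P l gX rX gZ rZ X Z hX hZ hXZ hiid gS rS hgS hrS n m _ (inj_comp iJ_inj fi).
pose eX (r : 'I_m) : R := if r == ord0 then m%:R * (rX * gX) else 0.
have lamX r : lam2 gX rX + eX r = if r == ord0 then lam1 gX rX m else lam2 gX rX.
  by rewrite /eX; case: ifP => _; rewrite ?lam1_eig ?addr0.
have z r : lam2 gS rS + eig r = 0 -> lam2 gX rX + eX r = 0.
  have ml : (m <= l)%N by have := leq_card _ (inj_comp iJ_inj fi); rewrite !card_ord.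
  by rewrite lamE lamX; case: ifP => _; [exact: hX0|exact: hX2].
have h t r : corr P Sf encf (dir Xf (house R r) t) = ((lam2 gX rX + eX r) / (lam2 gS rS + eig r)) ^+ 2 *
    corr P Sf encf (dir Sf (house R r) t).
  by apply: (corr_dirX gSf hj menc t (eigE r) (house_eigen (rX * gX) r) (z r)).
rewrite exchange_big/= (eq_bigr (fun t => \sum_r ((lam2 gX rX + eX r) / (lam2 gS rS + eig r)) ^+ 2 *
    corr P Sf encf (dir Sf (house R r) t))); last first.
  move=> t _; rewrite (corr_coordX gSf hj menc t (@house_parseval R m')); apply: eq_bigr => r _; exact: h.
rewrite nsum split0; congr (_ + _).
  by rewrite lamE lamX eqxx -mulr_sumr mulrCA.
rewrite mulr_sumr; apply: eq_bigr => r /negbTE r0.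
by rewrite lamE lamX r0 -mulr_sumr mulrCA.
Qed.

Lemma block_all : exists E1 E2 : R,
  [/\ forall a b, 0 < a -> 0 < b ->
  ln (1 + a * (lam1 gS rS m - th)) - a * (lam1 gS rS m - th) +
    (1 + a * (lam1 gS rS m - th)) * ((lam1 gS rS m - th) / lam1 gS rS m ^+ 2) * E1 +
  (m'%:R * (ln (1 + a * (lam2 gS rS - th)) - a * (lam2 gS rS - th)) +
    (1 + a * (lam2 gS rS - th)) * ((lam2 gS rS - th) / lam2 gS rS ^+ 2) * E2) +
  ((m'%:R + 1) * (ln (1 + b * th) - b * th) + (1 + b * th) / th * (\sum_i block_noise (f i)))
  <= 2 / n%:R * \sum_i ln (M (iJ (f i)))%:R,
  forall al be, (2 * al * (th / lam1 gS rS m) - al ^+ 2 + 2 * al * be * ((lam1 gS rS m - th) / lam1 gS rS m)) * E1 -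
   be ^+ 2 * (lam1 gS rS m - th) <= (\sum_i block_noise (f i)) / (m'%:R + 1),
  forall al be, (2 * al * (th / lam2 gS rS) - al ^+ 2 + 2 * al * be * ((lam2 gS rS - th) / lam2 gS rS)) * E2 -
   m'%:R * (be ^+ 2 * (lam2 gS rS - th)) <= m'%:R * ((\sum_i block_noise (f i)) / (m'%:R + 1)),
  m'%:R = 0 :> R -> E2 = 0 &
  n%:R^-1 * (\sum_i \sum_t corr P (fun t i => src X Z t (iJ (f i))) (fun i => encK phi (iJ (f i))) (X (t : 'I_n) (iJ (f i)))) =
    (lam1 gX rX m / lam1 gS rS m) ^+ 2 * E1 + (lam2 gX rX / lam2 gS rS) ^+ 2 * E2].
Proof.
exists E1, E2; split; [exact: block_rate|exact: block_cor1|exact: block_cor2|exact: block_E2|exact: block_dist].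
Qed.

End Block.

(** * Eigenvalues, distortion functions and the test-channel noise *)

Section Params.
Variables (R : realType) (l : nat) (hl : (2 <= l)%N).

Lemma psd_lam2 (g r : R) : psd (eqcov l g r) -> 0 <= lam2 g r.
Proof.
move=> h; have l0 : (0 < l)%N by apply: leq_trans hl.
pose i0 := Ordinal l0; pose i1 := Ordinal hl.
have := h (\col_i ((i == i0)%:R - (i == i1)%:R)).
rewrite -mulmxA mxE; under eq_bigr do rewrite !mxE.
have -> : \sum_i ((i == i0)%:R - (i == i1)%:R) * \sum_j eqcov l g r i j * (\col_i0 ((i0 == Ordinal l0)%:R - (i0 == i1)%:R)) j ord0 =
   \sum_i \sum_j ((i == i0)%:R - (i == i1)%:R) * ((j == i0)%:R - (j == i1)%:R) * eqcov l g r i j :> R.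
  by apply: eq_bigr => i _; rewrite mulr_sumr; apply: eq_bigr => j _; rewrite !mxE; ring.
rewrite (qformE g r (fun i : 'I_l => (i == i0)%:R - (i == i1)%:R)) /qform.
have -> : \sum_(i < l) ((i == i0)%:R - (i == i1)%:R) = 0 :> R.
  have s1 i' : \sum_(i < l) (i == i')%:R = 1 :> R.
    by rewrite (bigD1 i')//= eqxx big1 ?addr0// => i /negbTE ->.
  by rewrite sumrB !s1 subrr.
have -> : \sum_(i < l) ((i == i0)%:R - (i == i1)%:R) ^+ 2 = 2 :> R.
  rewrite (bigD1 i0)//= (bigD1 i1)//= big1 => [|i /andP[/negbTE -> /negbTE ->]]; last by rewrite subrr expr0n.
  by rewrite subr0 sub0r sqrrN !expr1n addr0.
by rewrite expr0n mulr0 addr0 pmulr_lge0.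
Qed.

(** The all-ones vector settles m = l; since [lam1 g r m] is affine in m and equals [lam2 g r] at m
    = 0, the other values interpolate two nonnegative numbers. *)
Lemma psd_lam1 (g r : R) m : psd (eqcov l g r) -> (m <= l)%N -> 0 <= lam1 g r m.
Proof.
move=> h ml; have h2 := psd_lam2 h.
have l0 : (0 < l)%N by apply: leq_trans hl.
have hl1 : 0 <= lam1 g r l.
  have := h (const_mx 1); rewrite -mulmxA mxE; under eq_bigr do rewrite !mxE.
  have -> : \sum_j 1 * (\sum_j0 eqcov l g r j j0 * (const_mx 1 : 'cV[R]_l) j0 ord0) =
     \sum_i \sum_j 1 * 1 * eqcov l g r i j :> R.
    by apply: eq_bigr => i _; rewrite mul1r; apply: eq_bigr => j _; rewrite !mxE mulr1 !mul1r.
  rewrite (qformE g r (fun=> 1)) /qform; under eq_bigr do rewrite expr1n.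
  rewrite sumr_const card_ord.
  have -> : lam2 g r * l%:R + r * g * l%:R ^+ 2 = lam1 g r l * l%:R by rewrite /lam1 /lam2; ring.
  by rewrite pmulr_lge0 ?ltr0n.
have -> : lam1 g r m = ((l - m)%:R * lam2 g r + m%:R * lam1 g r l) / l%:R.
  by rewrite natrB// /lam1 /lam2; field; rewrite pnatr_eq0 -lt0n.
by rewrite divr_ge0// addr_ge0// mulr_ge0.
Qed.

Lemma lam_mean (g r : R) m : lam1 g r m + (m%:R - 1) * lam2 g r = m%:R * g.
Proof. by rewrite /lam1 /lam2; ring. Qed.

(** Clearing denominators gives [c * q ^+ 2 + s * q - t = 0], and the upper bound on c says t > 0,
    so the larger root is positive. A vanishing pole has a vanishing numerator and leaves a linear
    equation. *)
Lemma two_poles (A B a b c : R) : 0 <= A -> 0 <= B -> 0 <= a -> 0 <= b -> (a = 0 -> A = 0) -> (b = 0 -> B = 0) ->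
  0 < c < A / a + B / b -> exists2 q, 0 < q & A / (a + q) + B / (b + q) = c.
Proof.
move=> A0 B0 a0 b0 aA bB /andP[c0 cc].
have lin (D d : R) : 0 <= D -> 0 <= d -> c < D / d -> exists2 q, 0 < q & D / (d + q) = c.
  move=> D0 d0 h; have d0' : 0 < d.
    by rewrite lt_neqAle d0 andbT; apply: contraTneq h => <-; rewrite invr0 mulr0 -leNgt ltW.
  have D0' : 0 < D by have := lt_trans c0 h; rewrite pmulr_lgt0 ?invr_gt0.
  exists (D / c - d); first by rewrite subr_gt0 ltr_pdivlMr// mulrC -ltr_pdivlMr.
  by rewrite addrC subrK invfM invrK mulrA divff ?mul1r// gt_eqF.
have [a00|a00] := eqVneq a 0.
  have [q q0 e] := lin B b B0 b0 ltac:(by move: cc; rewrite aA// mul0r add0r).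
  by exists q => //; rewrite aA// mul0r add0r.
have [b00|b00] := eqVneq b 0.
  have [q q0 e] := lin A a A0 a0 ltac:(by move: cc; rewrite bB// mul0r addr0).
  by exists q => //; rewrite bB// mul0r addr0.
have ap : 0 < a by rewrite lt_neqAle eq_sym a00.
have bp : 0 < b by rewrite lt_neqAle eq_sym b00.
pose s := c * (a + b) - A - B; pose t := A * b + B * a - c * a * b.
have t0 : 0 < t.
  rewrite subr_gt0 -ltr_pdivlMr// -ltr_pdivlMr//; rewrite (_ : (_ + _) / _ / _ = A / a + B / b)//.
  by field; rewrite a00 b00.
pose D := s ^+ 2 + 4 * c * t.
have D0 : s ^+ 2 < D by rewrite ltrDl !mulr_gt0.
have D00 : 0 <= D by rewrite (le_trans _ (ltW D0))// sqr_ge0.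
have sD : s < Num.sqrt D.
  by rewrite (le_lt_trans (ler_norm _))// -sqrtr_sqr ltr_sqrt// (le_lt_trans _ D0)// sqr_ge0.
pose q := (Num.sqrt D - s) / (2 * c).
have q0 : 0 < q by rewrite divr_gt0 ?subr_gt0// mulr_gt0.
exists q => //; have qq : c * q ^+ 2 + s * q - t = 0.
  have := sqr_sqrtr D00; rewrite /q; move: (Num.sqrt D) => y; rewrite /D => hy.
  rewrite (_ : t = (y ^+ 2 - s ^+ 2) / (4 * c)); last by rewrite hy; field; rewrite gt_eqF.
  by field; rewrite gt_eqF.
have aq : a + q != 0 by rewrite gt_eqF// addr_gt0.
have bq : b + q != 0 by rewrite gt_eqF// addr_gt0.
apply/eqP; rewrite -subr_eq0; apply/eqP; transitivity (- (c * q ^+ 2 + s * q - t) / ((a + q) * (b + q))).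
  by rewrite /s /t; field; rewrite aq bq.
by rewrite qq oppr0 mul0r.
Qed.

Variables (gX rX gZ rZ gS rS : R).
Hypotheses (psdX : psd (eqcov l gX rX)) (psdZ : psd (eqcov l gZ rZ)).
Hypotheses (hgS : gS = gX + gZ) (hrS : rS * gS = rX * gX + rZ * gZ) (hgX : 0 < gX).

Lemma lam1S m : lam1 gS rS m = lam1 gX rX m + lam1 gZ rZ m.
Proof. by rewrite -!lam1_eig (lam2S hgS hrS) hrS; ring. Qed.

Lemma lamX0 (x y s : R) : s = x + y -> 0 <= x -> 0 <= y -> s = 0 -> x = 0.
Proof. by move=> -> x0 y0 e; apply/eqP; rewrite eq_le x0 andbT -e lerDl. Qed.

(** With s = x + z, the fraction [x * (z + q) / (s + q)] is [x - x ^+ 2 / (s + q)]: prior variance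
    minus the energy of the linear estimate. *)
Lemma dfunE m q : (0 < m <= l)%N -> 0 < q -> dfun gX rX gZ rZ gS rS m q =
  gX - (lam1 gX rX m ^+ 2 / m%:R / (lam1 gS rS m + q) + (m%:R - 1) * lam2 gX rX ^+ 2 / m%:R / (lam2 gS rS + q)).
Proof.
move=> /andP[m0 ml] q0; rewrite /dfun.
have z1 : 0 <= lam1 gX rX m by exact: psd_lam1.
have z2 : 0 <= lam1 gZ rZ m by exact: psd_lam1.
have z3 := psd_lam2 psdX; have z4 := psd_lam2 psdZ.
have m0' : m%:R != 0 :> R by rewrite pnatr_eq0 -lt0n.
have gE : gX = (lam1 gX rX m + (m%:R - 1) * lam2 gX rX) / m%:R by rewrite lam_mean mulrAC divff ?mul1r.
rewrite [X in _ = X - _]gE.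
have p1 : lam1 gX rX m + lam1 gZ rZ m + q != 0 by rewrite gt_eqF// ltr_wpDl// addr_ge0.
have p2 : lam2 gX rX + lam2 gZ rZ + q != 0 by rewrite gt_eqF// ltr_wpDl// addr_ge0.
by rewrite lam1S (lam2S hgS hrS); field; rewrite m0' p1 p2.
Qed.

(** The expression for [dfun] read at q = 0. A vanishing source eigenvalue forces a vanishing signal
    eigenvalue, so with 0^-1 = 0 both branches of the definition take the same form. *)
Lemma dminE m : (0 < m <= l)%N -> dmin gX rX gZ rZ gS rS m =
  gX - (lam1 gX rX m ^+ 2 / m%:R / lam1 gS rS m + (m%:R - 1) * lam2 gX rX ^+ 2 / m%:R / lam2 gS rS).
Proof.
move=> /andP[m0 ml].
have z1 : 0 <= lam1 gX rX m by exact: psd_lam1.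
have z2 : 0 <= lam1 gZ rZ m by exact: psd_lam1.
have z3 := psd_lam2 psdX; have z4 := psd_lam2 psdZ.
have m0' : m%:R != 0 :> R by rewrite pnatr_eq0 -lt0n.
have gen (x y s : R) : s = x + y -> 0 <= x -> 0 <= y -> (if s == 0 then 0 else x * y / s) = x - x ^+ 2 / s.
  move=> e x0 y0; case: eqP => [s0|/eqP s0]; last by rewrite [in LHS](_ : y = s - x) ?e; [field; rewrite -e|rewrite addrC addKr].
  by rewrite s0 invr0 mulr0 subr0 (lamX0 e).
rewrite /dmin /dmin1 /dmin2 (gen _ _ _ (lam1S m))// (gen _ _ _ (lam2S hgS hrS))//.
have gE : gX = (lam1 gX rX m + (m%:R - 1) * lam2 gX rX) / m%:R by rewrite lam_mean mulrAC divff ?mul1r.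
rewrite [X in _ = X - _]gE.
move: ((lam1 gS rS m)^-1) ((lam2 gS rS)^-1) => x y; by field.
Qed.

Lemma lamQ_spec k dk : (0 < k <= l)%N -> dmin gX rX gZ rZ gS rS k < dk < gX ->
  0 < lamQ gX rX gZ rZ gS rS k dk /\ dfun gX rX gZ rZ gS rS k (lamQ gX rX gZ rZ gS rS k dk) = dk.
Proof.
move=> hk /andP[d1 d2]; rewrite /lamQ; case: xgetP => [q _ []//|h].
have /andP[k0 kl] := hk.
have z1 : 0 <= lam1 gX rX k by exact: psd_lam1.
have z2 : 0 <= lam1 gZ rZ k by exact: psd_lam1.
have z3 := psd_lam2 psdX; have z4 := psd_lam2 psdZ.
have k1 : 0 <= k%:R - 1 :> R by rewrite subr_ge0 ler1n.
have [|||||||q q0 e] := @two_poles (lam1 gX rX k ^+ 2 / k%:R) ((k%:R - 1) * lam2 gX rX ^+ 2 / k%:R)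
  (lam1 gS rS k) (lam2 gS rS) (gX - dk).
- by rewrite divr_ge0// sqr_ge0.
- by rewrite divr_ge0// mulr_ge0// sqr_ge0.
- by rewrite lam1S addr_ge0.
- by rewrite (lam2S hgS hrS) addr_ge0.
- by move=> /(lamX0 (lam1S k) z1 z2) ->; rewrite expr0n mul0r.
- by move=> /(lamX0 (lam2S hgS hrS) z3 z4) ->; rewrite expr0n mulr0 mul0r.
- by move: d1; rewrite dminE// subr_gt0 d2 /= !ltrBlDr => h1; rewrite addrC.
have := h q; case; split => //; rewrite dfunE// e; ring.
Qed.

Lemma rbarE k dk (q := lamQ gX rX gZ rZ gS rS k dk) : (0 < k <= l)%N -> 0 < q ->
  2 * k%:R * rbar gX rX gZ rZ gS rS k dk = ln (lam1 gS rS k + q) + (k%:R - 1) * ln (lam2 gS rS + q) - k%:R * ln q.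
Proof.
move=> /andP[k0 kl] q0; rewrite /rbar -/q mulrA divff ?mul1r; last by rewrite mulf_neq0// pnatr_eq0 -?lt0n.
have p1 : 0 < lam1 gS rS k + q by rewrite ltr_wpDl// lam1S addr_ge0// psd_lam1.
have p2 : 0 < lam2 gS rS + q by rewrite ltr_wpDl// (lam2S hgS hrS) addr_ge0// psd_lam2.
rewrite lnM ?posrE ?mulr_gt0 ?exprn_gt0 ?invr_gt0 ?exprn_gt0//.
rewrite lnM ?posrE ?exprn_gt0// lnV ?posrE ?exprn_gt0// !lnXn//.
rewrite -(mulr_natl (ln (lam2 gS rS + q))) -(mulr_natl (ln q)).
by rewrite -[in RHS](prednK k0) -natr1 addrK natr1 prednK.
Qed.

End Params.

Lemma le_eps (R : realFieldType) (a b c e0 : R) : 0 <= c -> 0 < e0 -> (forall e, 0 < e < e0 -> a <= b + c * e) -> a <= b.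
Proof.
move=> c0 e00 h; rewrite leNgt; apply/negP => ab.
have c1 : 0 < c + 1 by rewrite ltr_wpDl.
pose e := Num.min ((a - b) / (2 * (c + 1))) (e0 / 2).
have e1 : 0 < e by rewrite lt_min !divr_gt0 ?subr_gt0 ?mulr_gt0.
have e2 : e < e0 by rewrite gt_min; apply/orP; right; rewrite ltr_pdivrMr// ltr_pMr// ltr1n.
have := h e; rewrite e1 e2 => /(_ isT); apply/negP; rewrite -ltNge.
have h1 : e * (2 * (c + 1)) <= a - b by rewrite -ler_pdivlMr ?mulr_gt0// ge_min lexx.
have : c * e <= e * (c + 1) by rewrite mulrC ler_wpM2l ?ler_wpDr// ltW.
have : 0 < e * (c + 1) by rewrite mulr_gt0.
move: h1; rewrite mulrCA; move: (e * (c + 1)) => z; lra.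
Qed.

(** * Weights that combine the converse inequalities *)

Section Multipliers.
Variables (R : realType) (l1 l2 x1 x2 q th K1 : R).
Hypotheses (q0 : 0 < q) (th0 : 0 < th) (l1th : th <= l1) (l2th : th <= l2) (K10 : 0 <= K1).
Let u1 := l1 - th.
Let u2 := l2 - th.
Let D := x1 ^+ 2 / (l1 + q) ^+ 2 + K1 * (x2 ^+ 2 / (l2 + q) ^+ 2).
Let S := (K1 + 1) * th / q + u1 / (l1 + q) + K1 * (u2 / (l2 + q)).
Hypothesis D0 : 0 < D.
Hypothesis h1 : u1 * (l1 + q) * D <= x1 ^+ 2 * S.
Hypothesis h2 : K1 != 0 -> u2 * (l2 + q) * D <= x2 ^+ 2 * S.

(** The last two equations express Y1 and Y2 through V, and the normalisation
    [Y1 + K1 * Y2 = K1 + 1] then forces [V = S / ((th + q) * D)]. The hypotheses [h1] and [h2] are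
    the signs of Y1 and Y2. *)
Lemma multipliers_aux : exists V Y1 Y2, [/\ [/\ 0 <= V, 0 <= Y1 & 0 <= Y2], Y1 + K1 * Y2 = K1 + 1,
  V * (x1 / l1) ^+ 2 = (l1 + q) / ((th + q) * l1 ^+ 2) * (u1 + th / q * (l1 + q) * Y1) &
  K1 != 0 -> V * (x2 / l2) ^+ 2 = (l2 + q) / ((th + q) * l2 ^+ 2) * (u2 + th / q * (l2 + q) * Y2)].
Proof.
have l10 : 0 < l1 by exact: lt_le_trans l1th.
have l20 : 0 < l2 by exact: lt_le_trans l2th.
have p1 : 0 < l1 + q by rewrite addr_gt0.
have p2 : 0 < l2 + q by rewrite addr_gt0.
have tq : 0 < th + q by rewrite addr_gt0.
have S0 : 0 <= S.
  apply: addr_ge0; first apply: addr_ge0.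
  - by apply: divr_ge0; [apply: mulr_ge0; [exact: addr_ge0|exact: ltW]|exact: ltW].
  - by apply: divr_ge0; [rewrite subr_ge0|exact: ltW].
  - by apply: mulr_ge0 => //; apply: divr_ge0; [rewrite subr_ge0|exact: ltW].
pose y x l := q / (th * (l + q)) * (x ^+ 2 * S / (D * (l + q)) - (l - th)).
have y0 x l : 0 < l + q -> (l - th) * (l + q) * D <= x ^+ 2 * S -> 0 <= y x l.
  move=> pl h; rewrite mulr_ge0 ?divr_ge0 ?mulr_ge0 ?(ltW q0) ?(ltW th0) ?(ltW pl)//.
  by rewrite subr_ge0 ler_pdivlMr ?mulr_gt0// (mulrC D) mulrA.
(* For a single encoder the complement is trivial and no sign condition is at hand for it, so Y2 is
   set to 0. *)
exists (S / ((th + q) * D)), (y x1 l1), (if K1 == 0 then 0 else y x2 l2).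
have Dn : D != 0 by rewrite gt_eqF.
split.
- split; [by rewrite divr_ge0// mulr_ge0// ltW|exact: y0|case: ifPn => // k0; apply: y0 => //; exact: h2].
- have -> : K1 * (if K1 == 0 then 0 else y x2 l2) = K1 * y x2 l2 by case: eqP => [->|//]; rewrite !mul0r.
  transitivity (q / th * (S / D * (x1 ^+ 2 / (l1 + q) ^+ 2 + K1 * (x2 ^+ 2 / (l2 + q) ^+ 2)) -
      (u1 / (l1 + q) + K1 * (u2 / (l2 + q))))).
    by rewrite /y /u1 /u2; field; rewrite Dn !gt_eqF.
  by rewrite -/D divfK// /S; field; rewrite !gt_eqF.
- by rewrite /y /u1; field; rewrite Dn !gt_eqF.
- by move=> k0; rewrite (negbTE k0) /y /u2; field; rewrite Dn !gt_eqF.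
Qed.

End Multipliers.

(* Nonnegative weights of the correlation inequalities along the all-ones vector and its complement. *)
Definition multipliers (R : realType) (l1 l2 x1 x2 q th K1 : R) := exists V Y1 Y2,
  [/\ [/\ 0 <= V, 0 <= Y1 & 0 <= Y2], Y1 + K1 * Y2 = K1 + 1,
  V * (x1 / l1) ^+ 2 = (l1 + q) / ((th + q) * l1 ^+ 2) * (l1 - th + th / q * (l1 + q) * Y1) &
  K1 != 0 -> V * (x2 / l2) ^+ 2 = (l2 + q) / ((th + q) * l2 ^+ 2) * (l2 - th + th / q * (l2 + q) * Y2)].

Section MultipliersConditions.
Variables (R : realType) (l1 l2 x1 x2 q K1 : R).
Hypotheses (q0 : 0 < q) (l10 : 0 <= l1) (l20 : 0 <= l2) (x10 : 0 <= x1) (x20 : 0 <= x2) (K10 : 0 <= K1).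
Hypothesis xx : 0 < x1 + K1 * x2.

Let p1 : 0 < l1 + q. Proof. by rewrite ltr_wpDl. Qed.
Let p2 : 0 < l2 + q. Proof. by rewrite ltr_wpDl. Qed.

Let D0 : 0 < x1 ^+ 2 / (l1 + q) ^+ 2 + K1 * (x2 ^+ 2 / (l2 + q) ^+ 2).
Proof.
have [e|e] := eqVneq x1 0.
  move: xx; rewrite e expr0n !mul0r !add0r => h.
  have K0 : 0 < K1 by rewrite lt_neqAle K10 andbT; apply: contraTneq h => <-; rewrite mul0r ltxx.
  by move: h; rewrite pmulr_rgt0// => h; rewrite mulr_gt0// divr_gt0// exprn_gt0.
have h1 : 0 < x1 ^+ 2 / (l1 + q) ^+ 2 by rewrite divr_gt0 ?exprn_gt0// lt_neqAle eq_sym e.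
by rewrite ltr_pwDl// mulr_ge0// divr_ge0 ?sqr_ge0.
Qed.

Lemma multipliers_of th : 0 < th -> th <= l1 -> th <= l2 ->
  0 <= x1 ^+ 2 * ((K1 + 1) * th / q + K1 * (l2 - th) / (l2 + q)) - K1 * (l1 - th) * (l1 + q) * x2 ^+ 2 / (l2 + q) ^+ 2 ->
  0 <= x2 ^+ 2 * ((K1 + 1) * th / q + (l1 - th) / (l1 + q)) - (l2 - th) * (l2 + q) * x1 ^+ 2 / (l1 + q) ^+ 2 ->
  multipliers l1 l2 x1 x2 q th K1.
Proof.
move=> t0 t1 t2 c1 c2; apply: multipliers_aux => //.
  rewrite -subr_ge0; apply: le_trans c1 _; apply: le_of_eq; field.
  by rewrite !gt_eqF.
move=> _; rewrite -subr_ge0; apply: le_trans c2 _; apply: le_of_eq; field.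
by rewrite !gt_eqF.
Qed.

Let shrinkE a : 0 <= a -> shrink a q = a * q / (a + q).
Proof. by move=> a0; rewrite /shrink; field; rewrite gt_eqF// ltr_wpDl. Qed.

(** At th = l2 nothing of Y is left in the complement, so Y2 is nonnegative at once; the sign of Y1
    is condition i) up to the factor [l2 * q]. *)
Lemma multipliers_i (mu := shrink l2 q / shrink l1 q) : 0 < l2 -> l2 <= l1 ->
  0 <= K1 * x2 ^+ 2 * l1 ^+ 2 * mu * (mu - 1) + (K1 + 1) * x1 ^+ 2 * l2 ^+ 2 ->
  multipliers l1 l2 x1 x2 q l2 K1.
Proof.
rewrite /mu !shrinkE// => l2p l21 c; have l1p : 0 < l1 by exact: lt_le_trans l21.
apply: multipliers_of => //; last first.
  rewrite subrr !mul0r subr0; apply: mulr_ge0; first exact: sqr_ge0.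
  apply: addr_ge0; apply: divr_ge0; rewrite ?subr_ge0 ?(ltW p1) ?(ltW q0)//.
  by apply: mulr_ge0; rewrite ?addr_ge0.
rewrite -(pmulr_rge0 _ (mulr_gt0 l2p q0)); apply: le_trans c _.
apply: le_of_eq; field.
by rewrite !gt_eqF.
Qed.

(** Mirror image of the preceding choice: at th = l1 the sign of Y1 is clear and that of Y2 is
    condition ii) up to the factor [l1 * q]. *)
Lemma multipliers_ii (nu := shrink l1 q / shrink l2 q) : 0 < l1 -> l1 <= l2 ->
  0 <= x1 ^+ 2 * l2 ^+ 2 * nu * (nu - 1) + (K1 + 1) * x2 ^+ 2 * l1 ^+ 2 ->
  multipliers l1 l2 x1 x2 q l1 K1.
Proof.
rewrite /nu !shrinkE// => l1p l12 c; have l2p : 0 < l2 by exact: lt_le_trans l12.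
apply: multipliers_of => //.
  rewrite subrr !(mul0r, mulr0) subr0; apply: mulr_ge0; first exact: sqr_ge0.
  apply: addr_ge0.
    by apply: divr_ge0; [apply: mulr_ge0; [exact: addr_ge0|by []]|exact: ltW].
  by apply: divr_ge0; [apply: mulr_ge0; [by []|rewrite subr_ge0]|exact: ltW].
rewrite -(pmulr_rge0 _ (mulr_gt0 l1p q0)); apply: le_trans c _.
apply: le_of_eq; field.
by rewrite !gt_eqF.
Qed.

(** Here th = lj lies below both eigenvalues and both signs are at stake. The two inequalities of
    (b) are these signs multiplied by the explicit positive factors F. *)
Lemma multipliers_b lj (nu := shrink l1 q / shrink l2 q) (nuj := shrink lj q / shrink l2 q) :
  0 < lj -> lj <= l1 -> l1 <= l2 ->
  0 <= (nuj + K1) * x1 ^+ 2 * l2 ^+ 2 * nu ^+ 2 + K1 * (nuj - nu) * x2 ^+ 2 * l1 ^+ 2 ->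
  0 <= (nuj - 1) * x1 ^+ 2 * l2 ^+ 2 * nu ^+ 2 + (K1 * nuj + nu) * x2 ^+ 2 * l1 ^+ 2 ->
  multipliers l1 l2 x1 x2 q lj K1.
Proof.
move=> ljp lj1 l12; rewrite /nu /nuj !shrinkE ?(ltW ljp)// => c1 c2.
have l1p : 0 < l1 by exact: lt_le_trans lj1.
have l2p : 0 < l2 by exact: lt_le_trans l12.
have pj : 0 < lj + q by rewrite addr_gt0.
apply: multipliers_of => //; first exact: le_trans l12.
  have F : 0 < q * (l2 + q) ^+ 3 * l1 ^+ 2 / ((l1 + q) ^+ 2 * l2 * (lj + q)).
    by rewrite divr_gt0 ?mulr_gt0 ?exprn_gt0.
  rewrite -(pmulr_rge0 _ F); apply: le_trans c1 _.
  apply: le_of_eq; field.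
  by rewrite !gt_eqF.
have F : 0 < q * (l2 + q) * l1 ^+ 2 / (l2 * (lj + q)) by rewrite divr_gt0 ?mulr_gt0 ?exprn_gt0.
rewrite -(pmulr_rge0 _ F); apply: le_trans c2 _.
apply: le_of_eq; field.
by rewrite !gt_eqF.
Qed.

(** For th = 0 the terms with Y1 and Y2 vanish, and both are set to 1. The direction with zero
    eigenvalue carries no signal and gives 0 = 0, so V is solved from the other direction, whose
    signal eigenvalue is nonzero by [xx]. *)
Lemma multipliers_0 : l1 = 0 \/ l2 = 0 -> (l1 = 0 -> x1 = 0) -> (l2 = 0 -> x2 = 0) ->
  multipliers l1 l2 x1 x2 q 0 K1.
Proof.
move=> h e1 e2.
have gen l x : 0 <= l -> l != 0 -> x != 0 -> (l + q) * l / (q * x ^+ 2) * (x / l) ^+ 2 =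
    (l + q) / ((0 + q) * l ^+ 2) * (l - 0 + 0 / q * (l + q) * 1).
  by move=> h0 hl hx; field; rewrite hl hx gt_eqF.
have gen0 V l x : x = 0 -> l = 0 -> V * (x / l) ^+ 2 = (l + q) / ((0 + q) * l ^+ 2) * (l - 0 + 0 / q * (l + q) * 1).
  by move=> -> ->; rewrite mul0r expr0n !(mulr0, mul0r, subr0, addr0).
have V0 l x : 0 <= l -> 0 <= (l + q) * l / (q * x ^+ 2).
  by move=> h0; apply: divr_ge0; apply: mulr_ge0; rewrite ?addr_ge0 ?sqr_ge0 ?(ltW q0).
have [l1z|l1z] := eqVneq l1 0.
  have x2z : x2 != 0 by apply: contraTneq xx => ->; rewrite e1// mulr0 addr0 ltxx.
  exists ((l2 + q) * l2 / (q * x2 ^+ 2)), 1, 1; split.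
  - by split; [exact: V0|exact: ler01|exact: ler01].
  - by rewrite mulr1 addrC.
  - by apply: gen0 => //; exact: e1.
  - by move=> _; apply: gen => //; apply: contra x2z => /eqP /e2 ->.
have l2z : l2 = 0 by case: h => // h; rewrite h eqxx in l1z.
have x1z : x1 != 0 by apply: contraTneq xx => ->; rewrite e2// mulr0 addr0 ltxx.
exists ((l1 + q) * l1 / (q * x1 ^+ 2)), 1, 1; split.
- by split; [exact: V0|exact: ler01|exact: ler01].
- by rewrite mulr1 addrC.
- exact: gen.
- by move=> _; apply: gen0 => //; exact: e2.
Qed.

End MultipliersConditions.

(** * Converse for the rate and for the distortions *)

Section Converse.
Context {R : realType} {dT : measure_display} {Omega : measurableType dT}.
Variables (P : probability Omega R) (l : nat) (hl : (2 <= l)%N) (gX rX gZ rZ gS rS : R).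
Hypotheses (psdX : psd (eqcov l gX rX)) (psdZ : psd (eqcov l gZ rZ)).
Hypotheses (hgS : gS = gX + gZ) (hrS : rS * gS = rX * gX + rZ * gZ) (hgX : 0 < gX).
Variables (X Z : nat -> 'I_l -> Omega -> R).
Hypothesis hX : forall t, gaussian_vec P (X t) (eqcov l gX rX).
Hypothesis hZ : forall t, gaussian_vec P (Z t) (eqcov l gZ rZ).
Hypothesis hXZ : indep_signal_noise P X Z.
Hypothesis hiid : indep_times P X Z.

Let mX t i : measurable_fun setT (X t i). Proof. by have [] := hX t. Qed.
Let mZ t i : measurable_fun setT (Z t i). Proof. by have [] := hZ t. Qed.

Lemma gaussX t i : L1 P (fun w => X t i w ^+ 2) /\ mean P (fun w => X t i w ^+ 2) = gX.
Proof.
have g : gfam P (fun (u : 'I_t.+1) i => X u i) (lam2 gX rX) (rX * gX).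
  move=> a; have := proc_gauss hX hZ hXZ hiid a (fun=> 0).
  rewrite (_ : (fun w => _) = (fun w => \sum_p a p * X p.1 p.2 w)); last first.
    by apply/funext => w; rewrite [X in _ + X]big1 ?addr0// => p _; rewrite mul0r.
  congr (gauss1 P _ _); apply: eq_bigr => u _; rewrite -[RHS]addr0; congr (_ + _).
  have z2 : \sum_(i < l) (0 : R) ^+ 2 = 0 by rewrite big1// => j _; rewrite expr0n.
  by rewrite /qAB z2 big1_eq expr0n/= !mulr0 addr0.
have [h ->] := gauss1_sq (gfam1 g ord_max i); split=> //.
by rewrite /lam2; ring.
Qed.

Variables (k' : nat) (r : R) (d : nat -> R).
Let k := k'.+1.
Hypothesis kl : (k <= l)%N.
Hypothesis hRD : RD P X Z k r d.

Lemma RD_elim eps : 0 < eps -> exists (n : nat) (M : 'I_l -> nat) (phi : forall i : 'I_l, ('I_n -> R) -> 'I_(M i)),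
  [/\ (0 < n)%N, forall i c, borelRn (phi i @^-1` [set c]),
   forall f : 'I_k -> 'I_l, injective f -> 2 / n%:R * \sum_i ln (M (f i))%:R <= 2 * k%:R * (r + eps) &
   forall m (f : 'I_m -> 'I_l), (k <= m)%N -> injective f ->
     m%:R * gX - m%:R * (d m + eps) <= n%:R^-1 * \sum_(i < m) \sum_(t < n)
       corr P (fun (t : 'I_n) i => src X Z t (f i)) (fun i => encK phi (f i)) (X t (f i))].
Proof.
move=> e0; have [n [M [phi [n0 [mphi [hr hd]]]]]] := hRD e0.
exists n, M, phi; have n0' : n%:R != 0 :> R by rewrite pnatr_eq0 -lt0n.
split=> // [f fi|m f km fi].
  have := hr [set f i | i : 'I_k]; rewrite card_imset_ord// => /(_ erefl).
  rewrite (sum_image fi (fun i => ln (M i)%:R)) => h.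
  rewrite (_ : 2 / n%:R * _ = 2 * k%:R * ((k * n)%:R^-1 * \sum_i ln (M (f i))%:R)).
    by rewrite ler_wpM2l// mulr_ge0.
  by rewrite natrM; field; rewrite n0' pnatr_eq0.
have := hd [set f i | i : 'I_m]; rewrite card_imset_ord// => /(_ km).
have m0 : (0 < m)%N by exact: leq_trans km.
have m0' : m%:R != 0 :> R by rewrite pnatr_eq0 -lt0n.
pose c i t := corr P (fun (t : 'I_n) i => src X Z t (f i)) (fun i => encK phi (f i)) (X t i).
rewrite (_ : (\sum_(i in _) _)%E = (\sum_(i in [set f i | i : 'I_m]) \sum_(t < n) (gX - c i t))%:E); last first.
  rewrite -sumEFin; apply: eq_bigr => i _; rewrite -sumEFin; apply: eq_bigr => t _.
  by rewrite (mse_corr mX mZ (fun t i => (gaussX t i).1) mphi f) (gaussX _ _).2.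
rewrite -EFinM lee_fin (sum_image fi (fun i => \sum_(t < n) (gX - c i t))).
have gen (c' : 'I_m -> 'I_n -> R) : \sum_i \sum_t (gX - c' i t) = m%:R * n%:R * gX - \sum_i \sum_t c' i t.
  rewrite (eq_bigr (fun i => n%:R * gX - \sum_t c' i t)) => [|i _].
    by rewrite sumrB sumr_const card_ord -(mulr_natl (_ * gX)) mulrA.
  by rewrite sumrB sumr_const card_ord mulr_natl.
rewrite (gen (fun i t => c (f i) t)) natrM => h.
have {h} := ler_wpM2l (ler0n R m) h; rewrite -/c; move: (\sum_i _) => s h.
rewrite -subr_ge0 in h; rewrite -subr_ge0; apply: le_trans h _.
by apply: le_of_eq; field; rewrite m0' n0'.
Qed.

Let lX1 m : (m <= l)%N -> 0 <= lam1 gX rX m. Proof. exact: psd_lam1. Qed.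
Let lZ1 m : (m <= l)%N -> 0 <= lam1 gZ rZ m. Proof. exact: psd_lam1. Qed.
Let lX2 : 0 <= lam2 gX rX. Proof. exact: psd_lam2 hl _ _ psdX. Qed.
Let lZ2 : 0 <= lam2 gZ rZ. Proof. exact: psd_lam2 hl _ _ psdZ. Qed.
Let lS1 m : (m <= l)%N -> 0 <= lam1 gS rS m.
Proof. by move=> ml; rewrite (lam1S hgS hrS) addr_ge0 ?lX1 ?lZ1. Qed.
Let lS2 : 0 <= lam2 gS rS. Proof. by rewrite (lam2S hgS hrS) addr_ge0. Qed.
Let h10 m : (m <= l)%N -> lam1 gS rS m = 0 -> lam1 gX rX m = 0.
Proof. by move=> ml; apply: lamX0 (lam1S hgS hrS m) (lX1 ml) (lZ1 ml). Qed.
Let h20 : lam2 gS rS = 0 -> lam2 gX rX = 0.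
Proof. by apply: lamX0 (lam2S hgS hrS) lX2 lZ2. Qed.

Let b1 m := (lam1 gX rX m / lam1 gS rS m) ^+ 2.
Let b2 := (lam2 gX rX / lam2 gS rS) ^+ 2.

Let bl (x s : R) : (s = 0 -> x = 0) -> (x / s) ^+ 2 * s ^+ 2 = x ^+ 2.
Proof.
move=> h; have [e|e] := eqVneq s 0; first by rewrite (h e) mul0r expr0n mul0r.
by rewrite -exprMn divfK.
Qed.

(** One code yields one family e of noise energies, shared by the rate inequalities of all choices g
    of k encoders and the correlation inequalities of the whole block. The multiplier turns the
    tolerance in the distortion of k encoders into the slack [V * k * eps]. *)
Lemma converse_ineq j' (j := j'.+1) (q th V Y1 Y2 eps : R) : 0 < eps -> (k <= j)%N -> (j <= l)%N ->
  0 < q -> dfun gX rX gZ rZ gS rS k q = d k ->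
  0 <= th -> th <= lam1 gS rS j -> th <= lam1 gS rS k -> th <= lam2 gS rS ->
  0 <= V -> 0 <= Y1 -> 0 <= Y2 -> Y1 + k'%:R * Y2 = k'%:R + 1 ->
  V * b1 k = (lam1 gS rS k + q) / ((th + q) * lam1 gS rS k ^+ 2) * (lam1 gS rS k - th + th / q * (lam1 gS rS k + q) * Y1) ->
  (k'%:R != 0 :> R -> V * b2 = (lam2 gS rS + q) / ((th + q) * lam2 gS rS ^+ 2) * (lam2 gS rS - th + th / q * (lam2 gS rS + q) * Y2)) ->
  exists (e : 'I_j -> R) (E1 E2 : R),
  [/\ forall g : 'I_k -> 'I_j, injective g -> forall x, 0 < x <= 1 ->
    ln (lam1 gS rS k + q) + k'%:R * ln (lam2 gS rS + q) - (k'%:R + 1) * ln q - V * k%:R * eps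
      + (th != 0)%:R * ((x^-1 - 1) * ((th + q) / q) * ((\sum_i e (g i)) / th - (k'%:R + 1)) - (k'%:R + 1) * ln x)
      <= 2 * k%:R * (r + eps),
    forall al be, (2 * al * (th / lam1 gS rS j) - al ^+ 2 + 2 * al * be * ((lam1 gS rS j - th) / lam1 gS rS j)) * E1 -
      be ^+ 2 * (lam1 gS rS j - th) <= (\sum_i e i) / (j'%:R + 1),
    forall al be, (2 * al * (th / lam2 gS rS) - al ^+ 2 + 2 * al * be * ((lam2 gS rS - th) / lam2 gS rS)) * E2 -
      j'%:R * (be ^+ 2 * (lam2 gS rS - th)) <= j'%:R * ((\sum_i e i) / (j'%:R + 1)) &
    j%:R * gX - j%:R * (d j + eps) <= b1 j * E1 + b2 * E2].
Proof.
move=> e0 kj jl q0 hdk th0 t1 t1k t2 V0 Y10 Y20 YE HC1 HC2.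
have [n [M [phi [n0 mphi hr hd]]]] := RD_elim e0.
pose iJ := widen_ord jl; have iJ_inj : injective iJ by move=> x y /(congr1 val) /= /val_inj.
pose e := @block_noise _ _ _ P l gX X Z gS rS j' iJ n th M phi.
have blk m' f fi h := @block_all _ _ _ P l gX rX gZ rZ X Z hX hZ hXZ hiid gS rS hgS hrS hgX j' iJ iJ_inj n n0 th th0 t1 t2 h10 h20 M phi mphi m' f fi h.
have [F1 [F2 [_ c1 c2 _ dd]]] := blk j' id (@inj_id _) t1.
exists e, F1, F2; split; [|exact: c1|exact: c2|by rewrite -dd; exact: (hd _ iJ)].
move=> g gi x hx.
have [E1 [E2 [rt d1 d2 E20 dist]]] := blk k' g gi t1k.
have hr' := hr _ (inj_comp iJ_inj gi).
have rt' a b (a0 : 0 < a) (b0 : 0 < b) := le_trans (rt a b a0 b0) hr'.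
have := converse_algebra q0 th0 t1k t2 (ler0n R k') Y10 Y20 YE HC1 HC2 E20 rt' (fun _ => d1 _ _) (fun _ => d2 _ _) hx.
apply: le_trans; rewrite lerD2r lerD2l.
have := hd _ _ (leqnn k) (inj_comp iJ_inj gi); rewrite dist => hh.
have h3 : b1 k * (lam1 gS rS k ^+ 2 / (lam1 gS rS k + q)) + b2 * (k'%:R * (lam2 gS rS ^+ 2 / (lam2 gS rS + q))) = k%:R * gX - k%:R * d k.
  rewrite mulrA bl; last exact: h10.
  rewrite [b2 * _]mulrCA [b2 * _]mulrA bl// -hdk (dfunE hl psdX psdZ hgS hrS)//.
  have k0 : k%:R != 0 :> R by rewrite pnatr_eq0.
  have -> : k%:R - 1 = k'%:R :> R by rewrite -natr1 addrK.
  by move: ((lam1 gS rS k + q)^-1) ((lam2 gS rS + q)^-1) => x1 x2; field.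
rewrite -mulrA -mulrN; apply: ler_wpM2l => //.
rewrite -/(b1 k) -/b2 in hh.
have -> : b1 k * (E1 - lam1 gS rS k ^+ 2 / (lam1 gS rS k + q)) + b2 * (E2 - k'%:R * (lam2 gS rS ^+ 2 / (lam2 gS rS + q))) =
  b1 k * E1 + b2 * E2 - (k%:R * gX - k%:R * d k) by rewrite -h3; ring.
by rewrite -subr_ge0 in hh; rewrite -subr_ge0; apply: le_trans hh _; apply: le_of_eq; ring.
Qed.

Let gS0 : 0 <= gS.
Proof.
have h := lam_mean gS rS 1; rewrite subrr mul0r addr0 mul1r in h.
by rewrite -h lS1// (leq_trans _ kl).
Qed.

Let kE : k'%:R + 1 = k%:R :> R. Proof. by rewrite natr1. Qed.
Let k0 : 0 < k%:R :> R. Proof. by rewrite ltr0n. Qed.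

Let lam12_le m : rS <= 0 -> lam1 gS rS m <= lam2 gS rS.
Proof. by move=> r0; rewrite -lam1_eig gerDl mulr_ge0_le0// mulr_le0_ge0. Qed.
Let lam21_le m : 0 <= rS -> lam2 gS rS <= lam1 gS rS m.
Proof. by move=> r0; rewrite -lam1_eig lerDl mulr_ge0// mulr_ge0. Qed.

Let q := lamQ gX rX gZ rZ gS rS k (d k).
Hypothesis hd : dmin gX rX gZ rZ gS rS k < d k < gX.
Let kk : (0 < k <= l)%N. Proof. by rewrite kl. Qed.
Let q0 : 0 < q. Proof. by have [] := lamQ_spec hl psdX psdZ hgS hrS kk hd. Qed.
Let hdk : dfun gX rX gZ rZ gS rS k q = d k. Proof. by have [] := lamQ_spec hl psdX psdZ hgS hrS kk hd. Qed.

Let x1 := lam1 gX rX k.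
Let x2 := lam2 gX rX.
Let l1 := lam1 gS rS k.
Let l2 := lam2 gS rS.
Let xx : x1 + k'%:R * x2 = k%:R * gX.
Proof. by rewrite -(lam_mean gX rX k) -natr1 addrK. Qed.

Let k1E : k%:R - 1 = k'%:R :> R. Proof. by rewrite -kE addrK. Qed.
Let xx0 : 0 < x1 + k'%:R * x2. Proof. by rewrite xx mulr_gt0. Qed.
Let l10 : 0 <= l1. Proof. exact: lS1. Qed.
Let x10 : 0 <= x1. Proof. exact: lX1. Qed.

Let Rb := ln (l1 + q) + k'%:R * ln (l2 + q) - (k'%:R + 1) * ln q.
Let RbE : 2 * k%:R * rbar gX rX gZ rZ gS rS k (d k) = Rb.
Proof. by rewrite (rbarE hl psdX psdZ hgS hrS kk q0) k1E /Rb kE. Qed.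

Lemma converse_rate :
  cond_i gX rX gZ rZ gS rS k (d k) \/ cond_ii gX rX gZ rZ gS rS k (d k) -> rbar gX rX gZ rZ gS rS k (d k) <= r.
Proof.
move=> hc.
suff [th [t0 t1 t2 [V [Y1 [Y2 [[V0 Y10 Y20] YE H1 H2]]]]]] : exists th, [/\ 0 <= th, th <= l1, th <= l2 & multipliers l1 l2 x1 x2 q th k'%:R].
  have k2 : 0 < 2 * k%:R :> R by rewrite mulr_gt0.
  rewrite -(ler_pM2l k2) RbE; apply: (@le_eps _ _ _ (2 * k%:R + V * k%:R) 1) => //.
    by rewrite addr_ge0 ?mulr_ge0.
  move=> e /andP[e0 _].
  have [en [E1 [E2 [h _ _ _]]]] := converse_ineq e0 (leqnn k) kl q0 hdk t0 t1 t1 t2 V0 Y10 Y20 YE H1 H2.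
  (* At x = 1 the noise term vanishes and the bare rate bound remains. *)
  have := h id (@inj_id _) 1; rewrite ltr01 lexx => /(_ isT).
  rewrite invr1 subrr !mul0r ln1 mulr0 subr0 mulr0 addr0 -/Rb; lra.
have [h0|h0] := boolP ((l1 == 0) || (l2 == 0)).
  (* No positive th fits below a zero eigenvalue. *)
  exists 0; split=> //; apply: multipliers_0 => //; first by case/orP: h0 => /eqP; [left|right].
  exact: h10.
move: h0; rewrite negb_or => /andP[h1 h2].
have l1p : 0 < l1 by rewrite lt_neqAle eq_sym h1.
have l2p : 0 < l2 by rewrite lt_neqAle eq_sym h2.
case: hc => -[r0]; rewrite ?/mu_k ?/nu_k -/q ?k1E -?kE -/x1 -/x2 -/l1 -/l2 => c.
  exists l2; split=> //; first exact: lam21_le.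
  by apply: multipliers_i => //; exact: lam21_le.
exists l1; split=> //; first exact: lam12_le.
by apply: multipliers_ii => //; exact: lam12_le.
Qed.

Hypothesis rE : r = rbar gX rX gZ rZ gS rS k (d k).

(** Equality in the rate leaves no room for the noise term. This bounds the energies above on each
    window of k encoders, hence on average over all j; the correlation inequalities for j encoders,
    with the test-channel coefficients, then bound the energies of the source estimates and thereby
    [d j]. *)
Lemma converse_dist_gen j' (j := j'.+1) (th : R) : (k <= j)%N -> (j <= l)%N -> 0 < th -> th <= lam1 gS rS j ->
  th <= l1 -> th <= l2 -> multipliers l1 l2 x1 x2 q th k'%:R -> dfun gX rX gZ rZ gS rS j q <= d j.
Proof.
move=> kj jl t0 tj t1 t2 [V [Y1 [Y2 [[V0 Y10 Y20] YE H1 H2]]]].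
pose lj := lam1 gS rS j; pose xj := lam1 gX rX j; pose tau := th + q.
have tau0 : 0 < tau by rewrite addr_gt0.
have lj0 : 0 < lj by exact: lt_le_trans tj.
have l2p : 0 < l2 by exact: lt_le_trans t2.
have pj : 0 < lj + q by rewrite addr_gt0.
have p2 : 0 < l2 + q by rewrite addr_gt0.
have jn : j%:R != 0 :> R by rewrite pnatr_eq0.
have j0 : 0 < j%:R :> R by rewrite ltr0n.
have jE : j'%:R + 1 = j%:R :> R by rewrite natr1.
have j1E : j%:R - 1 = j'%:R :> R by rewrite -jE addrK.
pose be := th / tau.
pose G := xj ^+ 2 / (lj + q) ^+ 2 + j'%:R * (x2 ^+ 2 / (l2 + q) ^+ 2).
have G0 : 0 <= G.
  by apply: addr_ge0; [|apply: mulr_ge0 => //]; apply: divr_ge0; exact: sqr_ge0.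
rewrite (dfunE hl psdX psdZ hgS hrS)//.
rewrite j1E -/xj -/lj -/x2 -/l2.
suff main : j%:R * gX - j%:R * d j <= xj ^+ 2 / (lj + q) + j'%:R * (x2 ^+ 2 / (l2 + q)).
  rewrite -(ler_pM2l j0) -subr_ge0; rewrite -subr_ge0 in main; apply: le_trans main _.
  by apply: le_of_eq; field; rewrite jn !gt_eqF.
(* Two nested limits. The constant [C] below grows like 1/y, so the coding slack e has to vanish
   first at fixed y, and y = 1 - x afterwards. *)
apply: (@le_eps _ _ _ (G / be ^+ 2 * (th * q / tau)) 1) => //.
  by apply: mulr_ge0; apply: divr_ge0; rewrite ?sqr_ge0 ?mulr_ge0// ltW.
move=> y /andP[y0 y1]; pose x := 1 - y.
have x0 : 0 < x by rewrite subr_gt0.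
pose C := th * (2 * k%:R + V * k%:R) * (q * x / (tau * y)).
have C0 : 0 <= C.
  apply: mulr_ge0; first by apply: mulr_ge0; rewrite ?(ltW t0)// addr_ge0// mulr_ge0.
  by apply: divr_ge0; apply: mulr_ge0; exact: ltW.
apply: (@le_eps _ _ _ (G / be ^+ 2 * (C / k%:R) + j%:R) 1) => //.
  apply: addr_ge0 => //; apply: mulr_ge0; first by apply: divr_ge0; rewrite ?sqr_ge0.
  exact: divr_ge0.
move=> e /andP[e0 _].
have [en [E1 [E2 [h c1 c2 dd]]]] := converse_ineq e0 kj jl q0 hdk (ltW t0) tj t1 t2 V0 Y10 Y20 YE H1 H2.
have win (g : 'I_k -> 'I_j) : injective g -> \sum_i en (g i) <= k%:R * th * (1 - q * x / tau) + C * e.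
  move=> gi; have := h g gi x; rewrite x0 /= gerBl (ltW y0) => /(_ isT).
  rewrite (gt_eqF t0) mul1r -/Rb -/tau [2 * k%:R * (r + e)]mulrDr rE RbE kE.
  (* The gain [- ln x >= y] is of first order in y, the same order as the factor of the energy
     excess; dividing by y is what yields a bound on the energies. *)
  have lnx : ln x <= - y by have := @le_ln1Dx R (- y); rewrite ltrN2 y1; exact.
  move: (\sum_i en (g i)) => N hN.
  have F : 0 < th * (q * x / (tau * y)) by rewrite mulr_gt0// divr_gt0// mulr_gt0.
  have hy : x^-1 - 1 = y / x by rewrite /x; field; rewrite gt_eqF.
  rewrite hy in hN.
  have h2 : y / x * (tau / q) * (N / th - k%:R) <= (2 * k%:R + V * k%:R) * e - k%:R * y.
    have : k%:R * ln x <= - (k%:R * y) by rewrite -mulrN ler_wpM2l.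
    move: hN; rewrite -(mulrA V); lra.
  have := ler_wpM2l (ltW F) h2; rewrite -subr_ge0 => h3; rewrite -subr_ge0; apply: le_trans h3 _.
  apply: le_of_eq; rewrite /C; field.
  by rewrite !gt_eqF.
(* Windows are shifted cyclically by the addition of ['I_j], so each index is met exactly k times
   and the mean over windows is the mean over the block. *)
have NJ : (\sum_i en i) / j%:R <= th * (1 - q * x / tau) + C / k%:R * e.
  pose w (s : 'I_j) (i : 'I_k) : 'I_j := s + widen_ord kj i.
  have wi s : injective (w s) by move=> a b /addrI /(congr1 val) /= /val_inj.
  have : \sum_s \sum_i en (w s i) <= \sum_(s < j) (k%:R * th * (1 - q * x / tau) + C * e).
    by apply: ler_sum => s _; exact: win.
  have -> : \sum_s \sum_i en (w s i) = k%:R * \sum_i en i.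
    rewrite exchange_big/= (eq_bigr (fun=> \sum_i en i)) => [|i _]; last first.
      by rewrite (reindex_inj (@addIr _ (- widen_ord kj i)))/=; apply: eq_bigr => s _; rewrite /w subrK.
    by rewrite sumr_const card_ord mulr_natl.
  rewrite sumr_const card_ord -[X in _ <= X]mulr_natl => h3.
  have kj0 : 0 < j%:R * k%:R :> R by rewrite mulr_gt0.
  rewrite -(ler_pM2l kj0) -subr_ge0; rewrite -subr_ge0 in h3; apply: le_trans h3 _.
  by apply: le_of_eq; field; rewrite jn !gt_eqF.
pose al z := be * (z + q) / z.
have alE z : 0 < z -> 2 * al z * (th / z) - al z ^+ 2 + 2 * al z * be * ((z - th) / z) = al z ^+ 2.
  by move=> z0; rewrite /al /be /tau; field; rewrite !gt_eqF// addr_gt0.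
have := c1 (al lj) be; have := c2 (al l2) be; rewrite -/lj -/l2 !alE// jE => c2' c1'.
have be0 : 0 < be by rewrite divr_gt0.
set m := _ / _ in NJ c1' c2'.
have B1 : b1 j * E1 <= xj ^+ 2 / (be ^+ 2 * (lj + q) ^+ 2) * (m + be ^+ 2 * (lj - th)).
  have : al lj ^+ 2 * E1 <= m + be ^+ 2 * (lj - th) by rewrite -lerBlDr.
  have F : 0 <= xj ^+ 2 / (be ^+ 2 * (lj + q) ^+ 2).
    by apply: divr_ge0; [exact: sqr_ge0|apply: mulr_ge0; exact: sqr_ge0].
  move=> /(ler_wpM2l F); apply: le_trans; apply: le_of_eq.
  by rewrite /b1 -/xj -/lj /al; field; rewrite !gt_eqF.
have B2 : b2 * E2 <= x2 ^+ 2 / (be ^+ 2 * (l2 + q) ^+ 2) * (j'%:R * m + j'%:R * (be ^+ 2 * (l2 - th))).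
  have : al l2 ^+ 2 * E2 <= j'%:R * m + j'%:R * (be ^+ 2 * (l2 - th)) by rewrite -lerBlDr.
  have F : 0 <= x2 ^+ 2 / (be ^+ 2 * (l2 + q) ^+ 2).
    by apply: divr_ge0; [exact: sqr_ge0|apply: mulr_ge0; exact: sqr_ge0].
  move=> /(ler_wpM2l F); apply: le_trans; apply: le_of_eq.
  by rewrite /b2 -/x2 -/l2 /al; field; rewrite !gt_eqF.
have GE : xj ^+ 2 / (be ^+ 2 * (lj + q) ^+ 2) * (m + be ^+ 2 * (lj - th)) +
    x2 ^+ 2 / (be ^+ 2 * (l2 + q) ^+ 2) * (j'%:R * m + j'%:R * (be ^+ 2 * (l2 - th))) =
    G / be ^+ 2 * m + (xj ^+ 2 / (lj + q) ^+ 2 * (lj - th) + j'%:R * (x2 ^+ 2 / (l2 + q) ^+ 2 * (l2 - th))).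
  by rewrite /G; field; rewrite !gt_eqF.
have Gm : G / be ^+ 2 * m <= G / be ^+ 2 * (th * (1 - q * x / tau) + C / k%:R * e).
  by apply: ler_wpM2l => //; apply: divr_ge0; rewrite ?sqr_ge0.
have fin : G / be ^+ 2 * (th * (1 - q * x / tau)) +
   (xj ^+ 2 / (lj + q) ^+ 2 * (lj - th) + j'%:R * (x2 ^+ 2 / (l2 + q) ^+ 2 * (l2 - th))) =
   xj ^+ 2 / (lj + q) + j'%:R * (x2 ^+ 2 / (l2 + q)) + G / be ^+ 2 * (th * q / tau) * y.
  by rewrite /G /be /x /tau; field; rewrite !gt_eqF.
have := lerD B1 B2; rewrite GE => B12; have {B12}dd2 := le_trans dd B12.
move: dd2 Gm fin; rewrite [G / be ^+ 2 * (_ + _)]mulrDr (mulrA (G / be ^+ 2) (C / k%:R)).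
rewrite [(_ + j%:R) * e]mulrDl [j%:R * (_ + e)]mulrDr.
move: (G / be ^+ 2 * m) (G / be ^+ 2 * (th * _)) (G / be ^+ 2 * (C / k%:R) * e) (xj ^+ 2 / (lj + q) ^+ 2 * _ + _) (xj ^+ 2 / (lj + q) + _) (G / be ^+ 2 * _ * y) => z1 z2 z3 z4 z5 z6.
move: (j%:R * gX) (j%:R * d j) (j%:R * e) => z7 z8 z9; lra.
Qed.

End Converse.

(** * Achievability *)

Section FiniteIid.
Variables (R : realFieldType) (I Z : finType) (mu : I -> Z -> R).
Hypothesis mu0 : forall t x, 0 <= mu t x.
Hypothesis mu1 : forall t, \sum_x mu t x = 1.

Definition wprod (z : {ffun I -> Z}) : R := \prod_t mu t (z t).

Lemma wprod_ge0 z : 0 <= wprod z. Proof. by apply: prodr_ge0. Qed.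

Lemma sum_wprod : \sum_z wprod z = 1.
Proof. by rewrite /wprod -bigA_distr_bigA/= big1. Qed.

Lemma sum_wprodM (G : I -> Z -> R) : \sum_z wprod z * \prod_t G t (z t) = \prod_t \sum_x mu t x * G t x.
Proof.
by rewrite bigA_distr_bigA/=; apply: eq_bigr => z _; rewrite /wprod -big_split.
Qed.

Lemma wprod_var (G : I -> Z -> R) : (forall t, \sum_x mu t x * G t x = 0) ->
  \sum_z wprod z * (\sum_t G t (z t)) ^+ 2 = \sum_t \sum_x mu t x * G t x ^+ 2.
Proof.
move=> G0.
have F t t' : \sum_z wprod z * (G t (z t) * G t' (z t')) = if t' == t then \sum_x mu t x * G t x ^+ 2 else 0.
  transitivity (\sum_z wprod z * \prod_u ((if u == t then G u (z u) else 1) * (if u == t' then G u (z u) else 1))).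
    by apply: eq_bigr => z _; rewrite big_split/= !big_if_eq.
  rewrite (sum_wprodM (fun u x => (if u == t then G u x else 1) * (if u == t' then G u x else 1))).
  rewrite (bigD1 t)//= eqxx; case: ifPn => [/eqP ->|ne].
    rewrite eqxx [X in _ * X]big1 ?mulr1; last first.
      by move=> u ne; rewrite (negbTE ne) -[RHS](mu1 u); apply: eq_bigr => x _; rewrite !mulr1.
    by apply: eq_bigr => x _; rewrite expr2.
  rewrite eq_sym (negbTE ne) (eq_bigr (fun x => mu t x * G t x)) ?G0 ?mul0r// => x _.
  by rewrite mulr1.
transitivity (\sum_t \sum_t' \sum_z wprod z * (G t (z t) * G t' (z t'))).
  under eq_bigr do rewrite expr2 mulr_suml mulr_sumr.
  rewrite exchange_big/=; apply: eq_bigr => t _.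
  by under eq_bigr do rewrite mulr_sumr mulr_sumr; rewrite exchange_big/=.
apply: eq_bigr => t _; rewrite (bigD1 t)//= F eqxx [X in _ + X]big1 ?addr0// => t' ne.
by rewrite F (negbTE ne).
Qed.

(** Chebyshev's inequality, with [ga] the gap between the means and the level c. All later error
    terms are kept at this order, one over the block length. *)
Lemma wprod_tail (F : I -> Z -> R) (c ga V : R) : (0 < #|I|)%N -> 0 < ga ->
  (forall t, \sum_x mu t x * F t x <= c - ga) -> (forall t, \sum_x mu t x * F t x ^+ 2 <= V) ->
  \sum_z wprod z * (#|I|%:R * c < \sum_t F t (z t))%R%:R <= V / (#|I|%:R * ga ^+ 2).
Proof.
move=> n0 g0 hE hV; pose e t := \sum_x mu t x * F t x.
have nn : 0 < #|I|%:R :> R by rewrite ltr0n.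
have b z : (#|I|%:R * c < \sum_t F t (z t))%R%:R <= (\sum_t (F t (z t) - e t)) ^+ 2 / (#|I|%:R * ga) ^+ 2 :> R.
  case: ltP => h /=; last by rewrite mulr_ge0 ?sqr_ge0// invr_ge0 sqr_ge0.
  rewrite ler_pdivlMr ?exprn_gt0 ?mulr_gt0// mul1r ler_sqr ?nnegrE ?mulr_ge0 ?(ltW g0) ?(ltW nn)//.
    rewrite sumrB lerBrDr; apply: le_trans (ltW h); rewrite addrC -lerBrDr -mulrBr.
    by rewrite mulr_natl -sumr_const; apply: ler_sum => t _; exact: hE.
  rewrite sumrB subr_ge0; apply: le_trans (ltW h).
  rewrite mulr_natl -sumr_const; apply: ler_sum => t _; apply: le_trans (hE t) _.
  by rewrite gerBl ltW.
apply: (@le_trans _ _ (\sum_z wprod z * ((\sum_t (F t (z t) - e t)) ^+ 2 / (#|I|%:R * ga) ^+ 2))).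
  by apply: ler_sum => z _; rewrite ler_wpM2l ?wprod_ge0.
under eq_bigr do rewrite mulrA; rewrite -mulr_suml (wprod_var (G := fun t x => F t x - e t)); last first.
  move=> t; under eq_bigr do rewrite mulrBr.
  by rewrite sumrB -mulr_suml mu1 mul1r subrr.
have h : \sum_t \sum_x mu t x * (F t x - e t) ^+ 2 <= #|I|%:R * V.
  rewrite mulr_natl -sumr_const; apply: ler_sum => t _; apply: le_trans (hV t).
  rewrite -subr_ge0 -sumrB (_ : \sum_x _ = e t ^+ 2) ?sqr_ge0//.
  rewrite (eq_bigr (fun x => 2 * e t * (mu t x * F t x) - e t ^+ 2 * mu t x)) => [|x _]; last by ring.
  by rewrite sumrB -!mulr_sumr mu1 -/(e t); ring.
rewrite ler_pdivrMr ?exprn_gt0 ?mulr_gt0//; apply: le_trans h _.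
apply: le_of_eq; field.
by rewrite !gt_eqF.
Qed.

Lemma wprod_exists (F : {ffun I -> Z} -> R) c : \sum_z wprod z * F z <= c -> exists z, F z <= c.
Proof.
move=> h; apply: contrapT => /forallNP hn.
have hc z : c < F z by have := hn z; move/negP; rewrite -ltNge.
have : \sum_z wprod z * (F z - c) <= 0.
  by under eq_bigr do rewrite mulrBr; rewrite sumrB -mulr_suml sum_wprod mul1r subr_le0.
apply/negP; rewrite -ltNge.
have [z0 z0p] : exists z, 0 < wprod z.
  apply: contrapT => /forallNP h0; have := sum_wprod; rewrite big1 => [/eqP|z _].
    by rewrite eq_sym oner_eq0.
  by apply/eqP; rewrite eq_le wprod_ge0 andbT leNgt; apply/negP; exact: h0.
rewrite (bigD1 z0)//= ltr_pwDl ?mulr_gt0 ?subr_gt0//.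
by apply: sumr_ge0 => z _; rewrite mulr_ge0 ?wprod_ge0// subr_ge0 ltW.
Qed.

End FiniteIid.

Section Marginals.
Variables (R : realFieldType) (I Z : finType) (mu : I -> Z -> R).
Hypothesis mu1 : forall t, \sum_x mu t x = 1.

Lemma wprod_marg1 i (G : Z -> R) : \sum_z wprod mu z * G (z i) = \sum_x mu i x * G x.
Proof.
transitivity (\sum_z wprod mu z * \prod_j (if j == i then G (z j) else 1)).
  by apply: eq_bigr => z _; rewrite big_if_eq.
rewrite (sum_wprodM mu (fun j x => if j == i then G x else 1)) (bigD1 i)//= eqxx [X in _ * X]big1 ?mulr1// => j ne.
by rewrite (negbTE ne) -[RHS](mu1 j); apply: eq_bigr => x _; rewrite mulr1.
Qed.

Lemma wprod_marg2 i i' (F G : Z -> R) : i' != i ->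
  \sum_z wprod mu z * (F (z i) * G (z i')) = (\sum_x mu i x * F x) * (\sum_x mu i' x * G x).
Proof.
move=> ii.
transitivity (\sum_z wprod mu z * \prod_j ((if j == i then F (z j) else 1) * (if j == i' then G (z j) else 1))).
  by apply: eq_bigr => z _; rewrite big_split/= !big_if_eq.
rewrite (sum_wprodM mu (fun j x => (if j == i then F x else 1) * (if j == i' then G x else 1))).
rewrite (bigD1 i)//= (bigD1 i')//= eqxx (negbTE ii) eq_sym (negbTE ii) eqxx.
rewrite [X in _ * (_ * X)]big1 ?mulr1; last first.
  move=> j /andP[/negbTE -> /negbTE ->]; rewrite -[RHS](mu1 j).
  by apply: eq_bigr => x _; rewrite !mulr1.
by congr (_ * _); apply: eq_bigr => x _; rewrite ?mulr1 ?mul1r.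
Qed.

Lemma wprod_marg (K : finType) (e : K -> I) (G : {ffun K -> Z} -> R) : injective e ->
  \sum_z wprod mu z * G [ffun j => z (e j)] = \sum_y wprod (fun j => mu (e j)) y * G y.
Proof.
move=> ei.
(* The indicator that z restricts to y along e, written as a product over I so that its mean
   factorises. *)
pose g (y : {ffun K -> Z}) (i : I) (x : Z) : R := \prod_j (if e j == i then (x == y j)%:R else 1).
have gE y z : \prod_i g y i (z i) = (y == [ffun j => z (e j)])%:R.
  rewrite /g exchange_big/= (eq_bigr (fun j => (z (e j) == y j)%:R)); last first.
    move=> j _; rewrite (eq_bigr (fun i => if i == e j then (z i == y j)%:R else 1)) ?big_if_eq// => i _.
    by rewrite eq_sym.
  case: eqP => [->|ne]; first by rewrite big1// => j _; rewrite ffunE eqxx.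
  have [j nj] : exists j, z (e j) != y j.
    apply: contrapT => /forallNP h; apply: ne; apply/ffunP => j; rewrite ffunE.
    by apply/eqP; rewrite eq_sym; apply: contrapT => nj; apply: (h j); apply/negP.
  by rewrite (bigD1 j)//= (negbTE nj) mul0r.
transitivity (\sum_z \sum_y G y * (wprod mu z * \prod_i g y i (z i))).
  apply: eq_bigr => z _; rewrite (bigD1 [ffun j => z (e j)])//= gE eqxx mulr1 mulrC big1 ?addr0// => y ne.
  by rewrite gE (negbTE ne) !mulr0.
rewrite exchange_big/=; apply: eq_bigr => y _; rewrite -mulr_sumr mulrC sum_wprodM; congr (_ * _).
have gi j x : g y (e j) x = (x == y j)%:R.
  rewrite /g (eq_bigr (fun i => if i == j then (x == y i)%:R else 1)) ?big_if_eq// => i _.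
  by rewrite (inj_eq ei).
rewrite /wprod (bigID (fun i => i \in codom e))/= [X in _ * X]big1 ?mulr1; last first.
  move=> i ni; rewrite -[RHS](mu1 i); apply: eq_bigr => x _; rewrite /g big1 ?mulr1// => j _.
  by case: eqP ni => // <-; rewrite codom_f.
have uc : uniq (codom e) by rewrite map_inj_uniq ?enum_uniq.
rewrite -(big_uniq _ uc)/= big_map big_enum/=.
apply: eq_bigr => j _; rewrite (bigD1 (y j))//= gi eqxx mulr1 big1 ?addr0// => x ne.
by rewrite gi (negbTE ne) mulr0.
Qed.
End Marginals.

Lemma expRN_le (R : realType) (x : R) : 0 < x -> expR (- x) <= x^-1.
Proof.
move=> x0; rewrite expRN lef_pV2 ?posrE ?expR_gt0//.
by apply: le_trans (expR_ge1Dx x); rewrite lerDr.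
Qed.

Section Chain.
Variables (R : realType) (l : nat) (B : finType).
Local Notation ys := {ffun 'I_l -> B}.
Definition upd (y : ys) (i : 'I_l) (b : B) : ys := [ffun j => if j == i then b else y j].
Variable psi : 'I_l -> {set 'I_l} -> ys -> R.

(* Chain of one-dimensional sub-kernels along the enumeration of the coordinates to be recovered. *)
Fixpoint chain (D : {set 'I_l}) (s : seq 'I_l) (y : ys) : R :=
  if s is i :: s' then psi i D y * chain (i |: D) s' y else 1.

Definition agree_off (s : seq 'I_l) (y y' : ys) := [forall j, (j \notin s) ==> (y' j == y j)].

Hypothesis psi_ge0 : forall i D y, 0 <= psi i D y.
Hypothesis psi_sum : forall i (D : {set 'I_l}) y, i \notin D -> \sum_b psi i D (upd y i b) <= 1.
Hypothesis psi_loc : forall i (D : {set 'I_l}) (y y' : ys), y i = y' i -> {in D, y =1 y'} -> psi i D y = psi i D y'.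

Lemma chain_ge0 s D y : 0 <= chain D s y.
Proof. by elim: s D => //= i s' ih D; rewrite mulr_ge0. Qed.

(** The coordinates of s are summed out from the last to the first: each kernel has mass at most one
    and does not see the later coordinates. *)
Lemma chain_sum s (D : {set 'I_l}) (y : ys) : uniq s -> (forall i, i \in s -> i \notin D) ->
  \sum_(y' | agree_off s y y') chain D s y' <= 1.
Proof.
elim: s D y => [|i s ih] D y us sD /=.
  rewrite (big_pred1 y)// => y'; apply/forallP/eqP => [h0|-> j].
    by apply/ffunP => j; apply/eqP; exact: h0.
  by rewrite eqxx implybT.
move: us => /=/andP[is_ us].
have iD : i \notin D by apply: sD; rewrite mem_head.
rewrite (partition_big (fun y' : ys => y' i) xpredT)//=.
apply: le_trans (psi_sum y iD); apply: ler_sum => b _.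
rewrite (eq_bigl (agree_off s (upd y i b))); last first.
  move=> y'; apply/andP/forallP => [[/forallP h0 /eqP yb] j|h0].
    rewrite /upd ffunE; case: (j =P i) => [->|/eqP ji]; first by rewrite yb eqxx implybT.
    by apply/implyP => js; have /implyP := h0 j; rewrite in_cons negb_or ji js; apply.
  have yb : y' i == b by have /implyP := h0 i; rewrite /upd ffunE eqxx; apply.
  split=> //; apply/forallP => j; apply/implyP; rewrite in_cons negb_or => /andP[ji js].
  by have /implyP := h0 j; rewrite /upd ffunE (negbTE ji); apply.
rewrite (eq_bigr (fun y' => psi i D (upd y i b) * chain (i |: D) s y')) => [|y' /forallP h0].
  rewrite -mulr_sumr; apply: ler_piMr => //.
  apply: ih => // j js; rewrite finset.in_setU1 negb_or sD ?in_cons ?js ?orbT// andbT.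
  by apply: contraNneq is_ => <-.
congr (_ * _); apply: psi_loc => [|j jD].
  by apply/eqP; have /implyP := h0 i; apply.
apply/eqP; have /implyP := h0 j; apply; apply: contraL jD => js; apply: sD.
by rewrite in_cons js orbT.
Qed.

End Chain.

(** * Random codebooks with random colours *)

Section RandomCode.
Variables (R : realType) (l : nat) (A B : finType).
Local Notation xs := {ffun 'I_l -> A}.
Local Notation ys := {ffun 'I_l -> B}.
Variables (PS : xs -> R) (w : A -> B -> R) (h h2 h1 : R).
Hypothesis PS0 : forall x, 0 <= PS x.
Hypothesis PS1 : \sum_x PS x = 1.
Hypothesis w0 : forall a b, 0 <= w a b.
Hypothesis w1 : forall a, \sum_b w a b = 1.
Hypothesis went : forall a, h <= \sum_b w a b * - ln (w a b).
Hypothesis h12 : h1 < h2.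
Hypothesis h2h : h2 < h.

Definition letter_law (z : xs * ys) : R := PS z.1 * \prod_i w (z.1 i) (z.2 i).

Lemma sum_kernel (x : xs) : \sum_(y : ys) \prod_i w (x i) (y i) = 1.
Proof. by rewrite -(bigA_distr_bigA (fun i b => w (x i) b)) big1. Qed.

Lemma letter_law_ge0 z : 0 <= letter_law z.
Proof. by rewrite mulr_ge0// prodr_ge0. Qed.

Lemma sum_letter_law : \sum_z letter_law z = 1.
Proof.
rewrite -(pair_bigA _ (fun (x : xs) (y : ys) => PS x * \prod_i w (x i) (y i)))/= -[RHS]PS1.
by apply: eq_bigr => x _; rewrite -mulr_sumr sum_kernel mulr1.
Qed.

Variables (k : nat) (psi : 'I_l -> {set 'I_l} -> ys -> R) (eta : nat -> R).
Hypothesis psi_gt0 : forall i D y, 0 < psi i D y.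
Hypothesis psi_sum : forall i (D : {set 'I_l}) y, i \notin D -> \sum_b psi i D (upd y i b) <= 1.
Hypothesis psi_loc : forall i (D : {set 'I_l}) (y y' : ys), y i = y' i -> {in D, y =1 y'} -> psi i D y = psi i D y'.
Variables (F : {set 'I_l} -> xs * ys -> R) (c : {set 'I_l} -> R).
Hypothesis Fc : forall j, \sum_z letter_law z * F j z < c j.
Hypothesis psi_eta : forall i (D : {set 'I_l}), i \notin D -> (#|D| < k)%N ->
  \sum_z letter_law z * - ln (psi i D z.2) < eta #|D|.
Variable rho : R.
Hypothesis rate : forall b, (0 < b <= k)%N -> \sum_(k - b <= m < k) eta m < b%:R * (rho + h1).

Variable n : nat.
Local Notation An := {ffun 'I_n -> A}.
Local Notation Bn := {ffun 'I_n -> B}.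
Local Notation zs := {ffun 'I_n -> xs * ys}.
Local Notation Ys := {ffun 'I_n -> ys}.

Definition word (T : Type) (v : {ffun 'I_n -> {ffun 'I_l -> T}}) (i : 'I_l) : {ffun 'I_n -> T} := [ffun t => v t i].

Let psi_ge0 i D y : 0 <= psi i D y. Proof. exact: ltW. Qed.

(** Typicality is one-sided and relative to the predictors: no coordinate of A' is much less likely
    than expected, given any set of the others. This is what the counting of confusable tuples
    consumes. *)
Definition typS (A' : {set 'I_l}) (v : Ys) :=
  [forall i, forall D : {set 'I_l}, [&& i \in A', D \subset A' & i \notin D] ==>
    (\sum_t - ln (psi i D (v t)) <= n%:R * eta #|D|)].

Definition conflicts (A' : {set 'I_l}) (s : seq 'I_l) (v v' : Ys) :=
  [&& typS A' v', [forall t, agree_off s (v t) (v' t)] & all (fun i => word v' i != word v i) s].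

Lemma chain_typ (A' : {set 'I_l}) s (D : {set 'I_l}) (v : Ys) : typS A' v -> uniq s -> (forall i, i \in s -> (i \in A') && (i \notin D)) ->
  D \subset A' -> 1 <= expR (n%:R * \sum_(#|D| <= m < #|D| + size s) eta m) * \prod_t chain psi D s (v t).
Proof.
move=> tv; elim: s D => [|i s ih] D us sD DA.
  by rewrite addn0 big_geq// mulr0 expR0 mul1r big1.
move: us => /=/andP[is_ us].
have /andP[iA iD] : (i \in A') && (i \notin D) by apply: sD; rewrite mem_head.
have h0 : 1 <= expR (n%:R * \sum_(#|i |: D| <= m < #|i |: D| + size s) eta m) * \prod_t chain psi (i |: D) s (v t).
  apply: ih => //; last by rewrite finset.subUset finset.sub1set iA.
  move=> j js; have /andP[-> jD] := sD j ltac:(by rewrite in_cons js orbT).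
  by rewrite finset.in_setU1 negb_or jD andbT; apply: contraNneq is_ => <-.
have h3 : 1 <= expR (n%:R * eta #|D|) * \prod_t psi i D (v t).
  have /forallP /(_ i) /forallP /(_ D) := tv; rewrite iA DA iD /= => hl.
  have -> : \prod_t psi i D (v t) = expR (\sum_t ln (psi i D (v t))).
    by rewrite expR_sum; apply: eq_bigr => t _; rewrite lnK// posrE.
  rewrite -expRD -{1}[1]expR0 ler_expR.
  have -> : \sum_t ln (psi i D (v t)) = - \sum_(t < n) - ln (psi i D (v t)) by rewrite sumrN opprK.
  by rewrite subr_ge0.
have cD : #|i |: D| = #|D|.+1 by rewrite cardsU1 iD.
rewrite big_split/= big_ltn; last by rewrite -addSnnS addSn ltnS leq_addr.
rewrite mulrDr expRD mulrACA -addSnnS -cD -{1}[1]mulr1.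
by apply: ler_pM.
Qed.

(** Typicality gives each conflicting tuple a chain weight at least the inverse of the bound, while
    the weights of all tuples agreeing with v off s sum to at most one. Starting from A' without s,
    the predictors know from k - size s up to k - 1 coordinates. *)
Lemma conflicts_count (A' : {set 'I_l}) s (v : Ys) : uniq s -> {subset s <= A'} -> #|A'| = k ->
  \sum_(v' | conflicts A' s v v') (1 : R) <= expR (n%:R * \sum_(k - size s <= m < k) eta m).
Proof.
move=> us sA cA; pose D := A' :\: [set i in s].
have sD i : i \in s -> (i \in A') && (i \notin D) by move=> h0; rewrite sA// !inE h0.
have DA : D \subset A' by exact: finset.subsetDl.
have cD : (#|D| + size s = k)%N.
  have -> : size s = #|[set i in s]| by rewrite cardsE (card_uniqP us).
  rewrite -cA -(cardsID [set i in s] A') addnC; congr (_ + _)%N; apply: eq_card => i.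
  by rewrite !inE; case: (boolP (i \in s)) => [/sA ->|]; rewrite ?andbF.
have cDs : #|D| = (k - size s)%N by rewrite -cD addnK.
apply: (@le_trans _ _ (\sum_(v' : Ys | [forall t, agree_off s (v t) (v' t)])
    expR (n%:R * \sum_(k - size s <= m < k) eta m) * \prod_t chain psi D s (v' t))).
  rewrite [leLHS]big_mkcond [leRHS]big_mkcond; apply: ler_sum => v' _.
  rewrite /conflicts; case: (boolP (typS A' v')) => /= tv; last first.
    case: ifP => // _; rewrite mulr_ge0 ?expR_ge0// prodr_ge0// => t _.
    exact: (chain_ge0 psi_ge0).
  case: [forall t, _] => //=; have := chain_typ tv us sD DA; rewrite cD cDs.
  by case: ifP => // _ h0; apply: le_trans h0.
rewrite -mulr_sumr ler_piMr ?expR_ge0//.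
rewrite (eq_bigl (fun v' : Ys => v' \in family (fun t => agree_off s (v t)))); last first.
  by move=> v'; apply/forallP/familyP.
rewrite -(bigA_distr_big_dep _ (fun _ y => chain psi D s y)).
apply: prodr_ile1 => t _; apply/andP; split.
  by apply: sumr_ge0 => y _; exact: (chain_ge0 psi_ge0).
by apply: (chain_sum psi_ge0 psi_sum psi_loc) => // i /sD /andP[].
Qed.

Variables (M : nat) (b0 : B) (Vw : R).
Hypothesis n0 : (0 < n)%N.
Hypothesis M0 : (0 < M)%N.
Hypothesis h10 : 0 <= h1.
Hypothesis Mrho : expR (n%:R * rho) <= M%:R.
Hypothesis Vw_le : forall a, \sum_b w a b * ln (w a b) ^+ 2 <= Vw.
Hypothesis nV : Vw / (n%:R * (h - h2) ^+ 2) <= 4^-1.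

(** Inclusion probability of a word. Of the exponents [h1 < h2 < h], the gap below h makes words of
    kernel probability above [expR (- (n%:R * h2))] rare, and the gap above h1 makes the others
    small enough for sums over the codebook to concentrate. *)
Definition th : R := expR (- (n%:R * h1)).
(* A word belongs to a random codebook with probability [th], and then carries a uniform colour. *)
Definition col_law (o : option 'I_M) : R := if o is Some _ then th / M%:R else 1 - th.

Lemma th_gt0 : 0 < th. Proof. exact: expR_gt0. Qed.
Lemma th_le1 : th <= 1.
Proof. by rewrite /th -{2}[1]expR0 ler_expR oppr_le0 mulr_ge0. Qed.
Lemma M_gt0 : 0 < M%:R :> R. Proof. by rewrite ltr0n. Qed.

Lemma col_law_ge0 o : 0 <= col_law o.
Proof. by case: o => [c'|] /=; rewrite ?subr_ge0 ?th_le1// divr_ge0 ?(ltW th_gt0). Qed.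

Lemma sum_option (T : finType) (G : option T -> R) : \sum_o G o = G None + \sum_x G (Some x).
Proof.
rewrite (bigD1 None)//=; congr (_ + _); rewrite (reindex_omap Some id)/=; last by case.
by apply: eq_bigl => x; rewrite eqxx.
Qed.

Lemma sum_col_law : \sum_o col_law o = 1.
Proof.
rewrite sum_option /= sumr_const card_ord -(mulr_natr (th / _)) divfK ?gt_eqF ?M_gt0//.
by rewrite subrK.
Qed.

Lemma col_some : \sum_o col_law o * (o != None)%:R = th.
Proof.
rewrite sum_option /= mulr0 add0r; under eq_bigr do rewrite mulr1.
by rewrite sumr_const card_ord -(mulr_natr (th / _)) divfK ?gt_eqF ?M_gt0.
Qed.

Definition col_word : {ffun Bn -> option 'I_M} -> R := wprod (fun=> col_law).

Lemma same_color (v v' : Bn) : v' != v ->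
  \sum_x col_word x * ((x v != None) && (x v' == x v))%:R = th * (th / M%:R).
Proof.
move=> vv.
transitivity (\sum_x \sum_(o : 'I_M) col_word x * ((x v == Some o)%:R * (x v' == Some o)%:R)).
  apply: eq_bigr => x _; rewrite -mulr_sumr; congr (_ * _).
  case: (x v) => [c'|] /=; last by rewrite big1// => o _; rewrite mul0r.
  rewrite (bigD1 c')//= eqxx mul1r big1 ?addr0// => o' ne.
  by rewrite (_ : (Some c' == Some o') = false) ?mul0r//; apply: contraNF ne => /eqP [->].
have so (o : 'I_M) : \sum_o' col_law o' * (o' == Some o)%:R = th / M%:R.
  rewrite (bigD1 (Some o))//= eqxx mulr1 big1 ?addr0// => o' /negbTE ->.
  by rewrite mulr0.
rewrite exchange_big/= (eq_bigr (fun=> th / M%:R * (th / M%:R))); last first.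
  move=> o _; rewrite (wprod_marg2 (fun=> sum_col_law) (fun o' => (o' == Some o)%:R) (fun o' => (o' == Some o)%:R) vv).
  by rewrite so.
rewrite sumr_const card_ord -[LHS]mulr_natr mulrAC; congr (_ * _).
by rewrite divfK ?gt_eqF ?M_gt0.
Qed.

Local Notation cbs := {ffun 'I_l -> {ffun Bn -> option 'I_M}}.
Definition cb_law (cb : cbs) : R := wprod (fun=> col_word) cb.

Lemma col_word_ge0 x : 0 <= col_word x. Proof. exact: wprod_ge0 (fun _ => col_law_ge0) x. Qed.
Lemma sum_col_word : \sum_x col_word x = 1. Proof. exact: sum_wprod (fun=> sum_col_law). Qed.
Lemma cb_law_ge0 cb : 0 <= cb_law cb. Proof. exact: wprod_ge0 (fun _ => col_word_ge0) cb. Qed.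

(** A product over encoders because the codebooks are independent, so that its mean factorises. *)
Definition hit (D : {set 'I_l}) (cb : cbs) (v v' : Ys) : R := \prod_i
  ((cb i (word v i) != None) && ((i \in D) ==> (cb i (word v' i) == cb i (word v i))))%:R.

Lemma hit_mean (D : {set 'I_l}) (v v' : Ys) : (forall i, i \in D -> word v' i != word v i) ->
  \sum_cb cb_law cb * hit D cb v v' = th ^+ l * (th / M%:R) ^+ #|D|.
Proof.
move=> vv; rewrite /hit (sum_wprodM (fun=> col_word)
  (fun i x => ((x (word v i) != None) && ((i \in D) ==> (x (word v' i) == x (word v i))))%:R)).
rewrite (eq_bigr (fun i => th * (if i \in D then th / M%:R else 1))); last first.
  move=> i _; case: ifP => iD /=; first by rewrite (same_color (vv i iD)).
  under eq_bigr do rewrite andbT.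
  by rewrite (wprod_marg1 (fun=> sum_col_law) (word v i) (fun o => (o != None)%:R)) col_some mulr1.
by rewrite big_split/= prodr_const card_ord -big_mkcond/= prodr_const.
Qed.

Definition kern (a : An) (v : Bn) : R := wprod (fun t => w (a t)) v.
(* Likely words are discarded: this keeps the variance of the normalisation [Zc] small. *)
Definition ckern a v := kern a v * (kern a v <= expR (- (n%:R * h2)))%R%:R.
Definition Zc (x : {ffun Bn -> option 'I_M}) a := \sum_v ckern a v * (x v != None)%:R.

Lemma kern_ge0 a v : 0 <= kern a v. Proof. exact: wprod_ge0 (fun t => w0 (a t)) v. Qed.
Lemma sum_kern a : \sum_v kern a v = 1. Proof. exact: sum_wprod (fun t => w1 (a t)). Qed.
Lemma ckern_ge0 a v : 0 <= ckern a v. Proof. by rewrite mulr_ge0 ?kern_ge0. Qed.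
Lemma ckern_le a v : ckern a v <= kern a v.
Proof. by rewrite ler_piMr ?kern_ge0// lern1 leq_b1. Qed.

(** By Chebyshev the log-likelihood of a word drawn from the kernel exceeds [- (n%:R * h2)] with
    probability at most 1/4. *)
Lemma ckern_mass a : 3 / 4 <= \sum_v ckern a v.
Proof.
have nn : (0 < #|'I_n|)%N by rewrite card_ord.
have h2h' : 0 < h - h2 by rewrite subr_gt0.
have hE (t : 'I_n) : \sum_b w (a t) b * ln (w (a t) b) <= - h2 - (h - h2).
  by have := went (a t); under eq_bigr do rewrite mulrN; rewrite sumrN; lra.
have := wprod_tail (fun t => w0 (a t)) (fun t => w1 (a t)) nn h2h' hE (fun t => Vw_le (a t)).
rewrite card_ord => tl.
suff : 1 - \sum_v ckern a v <= Vw / (n%:R * (h - h2) ^+ 2) by move: nV; lra.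
apply: le_trans tl; rewrite -[X in X - _](sum_kern a) -sumrB; apply: ler_sum => v _.
rewrite /ckern -{1}[kern a v]mulr1 -mulrBr.
change (wprod _ v) with (kern a v); have : 0 <= kern a v := kern_ge0 a v; rewrite le_eqVlt => /orP[/eqP <-|k0]; first by rewrite !mul0r.
rewrite ler_wpM2l ?kern_ge0//; case: (leP (kern a v)) => kh /=; first by rewrite subrr.
rewrite subr0 (_ : (_ < _) = true)//; have : - (n%:R * h2) < ln (kern a v).
  by rewrite -(expRK (- (n%:R * h2))) ltr_ln ?posrE ?expR_gt0.
rewrite mulrN /kern /wprod ln_prod//.
by move=> t; rewrite lt_neqAle w0 andbT; apply/eqP => e0; move: k0; rewrite /kern /wprod (bigD1 t)//= -e0 mul0r ltxx.
Qed.

(** The mean of [Zc] is at least 3/4 of th, so falling below th/2 is a deviation by th/4, whence the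
    16. Truncation bounds the variance by [th * expR (- (n%:R * h2))]. *)
Lemma Zc_tail a : \sum_x col_word x * (Zc x a < th / 2)%R%:R <= 16 * expR (- (n%:R * (h2 - h1))).
Proof.
pose W := \sum_v ckern a v; have t0 := th_gt0; have W34 : 3 / 4 <= W := ckern_mass a.
have W1 : W <= 1 by rewrite -(sum_kern a); apply: ler_sum => v _; exact: ckern_le.
have b x : (Zc x a < th / 2)%R%:R <= (16 / th ^+ 2) * (\sum_v ckern a v * ((x v != None)%:R - th)) ^+ 2.
  case: ltP => hz /=; last by rewrite mulr_ge0 ?sqr_ge0// divr_ge0 ?sqr_ge0.
  rewrite mulrAC ler_pdivlMr ?exprn_gt0// mul1r.
  have -> : \sum_v ckern a v * ((x v != None)%:R - th) = Zc x a - W * th.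
    by under eq_bigr do rewrite mulrBr; rewrite sumrB -mulr_suml.
  have : th / 4 <= W * th - Zc x a by nra.
  nra.
apply: (@le_trans _ _ (\sum_x col_word x * ((16 / th ^+ 2) * (\sum_v ckern a v * ((x v != None)%:R - th)) ^+ 2))).
  by apply: ler_sum => x _; rewrite ler_wpM2l ?col_word_ge0.
under eq_bigr do rewrite mulrCA; rewrite -mulr_sumr.
have z0 : \sum_o col_law o * ((o != None)%:R - th) = 0.
  by under eq_bigr do rewrite mulrBr; rewrite sumrB col_some -mulr_suml sum_col_law mul1r subrr.
rewrite (wprod_var (mu := fun _ : Bn => col_law) (fun=> sum_col_law) (G := fun v o => ckern a v * ((o != None)%:R - th))); last first.
  by move=> v; under eq_bigr do rewrite mulrCA; rewrite -mulr_sumr z0 mulr0.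
have s2 : \sum_o col_law o * ((o != None)%:R - th) ^+ 2 <= th.
  rewrite (eq_bigr (fun o => (1 - 2 * th) * (col_law o * (o != None)%:R) + th ^+ 2 * col_law o)); last first.
    by move=> o _; case: (o != None) => /=; ring.
  by rewrite big_split/= -!mulr_sumr col_some sum_col_law; nra.
have -> : 16 * expR (- (n%:R * (h2 - h1))) = 16 / th ^+ 2 * (th * expR (- (n%:R * h2))).
  rewrite (_ : - (n%:R * (h2 - h1)) = - (n%:R * h2) - - (n%:R * h1)); last by ring.
  by rewrite expRD (expRN (- (n%:R * h1))) -/th; field; rewrite gt_eqF.
rewrite ler_pM2l ?divr_gt0 ?exprn_gt0//.
apply: (@le_trans _ _ (\sum_v ckern a v * (th * expR (- (n%:R * h2))))); last first.
  by rewrite -mulr_suml ler_piMl// mulr_ge0 ?expR_ge0 ?ltW.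
apply: ler_sum => v _; under eq_bigr do rewrite exprMn mulrCA.
rewrite -mulr_sumr expr2 -mulrA ler_wpM2l ?ckern_ge0// mulrC ler_pM ?ckern_ge0//.
  by apply: sumr_ge0 => o _; rewrite mulr_ge0 ?col_law_ge0 ?sqr_ge0.
by rewrite /ckern; case: (leP (kern a v)) => /=; rewrite ?mulr1 ?mulr0 ?expR_ge0.
Qed.

(** The likelihood encoder as a transition kernel: the test channel, truncated, restricted to the
    codebook and renormalised. A constant word keeps it a probability when no candidate is left. *)
Definition kap (x : {ffun Bn -> option 'I_M}) (a : An) (v : Bn) : R :=
  if Zc x a == 0 then (v == [ffun=> b0])%:R else ckern a v * (x v != None)%:R / Zc x a.

Lemma Zc_ge0 x a : 0 <= Zc x a.
Proof. by apply: sumr_ge0 => v _; rewrite mulr_ge0 ?ckern_ge0. Qed.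

Lemma kap_ge0 x a v : 0 <= kap x a v.
Proof. by rewrite /kap; case: ifP => // _; rewrite divr_ge0 ?Zc_ge0// mulr_ge0 ?ckern_ge0. Qed.

Lemma sum_kap x a : \sum_v kap x a v = 1.
Proof.
rewrite /kap; have [_|Z0] := eqVneq (Zc x a) 0; last by rewrite -mulr_suml mulfV.
by rewrite (bigD1 [ffun=> b0])//= eqxx big1 ?addr0// => v /negbTE ->.
Qed.

Lemma kap_le x a v : th / 2 <= Zc x a -> kap x a v <= 2 / th * (kern a v * (x v != None)%:R).
Proof.
move=> hz; have t0 := th_gt0; have Z0 : 0 < Zc x a by apply: lt_le_trans hz; rewrite divr_gt0.
have zi : (Zc x a)^-1 <= 2 / th.
  by rewrite (_ : 2 / th = (th / 2)^-1) ?lef_pV2 ?posrE// ?divr_gt0// invfM invrK mulrC.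
rewrite /kap gt_eqF// mulrC; apply: ler_pM => //; rewrite ?invr_ge0 ?Zc_ge0 ?mulr_ge0 ?ckern_ge0 ?kern_ge0//.
by rewrite ler_wpM2r ?ckern_le.
Qed.

Local Notation Sn := {ffun 'I_n -> xs}.
Definition transp (y : {ffun 'I_l -> Bn}) : Ys := [ffun t => [ffun i => y i t]].

Lemma word_transp y i : word (transp y) i = y i.
Proof. by apply/ffunP => t; rewrite !ffunE. Qed.

Definition atyp (s : Sn) (v : Ys) : bool :=
  [exists D, n%:R * c D < \sum_t F D (s t, v t)] || [exists D : {set 'I_l}, (#|D| == k) && ~~ typS D v].

Definition cfl (v : Ys) (p : {set 'I_l} * {set 'I_l} * Ys) : bool :=
  [&& #|p.1.1| == k, p.1.2 != finset.set0, p.1.2 \subset p.1.1 & conflicts p.1.1 (enum p.1.2) v p.2].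

Definition same_on (D : {set 'I_l}) (cb : cbs) (v v' : Ys) : bool :=
  [forall i, (i \in D) ==> (cb i (word v' i) == cb i (word v i))].

(** Outside this event decoding succeeds simultaneously for all sets of at least k encoders. *)
Definition bad (cb : cbs) (s : Sn) (v : Ys) : bool :=
  [|| atyp s v, [exists p, cfl v p && same_on p.1.2 cb v p.2] | [exists i, cb i (word v i) == None]].

Lemma hit_ge0 D cb v v' : 0 <= hit D cb v v'.
Proof. by apply: prodr_ge0. Qed.

Lemma bad_split (cb : cbs) (s : Sn) (v : Ys) : (\prod_i (cb i (word v i) != None)%:R) * (bad cb s v)%:R <=
  (atyp s v)%:R * hit finset.set0 cb v v + \sum_p (cfl v p)%:R * hit p.1.2 cb v p.2.
Proof.
have s0 : 0 <= \sum_p (cfl v p)%:R * hit p.1.2 cb v p.2.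
  by apply: sumr_ge0 => p _; rewrite mulr_ge0 ?hit_ge0.
rewrite /bad; case: (boolP [exists i, cb i (word v i) == None]) => [/existsP[i hi]|/existsPn nN].
  by rewrite (bigD1 i)//= hi !mul0r addr_ge0// mulr_ge0 ?hit_ge0.
rewrite orbF big1 ?mul1r; last by move=> i _; rewrite nN.
case: (boolP (atyp s v)) => at_ /=.
  by rewrite /hit big1 ?mul1r ?lerDl// => i _; rewrite nN finset.in_set0.
rewrite mul0r add0r; case: existsP => // -[p /andP[cp /forallP sp]].
rewrite (bigD1 p)//= cp mul1r /hit big1; last by move=> i _; rewrite nN sp.
by rewrite lerDl; apply: sumr_ge0 => q _; rewrite mulr_ge0 ?hit_ge0.
Qed.

(** If all normalisations are at least th/2, the random kernel is at most [2 / th] times the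
    memoryless one on codebook words; otherwise the first sum is already at least one. *)
Lemma kap_sum_bad (cb : cbs) (s : Sn) :
  \sum_(y : {ffun 'I_l -> Bn}) (\prod_i kap (cb i) (word s i) (y i)) * (bad cb s (transp y))%:R <=
  \sum_i (Zc (cb i) (word s i) < th / 2)%R%:R + (2 / th) ^+ l * \sum_(y : {ffun 'I_l -> Bn}) (\prod_i kern (word s i) (y i)) *
    ((atyp s (transp y))%:R * hit finset.set0 cb (transp y) (transp y) +
     \sum_p (cfl (transp y) p)%:R * hit p.1.2 cb (transp y) p.2).
Proof.
have t0 := th_gt0.
have K0 (y : {ffun 'I_l -> Bn}) : 0 <= \prod_i kern (word s i) (y i) by apply: prodr_ge0 => i _; exact: kern_ge0.
have k0 (y : {ffun 'I_l -> Bn}) : 0 <= \prod_i kap (cb i) (word s i) (y i) by apply: prodr_ge0 => i _; exact: kap_ge0.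
have R0 (y : {ffun 'I_l -> Bn}) : 0 <= (\prod_i kern (word s i) (y i)) *
    ((atyp s (transp y))%:R * hit finset.set0 cb (transp y) (transp y) +
     \sum_p (cfl (transp y) p)%:R * hit p.1.2 cb (transp y) p.2).
  by rewrite mulr_ge0// addr_ge0 ?mulr_ge0 ?hit_ge0//; apply: sumr_ge0 => p _; rewrite mulr_ge0 ?hit_ge0.
have q0 : 0 <= (2 / th) ^+ l :> R by rewrite exprn_ge0// divr_ge0// ltW.
case: (boolP [exists i, (Zc (cb i) (word s i) < th / 2)%R]) => [/existsP[i hi]|/existsPn hN].
  rewrite -[leLHS]addr0; apply: lerD; last by rewrite mulr_ge0// sumr_ge0.
  apply: (@le_trans _ _ 1).
    have s1 : \sum_(y : {ffun 'I_l -> Bn}) \prod_i kap (cb i) (word s i) (y i) = 1.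
      by rewrite -(bigA_distr_bigA (fun i v => kap (cb i) (word s i) v)) big1// => j _; exact: sum_kap.
    by rewrite [leRHS](esym s1); apply: ler_sum => y _; rewrite ler_piMr// lern1 leq_b1.
  by rewrite (bigD1 i)//= hi lerDl; apply: sumr_ge0.
rewrite -[leLHS]add0r; apply: lerD; first exact: sumr_ge0.
rewrite mulr_sumr; apply: ler_sum => y _.
apply: (@le_trans _ _ ((2 / th) ^+ l * ((\prod_i kern (word s i) (y i)) * (\prod_i (cb i (word (transp y) i) != None)%:R)) * (bad cb s (transp y))%:R)).
  have cE : (2 / th) ^+ l = \prod_(i < l) (2 / th) by rewrite prodr_const card_ord.
  rewrite ler_wpM2r// -big_split/= cE -big_split/=.
  apply: ler_prod => i _; rewrite kap_ge0/= word_transp; apply: kap_le.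
  by rewrite leNgt.
rewrite -!mulrA ler_wpM2l// ler_wpM2l//; exact: bad_split.
Qed.

(** Averaging over the codebooks returns a factor th for each of the l words that must be present.
    It cancels the th in the density ratio and leaves [2 ^+ l]. *)
Lemma mean_bad (s : Sn) :
  \sum_cb cb_law cb * (\sum_(y : {ffun 'I_l -> Bn}) (\prod_i kap (cb i) (word s i) (y i)) * (bad cb s (transp y))%:R) <=
  l%:R * (16 * expR (- (n%:R * (h2 - h1)))) + 2 ^+ l * \sum_(y : {ffun 'I_l -> Bn}) (\prod_i kern (word s i) (y i)) *
    ((atyp s (transp y))%:R + \sum_p (cfl (transp y) p)%:R * (th / M%:R) ^+ #|p.1.2|).
Proof.
apply: le_trans (ler_sum _ (fun cb _ => ler_wpM2l (cb_law_ge0 cb) (kap_sum_bad cb s))) _.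
under eq_bigr do rewrite mulrDr; rewrite big_split/=; apply: lerD.
  under eq_bigr do rewrite mulr_sumr; rewrite exchange_big/=.
  rewrite -[X in X%:R * _](card_ord l) mulr_natl -sumr_const; apply: ler_sum => i _.
  rewrite (wprod_marg1 (fun=> sum_col_word) i (fun x => (Zc x (word s i) < th / 2)%R%:R)).
  exact: Zc_tail.
under eq_bigr do rewrite mulrCA; rewrite -mulr_sumr.
have t0 := th_gt0.
have -> : 2 ^+ l = (2 / th) ^+ l * th ^+ l :> R by rewrite -exprMn divfK// gt_eqF.
rewrite -mulrA ler_wpM2l ?exprn_ge0 ?divr_ge0 ?(ltW t0)//.
rewrite [leRHS]mulr_sumr.
under eq_bigr do rewrite mulr_sumr.
rewrite exchange_big/=; apply: ler_sum => y _.
under eq_bigr do rewrite mulrCA; rewrite -mulr_sumr mulrCA ler_wpM2l//.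
  by apply: prodr_ge0 => i _; exact: kern_ge0.
rewrite [leRHS]mulrDr.
under [leLHS]eq_bigr do rewrite mulrDr.
rewrite big_split/=; apply: lerD.
  under [leLHS]eq_bigr do rewrite mulrCA.
  rewrite -mulr_sumr hit_mean; last by move=> i; rewrite finset.in_set0.
  by rewrite finset.cards0 expr0 mulr1 [leLHS]mulrC.
rewrite [leRHS]mulr_sumr.
under [leLHS]eq_bigr do rewrite mulr_sumr.
rewrite exchange_big/=; apply: ler_sum => p _.
under [leLHS]eq_bigr do rewrite mulrCA; rewrite -mulr_sumr.
case: (boolP (cfl (transp y) p)) => cp; last by rewrite !mul0r mulr0.
rewrite hit_mean ?mul1r// => i ip; case/and4P: cp => _ _ _ /and3P[_ _ /allP]; apply.
by rewrite mem_enum.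
Qed.

(* Error exponent of the event that [b] of the [k] codewords are confused. *)
Definition flux (b : nat) : R := b%:R * (rho + h1) - \sum_(k - b <= m < k) eta m.
Definition Kc : R := \sum_(q : {set 'I_l} * {set 'I_l}) `|flux #|q.2| |^-1.

Lemma conflict_bound v : \sum_p (cfl v p)%:R * (th / M%:R) ^+ #|p.1.2| <= Kc / n%:R.
Proof.
have nn : 0 < n%:R :> R by rewrite ltr0n.
rewrite -(pair_bigA _ (fun (q : {set 'I_l} * {set 'I_l}) v' => (cfl v (q, v'))%:R * (th / M%:R) ^+ #|q.2|))/=.
rewrite /Kc mulr_suml; apply: ler_sum => -[A' D] _ /=.
rewrite -mulr_suml.
case: (boolP [&& #|A'| == k, D != finset.set0 & D \subset A']) => [/and3P[/eqP cA D0 DA]|hn]; last first.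
  rewrite big1 ?mul0r ?mulr_ge0 ?invr_ge0// => v' _; rewrite /cfl /=; move: hn.
  by do 3 (case: (X in X && _) => //=).
have Dk : (0 < #|D| <= k)%N by rewrite finset.card_gt0 D0 -cA subset_leq_card.
have fl : 0 < flux #|D| by rewrite subr_gt0 rate.
apply: (@le_trans _ _ (expR (n%:R * \sum_(k - #|D| <= m < k) eta m) * (th / M%:R) ^+ #|D|)).
  rewrite ler_wpM2r ?exprn_ge0 ?divr_ge0 ?(ltW th_gt0)//.
  have sD : {subset enum D <= A'} by move=> i; rewrite mem_enum => /(fintype.subsetP DA).
  have := conflicts_count v (enum_uniq D) sD cA; rewrite -cardE; apply: le_trans.
  by rewrite [leRHS]big_mkcond/=; apply: ler_sum => v' _; rewrite /cfl /= cA eqxx D0 DA; case: conflicts.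
apply: (@le_trans _ _ (expR (- (n%:R * flux #|D|)))).
  have -> : - (n%:R * flux #|D|) = n%:R * \sum_(k - #|D| <= m < k) eta m + #|D|%:R * - (n%:R * (rho + h1)).
    by rewrite /flux; ring.
  rewrite expRD ler_pM2l ?expR_gt0// expRM_natl lerXn2r ?nnegrE ?expR_ge0 ?divr_ge0 ?(ltW th_gt0)//.
  rewrite ler_pdivrMr ?M_gt0// /th; apply: le_trans (ler_wpM2l (expR_ge0 _) Mrho).
  by rewrite -expRD ler_expR; lra.
(* Exponential decay is weakened to 1/n, the order of the Chebyshev bounds, so that all errors add
   up to a constant over n. *)
rewrite gtr0_norm// -invfM [X in X^-1]mulrC; apply: expRN_le.
by rewrite mulr_gt0.
Qed.

(** Regrouping: kernels that act separately on encoders and without memory in time amount to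
    independent letters of the joint law. *)
Lemma joint_mass (G : Sn -> Ys -> R) :
  \sum_(s : Sn) (\prod_t PS (s t)) * (\sum_(y : {ffun 'I_l -> Bn}) (\prod_i kern (word s i) (y i)) * G s (transp y)) =
  \sum_(z : zs) wprod (fun=> letter_law) z * G [ffun t => (z t).1] [ffun t => (z t).2].
Proof.
transitivity (\sum_(s : Sn) \sum_(v : Ys) (\prod_t letter_law (s t, v t)) * G s v).
  apply: eq_bigr => s _; rewrite mulr_sumr.
  rewrite (reindex (fun v : Ys => [ffun i => word v i])); last first.
    exists transp => y _; first by apply/ffunP => t; apply/ffunP => i; rewrite !ffunE.
    by apply/ffunP => i; rewrite ffunE word_transp.
  apply: eq_bigr => v _; rewrite mulrA; congr (_ * G _ _); last first.
    by apply/ffunP => t; apply/ffunP => i; rewrite !ffunE.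
  rewrite /letter_law big_split/=; congr (_ * _).
  by rewrite exchange_big/=; apply: eq_bigr => i _; apply: eq_bigr => t _; rewrite !ffunE.
rewrite pair_bigA/= (reindex (fun z : zs => ([ffun t => (z t).1] : Sn, [ffun t => (z t).2] : Ys)))/=; last first.
  exists (fun q : Sn * Ys => [ffun t => (q.1 t, q.2 t)]) => [z _|[s v] _].
    by apply/ffunP => t; rewrite !ffunE; case: (z t).
  by congr (_, _); apply/ffunP => t; rewrite !ffunE.
apply: eq_bigr => z _; congr (_ * _); apply: eq_bigr => t _; rewrite !ffunE.
by case: (z t).
Qed.

Definition sqm (G : xs * ys -> R) : R := \sum_z letter_law z * G z ^+ 2.
Definition Ka : R := \sum_D sqm (F D) / (c D - \sum_z letter_law z * F D z) ^+ 2 +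
  \sum_(q : 'I_l * {set 'I_l}) sqm (fun z => - ln (psi q.1 q.2 z.2)) /
     (eta #|q.2| - \sum_z letter_law z * - ln (psi q.1 q.2 z.2)) ^+ 2.

Lemma letter_tail (G : xs * ys -> R) a : \sum_z letter_law z * G z < a ->
  \sum_(z : zs) wprod (fun=> letter_law) z * (n%:R * a < \sum_t G (z t))%R%:R <=
  (sqm G / (a - \sum_z letter_law z * G z) ^+ 2) / n%:R.
Proof.
move=> h0; have nn : (0 < #|'I_n|)%N by rewrite card_ord.
have g0 : 0 < a - \sum_z letter_law z * G z by rewrite subr_gt0.
have hE (t : 'I_n) : \sum_z letter_law z * G z <= a - (a - \sum_z letter_law z * G z) by rewrite subKr.
have := wprod_tail (fun _ : 'I_n => letter_law_ge0) (fun=> sum_letter_law) nn g0 hE (fun=> lexx _).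
by rewrite card_ord invfM mulrA -/(sqm G) mulrAC.
Qed.

Lemma atyp_bound : \sum_(z : zs) wprod (fun=> letter_law) z * (atyp [ffun t => (z t).1] [ffun t => (z t).2])%:R <= Ka / n%:R.
Proof.
have z12 (z : zs) t : ([ffun t => (z t).1] t, [ffun t => (z t).2] t) = z t by rewrite !ffunE; case: (z t).
apply: (@le_trans _ _ (\sum_D \sum_(z : zs) wprod (fun=> letter_law) z * (n%:R * c D < \sum_t F D (z t))%R%:R +
  \sum_(q : 'I_l * {set 'I_l}) \sum_(z : zs) wprod (fun=> letter_law) z *
    ((q.1 \notin q.2) && (#|q.2| < k)%N && (n%:R * eta #|q.2| < \sum_t - ln (psi q.1 q.2 (z t).2))%R)%:R)).
  rewrite [X in _ <= X + _]exchange_big/= [X in _ <= _ + X]exchange_big/= -big_split/=.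
  apply: ler_sum => z _; rewrite -!mulr_sumr -mulrDr ler_wpM2l ?(wprod_ge0 (fun _ : 'I_n => letter_law_ge0))//.
  rewrite /atyp; case: (boolP [exists D, _]) => [/existsP[D hD]|_] /=.
    have {}hD : n%:R * c D < \sum_t F D (z t) by under eq_bigr do rewrite -z12.
    rewrite (bigD1 D)//= hD -addrA lerDl addr_ge0//; exact: sumr_ge0.
  case: existsP => [[D /andP[/eqP cD]]|_]; last by rewrite addr_ge0//; apply: sumr_ge0.
  rewrite negb_forall => /existsP[i]; rewrite negb_forall => /existsP[D']; rewrite negb_imply -ltNge => /andP[/and3P[iD D'D iD'] hl].
  have {}hl : n%:R * eta #|D'| < \sum_t - ln (psi i D' (z t).2) by move: hl; under eq_bigr do rewrite ffunE.
  have D'k : (#|D'| < k)%N.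
    by rewrite -cD; apply: proper_card; apply/properP; split=> //; exists i.
  rewrite (bigD1 (i, D'))//= iD' D'k hl addrCA lerDl addr_ge0//; exact: sumr_ge0.
rewrite /Ka mulrDl !mulr_suml; apply: lerD.
  by apply: ler_sum => D _; exact: letter_tail.
apply: ler_sum => -[i D] _ /=.
case: (boolP (_ && _)) => [/andP[iD Dk]|_] /=; first exact: (letter_tail (psi_eta iD Dk)).
rewrite big1 ?mulr_ge0 ?invr_ge0 ?sqr_ge0// => [|z _]; last by rewrite mulr0.
by apply: sumr_ge0 => z _; rewrite mulr_ge0 ?letter_law_ge0 ?sqr_ge0.
Qed.

Definition Kbad : R := l%:R * (16 / (h2 - h1)) + 2 ^+ l * (Ka + Kc).

(** Two derandomisations. First a codebook is fixed. Then the random encoders become one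
    deterministic table, drawn from the product of the kernels over all pairs of encoder and input
    word: for given sources the entries consulted are distinct, hence independent. *)
Lemma code_exists : exists cb (fe : {ffun 'I_l * An -> Bn}),
  \sum_(s : Sn) (\prod_t PS (s t)) * (bad cb s (transp [ffun i => fe (i, word s i)]))%:R <= Kbad / n%:R.
Proof.
have nn : 0 < n%:R :> R by rewrite ltr0n.
have P0 (s : Sn) : 0 <= \prod_t PS (s t) by exact: prodr_ge0.
have P1 : \sum_(s : Sn) \prod_t PS (s t) = 1 by exact: (sum_wprod (fun _ : 'I_n => PS1)).
have [cb hcb] : exists cb : cbs, \sum_(s : Sn) (\prod_t PS (s t)) *
    (\sum_(y : {ffun 'I_l -> Bn}) (\prod_i kap (cb i) (word s i) (y i)) * (bad cb s (transp y))%:R) <= Kbad / n%:R.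
  apply: (wprod_exists (mu := fun _ : 'I_l => col_word) (fun=> col_word_ge0) (fun=> sum_col_word)).
  under eq_bigr do rewrite mulr_sumr; rewrite exchange_big/=.
  apply: (@le_trans _ _ (\sum_(s : Sn) (\prod_t PS (s t)) * (l%:R * (16 * expR (- (n%:R * (h2 - h1)))) +
    2 ^+ l * \sum_(y : {ffun 'I_l -> Bn}) (\prod_i kern (word s i) (y i)) * ((atyp s (transp y))%:R + Kc / n%:R)))).
    apply: ler_sum => s _; under eq_bigr do rewrite mulrCA; rewrite -mulr_sumr ler_wpM2l//.
    apply: le_trans (mean_bad s) _; rewrite lerD2l ler_wpM2l ?exprn_ge0//; apply: ler_sum => y _.
    by rewrite ler_wpM2l ?lerD2l ?conflict_bound//; apply: prodr_ge0 => i _; exact: kern_ge0.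
  under eq_bigr do rewrite mulrDr.
  rewrite big_split/= -mulr_suml P1 mul1r /Kbad [leRHS]mulrDl.
  apply: lerD.
    rewrite -mulrA ler_wpM2l// -mulrA ler_wpM2l// -invfM mulrC; apply: expRN_le.
    by rewrite mulr_gt0 ?subr_gt0.
  under eq_bigr do rewrite mulrCA; rewrite -mulr_sumr -mulrA ler_wpM2l ?exprn_ge0//.
  rewrite (joint_mass (fun s v => (atyp s v)%:R + Kc / n%:R)).
  under eq_bigr do rewrite mulrDr; rewrite big_split/= -mulr_suml (sum_wprod (fun _ : 'I_n => sum_letter_law)) mul1r.
  by rewrite mulrDl lerD2r atyp_bound.
exists cb; apply: (wprod_exists (mu := fun (q : 'I_l * An) => kap (cb q.1) q.2) (fun q => kap_ge0 (cb q.1) q.2) (fun q => sum_kap (cb q.1) q.2)).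
under eq_bigr do rewrite mulr_sumr; rewrite exchange_big/=.
apply: le_trans hcb; apply: ler_sum => s _; under eq_bigr do rewrite mulrCA; rewrite -mulr_sumr ler_wpM2l//.
have ei : injective (fun i : 'I_l => (i, word s i)) by move=> i i' [].
rewrite (wprod_marg (mu := fun (q : 'I_l * An) => kap (cb q.1) q.2) (fun q => sum_kap (cb q.1) q.2)
  (fun y => (bad cb s (transp y))%:R) ei).
exact: lexx.
Qed.

Hypothesis k0 : (0 < k)%N.
Hypothesis F_loc : forall (D : {set 'I_l}) x (y y' : ys), {in D, y =1 y'} -> F D (x, y) = F D (x, y').
Variable U : R.
Hypothesis FU : forall D z, F D z <= U.
Hypothesis U0 : 0 <= U.

Local Notation cols := {ffun 'I_l -> option 'I_M}.
Definition sound (cb : cbs) (D : {set 'I_l}) (col : cols) (v : Ys) : bool :=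
  [forall i, (i \in D) ==> (cb i (word v i) == col i)] &&
  [forall D' : {set 'I_l}, ((#|D'| == k) && (D' \subset D)) ==> typS D' v].
Definition dec (cb : cbs) (D : {set 'I_l}) (col : cols) : Ys := odflt [ffun=> [ffun=> b0]] [pick v | sound cb D col v].

Lemma dec_loc cb (D : {set 'I_l}) (col col' : cols) : {in D, col =1 col'} -> dec cb D col = dec cb D col'.
Proof.
move=> h0; congr odflt; apply: eq_pick => v; congr (_ && _); apply: eq_forallb => i.
by case: (boolP (i \in D)) => //= iD; rewrite h0.
Qed.

Lemma subset_card_with (D : {set 'I_l}) i : i \in D -> (k <= #|D|)%N -> exists2 D' : {set 'I_l}, #|D'| = k & (i \in D') && (D' \subset D).
Proof.
move=> iD kD; pose s := take k.-1 (enum (D :\ i)).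
have us : uniq s by rewrite take_uniq ?enum_uniq.
have sD j : j \in s -> (j != i) && (j \in D) by move=> /mem_take; rewrite mem_enum !inE.
exists (i |: [set j in s]%SET); last first.
  rewrite !inE eqxx/=; apply/fintype.subsetP => j; rewrite !inE => /orP[/eqP -> //|/sD /andP[]//].
rewrite cardsU1 !inE (_ : i \in s = false); last by apply/negP => /sD; rewrite eqxx.
rewrite cardsE (card_uniqP us) size_take -cardE.
have : (#|D :\ i|%SET = #|D|.-1)%N by rewrite (cardsD1 i D) iD.
move=> ->; move: k0 kD; case: (k) => // k' _; case: #|D| => //= d; rewrite ltnS leq_eqVlt.
by move=> /orP[/eqP ->|->]; rewrite ?ltnn ?add1n.
Qed.

(** Suppose the decoded tuple differs from v at i in D. Spliced into v on a k-subset D' of D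
    containing i, it gives a tuple that is typical on D', has the transmitted colours where it
    differs and agrees with v elsewhere. Such a conflict is excluded outside [bad]. *)
Lemma dec_good cb s v (D : {set 'I_l}) : (k <= #|D|)%N -> ~~ bad cb s v ->
  forall i, i \in D -> word (dec cb D [ffun i => cb i (word v i)]) i = word v i.
Proof.
move=> kD; rewrite /bad !negb_or => /and3P[nat nc _] i iD.
have tv (D' : {set 'I_l}) : #|D'| = k -> typS D' v.
  case/andP: nat => _ /existsPn/(_ D'); rewrite negb_and negbK => h0 /eqP kE.
  by rewrite kE in h0.
rewrite /dec; case: pickP => [v1 /andP[/forallP s1 /forallP s2]|/(_ v)] /=; last first.
  move=> /negbT; rewrite negb_and => /orP[/forallPn[j]|/forallPn[D']].
    by rewrite ffunE eqxx implybT.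
  by rewrite negb_imply => /andP[/andP[/eqP /tv -> _]].
apply/eqP; apply: contraT => wi.
have [D' D'k /andP[iD' D'D]] := subset_card_with iD kD.
pose E : {set 'I_l} := [set j in D' | word v1 j != word v j]%SET.
pose v' : Ys := [ffun t => [ffun j => if j \in D' then v1 t j else v t j]].
have wv' j : word v' j = if j \in D' then word v1 j else word v j.
  by apply/ffunP => t; rewrite !ffunE; case: ifP => _; rewrite ffunE.
have inE_ j : j \in E = (j \in D') && (word v1 j != word v j) by rewrite !inE.
case/existsP: nc; exists (D', E, v') => /=; apply/andP; split; last first.
  apply/forallP => j; apply/implyP; rewrite inE_ => /andP[jD' _]; rewrite wv' jD'.
  by have /implyP /(_ (fintype.subsetP D'D _ jD')) := s1 j; rewrite ffunE.
rewrite /cfl /= D'k eqxx /=; apply/and3P; split.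
- by apply/finset.set0Pn; exists i; rewrite inE_ iD' wi.
- by apply/fintype.subsetP => j; rewrite inE_ => /andP[].
apply/and3P; split.
- have := s2 D'; rewrite D'k eqxx D'D /= => /forallP t1.
  apply/forallP => j; apply/forallP => D2; apply/implyP => h0.
  have /forallP /(_ D2) /implyP /(_ h0) := t1 j; apply: le_trans.
  case/and3P: h0 => jD' D2D' _; apply: le_of_eq.
  apply: eq_bigr => t _; congr (- ln _); apply: psi_loc => [|u uD2]; rewrite !ffunE ?jD'//.
  by rewrite (fintype.subsetP D2D' _ uD2).
- apply/forallP => t; apply/forallP => j; apply/implyP; rewrite mem_enum inE_ negb_and negbK => h0.
  rewrite !ffunE; case: ifP => // jD'; move: h0; rewrite jD' /= => /eqP h0.
  by have := congr1 (fun f : Bn => f t) h0; rewrite !ffunE => ->.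
- by apply/allP => j; rewrite mem_enum inE_ => /andP[jD' nj]; rewrite wv' jD'.
Qed.

(** Bad sources have probability of order 1/n and cost at most order n, so the total cost exceeds
    [n%:R * c D] by a constant only. *)
Lemma code_perf : exists (enc : 'I_l -> An -> option 'I_M) (dc : {set 'I_l} -> cols -> Ys),
  (forall (D : {set 'I_l}) (col col' : cols), {in D, col =1 col'} -> dc D col = dc D col') /\
  forall D : {set 'I_l}, (k <= #|D|)%N ->
    \sum_(s : Sn) (\prod_t PS (s t)) * (\sum_t F D (s t, dc D [ffun i => enc i (word s i)] t)) <=
    n%:R * c D + (U + `|c D|) * Kbad.
Proof.
have nn : 0 < n%:R :> R by rewrite ltr0n.
have P0 (s : Sn) : 0 <= \prod_t PS (s t) by exact: prodr_ge0.
have P1 : \sum_(s : Sn) \prod_t PS (s t) = 1 by exact: (sum_wprod (fun _ : 'I_n => PS1)).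
have [cb [fe hb]] := code_exists.
exists (fun i a => cb i (fe (i, a))), (dec cb); split; first exact: dec_loc.
move=> D kD; pose v (s : Sn) := transp [ffun i => fe (i, word s i)].
have colE (s : Sn) : [ffun i => cb i (fe (i, word s i))] = [ffun i => cb i (word (v s) i)] :> cols.
  by apply/ffunP => i; rewrite !ffunE word_transp ffunE.
have pt (s : Sn) : \sum_t F D (s t, dec cb D [ffun i => cb i (fe (i, word s i))] t) <=
    n%:R * c D + (bad cb s (v s))%:R * (n%:R * (U + `|c D|)).
  rewrite colE; case: (boolP (bad cb s (v s))) => [_|nb]; rewrite ?mul1r ?mul0r ?addr0.
    apply: (@le_trans _ _ (n%:R * U)).
      by rewrite -[X in X%:R * _](card_ord n) mulr_natl -sumr_const; apply: ler_sum.
    rewrite -mulrDr ler_pM2l// addrCA lerDl -lerBlDr sub0r; exact: lerNnormlW.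
  have dg := dec_good kD nb; rewrite (eq_bigr (fun t => F D (s t, v s t))) => [|t _]; last first.
    by apply: F_loc => i iD; have := congr1 (fun f : Bn => f t) (dg i iD); rewrite [LHS]ffunE [RHS]ffunE.
  move: nb; rewrite /bad !negb_or => /and3P[/andP[/existsPn /(_ D) + _] _ _].
  by rewrite -leNgt.
apply: le_trans (ler_sum _ (fun s _ => ler_wpM2l (P0 s) (pt s))) _.
under eq_bigr do rewrite mulrDr.
rewrite big_split/= -mulr_suml P1 mul1r lerD2l.
rewrite (eq_bigr (fun s : Sn => (\prod_t PS (s t)) * (bad cb s (v s))%:R * (n%:R * (U + `|c D|)))) => [|s _]; last by rewrite !mulrA.
rewrite -mulr_suml mulrC (_ : (U + `|c D|) * Kbad = n%:R * (U + `|c D|) * (Kbad / n%:R)); last first.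
  by field; rewrite gt_eqF.
by rewrite ler_wpM2l// mulr_ge0 ?addr_ge0.
Qed.

End RandomCode.

Lemma random_code (R : realType) (l : nat) (A B : finType) (PS : {ffun 'I_l -> A} -> R) (w : A -> B -> R) (b0 : B) (h h1 : R)
  (k : nat) (psi : 'I_l -> {set 'I_l} -> {ffun 'I_l -> B} -> R) (eta : nat -> R)
  (F : {set 'I_l} -> {ffun 'I_l -> A} * {ffun 'I_l -> B} -> R) (c : {set 'I_l} -> R) (rho : R) :
  (forall x, 0 <= PS x) -> \sum_x PS x = 1 -> (forall a b, 0 <= w a b) -> (forall a, \sum_b w a b = 1) ->
  (forall a, h <= \sum_b w a b * - ln (w a b)) -> 0 <= h1 -> h1 < h -> (0 < k)%N ->
  (forall i D y, 0 < psi i D y) ->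
  (forall i (D : {set 'I_l}) y, i \notin D -> \sum_b psi i D (upd y i b) <= 1) ->
  (forall i (D : {set 'I_l}) (y y' : {ffun 'I_l -> B}), y i = y' i -> {in D, y =1 y'} -> psi i D y = psi i D y') ->
  (forall D, \sum_z letter_law PS w z * F D z < c D) ->
  (forall (D : {set 'I_l}) x (y y' : {ffun 'I_l -> B}), {in D, y =1 y'} -> F D (x, y) = F D (x, y')) ->
  (forall i (D : {set 'I_l}), i \notin D -> (#|D| < k)%N ->
     \sum_z letter_law PS w z * - ln (psi i D z.2) < eta #|D|) ->
  (forall b, (0 < b <= k)%N -> \sum_(k - b <= m < k) eta m < b%:R * (rho + h1)) ->
  exists (K : {set 'I_l} -> R) (N : nat), forall (n M : nat), (N < n)%N -> (0 < M)%N -> expR (n%:R * rho) <= M%:R ->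
  exists (enc : 'I_l -> {ffun 'I_n -> A} -> option 'I_M)
         (dc : {set 'I_l} -> {ffun 'I_l -> option 'I_M} -> {ffun 'I_n -> {ffun 'I_l -> B}}),
  (forall (D : {set 'I_l}) (col col' : {ffun 'I_l -> option 'I_M}), {in D, col =1 col'} -> dc D col = dc D col') /\
  forall D : {set 'I_l}, (k <= #|D|)%N ->
    \sum_(s : {ffun 'I_n -> {ffun 'I_l -> A}}) (\prod_t PS (s t)) *
      (\sum_t F D (s t, dc D [ffun i => enc i (word s i)] t)) <= n%:R * c D + K D.
Proof.
move=> PS0 PS1 w0 w1 went h10 h1h k0 psi0 psis psil Fc Fl pe rate.
pose h2 := (h1 + h) / 2.
have h12 : h1 < h2 by rewrite /h2; lra.
have h2h : h2 < h by rewrite /h2; lra.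
pose Vw := \sum_a \sum_b w a b * ln (w a b) ^+ 2.
have Vt a : 0 <= \sum_b w a b * ln (w a b) ^+ 2 by apply: sumr_ge0 => b _; rewrite mulr_ge0 ?sqr_ge0.
have Vle a : \sum_b w a b * ln (w a b) ^+ 2 <= Vw by rewrite /Vw (bigD1 a)//= lerDl sumr_ge0.
pose U := \sum_D \sum_z `|F D z|.
have FU D z : F D z <= U.
  apply: le_trans (ler_norm _) _; rewrite /U (bigD1 D)//= (bigD1 z)//= -addrA lerDl addr_ge0 ?sumr_ge0// => D' _.
  exact: sumr_ge0.
have U0 : 0 <= U by apply: sumr_ge0 => D _; exact: sumr_ge0.
exists (fun D => (U + `|c D|) * Kbad PS w h2 h1 k psi eta F c rho), (Num.truncn (4 * Vw / (h - h2) ^+ 2)).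
move=> n M nN M0 hM.
have n0 : (0 < n)%N by case: n nN {hM}.
have nV : Vw / (n%:R * (h - h2) ^+ 2) <= 4^-1.
  have g0 : 0 < (h - h2) ^+ 2 by rewrite exprn_gt0// subr_gt0.
  have := truncnS_gt (4 * Vw / (h - h2) ^+ 2); rewrite ltr_pdivrMr// => hn.
  have nl : (Num.truncn (4 * Vw / (h - h2) ^+ 2)).+1%:R <= n%:R :> R by rewrite ler_nat.
  have mg : 0 < n%:R * (h - h2) ^+ 2 by apply: mulr_gt0; rewrite ?ltr0n.
  rewrite ler_pdivrMr//.
  have : (Num.truncn (4 * Vw / (h - h2) ^+ 2)).+1%:R * (h - h2) ^+ 2 <= n%:R * (h - h2) ^+ 2 by rewrite ler_wpM2r// ltW.
  lra.
exact: (code_perf PS0 PS1 w0 w1 went h12 h2h psi0 psis psil Fc pe rate b0 n0 M0 h10 hM Vle nV k0 Fl FU U0).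
Qed.

Lemma indicb (R : realType) (T : Type) (b : T -> bool) : (fun x => (b x)%:R : R) = \1_[set x | b x].
Proof.
apply/funext => x; rewrite indicE; case: (boolP (b x)) => h; first by rewrite mem_set.
by rewrite memNset//; apply/negP.
Qed.

(** * Quantisation of the line and of the normal law *)

Section Lattice.
Context {R : realType}.
Definition mesh (N : nat) : R := N.+1%:R^-1.
(** Cells on each side of the centre: with mesh 1/(N+1) the grid reaches out to N+1, so refinement
    also widens it. *)
Definition halfw (N : nat) : nat := (N.+1 ^ 2)%N.
Definition pos (off N b : nat) : R := (b%:R - off%:R) * mesh N.
Definition cell (off N b : nat) (x : R) : bool := (pos off N b <= x) && (x < pos off N b + mesh N).

Lemma mesh_gt0 N : 0 < mesh N. Proof. by rewrite invr_gt0. Qed.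
Lemma mesh_le1 N : mesh N <= 1.
Proof. by rewrite invf_le1 ?ler1n. Qed.

Lemma cell_idx off N b x : cell off N b x = (b%:R <= x / mesh N + off%:R < b.+1%:R).
Proof.
have m0 := mesh_gt0 N; rewrite /cell /pos -lerBlDr -ler_pdivlMr//; congr (_ && _).
by rewrite -{2}[mesh N]mul1r -mulrDl -ltr_pdivrMr// -natr1 -[RHS]ltrBrDr addrAC.
Qed.

Lemma cell_uniq off N b b' x : cell off N b x -> cell off N b' x -> b = b'.
Proof.
rewrite !cell_idx => /andP[h1 h2] /andP[h3 h4].
have := le_lt_trans h1 h4; have := le_lt_trans h3 h2; rewrite !ltr_nat.
by rewrite !ltnS => h5 h6; apply/eqP; rewrite eqn_leq h5 h6.
Qed.

Lemma cell_ex N x : `|x| <= N.+1%:R -> exists j : 'I_(halfw N).*2.+1, cell (halfw N) N j x.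
Proof.
move=> hx; have m0 := mesh_gt0 N; set y := x / mesh N + (halfw N)%:R.
have hy : `|x / mesh N| <= (halfw N)%:R.
  rewrite normrM invrK (ger0_norm (ler0n _ _)) /halfw natrX expr2.
  by rewrite ler_wpM2r.
have y0 : 0 <= y by move: (hy); rewrite ler_norml /y => /andP[h _]; rewrite -lerBlDr sub0r.
have y1 : y <= (halfw N).*2%:R by rewrite -addnn natrD lerD2r; apply: le_trans hy; exact: ler_norm.
have h := truncn_itv y0.
have hj : (Num.truncn y < (halfw N).*2.+1)%N.
  by rewrite -(ltr_nat R); apply: le_lt_trans (le_trans _ y1) _; [case/andP: h|rewrite ltr_nat].
by exists (Ordinal hj); rewrite cell_idx.
Qed.

Lemma posK N : pos (halfw N) N (halfw N) = 0. Proof. by rewrite /pos subrr mul0r. Qed.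

Lemma cell_near off N b x : cell off N b x -> `|pos off N b - x| <= mesh N.
Proof. by rewrite /cell => /andP[h1 h2]; rewrite ler_norml; lra. Qed.

(** The r-th power of the quantised value, and 0 off the grid. For r = 0 it is the indicator of the
    grid, from which the normalisation of the quantised noise is obtained. *)
Definition qm (r N : nat) (x : R) : R := \sum_(j < (halfw N).*2.+1) pos (halfw N) N j ^+ r * (cell (halfw N) N j x)%:R.

Lemma qm_cell r N x (j : 'I_(halfw N).*2.+1) : cell (halfw N) N j x -> qm r N x = pos (halfw N) N j ^+ r.
Proof.
move=> hj; rewrite /qm (bigD1 j)//= hj mulr1 big1 ?addr0// => i ij.
case: (boolP (cell _ _ i x)) => hi; last by rewrite mulr0.
by case/eqP: ij; apply: val_inj => /=; exact: cell_uniq hi hj.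
Qed.

Lemma qm_out r N x : (forall j : 'I_(halfw N).*2.+1, ~~ cell (halfw N) N j x) -> qm r N x = 0.
Proof. by move=> h; rewrite /qm big1// => j _; rewrite (negbTE (h j)) mulr0. Qed.

Lemma qm_bound r N x : `|qm r N x| <= (`|x| + 1) ^+ r.
Proof.
have [[j hj]|h] := pselect (exists j : 'I_(halfw N).*2.+1, cell (halfw N) N j x); last first.
  rewrite qm_out ?normr0 ?exprn_ge0 ?addr_ge0// => j; apply/negP => hj.
  by apply: h; exists j.
rewrite (qm_cell r hj) normrX lerXn2r ?nnegrE ?addr_ge0//.
have := cell_near hj; have := mesh_le1 N; have := ler_normD (pos (halfw N) N j - x) x; rewrite subrK; lra.
Qed.

Lemma qm_lim r x : (fun N => qm r N x) @ \oo --> x ^+ r.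
Proof.
have e N : (Num.truncn `|x| <= N)%N -> qm r N x = qm 1 N x ^+ r /\ `|qm 1 N x - x| <= mesh N.
  move=> hN; have hx : `|x| <= N.+1%:R.
    by apply: le_trans (ltW (truncnS_gt _)) _; rewrite ler_nat ltnS.
  have [j hj] := cell_ex hx.
  by rewrite !(qm_cell _ hj) expr1; split=> //; exact: cell_near.
have l1 : (fun N => qm 1 N x) @ \oo --> x.
  apply/cvgrPdist_le => eps e0; have m0 : mesh @ \oo --> 0 := @cvg_harmonic R.
  move/cvgrPdist_le : m0 => /(_ _ e0) m0; near=> N.
  rewrite distrC; apply: (@le_trans _ _ (mesh N)).
    by apply: (e N _).2; near: N; exact: nbhs_infty_ge.
  have : `|0 - mesh N| <= eps by near: N.
  by rewrite sub0r normrN gtr0_norm ?mesh_gt0.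
have l2 : (fun N => qm 1 N x ^+ r) @ \oo --> x ^+ r.
  exact: (continuous_cvg _ (@exprn_continuous R r x) l1).
apply: cvg_trans l2; apply: near_eq_cvg; near=> N.
by rewrite (e N _).1//; near: N; exact: nbhs_infty_ge.
Unshelve. all: by end_near.
Qed.

Lemma measurable_cell off N b : measurable [set x : R | cell off N b x].
Proof.
rewrite (_ : [set x | _] = `[pos off N b, (pos off N b + mesh N)[%classic) //.
Qed.

Lemma measurable_cell_fun off N b : measurable_fun setT (fun x : R => (cell off N b x)%:R : R).
Proof.
by rewrite indicb; exact: measurable_indic (measurable_cell _ _ _).
Qed.

Lemma measurable_qm r N : measurable_fun setT (qm r N).
Proof.
apply: measurable_sum => j; apply: measurable_funM; first exact: measurable_cst.
exact: measurable_cell_fun.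
Qed.

(** Points off the grid go to the central cell, whose position is 0. This matches [qm 1], through
    which measurability is derived. *)
Definition quant (N : nat) (x : R) : 'I_(halfw N).*2.+1 :=
  odflt (inord (halfw N)) [pick j : 'I_(halfw N).*2.+1 | cell (halfw N) N j x].

Lemma quant_qm N x : pos (halfw N) N (quant N x) = qm 1 N x.
Proof.
rewrite /quant; case: pickP => [j hj|h] /=; first by rewrite (qm_cell _ hj).
rewrite inordK ?posK ?qm_out// => [j|]; first by rewrite h.
by rewrite ltnS -addnn leq_addr.
Qed.

Lemma pos_inj off N : injective (pos off N).
Proof.
move=> b b' /(mulIf (lt0r_neq0 (mesh_gt0 N))) /addIr /eqP.
by rewrite eqr_nat => /eqP.
Qed.

Lemma quant_meas N j : measurable (quant N @^-1` [set j]).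
Proof.
rewrite (_ : _ @^-1` _ = qm 1 N @^-1` [set pos (halfw N) N j]).
  by rewrite -[X in measurable X]setTI; apply: measurable_qm => //; exact: measurable_set1.
apply/seteqP; split => x /=; first by move=> <-; rewrite quant_qm.
by rewrite -quant_qm => /pos_inj h; apply: val_inj.
Qed.

Definition cp (off N : nat) (c s : R) (b : nat) : R :=
  mean std_normal (fun y : R => (cell off N b (c + s * y))%:R).

Let E (off N : nat) (c s : R) (b : nat) : set R := [set y | cell off N b (c + s * y)].

Lemma E_itv off N c s b : 0 < s -> E off N c s b = `[((pos off N b - c) / s), ((pos off N b - c) / s + mesh N / s)[%classic.
Proof.
move=> s0; apply/seteqP; split => y; rewrite /E /cell /= in_itv /= => /andP[h1 h2].
  by rewrite -mulrDl ler_pdivrMr// ltr_pdivlMr// (mulrC y); apply/andP; split; lra.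
move: h1 h2; rewrite -mulrDl ler_pdivrMr// ltr_pdivlMr// (mulrC y) => h1 h2.
by apply/andP; split; lra.
Qed.

Lemma cpE off N c s b : 0 < s -> (cp off N c s b)%:E = normal_prob (0 : R) 1 (E off N c s b).
Proof.
move=> s0; have mE : measurable (E off N c s b) by rewrite E_itv.
by rewrite /cp indicb mean_indic// fineK// fin_num_measure.
Qed.

Lemma muE off N c s b : 0 < s -> (@lebesgue_measure R (E off N c s b) = (mesh N / s)%:E)%E.
Proof.
move=> s0; rewrite E_itv// lebesgue_measure_itv /= lte_fin ltrDl divr_gt0 ?mesh_gt0//.
by rewrite -EFinB addrAC subrr add0r.
Qed.

(** Within a cell the Gaussian argument moves by at most one mesh, and in the standard variable the
    cell has length [mesh N / s]. The companion upper bound keeps the cross term of the square, as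
    there the mesh works in the opposite direction. *)
Lemma cp_lower off N c s b : 0 < s ->
  normal_peak 1 * expR (- (`|pos off N b - c| + mesh N) ^+ 2 / (2 * s ^+ 2)) * (mesh N / s) <= cp off N c s b.
Proof.
move=> s0; rewrite -lee_fin cpE// normal_pdf_density; last by rewrite E_itv.
rewrite EFinM -(muE off N c b s0) -integral_cst; last by rewrite E_itv.
apply: ge0_le_integral => //.
- by rewrite E_itv.
- by move=> x _; rewrite lee_fin mulr_ge0 ?normal_peak_ge0 ?expR_ge0.
- by apply/measurable_EFinP; apply: measurable_funTS; exact: measurable_normal_pdf.
move=> y /cell_near h; rewrite lee_fin normal_pdf01E ler_pM2l ?normal_peak_gt0// ler_expR.
have h2 : `|s * y| <= `|pos off N b - c| + mesh N.
  have := ler_normB (pos off N b - c) (pos off N b - (c + s * y)).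
  rewrite (_ : _ - _ - _ = s * y); last by ring.
  lra.
rewrite ler_pdivrMr ?mulr_gt0 ?exprn_gt0// (_ : - y ^+ 2 / 2 * (2 * s ^+ 2) = - `|s * y| ^+ 2); last first.
  by rewrite real_normK ?num_real//; field.
by rewrite lerN2 ler_sqr ?nnegrE// addr_ge0// ltW ?mesh_gt0.
Qed.

Lemma cp_upper off N c s b : 0 < s ->
  cp off N c s b <= normal_peak 1 * expR (- ((pos off N b - c) ^+ 2 - 2 * mesh N * `|pos off N b - c|) / (2 * s ^+ 2)) * (mesh N / s).
Proof.
move=> s0; rewrite -lee_fin cpE// normal_pdf_density; last by rewrite E_itv.
rewrite EFinM -(muE off N c b s0) -integral_cst; last by rewrite E_itv.
apply: ge0_le_integral => //.
- by rewrite E_itv.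
- by move=> x _; rewrite lee_fin normal_pdf_ge0.
- by apply/measurable_EFinP; apply: measurable_funTS; exact: measurable_normal_pdf.
move=> y /cell_near h; rewrite lee_fin normal_pdf01E ler_pM2l ?normal_peak_gt0// ler_expR.
set u := pos off N b - c; have {}h : `|u - s * y| <= mesh N by rewrite /u -addrA -opprD.
rewrite ler_pdivlMr ?mulr_gt0 ?exprn_gt0// (_ : - y ^+ 2 / 2 * (2 * s ^+ 2) = - (s * y) ^+ 2); last by field.
rewrite lerN2; have hu : u * (u - s * y) <= `|u| * mesh N.
  by apply: le_trans (ler_norm _) _; rewrite normrM ler_wpM2l.
have : 0 <= (u - s * y) ^+ 2 by exact: sqr_ge0.
nra.
Qed.

Lemma cp_gt0 off N c s b : 0 < s -> 0 < cp off N c s b.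
Proof.
move=> s0; apply: lt_le_trans (cp_lower off N c b s0).
by rewrite !mulr_gt0 ?normal_peak_gt0 ?expR_gt0 ?invr_gt0 ?mesh_gt0.
Qed.

Lemma cell_L1 off N c s b : 0 < s -> L1 std_normal (fun y : R => (cell off N b (c + s * y))%:R).
Proof.
move=> s0; apply: (@L1_bnd _ _ _ std_normal 1) => [|y]; last by rewrite ger0_norm// lern1 leq_b1.
by rewrite indicb; apply: measurable_indic; rewrite -/(E off N c s b) E_itv.
Qed.

Lemma cp_sum off N c s m : 0 < s -> \sum_(b < m) cp off N c s b <= 1.
Proof.
move=> s0; rewrite /cp -mean_sum => [|b _]; last exact: cell_L1.
rewrite -[leRHS](mean_cst std_normal); apply: le_mean; first by apply: L1_sum => b _; exact: cell_L1.
  exact: L1_cst.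
move=> y; have [[j hj]|h] := pselect (exists j : 'I_m, cell off N j (c + s * y)); last first.
  by rewrite big1// => b _; case: (boolP (cell _ _ b _)) => // hb; case: h; exists b.
rewrite (bigD1 j)//= hj big1 ?addr0// => i ij; case: (boolP (cell _ _ i _)) => // hi.
by case/eqP: ij; apply: val_inj; exact: cell_uniq hi hj.
Qed.

End Lattice.

Lemma cvg_fsum (R : realType) (I : Type) (s : seq I) (Q : pred I) (f : I -> nat -> R) (a : I -> R) :
  (forall i, Q i -> f i @ \oo --> a i) -> (fun N => \sum_(i <- s | Q i) f i N) @ \oo --> \sum_(i <- s | Q i) a i.
Proof.
move=> h; elim: s => [|i s ih].
  by rewrite big_nil; under eq_fun do rewrite big_nil; exact: cvg_cst.
rewrite big_cons; under eq_fun do rewrite big_cons.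
by case: ifP => Qi //; apply: cvgD => //; exact: h.
Qed.

Section Noise.
Context {R : realType}.
Variable q : R.
Hypothesis q0 : 0 < q.
Let s : R := Num.sqrt q.
Let s0 : 0 < s. Proof. by rewrite sqrtr_gt0. Qed.

(** Differential entropy of the normal law of variance v, half of ln (2 pi e v), as [normal_peak 1]
    is the inverse square root of 2 pi. *)
Definition ent0 (v : R) : R := ln (Num.sqrt v) + 2^-1 - ln (normal_peak 1).
Definition tot N : R := \sum_(e < (halfw N).*2.+1) cp (halfw N) N 0 s e.
Definition pn N (e : nat) : R := cp (halfw N) N 0 s e / tot N.
Definition nm r N : R := \sum_(e < (halfw N).*2.+1) pn N e * pos (halfw N) N e ^+ r.

Lemma tot_gt0 N : 0 < tot N.
Proof. by rewrite /tot big_ord_recl ltr_pwDl ?cp_gt0// sumr_ge0// => i _; exact: ltW (cp_gt0 _ _ _ _ _). Qed.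

Lemma pn_gt0 N e : 0 < pn N e. Proof. by rewrite divr_gt0 ?tot_gt0 ?cp_gt0. Qed.

Lemma pn_sum N : \sum_(e < (halfw N).*2.+1) pn N e = 1.
Proof. by rewrite -mulr_suml mulfV// gt_eqF ?tot_gt0. Qed.

Let gs : gauss1 (@std_normal R) (fun y => s * y) (s ^+ 2 * 1).
Proof. exact: gauss1Z gauss1_normal. Qed.

Lemma cp_moment r N : (r <= 2)%N ->
  \sum_(e < (halfw N).*2.+1) cp (halfw N) N 0 s e * pos (halfw N) N e ^+ r = mean std_normal (fun y => qm r N (s * y)).
Proof.
move=> r2; rewrite mean_sum => [|e _]; last by apply: L1Z; have := @cell_L1 R (halfw N) N 0 s e s0; under eq_fun do rewrite add0r.
apply: eq_bigr => e _; rewrite meanZ; last by have := @cell_L1 R (halfw N) N 0 s e s0; under eq_fun do rewrite add0r.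
by rewrite mulrC /cp; congr (_ * _); apply: eq_mean => y; rewrite add0r.
Qed.

Lemma cp_moment_lim r : (r <= 2)%N -> (fun N => mean std_normal (fun y => qm r N (s * y))) @ \oo -->
  mean std_normal (fun y => (s * y) ^+ r).
Proof.
move=> r2; have [sq sqE] := gauss1_sq gs.
have := @mean_dct R _ _ std_normal (fun N y => qm r N (s * y)) (fun y => (s * y) ^+ r) (fun y => 2 * (s * y) ^+ 2 + 2).
case=> //.
- by move=> N; apply: measurableT_comp; [exact: measurable_qm|exact: gs.1].
- by apply: L1D; [exact: L1Z|exact: L1_cst].
- move=> N y; apply: le_trans (qm_bound _ _ _) _.
  set x := s * y; rewrite -(real_normK (num_real x)); have x0 : 0 <= `|x| by [].
  apply: (@le_trans _ _ ((`|x| + 1) ^+ 2)); first by apply: ler_weXn2l => //; rewrite lerDr.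
  have : 0 <= (`|x| - 1) ^+ 2 by exact: sqr_ge0.
  nra.
- by move=> y; exact: qm_lim.
Qed.

Lemma tot_lim : tot @ \oo --> (1 : R).
Proof.
have := @cp_moment_lim 0 isT; rewrite (_ : mean _ _ = 1); last first.
  by rewrite -[RHS](mean_cst std_normal); apply: eq_mean => y; rewrite expr0.
apply: cvg_trans; apply: near_eq_cvg; apply: nearW => N; rewrite -cp_moment// /tot.
by apply: eq_bigr => e _; rewrite expr0 mulr1.
Qed.

Lemma nm_lim r : (r <= 2)%N -> nm r @ \oo --> mean std_normal (fun y => (s * y) ^+ r).
Proof.
move=> r2; rewrite (_ : mean _ _ = mean std_normal (fun y => (s * y) ^+ r) / 1); last by rewrite divr1.
have : (fun N => mean std_normal (fun y => qm r N (s * y)) * (tot N)^-1) @ \oo --> mean std_normal (fun y => (s * y) ^+ r) / 1.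
  by apply: cvgM; [exact: cp_moment_lim|apply: cvgV; [exact: oner_neq0|exact: tot_lim]].
apply: cvg_trans; apply: near_eq_cvg; apply: nearW => N; rewrite /= -cp_moment// mulr_suml.
by apply: eq_bigr => e _; rewrite /pn mulrAC.
Qed.

Lemma nm1_lim : nm 1 @ \oo --> (0 : R).
Proof.
have := @nm_lim 1 isT; rewrite (_ : mean _ _ = 0)//.
by rewrite -[RHS](gauss1_mean gs); apply: eq_mean => y; rewrite expr1.
Qed.

Lemma nm2_lim : nm 2 @ \oo --> q.
Proof.
have := @nm_lim 2 isT; rewrite (_ : mean _ _ = q)//.
by rewrite (gauss1_sq gs).2 mulr1 sqr_sqrtr// ltW.
Qed.

(** Cell probabilities are at most mesh times a Gaussian density up to a factor near 1, so the
    discrete entropy is at least the differential one minus ln (mesh), with errors governed by the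
    second moment [nm 2 N], which tends to q. *)
Lemma noise_entropy del : 0 < del -> \forall N \near \oo,
  - ln (mesh N) + ent0 q - del <= \sum_(e < (halfw N).*2.+1) pn N e * - ln (pn N e).
Proof.
move=> d0; pose g N := (1 - mesh N) * nm 2 N / (2 * q) - mesh N / (2 * q) + ln (tot N).
have m0 : mesh @ \oo --> (0 : R) := @cvg_harmonic R.
have gl : g @ \oo --> (1 - 0) * q / (2 * q) - 0 / (2 * q) + ln 1.
  apply: cvgD; last exact: continuous_cvg (continuous_ln ltr01) tot_lim.
  apply: cvgB; last exact: cvgMr_tmp m0.
  apply: cvgMr_tmp; apply: cvgM; last exact: nm2_lim.
  by apply: cvgB => //; exact: cvg_cst.
have ge : (1 - 0) * q / (2 * q) - 0 / (2 * q) + ln 1 = 2^-1.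
  by rewrite ln1; field; rewrite gt_eqF.
rewrite ge in gl; move/cvgrPdist_le : gl => /(_ _ d0) gl; near=> N.
have gN : 2^-1 - del <= g N.
  have : `|2^-1 - g N| <= del by near: N.
  by rewrite ler_norml; lra.
have mN := @mesh_gt0 R N; have tN := tot_gt0 N.
have pk : 0 < normal_peak 1 :> R := normal_peak_gt0 (oner_neq0 R).
have lb e : pn N e * (- ln (mesh N) + ln s - ln (normal_peak 1) + ln (tot N) +
   ((1 - mesh N) * pos (halfw N) N e ^+ 2 - mesh N) / (2 * q)) <= pn N e * - ln (pn N e).
  rewrite ler_wpM2l ?(ltW (pn_gt0 _ _))// /pn ln_div ?posrE ?cp_gt0//.
  set u := pos (halfw N) N e.
  have := cp_upper (halfw N) N 0 e s0; rewrite -/u subr0 => h.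
  have {}h : ln (cp (halfw N) N 0 s e) <= ln (normal_peak 1) - (u ^+ 2 - 2 * mesh N * `|u|) / (2 * q) + (ln (mesh N) - ln s).
    set w := (X in _ <= X) in h; have w0 : 0 < w.
      by apply: mulr_gt0; [apply: mulr_gt0 => //; exact: expR_gt0|exact: divr_gt0].
    move: h; rewrite -ler_ln ?posrE ?cp_gt0// /w.
    move=> h; apply: le_trans h _.
    rewrite lnM; [|by rewrite posrE; apply: mulr_gt0 => //; exact: expR_gt0|by rewrite posrE divr_gt0].
    rewrite ln_div ?posrE// lnM; [|by rewrite posrE|by rewrite posrE expR_gt0].
    rewrite expRK.
    by rewrite sqr_sqrtr ?(ltW q0)// mulNr.
  have hu : 2 * `|u| <= 1 + u ^+ 2.
    by rewrite -(real_normK (num_real u)); have := sqr_ge0 (`|u| - 1); nra.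
  have : ((1 - mesh N) * u ^+ 2 - mesh N) / (2 * q) <= (u ^+ 2 - 2 * mesh N * `|u|) / (2 * q).
    rewrite ler_pM2r ?invr_gt0 ?mulr_gt0//; have := ler_wpM2l (ltW mN) hu; nra.
  lra.
apply: le_trans (ler_sum _ (fun (e : 'I_(halfw N).*2.+1) _ => lb e)).
rewrite (eq_bigr (fun e : 'I_(halfw N).*2.+1 => (- ln (mesh N) + ln s - ln (normal_peak 1) + ln (tot N) - mesh N / (2 * q)) * pn N e +
  (1 - mesh N) / (2 * q) * (pn N e * pos (halfw N) N e ^+ 2))) => [|e _]; last by rewrite mulrBl; ring.
rewrite big_split/= -!mulr_sumr pn_sum -/(nm 2 N) mulr1 /ent0 -/s; move: gN; rewrite /g.
rewrite (_ : (1 - mesh N) * nm 2 N / (2 * q) = (1 - mesh N) / (2 * q) * nm 2 N); last by rewrite mulrAC.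
lra.
Unshelve. all: by end_near.
Qed.

(* The output alphabet is wide enough to hold every sum of quantised source and quantised noise. *)
Definition wk N (a b : nat) : R := \sum_(e < (halfw N).*2.+1) pn N e * (a + e == b)%N%:R.

Lemma wk_ge0 N a b : 0 <= wk N a b.
Proof. by apply: sumr_ge0 => e _; rewrite mulr_ge0// ltW ?pn_gt0. Qed.

Lemma wk_sum N (a : 'I_(halfw N).*2.+1) (f : nat -> R) :
  \sum_(b < (halfw N).*2.*2.+1) wk N a b * f b = \sum_(e < (halfw N).*2.+1) pn N e * f (a + e)%N.
Proof.
under eq_bigr do rewrite mulr_suml; rewrite exchange_big/=; apply: eq_bigr => e _.
have ae : (a + e < (halfw N).*2.*2.+1)%N by rewrite ltnS -[X in (_ <= X)%N]addnn; apply: leq_add; rewrite -ltnS ltn_ord.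
rewrite (bigD1 (Ordinal ae))//= eqxx mulr1 big1 ?addr0// => b nb.
by rewrite (_ : (_ == _) = false) ?mulr0 ?mul0r//; apply: contraNF nb => /eqP h; apply/eqP/val_inj.
Qed.

Lemma wk_at N a (e : 'I_(halfw N).*2.+1) : wk N a (a + e) = pn N e.
Proof.
rewrite /wk (bigD1 e)//= eqxx mulr1 big1 ?addr0// => e' ne.
by rewrite eqn_add2l (_ : (_ == _ :> nat) = false) ?mulr0//; apply: negbTE.
Qed.

Lemma pos_add N a e : pos (halfw N).*2 N (a + e) = pos (halfw N) N a + pos (halfw N) N e :> R.
Proof. by rewrite /pos -addnn !natrD; ring. Qed.

End Noise.

(** * One letter of the quantised system and its limits *)

Section Quantized.
Context {R : realType} {d : measure_display} {Omega : measurableType d}.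
Variables (P : probability Omega R) (l : nat) (X S : 'I_l -> Omega -> R).
Hypothesis mX : forall i, measurable_fun setT (X i).
Hypothesis mS : forall i, measurable_fun setT (S i).
Hypothesis sqX : forall i, L1 P (fun w => X i w ^+ 2).
Hypothesis sqS : forall i, L1 P (fun w => S i w ^+ 2).
Hypothesis EX : forall i, mean P (X i) = 0.
Hypothesis ES : forall i, mean P (S i) = 0.
Variable q : R.
Hypothesis q0 : 0 < q.

Definition na N := (halfw N).*2.+1.
Definition nb N := (halfw N).*2.*2.+1.
Local Notation xs N := {ffun 'I_l -> 'I_(na N)}.
Local Notation ys N := {ffun 'I_l -> 'I_(nb N)}.
Definition qv N w : xs N := [ffun i => quant N (S i w)].
Definition qind N (x : xs N) w : R := (qv N w == x)%:R.

Lemma qindE N (x : xs N) w : qind x w = \prod_i \1_(quant N @^-1` [set x i]) (S i w).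
Proof.
rewrite /qind; case: eqP => [<-|ne]; first by rewrite big1// => i _; rewrite indicE mem_set//= ffunE.
have [i ni] : exists i, quant N (S i w) != x i.
  apply: contrapT => /forallNP h; apply: ne; apply/ffunP => i; rewrite ffunE.
  by apply/eqP; apply: contrapT => ni; apply: (h i); apply/negP.
by rewrite (bigD1 i)//= indicE memNset ?mul0r//=; apply/eqP.
Qed.

Lemma measurable_qind N (x : xs N) : measurable_fun setT (qind x).
Proof.
rewrite (_ : qind x = fun w => \prod_i \1_(quant N @^-1` [set x i]) (S i w)); last by apply/funext => w; exact: qindE.
apply: measurable_prod => i _; apply: measurableT_comp (mS i).
by apply: measurable_indic; exact: quant_meas.
Qed.

Lemma qind_bnd N (x : xs N) w : `|qind x w| <= 1.
Proof. by rewrite ger0_norm ?ler0n// lern1 leq_b1. Qed.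

Lemma fin_mean N (h : Omega -> R) (G : xs N -> R) : L1 P h ->
  \sum_x mean P (fun w => h w * qind x w) * G x = mean P (fun w => h w * G (qv N w)).
Proof.
move=> Lh; rewrite (@eq_mean _ _ _ _ _ (fun w => \sum_x (h w * qind x w) * G x)) => [|w]; last first.
  rewrite (bigD1 (qv N w))//= /qind eqxx mulr1 big1 ?addr0// => x nx.
  by rewrite eq_sym (negbTE nx) mulr0 mul0r.
rewrite mean_sum => [|x _]; last by apply: L1Zr; exact: L1_Mb Lh (measurable_qind x) (qind_bnd x).
by apply: eq_bigr => x _; rewrite meanZr//; exact: L1_Mb Lh (measurable_qind x) (qind_bnd x).
Qed.

Definition PS N (x : xs N) : R := mean P (qind x).
Definition PX N i (x : xs N) : R := mean P (fun w => X i w * qind x w).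
(** Conditional mean of the signal given the quantised sources of all encoders. The letter law has
    no signal component; this function stands for the signal in the quadratic costs. *)
Definition cm N i (x : xs N) : R := PX i x / PS x.

Lemma PS_ge0 N (x : xs N) : 0 <= PS x. Proof. by apply: mean_ge0 => w; exact: ler0n. Qed.

Lemma PS_mean N (G : xs N -> R) : \sum_x PS x * G x = mean P (fun w => G (qv N w)).
Proof.
have := @fin_mean N (fun=> 1) G (L1_cst P 1); rewrite (@eq_mean _ _ _ _ (fun w => 1 * G (qv N w)) (fun w => G (qv N w))) => [<-|w]; last by rewrite mul1r.
by apply: eq_bigr => x _; congr (_ * _); apply: eq_mean => w; rewrite mul1r.
Qed.

Lemma PS_sum N : \sum_(x : xs N) PS x = 1.
Proof. by have := PS_mean (fun _ : xs N => 1); rewrite mean_cst => <-; apply: eq_bigr => x _; rewrite mulr1. Qed.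

Lemma qind_L1 N (x : xs N) : L1 P (qind x).
Proof. exact: L1_bnd (measurable_qind x) (qind_bnd x). Qed.

Lemma PXE N i (x : xs N) : PX i x = PS x * cm i x.
Proof.
rewrite /cm; have [e0|n0] := eqVneq (PS x) 0; last by rewrite mulrCA mulfV ?mulr1.
by rewrite e0 mul0r; exact: mean_bool0 (mX i) (sqX i) (measurable_qind x) e0.
Qed.

Definition wq N (a : 'I_(na N)) (b : 'I_(nb N)) : R := wk q N a b.
Definition val_ N (b : nat) : R := pos (halfw N).*2 N b.
Definition law N := letter_law (@PS N) (@wq N).

Lemma wq_sum N (a : 'I_(na N)) : \sum_b wq a b = 1.
Proof.
rewrite -(pn_sum q0 N); transitivity (\sum_(b < nb N) wq a b * 1); first by apply: eq_bigr => b _; rewrite mulr1.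
by rewrite (wk_sum q a (fun=> 1)); apply: eq_bigr => e _; rewrite mulr1.
Qed.

Lemma wq_val N (a : 'I_(na N)) : \sum_b wq a b * val_ N b = pos (halfw N) N a + nm q 1 N.
Proof.
rewrite /wq (wk_sum q a (val_ N)) (eq_bigr (fun e : 'I_(na N) => pos (halfw N) N a * pn q N e + pn q N e * pos (halfw N) N e ^+ 1)).
  by rewrite big_split/= -mulr_sumr (pn_sum q0 N) mulr1.
by move=> e _; rewrite /val_ pos_add; ring.
Qed.

Lemma wq_val2 N (a : 'I_(na N)) : \sum_b wq a b * val_ N b ^+ 2 =
  pos (halfw N) N a ^+ 2 + 2 * pos (halfw N) N a * nm q 1 N + nm q 2 N.
Proof.
rewrite /wq (wk_sum q a (fun b => val_ N b ^+ 2)) (eq_bigr (fun e : 'I_(na N) => pos (halfw N) N a ^+ 2 * pn q N e +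
  2 * pos (halfw N) N a * (pn q N e * pos (halfw N) N e ^+ 1) + pn q N e * pos (halfw N) N e ^+ 2)).
  by rewrite !big_split/= -!mulr_sumr (pn_sum q0 N) mulr1.
by move=> e _; rewrite /val_ pos_add; ring.
Qed.

Lemma law_split N (g : xs N -> R) (f : ys N -> R) :
  \sum_z law z * (g z.1 * f z.2) = \sum_x PS x * (g x * \sum_(y : ys N) wprod (fun i => wq (x i)) y * f y).
Proof.
rewrite -(pair_bigA _ (fun (x : xs N) (y : ys N) => law (x, y) * (g x * f y)))/=.
apply: eq_bigr => x _; rewrite !mulr_sumr; apply: eq_bigr => y _.
by rewrite /law /letter_law /wprod /=; ring.
Qed.

Lemma qm1_L2 N i : L1 P (fun w => qm 1 N (S i w) ^+ 2).
Proof.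
apply: (@L1_le _ _ _ _ _ (fun w => 2 * S i w ^+ 2 + 2)); last 2 first.
- by apply: L1D; [exact: L1Z|exact: L1_cst].
- move=> w; rewrite normrX; have := qm_bound 1 N (S i w); rewrite expr1 => h.
  apply: (@le_trans _ _ ((`|S i w| + 1) ^+ 2)); first by rewrite ler_sqr ?nnegrE// addr_ge0.
  by rewrite -(real_normK (num_real (S i w))); have := sqr_ge0 (`|S i w| - 1); nra.
by apply: measurable_funX; apply: measurableT_comp (mS i); exact: measurable_qm.
Qed.

Lemma measurable_qmS N i : measurable_fun setT (fun w => qm 1 N (S i w)).
Proof. by apply: measurableT_comp (mS i); exact: measurable_qm. Qed.

Definition Aq N i j : R := mean P (fun w => qm 1 N (S i w) * qm 1 N (S j w)).
Definition Bq N i : R := mean P (fun w => qm 1 N (S i w)).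
Definition Cq N i j : R := mean P (fun w => X i w * qm 1 N (S j w)).

Lemma law_vv N i j : \sum_(z : xs N * ys N) law z * (val_ N (z.2 i) * val_ N (z.2 j)) =
  Aq N i j + nm q 1 N * (Bq N i + Bq N j) + (if j == i then nm q 2 N else nm q 1 N ^+ 2).
Proof.
have w1 (x : xs N) (u : 'I_l) : \sum_b wq (x u) b = 1 by exact: wq_sum.
set c := (if _ then _ else _).
have -> : \sum_(z : xs N * ys N) law z * (val_ N (z.2 i) * val_ N (z.2 j)) =
   \sum_(x : xs N) PS x * (pos (halfw N) N (x i) * pos (halfw N) N (x j) + nm q 1 N * (pos (halfw N) N (x i) + pos (halfw N) N (x j)) + c).
  rewrite (eq_bigr (fun z : xs N * ys N => law z * (1 * (val_ N (z.2 i) * val_ N (z.2 j))))) => [|z _]; last by rewrite mul1r.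
  rewrite (law_split (fun=> 1) (fun y => val_ N (y i) * val_ N (y j))).
  apply: eq_bigr => x _; rewrite mul1r; congr (_ * _); rewrite /c; case: eqP => [->|/eqP ji].
    by rewrite (wprod_marg1 (w1 x) i (fun b => val_ N b * val_ N b)) (wq_val2 (x i)); ring.
  by rewrite (wprod_marg2 (w1 x) (fun b => val_ N b) (fun b => val_ N b) ji) !wq_val; ring.
rewrite (PS_mean (fun x : xs N => pos (halfw N) N (x i) * pos (halfw N) N (x j) + nm q 1 N * (pos (halfw N) N (x i) + pos (halfw N) N (x j)) + c)).
have Li k : L1 P (fun w => qm 1 N (S k w)) := L1_sq1 (measurable_qmS N k) (qm1_L2 N k).
have Lij := L1_sq (measurable_qmS N i) (measurable_qmS N j) (qm1_L2 N i) (qm1_L2 N j).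
rewrite (@eq_mean _ _ _ _ _ (fun w => qm 1 N (S i w) * qm 1 N (S j w) + nm q 1 N * (qm 1 N (S i w) + qm 1 N (S j w)) + c)); last first.
  by move=> w; rewrite !ffunE !quant_qm.
have L2 := L1Z (nm q 1 N) (L1D (Li i) (Li j)).
rewrite meanD; [|exact: L1D|exact: L1_cst].
by rewrite meanD// meanZ ?meanD// ?mean_cst//; exact: L1D.
Qed.

Lemma law_xv N i j : \sum_(z : xs N * ys N) law z * (cm i z.1 * val_ N (z.2 j)) = Cq N i j.
Proof.
have w1 (x : xs N) (u : 'I_l) : \sum_b wq (x u) b = 1 by exact: wq_sum.
have LX : L1 P (X i) := L1_sq1 (mX i) (sqX i).
rewrite (law_split (fun x => cm i x) (fun y => val_ N (y j))).
have -> : \sum_(x : xs N) PS x * (cm i x * \sum_(y : ys N) wprod (fun i => wq (x i)) y * val_ N (y j)) =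
   \sum_(x : xs N) PX i x * (pos (halfw N) N (x j) + nm q 1 N).
  by apply: eq_bigr => x _; rewrite (wprod_marg1 (w1 x) j (fun b => val_ N b)) wq_val mulrA -PXE.
rewrite (fin_mean (fun x : xs N => pos (halfw N) N (x j) + nm q 1 N) LX).
rewrite (@eq_mean _ _ _ _ _ (fun w => X i w * qm 1 N (S j w) + X i w * nm q 1 N)); last first.
  by move=> w; rewrite ffunE quant_qm mulrDr.
rewrite meanD; last exact: L1Zr; last exact: L1_sq (mX i) (measurable_qmS N j) (sqX i) (qm1_L2 N j).
by rewrite meanZr// EX mul0r addr0.
Qed.

Lemma qmS_lim (h : Omega -> R) j : measurable_fun setT h -> L1 P (fun w => h w ^+ 2) ->
  (fun N => mean P (fun w => h w * qm 1 N (S j w))) @ \oo --> mean P (fun w => h w * S j w).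
Proof.
move=> mh sh.
have := @mean_dct R _ _ P (fun N w => h w * qm 1 N (S j w)) (fun w => h w * S j w) (fun w => h w ^+ 2 + (2 * S j w ^+ 2 + 2)).
case=> //.
- by move=> N; apply: measurable_funM => //; exact: measurable_qmS.
- by apply: L1D => //; apply: L1D; [exact: L1Z|exact: L1_cst].
- move=> N w; rewrite normrM; have := qm_bound 1 N (S j w); rewrite expr1 => hb.
  rewrite -(real_normK (num_real (S j w))) -(real_normK (num_real (h w))).
  have := sqr_ge0 (`|S j w| - 1); have := sqr_ge0 (`|h w| - `|qm 1 N (S j w)|).
  have := normr_ge0 (qm 1 N (S j w)); have := normr_ge0 (S j w); nra.
- by move=> w; apply: cvgMl_tmp; have := @qm_lim R 1 (S j w); rewrite expr1.
Qed.

Lemma Aq_lim i j : (fun N => Aq N i j) @ \oo --> mean P (fun w => S i w * S j w).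
Proof.
have := @mean_dct R _ _ P (fun N w => qm 1 N (S i w) * qm 1 N (S j w)) (fun w => S i w * S j w) (fun w => (2 * S i w ^+ 2 + 2) + (2 * S j w ^+ 2 + 2)).
case=> //.
- by move=> N; apply: measurable_funM => //; exact: measurable_qmS.
- by apply: L1D => //; apply: L1D; (try exact: L1Z); exact: L1_cst.
- move=> N w; rewrite normrM; have := qm_bound 1 N (S j w); have := qm_bound 1 N (S i w); rewrite !expr1 => hb hb'.
  rewrite -(real_normK (num_real (S j w))) -(real_normK (num_real (S i w))).
  have := sqr_ge0 (`|S j w| - 1); have := sqr_ge0 (`|S i w| - 1).
  have := sqr_ge0 (`|qm 1 N (S i w)| - `|qm 1 N (S j w)|).
  have := normr_ge0 (qm 1 N (S j w)); have := normr_ge0 (qm 1 N (S i w)); nra.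
- by move=> w; apply: cvgM; have := @qm_lim R 1; [move=> /(_ (S i w))|move=> /(_ (S j w))]; rewrite expr1.
Qed.

Lemma Bq_lim i : (fun N => Bq N i) @ \oo --> (0 : R).
Proof.
rewrite -(ES i); have := @qmS_lim (fun=> 1) i (@measurable_cst _ _ _ _ _ _); rewrite (_ : mean P _ = mean P (S i)).
  move=> /(_ _)/wrap[|h]; first by under eq_fun do rewrite expr1n; exact: L1_cst.
  apply: cvg_trans h; apply: near_eq_cvg; apply: nearW => N; apply: eq_mean => w.
  by rewrite mul1r.
by apply: eq_mean => w; rewrite mul1r.
Qed.

Definition Mlim i j : R := mean P (fun w => S i w * S j w) + (if j == i then q else 0).

Lemma law_vv_lim i j :
  (fun N => \sum_(z : xs N * ys N) law z * (val_ N (z.2 i) * val_ N (z.2 j))) @ \oo --> Mlim i j.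
Proof.
under eq_fun do rewrite law_vv.
rewrite (_ : Mlim i j = mean P (fun w => S i w * S j w) + 0 * (0 + 0) + (if j == i then q else 0 ^+ 2)); last first.
  by rewrite mul0r addr0 expr0n.
apply: cvgD.
  apply: cvgD; first exact: Aq_lim.
  by apply: cvgM; [exact: nm1_lim|apply: cvgD; exact: Bq_lim].
case: eqP => _; first exact: nm2_lim.
rewrite expr2; under eq_fun do rewrite expr2.
by apply: cvgM; exact: nm1_lim.
Qed.

Lemma law_quad_lim (c : 'I_l -> R) :
  (fun N => \sum_(z : xs N * ys N) law z * (\sum_i c i * val_ N (z.2 i)) ^+ 2) @ \oo --> \sum_i \sum_j c i * c j * Mlim i j.
Proof.
rewrite (_ : (fun N => _) = (fun N => \sum_i \sum_j c i * c j * \sum_(z : xs N * ys N) law z * (val_ N (z.2 i) * val_ N (z.2 j)))).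
  apply: cvg_fsum => i _; apply: cvg_fsum => j _; apply: cvgMl_tmp; exact: law_vv_lim.
apply/funext => N; rewrite (eq_bigr (fun z : xs N * ys N => \sum_i \sum_j c i * c j * (law z * (val_ N (z.2 i) * val_ N (z.2 j))))).
  rewrite exchange_big/=; apply: eq_bigr => i _; rewrite exchange_big/=; apply: eq_bigr => j _.
  by rewrite mulr_sumr.
move=> z _; rewrite expr2 mulr_suml mulr_sumr; apply: eq_bigr => i _.
by rewrite !mulr_sumr; apply: eq_bigr => j _; ring.
Qed.

Lemma law_cross_lim i (b : 'I_l -> R) :
  (fun N => \sum_(z : xs N * ys N) law z * (cm i z.1 * \sum_j b j * val_ N (z.2 j))) @ \oo --> \sum_j b j * mean P (fun w => X i w * S j w).
Proof.
rewrite (_ : (fun N => _) = (fun N => \sum_j b j * Cq N i j)).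
  by apply: cvg_fsum => j _; apply: cvgMl_tmp; exact: qmS_lim.
apply/funext => N; rewrite (eq_bigr (fun z : xs N * ys N => \sum_j b j * (law z * (cm i z.1 * val_ N (z.2 j))))).
  by rewrite exchange_big/=; apply: eq_bigr => j _; rewrite -mulr_sumr law_xv.
by move=> z _; rewrite !mulr_sumr; apply: eq_bigr => j _; ring.
Qed.

Lemma law_ge0 N (z : xs N * ys N) : 0 <= law z.
Proof. by apply: letter_law_ge0 => [x|a b]; [exact: PS_ge0|exact: wk_ge0]. Qed.

Lemma law_sum N : \sum_(z : xs N * ys N) law z = 1.
Proof. by apply: sum_letter_law => [|a]; [exact: PS_sum|exact: wq_sum]. Qed.

Lemma wq_entropy del : 0 < del -> \forall N \near \oo, forall a : 'I_(na N),
  - ln (mesh N) + ent0 q - del <= \sum_b wq a b * - ln (wq a b).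
Proof.
move=> d0; near=> N => a; rewrite /wq (wk_sum q a (fun b => - ln (wk q N a b))).
rewrite (eq_bigr (fun e : 'I_(na N) => pn q N e * - ln (pn q N e))); last by move=> e _; rewrite wk_at.
by near: N; exact: noise_entropy.
Unshelve. all: by end_near.
Qed.

Variables (alpha tau : nat -> R) (be : {set 'I_l} -> 'I_l -> 'I_l -> R).
Hypothesis tau0 : forall m, 0 < tau m.

(* Quantised Gaussian prediction of [y i] from the coordinates in [D]; by exchangeability its
   coefficient and variance depend on [#|D|] only. *)
Definition psi N (i : 'I_l) (D : {set 'I_l}) (y : ys N) : R :=
  cp (halfw N).*2 N (alpha #|D| * \sum_(j in D) val_ N (y j)) (Num.sqrt (tau #|D|)) (y i).

Let st0 m : 0 < Num.sqrt (tau m). Proof. by rewrite sqrtr_gt0. Qed.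

Lemma psi_gt0 N i D (y : ys N) : 0 < psi i D y. Proof. exact: cp_gt0. Qed.

Lemma psi_sum N i (D : {set 'I_l}) (y : ys N) : i \notin D -> \sum_b psi i D (upd y i b) <= 1.
Proof.
move=> iD; apply: le_trans (cp_sum (halfw N).*2 N (alpha #|D| * \sum_(j in D) val_ N (y j)) (nb N) (st0 #|D|)).
apply: le_of_eq; apply: eq_bigr => b _; rewrite /psi {2}/upd ffunE eqxx.
rewrite (eq_bigr (fun j => val_ N (y j)))// => j jD; rewrite /upd ffunE.
by case: eqP jD iD => // -> ->.
Qed.

Lemma psi_loc N i (D : {set 'I_l}) (y y' : ys N) : y i = y' i -> {in D, y =1 y'} -> psi i D y = psi i D y'.
Proof.
move=> yi yD; rewrite /psi yi (eq_bigr (fun j => val_ N (y' j)))// => j jD.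
by rewrite yD.
Qed.

Definition resid (i : 'I_l) (D : {set 'I_l}) (j : 'I_l) : R := (j == i)%:R - (if j \in D then alpha #|D| else 0).

(** The cross-entropy of a Gaussian predictor depends on the outputs through the mean square of the
    prediction error alone. By hypothesis its limit equals the variance of the predictor, so the
    differential entropy is approached. *)
Lemma psi_entropy i (D : {set 'I_l}) del : 0 < del ->
  \sum_j \sum_j' resid i D j * resid i D j' * Mlim j j' = tau #|D| ->
  \forall N \near \oo, \sum_(z : xs N * ys N) law z * - ln (psi i D z.2) < - ln (mesh N) + ent0 (tau #|D|) + del.
Proof.
move=> d0 ht; set t := tau #|D| in ht *; have t0 : 0 < t by exact: tau0.
pose E N := \sum_(z : xs N * ys N) law z * (\sum_j resid i D j * val_ N (z.2 j)) ^+ 2.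
have El : E @ \oo --> t by rewrite -ht; exact: law_quad_lim.
pose g N := ((1 + mesh N) * E N + mesh N + mesh N * mesh N) / (2 * t).
have m0 : mesh @ \oo --> (0 : R) := @cvg_harmonic R.
have gl : g @ \oo --> ((1 + 0) * t + 0 + 0 * 0) / (2 * t).
  apply: cvgMr_tmp; apply: cvgD; last exact: cvgM.
  by apply: cvgD => //; apply: cvgM => //; apply: cvgD => //; exact: cvg_cst.
have ge : ((1 + 0) * t + 0 + 0 * 0) / (2 * t) = 2^-1 by field; rewrite gt_eqF.
rewrite ge in gl; move/cvgrPdist_lt : gl => /(_ _ d0) gl; near=> N.
have gN : g N < 2^-1 + del.
  have : `|2^-1 - g N| < del by near: N.
  by rewrite ltr_norml; lra.
have mN := @mesh_gt0 R N; have pk : 0 < normal_peak 1 :> R := normal_peak_gt0 (oner_neq0 R).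
have ub (z : xs N * ys N) : law z * - ln (psi i D z.2) <= law z * (- ln (mesh N) + ln (Num.sqrt t) - ln (normal_peak 1) +
   ((1 + mesh N) * (\sum_j resid i D j * val_ N (z.2 j)) ^+ 2 + mesh N + mesh N * mesh N) / (2 * t)).
  rewrite ler_wpM2l ?law_ge0// /psi -/t.
  set u := \sum_j resid i D j * val_ N (z.2 j).
  set c := alpha #|D| * _; have uE : pos (halfw N).*2 N (z.2 i) - c = u.
    rewrite /u; under eq_bigr do rewrite mulrBl; rewrite sumrB; congr (_ - _).
      by rewrite (bigD1 i)//= eqxx mul1r big1 ?addr0// => j /negbTE ->; rewrite mul0r.
    rewrite /c mulr_sumr big_mkcond/=; apply: eq_bigr => j _; case: ifP => //; by rewrite mul0r.
  have := cp_lower (halfw N).*2 N c (z.2 i) (st0 #|D|); rewrite uE -/t => h.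
  have w0 : 0 < normal_peak 1 * expR (- (`|u| + mesh N) ^+ 2 / (2 * Num.sqrt t ^+ 2)) * (mesh N / Num.sqrt t).
    by apply: mulr_gt0; [apply: mulr_gt0 => //; exact: expR_gt0|apply: divr_gt0 => //; exact: st0].
  move: h; rewrite -ler_ln ?posrE ?cp_gt0 ?st0//.
  rewrite lnM; [|by rewrite posrE; apply: mulr_gt0 => //; exact: expR_gt0|by rewrite posrE; apply: divr_gt0 => //; exact: st0].
  rewrite ln_div ?posrE ?st0// lnM; [|by rewrite posrE|by rewrite posrE expR_gt0].
  rewrite expRK sqr_sqrtr ?(ltW t0)// mulNr => h.
  have hu : (`|u| + mesh N) ^+ 2 / (2 * t) <= ((1 + mesh N) * u ^+ 2 + mesh N + mesh N * mesh N) / (2 * t).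
    rewrite ler_pM2r ?invr_gt0 ?mulr_gt0// -(real_normK (num_real u)).
    have := mulr_ge0 (ltW mN) (sqr_ge0 (`|u| - 1)); nra.
  lra.
apply: le_lt_trans (ler_sum _ (fun z _ => ub z)) _.
rewrite (eq_bigr (fun z : xs N * ys N => (- ln (mesh N) + ln (Num.sqrt t) - ln (normal_peak 1) + (mesh N + mesh N * mesh N) / (2 * t)) * law z +
   (1 + mesh N) / (2 * t) * (law z * (\sum_j resid i D j * val_ N (z.2 j)) ^+ 2))); last by move=> z _; rewrite !mulrDl; ring.
rewrite big_split/= -!mulr_sumr law_sum mulr1 -/(E N) /ent0; move: gN; rewrite /g.
rewrite (_ : ((1 + mesh N) * E N + mesh N + mesh N * mesh N) / (2 * t) = (mesh N + mesh N * mesh N) / (2 * t) + (1 + mesh N) / (2 * t) * E N); last first.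
  by rewrite !mulrDl; ring.
lra.
Unshelve. all: by end_near.
Qed.

Definition coef_in (D : {set 'I_l}) i j : R := if j \in D then be D i j else 0.
Definition est N (D : {set 'I_l}) i (y : ys N) : R := \sum_j coef_in D i j * val_ N (y j).
(* Excess of the squared error of the linear estimate over that of the zero estimate. *)
Definition Fq N (D : {set 'I_l}) (z : xs N * ys N) : R :=
  \sum_(i in D) (est D i z.2 ^+ 2 - 2 * (cm i z.1 * est D i z.2)).

Lemma est_loc N (D : {set 'I_l}) i (y y' : ys N) : {in D, y =1 y'} -> est D i y = est D i y'.
Proof.
move=> h; apply: eq_bigr => j _; rewrite /coef_in; case: ifP => jD; rewrite ?mul0r//.
by rewrite h.
Qed.

Lemma Fq_loc N (D : {set 'I_l}) x (y y' : ys N) : {in D, y =1 y'} -> Fq D (x, y) = Fq D (x, y').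
Proof. by move=> h; apply: eq_bigr => i _ /=; rewrite (est_loc i h). Qed.

Lemma Fq_lim (D : {set 'I_l}) : (fun N => \sum_(z : xs N * ys N) law z * Fq D z) @ \oo -->
  \sum_(i in D) (\sum_j \sum_j' coef_in D i j * coef_in D i j' * Mlim j j' -
     2 * \sum_j coef_in D i j * mean P (fun w => X i w * S j w)).
Proof.
rewrite (_ : (fun N => _) = (fun N => \sum_(i in D) (\sum_(z : xs N * ys N) law z * est D i z.2 ^+ 2 -
    2 * \sum_(z : xs N * ys N) law z * (cm i z.1 * est D i z.2)))); last first.
  apply/funext => N; under eq_bigr do rewrite mulr_sumr.
  rewrite exchange_big/=; apply: eq_bigr => i _; rewrite mulr_sumr -sumrB; apply: eq_bigr => z _.
  by ring.
apply: cvg_fsum => i _; apply: cvgB; first exact: law_quad_lim.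
by apply: cvgMl_tmp; exact: law_cross_lim.
Qed.

End Quantized.

Lemma gauss_cov (R : realType) (d : measure_display) (T : measurableType d) (P : probability T R) (u v : T -> R) (s c t : R) :
  (forall a b, gauss1 P (fun x => a * u x + b * v x) (a ^+ 2 * s + 2 * a * b * c + b ^+ 2 * t)) ->
  mean P (fun x => u x * v x) = c.
Proof.
move=> h.
have gu : gauss1 P u s.
  have := h 1 0; rewrite (_ : (fun x => _) = u); last by apply/funext => x; ring.
  by rewrite (_ : _ + _ = s)//; ring.
have gv : gauss1 P v t.
  have := h 0 1; rewrite (_ : (fun x => _) = v); last by apply/funext => x; ring.
  by rewrite (_ : _ + _ = t)//; ring.
have [Lu Eu] := gauss1_sq gu; have [Lv Ev] := gauss1_sq gv.
have [Ls Es] := gauss1_sq (h 1 1).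
have -> : mean P (fun x => u x * v x) = mean P (fun x => 2^-1 * ((1 * u x + 1 * v x) ^+ 2 - (u x ^+ 2 + v x ^+ 2))).
  by apply: eq_mean => x; field.
rewrite meanZ; last by apply: L1B => //; exact: L1D.
by rewrite meanB//; [rewrite meanD// Es Eu Ev; field|exact: L1D].
Qed.

Section SmeasFun.
Context {R : realType} {d : measure_display} {T : measurableType d}.
Variables (K : eqType) (F : K -> set (set T)).

Lemma smeas_comp (I : pred K) (f : T -> R) (h : R -> R) : smeas F I f -> measurable_fun setT h -> smeas F I (fun x => h (f x)).
Proof. by move=> sf mh B mB; rewrite -[X in sigI F I X]/(f @^-1` (h @^-1` B)); apply: sf; rewrite -[X in measurable X]setTI; exact: mh. Qed.

Lemma smeas_add (I : pred K) (f g : T -> R) : smeas F I f -> smeas F I g -> smeas F I (fun x => f x + g x).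
Proof. by move=> sf sg; apply/smeasP; apply: measurable_funD; exact/smeasP. Qed.
Lemma smeas_mul (I : pred K) (f g : T -> R) : smeas F I f -> smeas F I g -> smeas F I (fun x => f x * g x).
Proof. by move=> sf sg; apply/smeasP; apply: measurable_funM; exact/smeasP. Qed.
End SmeasFun.

(** * Block laws of the quantised process and its squared errors *)

Section Stationary.
Context {R : realType} {dT : measure_display} {Omega : measurableType dT}.
Variables (P : probability Omega R) (l : nat) (gX rX gZ rZ gS rS : R).
Variables (X Z : nat -> 'I_l -> Omega -> R).
Hypotheses (hgS : gS = gX + gZ) (hrS : rS * gS = rX * gX + rZ * gZ).
Hypothesis hX : forall t, gaussian_vec P (X t) (eqcov l gX rX).
Hypothesis hZ : forall t, gaussian_vec P (Z t) (eqcov l gZ rZ).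
Hypothesis hXZ : indep_signal_noise P X Z.
Hypothesis hiid : indep_times P X Z.

Let mX t i : measurable_fun setT (X t i). Proof. by have [] := hX t. Qed.
Let mZ t i : measurable_fun setT (Z t i). Proof. by have [] := hZ t. Qed.

Definition sig (t : nat) (i : 'I_l) (w : Omega) : R := X t i w + Z t i w.
Let lX := lam2 gX rX.
Let bX := rX * gX.
Let lS := lam2 gS rS.
Let bS := rS * gS.

Lemma measurable_sig t i : measurable_fun setT (sig t i).
Proof. exact: measurable_funD. Qed.

Lemma sig_joint t i (a : R) (b : 'I_l -> R) :
  gauss1 P (fun w => a * X t i w + \sum_j b j * sig t j w)
    (a ^+ 2 * (lX + bX) + 2 * a * (lX * b i + bX * \sum_j b j) + (lS * (\sum_j b j ^+ 2) + bS * (\sum_j b j) ^+ 2)).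
Proof.
have := proc_lin hX hZ hXZ hiid (s := [:: t]) (fun _ j => b j + (if j == i then a else 0)) (fun _ => b) isT.
rewrite big_seq1 (_ : (fun w => _) = (fun w => a * X t i w + \sum_j b j * sig t j w)); last first.
  apply/funext => w; rewrite big_seq1 /sig; under [in RHS]eq_bigr do rewrite mulrDr.
  under [in LHS]eq_bigr do rewrite mulrDl.
  rewrite [in RHS]big_split/= big_split/= addrA; congr (_ + _); rewrite addrC; congr (_ + _).
  by rewrite (bigD1 i)//= eqxx big1 ?addr0// => j /negbTE ->; rewrite mul0r.
congr (gauss1 P _ _); rewrite /qform big_split/=.
have e1 : \sum_j (if j == i then a else 0) = a.
  by rewrite (bigD1 i)//= eqxx big1 ?addr0// => j /negbTE ->.
have e2 : \sum_j (b j + (if j == i then a else 0)) ^+ 2 = \sum_j b j ^+ 2 + 2 * a * b i + a ^+ 2.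
  rewrite (eq_bigr (fun j => b j ^+ 2 + (if j == i then 2 * a * b i + a ^+ 2 else 0))); last first.
    by move=> j _; case: eqP => [->|_]; ring.
  by rewrite big_split/= -addrA; congr (_ + _); rewrite (bigD1 i)//= eqxx big1 ?addr0// => j /negbTE ->.
rewrite e1 e2 -/lX -/bX /lS (lam2S hgS hrS) -/lX /bS hrS -/bX; ring.
Qed.

Lemma sum_delta (i : 'I_l) (c : R) (f : 'I_l -> R) : \sum_j (if j == i then c else 0) * f j = c * f i.
Proof. by rewrite (bigD1 i)//= eqxx big1 ?addr0// => j /negbTE ->; rewrite mul0r. Qed.
Lemma sum_delta1 (i : 'I_l) (c : R) : \sum_j (if j == i then c else 0) = c.
Proof. by rewrite (bigD1 i)//= eqxx big1 ?addr0// => j /negbTE ->. Qed.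

Lemma sig_cross t i j : mean P (fun w => X t i w * sig t j w) = (if j == i then lX else 0) + bX.
Proof.
apply: (gauss_cov (s := lX + bX) (t := lS + bS)) => a b.
have := sig_joint t i a (fun j' => if j' == j then b else 0).
under eq_fun do rewrite sum_delta; rewrite sum_delta1 (_ : \sum_j' _ ^+ 2 = b ^+ 2); last first.
  by rewrite -[RHS](sum_delta1 j); apply: eq_bigr => j' _; case: eqP; rewrite ?expr0n.
congr (gauss1 P _ _); rewrite (eq_sym i j); case: eqP => _; ring.
Qed.

Lemma sig_cov t i j : mean P (fun w => sig t i w * sig t j w) = (if j == i then lS else 0) + bS.
Proof.
apply: (gauss_cov (s := lS + bS) (t := lS + bS)) => a b.
have := sig_joint t i 0 (fun j' => (if j' == i then a else 0) + (if j' == j then b else 0)).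
rewrite (_ : (fun w => _) = (fun w => a * sig t i w + b * sig t j w)); last first.
  by apply/funext => w; under eq_bigr do rewrite mulrDl; rewrite big_split/= !sum_delta mul0r add0r.
rewrite big_split/= !sum_delta1 (_ : \sum_j' _ ^+ 2 = a ^+ 2 + b ^+ 2 + (if j == i then 2 * a * b else 0)); last first.
  rewrite (eq_bigr (fun j' => ((if j' == i then a else 0) * a + (if j' == j then b else 0) * b) +
     (if j' == i then 2 * a else 0) * (if j' == j then b else 0))); last first.
    by move=> j' _; case: eqP => _; case: eqP => _; ring.
  rewrite big_split/= big_split/= !sum_delta -!expr2 (eq_sym j i); case: eqP => _; ring.
congr (gauss1 P _ _); rewrite (eq_sym i j); case: (j =P i) => _; ring.
Qed.

Lemma X_gauss t i : gauss1 P (X t i) (lX + bX).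
Proof.
have := sig_joint t i 1 (fun=> 0); rewrite (_ : (fun w => _) = X t i); last first.
  by apply/funext => w; rewrite big1 ?addr0 ?mul1r// => j _; rewrite mul0r.
by congr (gauss1 P _ _); rewrite !big1 ?expr0n//= => *; ring.
Qed.

Lemma sig_gauss t i : gauss1 P (sig t i) (lS + bS).
Proof.
have := sig_joint t i 0 (fun j => if j == i then 1 else 0); rewrite (_ : (fun w => _) = sig t i); last first.
  by apply/funext => w; rewrite mul0r add0r sum_delta mul1r.
congr (gauss1 P _ _); rewrite sum_delta1 (_ : \sum_j _ ^+ 2 = 1); first by ring.
by rewrite -[RHS](sum_delta1 i); apply: eq_bigr => j' _; case: eqP; rewrite ?expr1n ?expr0n.
Qed.

Let E N (x : {ffun 'I_l -> 'I_(na N)}) : set ('I_l -> R) := [set f | forall i, quant N (f i) = x i].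

Let E_rect N (x : {ffun 'I_l -> 'I_(na N)}) : <<s @rectangles R 'I_l >> (E x).
Proof.
apply: sub_sigma_algebra; exists (fun i => quant N @^-1` [set x i]); split=> // i.
exact: quant_meas.
Qed.

Let E_qind N (x : {ffun 'I_l -> 'I_(na N)}) t w : qind (sig t) x w = \1_(E x) (fun i => sig t i w).
Proof.
rewrite /qind indicE; case: eqP => h.
  by rewrite mem_set// => i; rewrite -h ffunE.
by rewrite memNset// => h2; apply: h; apply/ffunP => i; rewrite ffunE.
Qed.

Lemma PX_stat N i t (x : {ffun 'I_l -> 'I_(na N)}) : PX P (X t) (sig t) i x = PX P (X 0) (sig 0) i x.
Proof.
rewrite /PX; under eq_mean do rewrite E_qind; under [RHS]eq_mean do rewrite E_qind.
have := @gauss_law_w R _ _ _ _ P P _ (sig t) (sig 0) (fun b => lS * (\sum_j b j ^+ 2) + bS * (\sum_j b j) ^+ 2)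
  (measurable_sig t) (measurable_sig 0) (X t i) (X 0 i) (lX + bX) (lX + bX) (fun b => lX * b i + bX * \sum_j b j) (E x).
by apply => // a b; exact: sig_joint.
Qed.

Lemma PS_stat N t (x : {ffun 'I_l -> 'I_(na N)}) : PS P (sig t) x = PS P (sig 0) x.
Proof.
have l0 (i : 'I_l) (b : 'I_l -> R) u : gauss1 P (fun w => \sum_j b j * sig u j w) (lS * (\sum_j b j ^+ 2) + bS * (\sum_j b j) ^+ 2).
  have := sig_joint u i 0 b; rewrite (_ : (fun w => _) = (fun w => \sum_j b j * sig u j w)); last first.
    by apply/funext => w; rewrite mul0r add0r.
  by congr (gauss1 P _ _); ring.
have mE u : measurable [set w | E x (fun i => sig u i w)].
  rewrite (_ : [set w | _] = qind (sig u) x @^-1` [set 1]).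
    by rewrite -[X in measurable X]setTI; apply: (measurable_qind (measurable_sig u) x) => //; exact: measurable_set1.
  apply/seteqP; split => w /=; rewrite E_qind indicE; first by move=> h; rewrite mem_set.
  by case: (boolP (_ \in _)) => [/set_mem//|_ /eqP]; rewrite eq_sym oner_eq0.
have e u : PS P (sig u) x = fine (P [set w | E x (fun i => sig u i w)]).
  rewrite -mean_indic//; apply: eq_mean => w; rewrite E_qind !indicE.
  by congr (_%:R); apply/idP/idP => /set_mem h; apply/mem_set.
rewrite !e; congr fine; have [i|n0] := pickP (@predT 'I_l).
  move=> _; apply: (gauss_law (q := fun b => lS * (\sum_j b j ^+ 2) + bS * (\sum_j b j) ^+ 2)) => //.
  - exact: measurable_sig.
  - exact: measurable_sig.
  - by move=> b; exact: (l0 i).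
  - by move=> b; exact: (l0 i).
by congr (P _); apply/funext => w; congr E; apply/funext => i; have := n0 i.
Qed.

Let F t := sigma_of (fun p : 'I_l + 'I_l => match p with inl i => X t i | inr i => Z t i end).

Let sX t i : smeas F (pred1 t) (X t i). Proof. exact: proc_smeas. Qed.
Let sZ t i : smeas F (pred1 t) (Z t i).
Proof.
move=> B mB; apply: sub_sigma_algebra; exists t => /=; first exact: eqxx.
exact: (@sigma_of_gen _ _ _ _ _ (inr i)).
Qed.

Let s_qind N t (x : {ffun 'I_l -> 'I_(na N)}) : smeas F (pred1 t) (qind (sig t) x).
Proof.
rewrite (_ : qind _ _ = fun w => \prod_i \1_(quant N @^-1` [set x i]) (sig t i w)); last by apply/funext => w; exact: qindE.
apply: smeas_prod => i _; apply: (smeas_comp (h := \1_(quant N @^-1` [set x i]))).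
  by apply: smeas_add.
by apply: measurable_indic; exact: quant_meas.
Qed.

Variables (N n : nat).
Local Notation xs := {ffun 'I_l -> 'I_(na N)}.
Definition sword (w : Omega) : {ffun 'I_n -> xs} := [ffun t : 'I_n => qv (sig t) N w].

Lemma swordE (s : {ffun 'I_n -> xs}) w : (sword w == s)%:R = \prod_(t < n) qind (sig t) (s t) w.
Proof.
case: eqP => [<-|ne]; first by rewrite big1// => t _; rewrite /qind ffunE eqxx.
have [t nt] : exists t, sword w t != s t.
  apply: contrapT => /forallNP h; apply: ne; apply/ffunP => t.
  by apply/eqP; apply: contrapT => nt; apply: (h t); apply/negP.
by rewrite (bigD1 t)//= /qind; move: nt; rewrite ffunE => /negbTE ->; rewrite mul0r.
Qed.

Lemma word_law (s : {ffun 'I_n -> xs}) : mean P (fun w => (sword w == s)%:R) = \prod_t PS P (sig 0) (s t).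
Proof.
under eq_mean do rewrite swordE.
have := @proc_prod R _ Omega P l gX rX gZ rZ X Z hX hZ hiid 'I_n (fun t => pred1 (t : nat)) (fun t w => qind (sig t) (s t) w).
case=> [t t' u /eqP -> /eqP /val_inj //|t|t|_ ->].
- exact: s_qind.
- exact: (qind_L1 P (measurable_sig t)).
- by apply: eq_bigr => t _; exact: PS_stat.
Qed.

(** Independence over time separates letter t from the others, and stationarity moves it to time
    0. *)
Lemma word_law_X i (t : 'I_n) (s : {ffun 'I_n -> xs}) :
  mean P (fun w => X t i w * (sword w == s)%:R) = cm P (X 0) (sig 0) i (s t) * \prod_t PS P (sig 0) (s t).
Proof.
have LX : L1 P (X t i) := gauss1_L1 (X_gauss t i).
have := @proc_prod R _ Omega P l gX rX gZ rZ X Z hX hZ hiid 'I_n (fun u => pred1 (u : nat)) (fun u w => (if u == t then X t i w else 1) * qind (sig u) (s u) w).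
case=> [u u' v /eqP -> /eqP /val_inj //|u|u|_ h].
- case: eqP => [->|_]; first by apply: smeas_mul; [exact: sX|exact: s_qind].
  by rewrite (_ : (fun w => _) = qind (sig u) (s u)); [exact: s_qind|apply/funext => w; rewrite mul1r].
- case: eqP => [->|_]; first exact: L1_Mb LX (measurable_qind (measurable_sig t) _) (qind_bnd _ _).
  by rewrite (_ : (fun w => _) = qind (sig u) (s u)); [exact: (qind_L1 P (measurable_sig u))|apply/funext => w; rewrite mul1r].
transitivity (mean P (fun w => \prod_(u < n) ((if u == t then X t i w else 1) * qind (sig u) (s u) w))).
  apply: eq_mean => w; rewrite swordE big_split/=; congr (_ * _).
  by rewrite (bigD1 t)//= eqxx big1 ?mulr1// => u /negbTE ->.
rewrite h (bigD1 t)//= eqxx [in RHS](bigD1 t)//= mulrA; congr (_ * _).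
  transitivity (PX P (X t) (sig t) i (s t)) => //.
  rewrite PX_stat mulrC; apply: PXE => j; [exact: mX|exact: measurable_sig|exact: (gauss1_sq (X_gauss 0 j)).1].
apply: eq_bigr => u /negbTE ->; rewrite -(PS_stat u); apply: eq_mean => w.
by rewrite mul1r.
Qed.

Lemma measurable_sword (s : {ffun 'I_n -> xs}) : measurable_fun setT (fun w => (sword w == s)%:R : R).
Proof.
rewrite (_ : (fun w => _) = (fun w => \prod_(t < n) qind (sig t) (s t) w)); last by apply/funext => w; exact: swordE.
by apply: measurable_prod => t _; exact: (measurable_qind (measurable_sig t) (s t)).
Qed.

Lemma sword_sum (h : Omega -> R) (G : {ffun 'I_n -> xs} -> R) : L1 P h ->
  mean P (fun w => h w * G (sword w)) = \sum_s mean P (fun w => h w * (sword w == s)%:R) * G s.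
Proof.
move=> Lh; have Ls s : L1 P (fun w => h w * (sword w == s)%:R) by exact: L1_Mbool (measurable_sword s) Lh.
rewrite (@eq_mean _ _ _ _ _ (fun w => \sum_s (h w * (sword w == s)%:R) * G s)) => [|w]; last first.
  rewrite (bigD1 (sword w))//= eqxx mulr1 big1 ?addr0// => s ns.
  by rewrite eq_sym (negbTE ns) mulr0 mul0r.
rewrite mean_sum => [|s _]; last exact: L1Zr.
by apply: eq_bigr => s _; rewrite meanZr.
Qed.

Definition wl (s : {ffun 'I_n -> xs}) : R := \prod_t PS P (sig 0) (s t).

Lemma wl_ge0 s : 0 <= wl s. Proof. by apply: prodr_ge0 => t _; exact: PS_ge0. Qed.

(** The optimal estimate is at least as good as any function g of the message: on each class
    [2 * A * g - q * g ^+ 2 <= A ^+ 2 / q], where A = 0 whenever q = 0. *)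
Lemma class_corr (I C : finType) (kap : I -> C) (p a : I -> R) (g : C -> R) : (forall s, 0 <= p s) ->
  (forall s, p s = 0 -> a s = 0) ->
  \sum_s (2 * a s * g (kap s) - p s * g (kap s) ^+ 2) <=
  \sum_c (\sum_s a s * (kap s == c)%:R) ^+ 2 / \sum_s p s * (kap s == c)%:R.
Proof.
move=> p0 pa.
rewrite (eq_bigr (fun s => \sum_c (2 * a s * g c - p s * g c ^+ 2) * (kap s == c)%:R)); last by move=> s _; rewrite sum_eqb.
rewrite exchange_big/=; apply: ler_sum => c _.
set A := \sum_s a s * _; set q := \sum_s p s * _.
have -> : \sum_s (2 * a s * g c - p s * g c ^+ 2) * (kap s == c)%:R = 2 * A * g c - q * g c ^+ 2.
  rewrite (eq_bigr (fun s => 2 * g c * (a s * (kap s == c)%:R) - g c ^+ 2 * (p s * (kap s == c)%:R))) => [|s _]; last by ring.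
  by rewrite sumrB -!mulr_sumr -/A -/q; ring.
have q0 : 0 <= q by apply: sumr_ge0 => s _; rewrite mulr_ge0.
move: q0; rewrite le_eqVlt => /orP[/eqP qe|q0]; last first.
  rewrite ler_pdivlMr//; have := sqr_ge0 (A - q * g c); nra.
have z s : p s * (kap s == c)%:R = 0.
  have := qe; rewrite /q => /esym/eqP; rewrite psumr_eq0 => [/allP h|i _]; last by rewrite mulr_ge0.
  by apply/eqP; apply: h; rewrite mem_index_enum.
have -> : A = 0.
  rewrite /A big1// => s _; have := z s; case: (kap s == c); rewrite ?mulr1 ?mulr0//.
  exact: pa.
by rewrite -qe expr0n mulr0 !mul0r subrr.
Qed.

Variables (M : nat) (enc : 'I_l -> {ffun 'I_n -> 'I_(na N)} -> option 'I_M).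

(** Symbol 0 signals a word without colour; hence the alphabet of M + 1 letters. *)
Definition o2i (o : option 'I_M) : 'I_M.+1 := if o is Some c then lift ord0 c else ord0.
Definition i2o (v : nat) : option 'I_M := if v is v'.+1 then insub v' else None.
Lemma o2iK o : i2o (o2i o) = o.
Proof. by case: o => [c|] //=; rewrite /bump /= add0n; exact: valK. Qed.

Definition qword (f : 'I_n -> R) : {ffun 'I_n -> 'I_(na N)} := [ffun t => quant N (f t)].
Definition qenc (i : 'I_l) (f : 'I_n -> R) : 'I_M.+1 := o2i (enc i (qword f)).

Lemma qenc_meas i c : borelRn (qenc i @^-1` [set c]).
Proof.
have mq (a : {ffun 'I_n -> 'I_(na N)}) : measurable_fun setT (fun f : RV R 'I_n => (qword f == a)%:R : R).
  rewrite (_ : (fun f => _) = (fun f : RV R 'I_n => \prod_t \1_(quant N @^-1` [set a t]) (f t))).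
    apply: measurable_prod => t _; apply: measurableT_comp; last exact: measurable_coord.
    by apply: measurable_indic; exact: quant_meas.
  apply/funext => f; case: eqP => [<-|ne].
    by rewrite big1// => t _; rewrite indicE mem_set//= ffunE.
  have [t nt] : exists t, quant N (f t) != a t.
    apply: contrapT => /forallNP h; apply: ne; apply/ffunP => t; rewrite ffunE.
    by apply/eqP; apply: contrapT => nt; apply: (h t); apply/negP.
  by rewrite (bigD1 t)//= indicE memNset ?mul0r//=; apply/eqP.
have mG : measurable_fun setT (fun f : RV R 'I_n => \sum_a (o2i (enc i a) == c)%:R * (qword f == a)%:R : R).
  by apply: measurable_sum => a; apply: measurable_funM => //; exact: mq.
have GE (f : RV R 'I_n) : \sum_a (o2i (enc i a) == c)%:R * (qword f == a)%:R = (qenc i f == c)%:R :> R.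
  by rewrite sum_eqb.
have := mG measurableT [set 1] (measurable_set1 1); rewrite setTI.
rewrite (_ : _ @^-1` _ = qenc i @^-1` [set c]); first by [].
apply/seteqP; split => f /=; rewrite GE; first by case: eqP => // _ /eqP; rewrite eq_sym oner_eq0.
by move=> ->; rewrite eqxx.
Qed.

Variable dc : {set 'I_l} -> {ffun 'I_l -> option 'I_M} -> {ffun 'I_n -> {ffun 'I_l -> 'I_(nb N)}}.
Hypothesis dc_loc : forall (D : {set 'I_l}) (col col' : {ffun 'I_l -> option 'I_M}),
  {in D, col =1 col'} -> dc D col = dc D col'.
Variable be : {set 'I_l} -> 'I_l -> 'I_l -> R.
Hypothesis hgX : lX + bX = gX.

(** The conditional expectation given the messages of A does at least as well as the linear estimate
    formed from the decoded outputs; by [dc_loc] the latter is a function of these messages only. *)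
Lemma mse_bound (A : {set 'I_l}) :
  (\sum_(i in A) \sum_(t < n) mse P X Z qenc A i t <=
   (#|A|%:R * n%:R * gX + \sum_s wl s * \sum_t Fq P (X 0) (sig 0) be A (s t, dc A [ffun i => enc i (word s i)] t))%:E)%E.
Proof.
have [m [f [fi AE]]] : exists m (f : 'I_m -> 'I_l), injective f /\ A = [set f i | i : 'I_m]%SET.
  exists #|A|, (fun i => enum_val i); split; first exact: enum_val_inj.
  apply/setP => i; apply/idP/imsetP => [iA|[j _ ->]]; last exact: enum_valP.
  by exists (enum_rank_in iA i) => //; rewrite enum_rankK_in.
have sqX t i : L1 P (fun w => X t i w ^+ 2) := (gauss1_sq (X_gauss t i)).1.
have hc := mse_corr mX mZ sqX qenc_meas f; rewrite -AE in hc.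
pose Sf (t : 'I_n) (i : 'I_m) := src X Z t (f i).
pose encf (i : 'I_m) := encK qenc (f i).
pose colof (c : {ffun 'I_m -> 'I_(\max_(i < l) M.+1).+1}) : {ffun 'I_l -> option 'I_M} :=
  [ffun i => if [pick j | f j == i] is Some j then i2o (c j) else None].
pose kap (s : {ffun 'I_n -> xs}) : {ffun 'I_m -> 'I_(\max_(i < l) M.+1).+1} := [ffun j => inord (o2i (enc (f j) (word s (f j))))].
have kapE w : codew Sf encf w = kap (sword w).
  apply/ffunP => j; rewrite !ffunE /encf /encK /qenc; congr (inord (o2i (enc _ _))).
  by apply/ffunP => t; rewrite !ffunE.
have bM (v : 'I_M.+1) (j : 'I_m) : (v < (\max_(i < l) M.+1).+1)%N.
  by apply: (leq_trans (ltn_ord v)); apply: leqW; exact: (leq_bigmax (F := fun=> M.+1) (f j)).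
have colE s : dc A (colof (kap s)) = dc A [ffun i => enc i (word s i)].
  apply: dc_loc => i; rewrite {1}AE => /imsetP[j _ ->]; rewrite !ffunE.
  case: pickP => [j' /eqP /fi ->|/(_ j)]; last by rewrite eqxx.
  by rewrite ffunE inordK ?o2iK//; exact: bM.
have corr_ge i (t : 'I_n) : i \in A -> \sum_s wl s * (2 * (cm P (X 0) (sig 0) i (s t) * est be A i (dc A [ffun i => enc i (word s i)] t)) -
    est be A i (dc A [ffun i => enc i (word s i)] t) ^+ 2) <= corr P Sf encf (X t i).
  move=> iA.
  have e1 c : mean P (fun w => X t i w * (codew Sf encf w == c)%:R) = \sum_(s : {ffun 'I_n -> xs}) (cm P (X 0) (sig 0) i (s t) * wl s) * (kap s == c)%:R.
    under eq_mean do rewrite kapE.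
    rewrite (sword_sum (fun s => (kap s == c)%:R) (gauss1_L1 (X_gauss t i))).
    by apply: eq_bigr => s _; rewrite word_law_X.
  have e2 c : pS P Sf encf c = \sum_s wl s * (kap s == c)%:R.
    rewrite /pS; under eq_mean do rewrite kapE -[_%:R]mul1r.
    rewrite (sword_sum (fun s => (kap s == c)%:R) (L1_cst P 1)).
    by apply: eq_bigr => s _; rewrite /wl -word_law; congr (_ * _); apply: eq_mean => w; rewrite mul1r.
  rewrite /corr; under [leRHS]eq_bigr do rewrite e1 e2.
  have a0 (s : {ffun 'I_n -> xs}) : wl s = 0 -> cm P (X 0) (sig 0) i (s t) * wl s = 0 by move=> ->; rewrite mulr0.
  have := class_corr kap (fun c => est be A i (dc A (colof c) t)) wl_ge0 a0.
  apply: le_trans; apply: le_of_eq; apply: eq_bigr => s _; rewrite colE; ring.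
rewrite (eq_bigr (fun i => (\sum_(t < n) (gX - corr P Sf encf (X t i)))%:E)); last first.
  move=> i _; rewrite -sumEFin; apply: eq_bigr => t _; rewrite hc; congr (_ - _)%:E.
  by rewrite (gauss1_sq (X_gauss t i)).2.
rewrite sumEFin lee_fin.
apply: (@le_trans _ _ (\sum_(i in A) \sum_(t < n) (gX - \sum_s wl s * (2 * (cm P (X 0) (sig 0) i (s t) * est be A i (dc A [ffun i => enc i (word s i)] t)) -
    est be A i (dc A [ffun i => enc i (word s i)] t) ^+ 2)))).
  by apply: ler_sum => i iA; apply: ler_sum => t _; rewrite lerD2l lerN2; exact: corr_ge.
rewrite (eq_bigr (fun i => n%:R * gX + \sum_s wl s * \sum_(t < n) (est be A i (dc A [ffun i => enc i (word s i)] t) ^+ 2 -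
   2 * (cm P (X 0) (sig 0) i (s t) * est be A i (dc A [ffun i => enc i (word s i)] t))))); last first.
  move=> i _; rewrite sumrB sumr_const card_ord mulr_natl; congr (_ + _).
  rewrite exchange_big/= -sumrN; apply: eq_bigr => s _; rewrite mulr_sumr -sumrN; apply: eq_bigr => t _; ring.
rewrite big_split/= sumr_const -[(_ * gX) *+ _]mulr_natl mulrA lerD2l exchange_big/=.
apply: ler_sum => s _; rewrite -mulr_sumr ler_wpM2l ?wl_ge0//.
by rewrite exchange_big/=.
Qed.

End Stationary.

(** The last b terms of a nonincreasing sequence average to at most the overall mean. Applied to
    prediction entropies, it reduces the rate conditions for all b to that for b = k. *)
Lemma tail_avg (R : realFieldType) (f : nat -> R) (k b : nat) : (0 < b <= k)%N ->
  (forall m m', (m <= m' < k)%N -> f m' <= f m) ->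
  k%:R * (\sum_(k - b <= m < k) f m) <= b%:R * (\sum_(0 <= m < k) f m).
Proof.
move=> /andP[b0 bk] fd; set a := (k - b)%N; have ak : (a < k)%N by rewrite /a ltn_subrL b0 (leq_trans b0).
rewrite [X in _ <= _ * X](big_cat_nat (leq0n a) (ltnW ak))/=.
have kE : k%:R = a%:R + b%:R :> R by rewrite -natrD /a subnK.
have h1 : \sum_(a <= m < k) f m <= b%:R * f a.
  have -> : b%:R * f a = \sum_(a <= m < k) f a by rewrite sumr_const_nat /a subKn// mulr_natl.
  by apply: ler_sum_nat => m /andP[h1 h2]; apply: fd; rewrite h1.
have h2 : a%:R * f a <= \sum_(0 <= m < a) f m.
  have -> : a%:R * f a = \sum_(0 <= m < a) f a by rewrite sumr_const_nat subn0 mulr_natl.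
  by apply: ler_sum_nat => m /andP[_ h2]; apply: fd; rewrite (ltnW h2).
rewrite kE mulrDl mulrDr lerD2r; apply: le_trans (ler_wpM2l (ler0n R a) h1) _.
by rewrite mulrCA ler_wpM2l.
Qed.

(** * Achievability at the test channel *)

Section Achieve.
Context {R : realType} {dT : measure_display} {Omega : measurableType dT}.
Variables (P : probability Omega R) (l : nat) (hl : (2 <= l)%N) (gX rX gZ rZ gS rS : R).
Hypotheses (psdX : psd (eqcov l gX rX)) (psdZ : psd (eqcov l gZ rZ)).
Hypotheses (hgS : gS = gX + gZ) (hrS : rS * gS = rX * gX + rZ * gZ) (hgX : 0 < gX).
Variables (X Z : nat -> 'I_l -> Omega -> R).
Hypothesis hX : forall t, gaussian_vec P (X t) (eqcov l gX rX).
Hypothesis hZ : forall t, gaussian_vec P (Z t) (eqcov l gZ rZ).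
Hypothesis hXZ : indep_signal_noise P X Z.
Hypothesis hiid : indep_times P X Z.

Let mX t i : measurable_fun setT (X t i). Proof. by have [] := hX t. Qed.
Let mZ t i : measurable_fun setT (Z t i). Proof. by have [] := hZ t. Qed.

Variables (k : nat) (hk : (0 < k <= l)%N) (q : R) (q0 : 0 < q).
Let L := lam2 gS rS + q.
Let ro := rS * gS.
(** All-ones eigenvalue of the covariance of m test-channel outputs, in an affine form that yields L
    at m = 0. *)
Let den (m : nat) : R := L + m%:R * ro.

Let L0 : 0 < L.
Proof. by rewrite ltr_wpDl// (lam2S hgS hrS) addr_ge0//; exact: (psd_lam2 hl). Qed.

Let denE m : den m = lam1 gS rS m + q.
Proof. by rewrite /den /L -lam1_eig -/ro; ring. Qed.

Let den0 m : (m <= l)%N -> 0 < den m.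
Proof. by move=> ml; rewrite denE ltr_wpDl// (lam1S hgS hrS) addr_ge0//; exact: (psd_lam1 hl). Qed.

Let alpha (m : nat) : R := ro / den m.
(** Innovation variance of one output given m others, the ratio of the determinants for m + 1 and m
    outputs. The value 1 beyond l keeps it positive for every m. *)
Let tau (m : nat) : R := if (m < l)%N then L * den m.+1 / den m else 1.

Let tau0 m : 0 < tau m.
Proof. by rewrite /tau; case: ifP => // ml; rewrite divr_gt0 ?mulr_gt0 ?den0 ?(ltnW ml). Qed.

Let tauE m : (m < l)%N -> tau m = L + L * (ro / den m).
Proof.
move=> ml; have d0 := den0 (ltnW ml); rewrite /tau ml; have -> : den m.+1 = den m + ro by rewrite /den -natr1; ring.
by field; rewrite gt_eqF.
Qed.

(** Cross-multiplication leaves a multiple of [ro ^+ 2], so either sign of the correlation is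
    covered. *)
Let tau_decr m m' : (m <= m' < l)%N -> tau m' <= tau m.
Proof.
move=> /andP[mm ml]; have ml' : (m < l)%N := leq_ltn_trans mm ml.
rewrite !tauE// lerD2l ler_pM2l// ler_pdivlMr ?den0 ?(ltnW ml')// mulrAC ler_pdivrMr ?den0 ?(ltnW ml)//.
rewrite /den !mulrDr lerD2l mulrCA [leRHS]mulrCA ler_wpM2r ?ler_nat//.
by rewrite -expr2 sqr_ge0.
Qed.

(** The determinants telescope: the innovation variances multiply to the determinant of the output
    covariance of k encoders. *)
Let sum_tau : \sum_(0 <= m < k) (ln (tau m) - ln q) = 2 * k%:R * ((2 * k%:R)^-1 * (ln (den k) + (k%:R - 1) * ln L - k%:R * ln q)).
Proof.
have /andP[k0 kl] := hk; have kn : k%:R != 0 :> R by rewrite pnatr_eq0 -lt0n.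
rewrite sumrB sumr_const_nat subn0 -(mulr_natl (ln q)).
have -> : \sum_(0 <= m < k) ln (tau m) = k%:R * ln L + (ln (den k) - ln (den 0)).
  rewrite -(telescope_sumr (fun m => ln (den m)) (leq0n k)).
  have -> : k%:R * ln L = \sum_(0 <= m < k) ln L by rewrite sumr_const_nat subn0 mulr_natl.
  rewrite -big_split/=; apply: eq_big_nat => m /andP[_ mk]; have ml : (m < l)%N by exact: leq_trans mk kl.
  by rewrite /tau ml ln_div ?lnM ?posrE ?mulr_gt0 ?den0 ?(ltnW ml)// addrA.
by rewrite {2}/den mul0r addr0; field.
Qed.

Let b1 (m : nat) : R := lam1 gX rX m / den m.
Let b2 : R := lam2 gX rX / L.
(** Optimal linear estimator on D, the matrix Gamma_X (Gamma_S + q I)^-1, whose eigenvalues are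
    [b1 #|D|] on the all-ones vector and [b2] on its complement. *)
Let be (D : {set 'I_l}) (i j : 'I_l) : R := (if j == i then b2 else 0) + (b1 #|D| - b2) / #|D|%:R.

Let sg := sig X Z.
Let ml0 i j : Mlim P (sg 0) q i j = (if j == i then L else 0) + ro.
Proof. by rewrite /Mlim (sig_cov hgS hrS hX hZ hXZ hiid) /L; case: eqP => _; rewrite /ro; ring. Qed.

Let quadM (c : 'I_l -> R) : \sum_j \sum_j' c j * c j' * Mlim P (sg 0) q j j' = L * \sum_j c j ^+ 2 + ro * (\sum_j c j) ^+ 2.
Proof.
rewrite [(\sum_j c j) ^+ 2]expr2 mulr_suml !mulr_sumr -big_split/=; apply: eq_bigr => j _.
rewrite !mulr_sumr (eq_bigr (fun j' => (if j' == j then c j * L else 0) * c j' + ro * (c j * c j'))) => [|j' _].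
  by rewrite big_split/= sum_delta; congr (_ + _); ring.
by rewrite ml0; case: eqP => _; ring.
Qed.

Let sum_in (D : {set 'I_l}) (c : R) : \sum_j (if j \in D then c else 0) = #|D|%:R * c.
Proof. by rewrite -big_mkcond/= sumr_const mulr_natl. Qed.

Let resid_tau i (D : {set 'I_l}) : i \notin D ->
  \sum_j \sum_j' resid alpha i D j * resid alpha i D j' * Mlim P (sg 0) q j j' = tau #|D|.
Proof.
move=> iD; have ml : (#|D| < l)%N.
  by rewrite -[X in (_ < X)%N]card_ord; apply: (@proper_card _ D predT); apply/properP; split; [exact: subset_predT|exists i].
have d0 := den0 (ltnW ml).
rewrite quadM tauE// /resid; set a := alpha #|D|; set m : R := #|D|%:R.
have -> : \sum_j ((j == i)%:R - (if j \in D then a else 0)) ^+ 2 = 1 + m * a ^+ 2.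
  rewrite (eq_bigr (fun j => (if j == i then 1 else 0) + (if j \in D then a ^+ 2 else 0))); last first.
    by move=> j _; case: eqP => [->|_]; [rewrite (negbTE iD)|case: ifP => _] => /=; ring.
  by rewrite big_split/= sum_delta1 sum_in.
have -> : \sum_j ((j == i)%:R - (if j \in D then a else 0)) = 1 - m * a.
  rewrite sumrB sum_in; congr (_ - _); rewrite -[RHS](sum_delta1 i); apply: eq_bigr => j _.
  by case: eqP.
have -> : L = den #|D| - m * ro by rewrite /den addrK.
by rewrite /a /alpha; field; rewrite gt_eqF.
Qed.

Let Flim_val (D : {set 'I_l}) : (0 < #|D|)%N -> \sum_(i in D) (\sum_j \sum_j' coef_in be D i j * coef_in be D i j' * Mlim P (sg 0) q j j' -
     2 * \sum_j coef_in be D i j * mean P (fun w => X 0 i w * sg 0 j w)) = #|D|%:R * (dfun gX rX gZ rZ gS rS #|D| q - gX).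
Proof.
move=> D0; have ml : (#|D| <= l)%N by rewrite -[X in (_ <= X)%N]card_ord max_card.
have d0 := den0 ml; have mn : #|D|%:R != 0 :> R by rewrite pnatr_eq0 -lt0n.
set m : R := #|D|%:R in mn *; set c := (b1 #|D| - b2) / m.
have pt i : i \in D -> \sum_j \sum_j' coef_in be D i j * coef_in be D i j' * Mlim P (sg 0) q j j' -
     2 * \sum_j coef_in be D i j * mean P (fun w => X 0 i w * sg 0 j w) =
   L * (b2 ^+ 2 + 2 * b2 * c + m * c ^+ 2) + ro * b1 #|D| ^+ 2 - 2 * (lam2 gX rX * (b2 + c) + rX * gX * b1 #|D|).
  move=> iD; have s1 : \sum_j coef_in be D i j = b1 #|D|.
    rewrite /coef_in /be -/m -/c (eq_bigr (fun j => (if j == i then b2 else 0) + (if j \in D then c else 0))); last first.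
      by move=> j _; case: eqP => [->|_]; [rewrite iD|case: ifP => _]; ring.
    by rewrite big_split/= sum_delta1 sum_in -/m /c; field.
  rewrite quadM s1; congr (L * _ + _ - _ * _).
    rewrite /coef_in /be -/m -/c (eq_bigr (fun j => (if j == i then b2 ^+ 2 + 2 * b2 * c else 0) + (if j \in D then c ^+ 2 else 0))); last first.
      by move=> j _; case: eqP => [->|_]; [rewrite iD|case: ifP => _]; ring.
    by rewrite big_split/= sum_delta1 sum_in.
  rewrite (eq_bigr (fun j => (if j == i then lam2 gX rX else 0) * coef_in be D i j + coef_in be D i j * (rX * gX))); last first.
    by move=> j _; rewrite (sig_cross hgS hrS hX hZ hXZ hiid) mulrDr; congr (_ + _); rewrite mulrC.
  rewrite big_split/= sum_delta -mulr_suml s1 (mulrC (b1 _)); congr (_ * _ + _).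
  by rewrite /coef_in /be iD eqxx.
rewrite (eq_bigr _ pt) sumr_const -(mulr_natl (_ - _)) -/m; congr (_ * _).
have roE : ro = (den #|D| - L) / m by rewrite /den addrAC subrr add0r mulrC mulKf.
have rXE : rX * gX = (lam1 gX rX #|D| - lam2 gX rX) / m by rewrite -lam1_eig -/m addrAC subrr add0r [RHS]mulrC mulKf.
have mD : (0 < #|D| <= l)%N by rewrite D0.
rewrite (dfunE hl psdX psdZ hgS hrS mD q0) -denE -/L -/m roE rXE /c /b1 /b2; field.
by rewrite mn !gt_eqF.
Qed.

Lemma achievable eps : 0 < eps -> exists (n : nat) (M : 'I_l -> nat) (phi : forall i : 'I_l, ('I_n -> R) -> 'I_(M i)),
  [/\ (0 < n)%N, forall i c, borelRn (phi i @^-1` [set c]),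
   forall A : {set 'I_l}, #|A| = k -> (k * n)%:R^-1 * (\sum_(i in A) ln (M i)%:R) <=
      (2 * k%:R)^-1 * (ln (den k) + (k%:R - 1) * ln L - k%:R * ln q) + eps &
   forall A : {set 'I_l}, (k <= #|A|)%N ->
       (((#|A| * n)%:R^-1)%:E * (\sum_(i in A) \sum_(t < n) mse P X Z phi A i t)%E <= (dfun gX rX gZ rZ gS rS #|A| q + eps)%:E)%E].
Proof.
move=> e0; have /andP[k0 kl] := hk.
(* The rate slack eps/2 equals four [del]; entropy errors and the gap of the codebook exponent below
   h use three, so the rate conditions hold strictly. *)
set rb := (2 * k%:R)^-1 * _; pose del := eps / 8; have d0 : 0 < del by rewrite divr_gt0.
have mS i : measurable_fun setT (sg 0 i) by exact: measurable_sig.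
have gsX t i := gauss1_sq (X_gauss hgS hrS hX hZ hXZ hiid t i).
have gsS t i := gauss1_sq (sig_gauss hgS hrS hX hZ hXZ hiid t i).
have sqX i : L1 P (fun w => X 0 i w ^+ 2) := (gsX 0%N i).1.
have sqS i : L1 P (fun w => sg 0 i w ^+ 2) := (gsS 0%N i).1.
have EX i : mean P (X 0 i) = 0 := gauss1_mean (X_gauss hgS hrS hX hZ hXZ hiid 0 i).
have ES i : mean P (sg 0 i) = 0 := gauss1_mean (sig_gauss hgS hrS hX hZ hXZ hiid 0 i).
pose Fl (D : {set 'I_l}) := \sum_(i in D) (\sum_j \sum_j' coef_in be D i j * coef_in be D i j' * Mlim P (sg 0) q j j' -
     2 * \sum_j coef_in be D i j * mean P (fun w => X 0 i w * sg 0 j w)).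
pose xs N := {ffun 'I_l -> 'I_(na N)}; pose ys N := {ffun 'I_l -> 'I_(nb N)}.
have [N [nA nB nC nD]] : exists N, [/\ forall a : 'I_(na N), - ln (mesh N) + ent0 q - del <= \sum_b wq q a b * - ln (wq q a b),
   forall i (D : {set 'I_l}), i \notin D ->
     \sum_(z : xs N * ys N) law P (sg 0) q z * - ln (psi alpha tau i D z.2) < - ln (mesh N) + ent0 (tau #|D|) + del,
   forall D : {set 'I_l}, \sum_(z : xs N * ys N) law P (sg 0) q z * Fq P (X 0) (sg 0) be D z < Fl D + del &
   0 <= - ln (mesh N) + ent0 q - 2 * del].
  have wA := @wq_entropy R q q0 del d0.
  have wB : \forall N \near \oo, forall p : 'I_l * {set 'I_l}, p.1 \notin p.2 ->
     \sum_(z : xs N * ys N) law P (sg 0) q z * - ln (psi alpha tau p.1 p.2 z.2) < - ln (mesh N) + ent0 (tau #|p.2|) + del.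
    apply: filter_forall => -[i D] /=; case: (boolP (i \in D)) => iD; first by apply: nearW => N.
    have := psi_entropy mS sqS ES q0 tau0 d0 (resid_tau iD).
    by apply: filterS => N h _.
  have wC : \forall N \near \oo, forall D : {set 'I_l}, \sum_(z : xs N * ys N) law P (sg 0) q z * Fq P (X 0) (sg 0) be D z < Fl D + del.
    apply: filter_forall => D; have := Fq_lim (mX 0) mS sqX sqS EX ES q0 (be := be) (D := D).
    move=> /cvgrPdist_lt /(_ _ d0); apply: filterS => N; rewrite ltr_norml => /andP[h _].
    by rewrite -ltrBlDl -ltrN2 opprB.
  (* A fine mesh makes the kernel entropy large, which keeps the codebook exponent nonnegative. *)
  have wD : \forall N \near \oo, 0 <= - ln (mesh N) + ent0 q - 2 * del.
    exists (Num.truncn (expR (2 * del - ent0 q))) => // N /= hN.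
    suff : 2 * del - ent0 q <= - ln (mesh N) by lra.
    rewrite /mesh lnV ?posrE ?ltr0n// opprK -ler_expR lnK ?posrE ?ltr0n//.
    by apply: le_trans (ltW (truncnS_gt _)) _; rewrite ler_nat ltnS.
  have [N _ /(_ N (leqnn N)) [[h1 h2] [h3 h4]]] := filterI (filterI wA wB) (filterI wC wD).
  by exists N; split=> // i D iD; exact: (h2 (i, D)).
pose h := - ln (mesh N) + ent0 q - del.
pose eta m := - ln (mesh N) + ent0 (tau m) + del.
pose rho := rb + eps / 2.
have rate b : (0 < b <= k)%N -> \sum_(k - b <= m < k) eta m < b%:R * (rho + (h - del)).
  move=> bk; have /andP[b0 bk'] := bk.
  have lsq v : 0 < v -> ln (Num.sqrt v) = 2^-1 * ln v.
    move=> v0; have s0 : 0 < Num.sqrt v by rewrite sqrtr_gt0.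
    by rewrite -[in RHS](sqr_sqrtr (ltW v0)) lnXn// -[_ *+ 2]mulr_natl; field.
  (* The divergent mesh term is contained in h; what remains is half the log-ratio of innovation and
     noise variances. *)
  have E m : eta m = 2^-1 * (ln (tau m) - ln q) + (h + 2 * del).
    by rewrite /eta /h /ent0 !lsq//; field.
  rewrite (eq_bigr _ (fun m _ => E m)) big_split/= -mulr_sumr sumr_const_nat subKn// -(mulr_natl (h + _)).
  have fd m m' : (m <= m' < k)%N -> ln (tau m') - ln q <= ln (tau m) - ln q.
    move=> /andP[mm mk]; rewrite lerD2r ler_ln ?posrE ?tau0//; apply: tau_decr.
    by rewrite mm (leq_trans mk).
  have := tail_avg bk fd; rewrite sum_tau -/rb => ta.
  have kp : 0 < k%:R :> R by rewrite ltr0n.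
  have {}ta : 2^-1 * (\sum_(k - b <= m < k) (ln (tau m) - ln q)) <= b%:R * rb.
    by rewrite -(ler_pM2l kp) mulrCA; move: ta; move: (k%:R * _) => z; lra.
  have bp : 0 < b%:R :> R by rewrite ltr0n.
  have : 0 < b%:R * del by rewrite mulr_gt0.
  rewrite /rho; have : b%:R * (rb + eps / 2 + (h - del)) = b%:R * rb + b%:R * h + 3 * (b%:R * del).
    by rewrite /del; field.
  move=> ->; rewrite mulrDr (mulrCA _ 2); lra.
have h1h : h - del < h by rewrite ltrBlDr ltrDl.
have h10 : 0 <= h - del by rewrite /h; lra.
have Fc D : \sum_(z : xs N * ys N) letter_law (@PS R _ Omega P l (sg 0) N) (@wq R q N) z * Fq P (X 0) (sg 0) be D z < Fl D + del.
  exact: nC.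
have [K [N0 code]] := @random_code R l 'I_(na N) 'I_(nb N) (@PS R _ Omega P l (sg 0) N) (@wq R q N) (ord0 : 'I_(nb N)) h (h - del) k
   (@psi R l alpha tau N) eta (@Fq R _ Omega P l (X 0) (sg 0) be N) (fun D => Fl D + del) rho (PS_ge0 P (sg 0) (N := N)) (PS_sum P mS N)
   (fun a b => wk_ge0 q0 N a b) (fun a => wq_sum q0 a) nA h10 h1h k0
   (fun i D (y : ys N) => psi_gt0 alpha tau0 i D y)
   (fun i D (y : ys N) iD => psi_sum alpha tau0 y iD)
   (fun i D (y y' : ys N) => @psi_loc R l alpha tau N i D y y') Fc
   (fun D x (y y' : ys N) => @Fq_loc R _ Omega P l (X 0) (sg 0) be N D x y y')
   (fun i D iD _ => nB i D iD) rate.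
(* The block length is chosen so that eps/4 per letter covers both the constant excess distortion
   and the ln 3 spent on rounding the alphabet and adding its extra symbol. *)
pose KK := \sum_D `|K D| + ln 3.
pose n := (N0 + (Num.truncn (KK / (eps / 4))).+1)%N.
have n0 : (0 < n)%N by rewrite /n addnS.
have nn : 0 < n%:R :> R by rewrite ltr0n.
have nK : KK <= n%:R * (eps / 4).
  rewrite -ler_pdivrMr ?divr_gt0//; apply: le_trans (ltW (truncnS_gt _)) _.
  by rewrite /n natrD lerDr.
have l3 : 0 <= ln 3 :> R by rewrite ln_ge0// ler1n.
have KD D : K D <= n%:R * (eps / 4).
  apply: le_trans (ler_norm _) (le_trans _ nK); rewrite /KK (bigD1 D)//= -addrA lerDl addr_ge0//.
  exact: sumr_ge0.
have l3n : ln 3 <= n%:R * (eps / 4) by apply: le_trans nK; rewrite /KK lerDr sumr_ge0.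
pose M := (Num.truncn (expR (n%:R * rho))).+1.
have hM : expR (n%:R * rho) <= M%:R by apply: ltW; exact: truncnS_gt.
have nN : (N0 < n)%N by rewrite /n addnS ltnS leq_addr.
have [enc [dc [dcl hdc]]] := code n M nN isT hM.
exists n, (fun=> M.+1), (qenc enc); split=> //.
- by move=> i c; exact: qenc_meas.
- move=> A Ak; rewrite sumr_const Ak -(mulr_natl (ln _)) natrM invfM mulrA (mulrAC k%:R^-1) mulVf ?mul1r; last by rewrite pnatr_eq0 -lt0n.
  have rho0 : 0 <= rho.
    have h1 : ln q <= ln (den k) by rewrite ler_ln ?posrE ?den0// denE lerDr (lam1S hgS hrS) addr_ge0//; exact: (psd_lam1 hl).
    have h2 : ln q <= ln L by rewrite ler_ln ?posrE// lerDr (lam2S hgS hrS) addr_ge0//; exact: (psd_lam2 hl).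
    have k1 : 0 <= k%:R - 1 :> R by rewrite subr_ge0 ler1n.
    rewrite addr_ge0 ?divr_ge0 ?(ltW e0)// mulr_ge0 ?invr_ge0 ?mulr_ge0//.
    by have := ler_wpM2l k1 h2; lra.
  have M3 : M.+1%:R <= 3 * expR (n%:R * rho).
    have e1 : 1 <= expR (n%:R * rho) by rewrite -{1}[1]expR0 ler_expR mulr_ge0// ltW.
    have : (Num.truncn (expR (n%:R * rho)))%:R <= expR (n%:R * rho) by rewrite truncn_le expR_ge0.
    rewrite /M -2!natr1; lra.
  have : ln M.+1%:R <= ln 3 + n%:R * rho.
    rewrite -[X in _ + X]expRK -lnM ?posrE ?expR_gt0// ler_ln ?posrE ?ltr0n// mulr_gt0// expR_gt0//.
  move=> hln; rewrite mulrC ler_pdivrMr//; apply: le_trans hln _.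
  have ne : 0 < n%:R * eps by rewrite mulr_gt0.
  rewrite /rho; move: l3n ne; lra.
- move=> A kA; have A0 : (0 < #|A|)%N by exact: leq_trans kA.
  have An : 0 < (#|A| * n)%:R :> R by rewrite ltr0n muln_gt0 A0.
  have Ap : 1 <= #|A|%:R :> R by rewrite ler1n.
  have gE : lam2 gX rX + rX * gX = gX by rewrite /lam2; ring.
  apply: le_trans (lee_wpmul2l _ (mse_bound hgS hrS hX hZ hXZ hiid enc dcl be gE A)) _.
    by rewrite lee_fin invr_ge0 ltW.
  rewrite -EFinM lee_fin mulrC ler_pdivrMr//.
  apply: le_trans (lerD (lexx _) (hdc A kA)) _.
  rewrite /Fl Flim_val// natrM; have := KD A; have : 0 < n%:R * eps by rewrite mulr_gt0.
  have -> : (dfun gX rX gZ rZ gS rS #|A| q + eps) * (#|A|%:R * n%:R) =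
    #|A|%:R * n%:R * gX + n%:R * (#|A|%:R * (dfun gX rX gZ rZ gS rS #|A| q - gX)) + #|A|%:R * (n%:R * eps) by ring.
  rewrite /del mulrDr => ne; have : n%:R * eps <= #|A|%:R * (n%:R * eps) by rewrite ler_peMl// ltW.
  lra.
Qed.

End Achieve.

(** * Common source *)

Section Shearer.
Variables (R : realType) (l : nat) (B : finType).
Local Notation ys := {ffun 'I_l -> B}.
Variable p : ys -> R.
Hypothesis p0 : forall y, 0 <= p y.
Hypothesis p1 : \sum_y p y = 1.

Definition agree_on (D : {set 'I_l}) (y' y : ys) := [forall u, (u \in D) ==> (y' u == y u)].
Definition mg (D : {set 'I_l}) (y : ys) : R := \sum_y' p y' * (agree_on D y' y)%:R.

Lemma mg_ge0 D y : 0 <= mg D y.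
Proof. by apply: sumr_ge0 => y' _; rewrite mulr_ge0. Qed.

Lemma mg0 y : mg finset.set0 y = 1.
Proof.
rewrite -p1; apply: eq_bigr => y' _; rewrite (_ : agree_on _ _ _ = true) ?mulr1//.
by apply/forallP => u; rewrite finset.in_set0.
Qed.

Lemma mgT y : mg [set: 'I_l]%SET y = p y.
Proof.
rewrite /mg (bigD1 y)//= big1 ?addr0 => [|y' ny].
  by rewrite (_ : agree_on _ _ _ = true) ?mulr1//; apply/forallP => u; rewrite eqxx implybT.
rewrite (_ : agree_on _ _ _ = false) ?mulr0//; apply/forallP => h; case/eqP: ny; apply/ffunP => u.
by apply/eqP; have /implyP := h u; apply; rewrite finset.in_setT.
Qed.

Lemma mg_gt0 D y : 0 < p y -> 0 < mg D y.
Proof.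
move=> py; rewrite /mg (bigD1 y)//= ltr_pwDl//; last by apply: sumr_ge0 => y' _; rewrite mulr_ge0.
by rewrite (_ : agree_on _ _ _ = true) ?mulr1//; apply/forallP => u; rewrite eqxx implybT.
Qed.

Lemma mg_loc (D : {set 'I_l}) (y y' : ys) : {in D, y =1 y'} -> mg D y = mg D y'.
Proof.
move=> h; apply: eq_bigr => z _; congr (_ * _%:R); congr nat_of_bool.
by apply: eq_forallb => u; case: (boolP (u \in D)) => //= uD; rewrite h.
Qed.

Lemma mg_step i (D : {set 'I_l}) y : i \notin D -> \sum_b mg (i |: D) (upd y i b) = mg D y.
Proof.
move=> iD; rewrite /mg exchange_big/=; apply: eq_bigr => z _; rewrite -mulr_sumr; congr (_ * _).
rewrite (bigD1 (z i))//= big1 ?addr0 => [|b nb].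
  congr (_%:R); congr nat_of_bool; apply/forallP/forallP => h u; apply/implyP => uD.
    have /implyP := h u; rewrite finset.in_setU1 uD orbT => /(_ isT).
    by rewrite ffunE; case: (u =P i) uD iD => // -> ->.
  move: uD; rewrite finset.in_setU1 ffunE; case: (u =P i) => [->//|_] /= uD.
  by have /implyP := h u; apply.
rewrite (_ : agree_on _ _ _ = false)//; apply/forallP => /(_ i); rewrite finset.setU11 ffunE eqxx /=.
by rewrite eq_sym (negbTE nb).
Qed.

Variable A : {set 'I_l}.

Definition inc1 i (D : {set 'I_l}) y : R := ln (mg (i |: D) y) - ln (mg D y).
Fixpoint incA (D : {set 'I_l}) (s : seq 'I_l) (y : ys) : R :=
  if s is i :: s' then (i \in A)%:R * inc1 i D y + incA (i |: D) s' y else 0.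

(** Along the enumeration, a coordinate of A is predicted from the earlier coordinates in A, any
    other one from all earlier ones. The chain of these kernels is the law with which p is
    compared. *)
Definition cond_law i (D : {set 'I_l}) (y : ys) : R :=
  if i \in A then mg (A :&: (i |: D)) y / mg (A :&: D) y else mg (i |: D) y / mg D y.

Lemma cond_law_ge0 i D y : 0 <= cond_law i D y.
Proof. by rewrite /cond_law; case: ifP => _; rewrite divr_ge0 ?mg_ge0. Qed.

Lemma cond_law_sum i (D : {set 'I_l}) y : i \notin D -> \sum_b cond_law i D (upd y i b) <= 1.
Proof.
have aux (E : {set 'I_l}) : i \notin E -> \sum_b mg (i |: E) (upd y i b) / mg E (upd y i b) <= 1.
  move=> iE; rewrite (eq_bigr (fun b => mg (i |: E) (upd y i b) / mg E y)) => [|b _]; last first.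
    congr (_ / _); apply: mg_loc => u uE; rewrite ffunE; by case: (u =P i) uE iE => // -> ->.
  rewrite -mulr_suml mg_step//; have [->|n0] := eqVneq (mg E y) 0; first by rewrite mul0r.
  by rewrite mulfV.
move=> iD; rewrite /cond_law; have [iA|iA] := boolP (i \in A); last exact: aux.
have -> : A :&: (i |: D) = i |: (A :&: D).
  by apply/finset.setP => u; rewrite !finset.inE; case: (u =P i) => [->|_]; rewrite ?iA.
by apply: aux; rewrite finset.inE iA.
Qed.

Lemma cond_law_loc i (D : {set 'I_l}) (y y' : ys) : y i = y' i -> {in D, y =1 y'} -> cond_law i D y = cond_law i D y'.
Proof.
move=> yi yD; have h (E : {set 'I_l}) : {subset E <= i |: D} -> mg E y = mg E y'.
  move=> ED; apply: mg_loc => u /ED; rewrite finset.in_setU1 => /orP[/eqP ->//|]; exact: yD.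
rewrite /cond_law !h// => u; rewrite !finset.inE; first by move=> ->; rewrite orbT.
- by move=> /andP[_ ->]; rewrite orbT.
- by move=> /andP[].
Qed.

Lemma ln_chain s (D : {set 'I_l}) y : 0 < p y -> 0 < chain cond_law D s y /\
  ln (chain cond_law D s y) = ln (mg (A :&: (D :|: [set i in s]%SET)) y) - ln (mg (A :&: D) y)
   + (ln (mg (D :|: [set i in s]%SET) y) - ln (mg D y)) - incA D s y.
Proof.
move=> py; elim: s D => [|i s ih] D /=.
  have -> : D :|: [set i in [::]]%SET = D by apply/finset.setP => u; rewrite !finset.inE ?in_nil orbF.
  by rewrite ln1 !subrr; split=> //; ring.
have [c0 cE] := ih (i |: D).
have eD : i |: D :|: [set j in s]%SET = D :|: [set j in i :: s]%SET.
  by apply/finset.setP => u; rewrite !finset.inE orbCA orbA.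
rewrite eD in cE; have k0 : 0 < cond_law i D y by rewrite /cond_law; case: ifP => _; rewrite divr_gt0 ?mg_gt0.
split; first exact: mulr_gt0.
rewrite lnM ?posrE// cE /cond_law /inc1; have [iA|iA] := boolP (i \in A); rewrite /= ln_div ?posrE ?mg_gt0//; first by ring.
have -> : A :&: (i |: D) = A :&: D.
  by apply/finset.setP => u; rewrite !finset.inE; case: (u =P i) => [->|_]; rewrite ?(negbTE iA).
by ring.
Qed.

(** Nonnegativity of the divergence of p from the chain law. It expresses that further conditioning
    lowers entropy: the entropy of the A-marginal is at least the sum, over A, of the increments
    given all earlier coordinates. *)
Lemma subset_entropy : \sum_y p y * - incA finset.set0 (enum 'I_l) y <= \sum_y p y * - ln (mg A y).
Proof.
rewrite -subr_ge0 -sumrB.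
suff : \sum_y p y * (ln (mg A y) - incA finset.set0 (enum 'I_l) y) <= 0.
  rewrite -oppr_ge0 -sumrN => h; apply: le_trans h _; apply: le_of_eq.
  by apply: eq_bigr => y _; ring.
have ch : \sum_y chain cond_law finset.set0 (enum 'I_l) y <= 1.
  have [y0 _|e] := pickP (@predT ys); last by rewrite big1// => y; have := e y.
  have := chain_sum cond_law_ge0 cond_law_sum cond_law_loc y0 (enum_uniq 'I_l) (fun i _ => ltac:(by rewrite finset.in_set0) : i \notin finset.set0).
  by rewrite (eq_bigl predT)// => y; apply/forallP => j; rewrite mem_enum.
apply: (@le_trans _ _ (\sum_y (chain cond_law finset.set0 (enum 'I_l) y - p y))); last by rewrite sumrB p1 subr_le0.
apply: ler_sum => y _; have := p0 y; rewrite le_eqVlt => /orP[/eqP <-|py].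
  by rewrite mul0r subr0; exact: (chain_ge0 cond_law_ge0).
have [c0 cE] := ln_chain (enum 'I_l) finset.set0 py.
have fT : finset.set0 :|: [set i in enum 'I_l]%SET = [set: 'I_l]%SET by apply/finset.setP => u; rewrite !finset.inE mem_enum.
rewrite fT finset.setIT finset.setI0 !mg0 ln1 !subr0 mgT in cE.
have -> : ln (mg A y) - incA finset.set0 (enum 'I_l) y = ln (chain cond_law finset.set0 (enum 'I_l) y) - ln (p y).
  by rewrite cE; ring.
have h := expR_ge1Dx (ln (chain cond_law finset.set0 (enum 'I_l) y) - ln (p y)); rewrite expRB !lnK ?posrE// in h.
have := ler_wpM2l (ltW py) h; rewrite [p y * (_ / _)]mulrC divfK ?gt_eqF//; lra.
Qed.

End Shearer.

(** Summed over s, each increment is counted k times, and by the chain rule the increments add up to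
    the logarithm of p. *)
Lemma shearer (R : realType) (l : nat) (B S : finType) (p : {ffun 'I_l -> B} -> R) (A : S -> {set 'I_l}) (k : R) :
  (forall y, 0 <= p y) -> \sum_y p y = 1 -> (forall i, \sum_s (i \in A s)%:R = k) ->
  k * \sum_y p y * - ln (p y) <= \sum_s \sum_y p y * - ln (mg p (A s) y).
Proof.
move=> p0 p1 hk; apply: le_trans (ler_sum _ (fun s _ => subset_entropy p0 p1 (A s))).
rewrite exchange_big/= mulr_sumr; apply: ler_sum => y _; rewrite -mulr_sumr mulrCA sumrN.
have [->|n0] := eqVneq (p y) 0; first by rewrite !mul0r.
rewrite ler_pM2l; last by rewrite lt_neqAle eq_sym n0 p0.
have h s D : \sum_t incA p (A t) D s y = k * (ln (mg p (D :|: [set i in s]%SET) y) - ln (mg p D y)).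
  elim: s D => [|i s ih] D /=.
    have -> : D :|: [set i in [::]]%SET = D by apply/finset.setP => u; rewrite !finset.inE ?in_nil orbF.
    by rewrite big1// subrr mulr0.
  rewrite big_split/= ih -mulr_suml hk.
  have -> : i |: D :|: [set j in s]%SET = D :|: [set j in i :: s]%SET.
    by apply/finset.setP => u; rewrite !finset.inE orbCA orbA.
  by rewrite /inc1; ring.
have fT : finset.set0 :|: [set i in enum 'I_l]%SET = [set: 'I_l]%SET by apply/finset.setP => u; rewrite !finset.inE mem_enum.
by rewrite h fT mg0// mgT ln1 subr0 mulrN.
Qed.

Lemma window_entropy (R : realType) (l k : nat) (B : finType) (p : {ffun 'I_l -> B} -> R) (g : 'I_k -> 'I_l)
  (q : {ffun 'I_k -> B} -> R) : (forall c, q c = \sum_y p y * ([ffun a => y (g a)] == c)%:R) ->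
  \sum_c q c * - ln (q c) = \sum_y p y * - ln (mg p [set g a | a : 'I_k]%SET y).
Proof.
move=> qE; have qg (y : {ffun 'I_l -> B}) : q [ffun a => y (g a)] = mg p [set g a | a : 'I_k]%SET y.
  rewrite qE; apply: eq_bigr => z _; congr (_ * _%:R); congr nat_of_bool; apply/eqP/forallP => [h u|h].
    apply/implyP => /imsetP[a _ ->]; apply/eqP.
    by have := congr1 (fun f : {ffun 'I_k -> B} => f a) h; rewrite !ffunE.
  apply/ffunP => a; rewrite !ffunE; apply/eqP; have /implyP := h (g a); apply.
  by apply/imsetP; exists a.
under eq_bigr do rewrite {1}qE mulr_suml; rewrite exchange_big/=; apply: eq_bigr => y _.
rewrite (bigD1 [ffun a => y (g a)])//= eqxx mulr1 qg big1 ?addr0// => c nc.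
by rewrite eq_sym (negbTE nc) mulr0 mul0r.
Qed.

(** * Encoders of a common source treated as one *)

Section Bundle.
Context {R : realType} {d1 d2 : measure_display}.
Context {T1 : measurableType d1} {T2 : measurableType d2}.
Variables (P2 : probability T2 R).
Variables (n l : nat) (K : finType) (enc : 'I_l -> RV R 'I_n -> K).
Hypothesis menc : forall i k, <<s @rectangles R 'I_n >> (enc i @^-1` [set k]).

(* Encoders that observe the same source are regarded as a single encoder. *)
Definition bundle m (a : 'I_m -> 'I_l) (_ : 'I_1) (f : RV R 'I_n) : {ffun 'I_m -> K} := [ffun i => enc (a i) f].

Lemma bundle_meas m (a : 'I_m -> 'I_l) i c : <<s @rectangles R 'I_n >> (bundle a i @^-1` [set c]).
Proof.
have -> : bundle a i @^-1` [set c] = \big[setI/setT]_(i < m) (enc (a i) @^-1` [set c i]).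
  apply/seteqP; split => f /=.
    by move=> <-; elim/big_ind: _ => // u _ /=; rewrite ffunE.
  by move=> h; apply/ffunP => u; move: h; rewrite (bigD1 u)//= ffunE => -[].
by apply: (@bigsetI_measurable _ (RV R 'I_n)) => u _; exact: menc.
Qed.

Variables (Y : 'I_n -> 'I_1 -> T1 -> R) (N : 'I_n -> 'I_1 -> T2 -> R).
Hypothesis mY : forall t i, measurable_fun setT (Y t i).
Variable th : R.
Hypothesis gN : forall t i, gauss1 P2 (N t i) th.

Lemma ent_single (K' : finType) (e : 'I_1 -> RV R 'I_n -> K') w :
  ent P2 e Y N w = \sum_k qcond P2 e Y N ord0 k w * - ln (qcond P2 e Y N ord0 k w).
Proof.
rewrite /ent (reindex (fun k : K' => [ffun _ : 'I_1 => k])); last first.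
  exists (fun c : {ffun 'I_1 -> K'} => c ord0) => [k _|c _]; first by rewrite ffunE.
  by apply/ffunP => i; rewrite ffunE (ord1 i).
suff h k : pcond P2 e Y N [ffun _ : 'I_1 => k] w = qcond P2 e Y N ord0 k w by apply: eq_bigr => k _; rewrite h.
apply: eq_mean => x; congr (_%:R); congr nat_of_bool; apply/eqP/eqP => [->|h]; first by rewrite ffunE.
by apply/ffunP => i; rewrite (ord1 i) h ffunE.
Qed.

Lemma qcond_bundle m m' (a : 'I_m -> 'I_l) (g : 'I_m' -> 'I_m) c w :
  qcond P2 (bundle (a \o g)) Y N ord0 c w =
  \sum_y qcond P2 (bundle a) Y N ord0 y w * ([ffun i => y (g i)] == c)%:R.
Proof.
have lb y : L1 P2 (fun x => (cword (bundle a) Y N (w, x) ord0 == y)%:R).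
  have mb : measurable_fun setT (fun x => (cword (bundle a) Y N (w, x) ord0 == y)%:R : R) := mslice w (mcw1 (bundle_meas a) mY gN ord0 y).
  exact: (L1_bool P2 mb).
under eq_bigr do rewrite mulrC -meanZ//.
rewrite -mean_sum => [|y _]; last exact: L1Z.
apply: eq_mean => x; rewrite sum_eqb; congr (_%:R); congr nat_of_bool; congr (_ == c).
by apply/ffunP => i; rewrite !ffunE.
Qed.

End Bundle.

Section Common.
Context {R : realType} {dT : measure_display} {Omega : measurableType dT}.
Variables (P : probability Omega R) (l : nat) (gX rX gZ rZ gS rS : R).
Variables (X Z : nat -> 'I_l -> Omega -> R).
Hypothesis hX : forall t, gaussian_vec P (X t) (eqcov l gX rX).
Hypothesis hZ : forall t, gaussian_vec P (Z t) (eqcov l gZ rZ).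
Hypothesis hXZ : indep_signal_noise P X Z.
Hypothesis hiid : indep_times P X Z.
Hypotheses (hgS : gS = gX + gZ) (hrS : rS * gS = rX * gX + rZ * gZ) (hgX : 0 < gX).
Hypotheses (gS0 : 0 < gS) (S2 : lam2 gS rS = 0) (X2 : lam2 gX rX = 0).
Variables (n : nat) (i0 : 'I_l).

Let rSg : rS * gS = gS. Proof. by move: S2; rewrite /lam2 mulrBl mul1r => /eqP; rewrite subr_eq0 eq_sym => /eqP. Qed.
Let rXg : rX * gX = gX. Proof. by move: X2; rewrite /lam2 mulrBl mul1r => /eqP; rewrite subr_eq0 eq_sym => /eqP. Qed.

Definition common (t : 'I_n) (_ : 'I_1) (w : Omega) : R := src X Z t i0 w.

Lemma common_gfam : gfam P common gS 0.
Proof.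
have f1 : injective (fun _ : 'I_1 => i0) by move=> x y _; rewrite (ord1 x) (ord1 y).
move=> b; have := proc_src hX hZ hXZ hiid hgS hrS f1 b.
congr (gauss1 P _ _); apply: eq_bigr => t _; rewrite /qAB S2 rSg !big_ord1; ring.
Qed.

Let rep m (t : 'I_n) (_ : 'I_m) (w : Omega) : R := src X Z t i0 w.

Let rep_gfam m : gfam P (@rep m) 0 gS.
Proof.
move=> b; have := common_gfam (fun p => \sum_i b (p.1, i)).
congr (gauss1 P _ _); last by apply: eq_bigr => t _; rewrite /qAB !big_ord1; ring.
apply/funext => w; rewrite !sum_pair; apply: eq_bigr => t _.
by rewrite big_ord1 /= mulr_suml.
Qed.

Variables (K : finType) (enc : 'I_l -> RV R 'I_n -> K).
Hypothesis menc : forall i k, <<s @rectangles R 'I_n >> (enc i @^-1` [set k]).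

(** With [lam2 gS rS = 0] the sources have covariance gS times the all-ones matrix, like m copies of
    one source, and codeword statistics are compared through these laws. Each signal has covariance
    gX with every source, whence the factor gX / gS. *)
Lemma corr_common m' (m := m'.+1) (f : 'I_m -> 'I_l) i (t : 'I_n) : injective f ->
  corr P (fun (t : 'I_n) i => src X Z t (f i)) (fun i => enc (f i)) (X t (f i)) =
  (gX / gS) ^+ 2 * corr P common (bundle enc f) (dir common (fun=> 1) t).
Proof.
move=> fi; pose V (t : 'I_n) i := src X Z t (f i).
have gV : gfam P V 0 gS by rewrite -[X in gfam _ _ X _]S2 -[X in gfam _ _ _ X]rSg; exact: proc_src.
have mf a k : <<s @rectangles R 'I_n >> (enc (f a) @^-1` [set k]) by exact: menc.
have cE w c : (codew common (bundle enc f) w == [ffun _ : 'I_1 => c]) = (codew (@rep m) (fun i => enc (f i)) w == c).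
  apply/eqP/eqP => [/ffunP /(_ ord0)|<-]; rewrite ?ffunE.
    by move=> <-; apply/ffunP => u; rewrite !ffunE.
  by apply/ffunP => u; rewrite !ffunE; apply/ffunP => v; rewrite !ffunE.
have m0 : m%:R != 0 :> R by rewrite pnatr_eq0.
rewrite /corr [in RHS](reindex (fun c : {ffun 'I_m -> K} => [ffun _ : 'I_1 => c])); last first.
  exists (fun c : {ffun 'I_1 -> {ffun 'I_m -> K}} => c ord0) => [k _|c _]; first by rewrite ffunE.
  by apply/ffunP => u; rewrite ffunE (ord1 u).
rewrite mulr_sumr; apply: eq_bigr => c _.
have -> : pS P common (bundle enc f) [ffun _ : 'I_1 => c] = pS P V (fun i => enc (f i)) c.
  rewrite /pS; under eq_mean do rewrite cE.
  have e (U : 'I_n -> 'I_m -> Omega -> R) : (forall t i, measurable_fun setT (U t i)) ->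
      mean P (fun x => (codew U (fun i => enc (f i)) x == c)%:R) =
      fine (P [set x | forall a : 'I_m, enc (f a) (fun t => U t a x) = c a]).
    move=> mU; rewrite -mean_indic; last first.
      by apply: (measurable_rectangles (U := fun p x => U p.1 p.2 x) _ (rect_code mf c)) => p; exact: mU.
    apply: eq_mean => x; rewrite indicE; case: eqP => h; [rewrite mem_set//|rewrite memNset//].
      by move=> a; rewrite -h ffunE.
    by move=> h'; apply: h; apply/ffunP => a; rewrite ffunE; exact: h'.
  rewrite e; last by move=> u a; exact: gfam_meas (@rep_gfam m) u a.
  rewrite e; last by move=> u a; exact: gfam_meas gV u a.
  congr fine; apply: (@gauss_law _ _ _ _ _ P P _ (fun p => @rep m p.1 p.2) (fun p => V p.1 p.2) _ _ _ _ (@rep_gfam m) gV (rect_code mf c)).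
    by move=> p; exact: gfam_meas (@rep_gfam m) _ _.
  by move=> p; exact: gfam_meas gV _ _.
(* Weights 1/m make this direction, applied to m copies, the source itself. *)
have eo : eigen gS (m%:R * gS) (fun _ : 'I_m => m%:R^-1).
  by move=> b; rewrite sumr_const card_ord -mulr_natr -mulr_sumr; field.
have -> : mean P (fun w => X t (f i) w * (codew V (fun i => enc (f i)) w == c)%:R) =
    gX / gS * mean P (fun w => dir common (fun=> 1) t w * (codew common (bundle enc f) w == [ffun _ : 'I_1 => c])%:R).
  rewrite (@eigen_transfer _ _ _ P _ _ _ _ _ (@rep_gfam m) _ _ mf _ _ P V (X t (f i)) gX (m%:R * gX) _ _ t c _ eo).
  - congr (_ * _); first by field; rewrite m0 gt_eqF.
    apply: eq_mean => w; rewrite cE; congr (_ * _).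
    by rewrite /dir big_ord1 mul1r -mulr_suml sumr_const card_ord -[_ *+ m]mulr_natr mulVf ?mul1r.
  - by move=> u a; exact: gfam_meas gV u a.
  - by rewrite add0r => /eqP; rewrite mulf_eq0 (negbTE m0) gt_eqF.
  move=> a b; have := proc_joint hX hZ hXZ hiid hgS hrS fi (fun p => if p == (t, i) then a else 0) b.
  congr (gauss1 P _ _).
    apply/funext => w; congr (_ + _); rewrite (bigD1 (t, i))//= eqxx big1 ?addr0// => p /negbTE ->.
    by rewrite mul0r.
  rewrite S2 X2 rSg rXg; apply: (sum_at (t0 := t)) => [|u ne] /=.
    rewrite /qAB !mul0r !add0r -[X in gX * X ^+ 2](_ : a = _); last first.
      by rewrite (bigD1 i)//= eqxx big1 ?addr0// => v nv; rewrite xpair_eqE (negbTE nv) andbF.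
    rewrite -(_ : a = \sum_i0 _); last first.
      by rewrite (bigD1 i)//= eqxx big1 ?addr0// => v nv; rewrite xpair_eqE (negbTE nv) andbF.
    by rewrite -mulr_sumr; field.
  rewrite [X in qAB 0 gX X](_ : _ = fun=> 0); last by apply/funext => v; rewrite xpair_eqE (negbTE ne).
  have z : \sum_(i1 < m) (if (u, i1) == (t, i) then a else 0) = 0.
    by rewrite big1// => v _; rewrite xpair_eqE (negbTE ne).
  by rewrite z /qAB big1_eq; ring.
by rewrite exprMn mulrA.
Qed.

End Common.

Lemma slack_bound (R : realFieldType) (A B C D E : R) : A + C + E <= B -> D <= C -> E <= B - (A + D).
Proof. lra. Qed.

Section CommonConverse.
Context {R : realType} {dT : measure_display} {Omega : measurableType dT}.
Variables (P : probability Omega R) (l : nat) (hl : (2 <= l)%N) (gX rX gZ rZ gS rS : R).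
Variables (X Z : nat -> 'I_l -> Omega -> R).
Hypothesis hX : forall t, gaussian_vec P (X t) (eqcov l gX rX).
Hypothesis hZ : forall t, gaussian_vec P (Z t) (eqcov l gZ rZ).
Hypothesis hXZ : indep_signal_noise P X Z.
Hypothesis hiid : indep_times P X Z.
Hypotheses (hgS : gS = gX + gZ) (hrS : rS * gS = rX * gX + rZ * gZ) (hgX : 0 < gX).
Hypotheses (gS0 : 0 < gS) (S2 : lam2 gS rS = 0) (X2 : lam2 gX rX = 0).
Variables (k' : nat) (r : R) (d : nat -> R).
Let k := k'.+1.
Hypothesis kl : (k <= l)%N.
Hypothesis hRD : RD P X Z k r d.

Lemma sum_affine (n : nat) (c1 c2 : R) (F : 'I_n -> R) : (0 < n)%N ->
  n%:R^-1 * \sum_t (c1 + c2 * F t) = c1 + c2 * (n%:R^-1 * \sum_t F t).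
Proof.
move=> n0; have n0' : n%:R != 0 :> R by rewrite pnatr_eq0 -lt0n.
by rewrite big_split/= sumr_const card_ord -mulr_sumr -mulr_natr; field.
Qed.

(** Given the scalar Y the codewords are still dependent, as they share the noise. H is twice the
    entropy per letter of all j codewords given Y; each window of k obeys the rate bound, and
    Shearer's inequality over the j cyclic windows passes it on to H. *)
Lemma common_ineq j' (j := j'.+1) (th a b eps : R) : 0 < eps -> (k <= j)%N -> (j <= l)%N ->
  0 < th -> th <= gS -> 0 < a -> 0 < b -> exists H e E : R,
  [/\ k%:R * H <= j%:R * (2 * k%:R * (r + eps) - (ln (1 + a * (gS - th)) - a * (gS - th) +
        (1 + a * (gS - th)) * ((gS - th) / gX ^+ 2) * (gX - d k - eps))),
      ln (1 + b * th) - b * th + (1 + b * th) / th * e <= H,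
      forall al be, (2 * al * (th / gS) - al ^+ 2 + 2 * al * be * ((gS - th) / gS)) * E - be ^+ 2 * (gS - th) <= e &
      gX - (d j + eps) <= (gX / gS) ^+ 2 * E].
Proof.
move=> e0 kj jl th0 ths a0 b0.
have [n [M [phi [n0 mphi hr hd]]]] := RD_elim hX hZ hXZ hiid hRD e0.
have n0' : n%:R != 0 :> R by rewrite pnatr_eq0 -lt0n.
have b1 (F : 'I_1 -> R) : \sum_i F i = F ord0 by rewrite big_ord1.
pose i0 := widen_ord jl ord0; pose iJ := widen_ord jl.
have iJ_inj : injective iJ by move=> x y /(congr1 val) /= /val_inj.
pose g (s : 'I_j) (i : 'I_k) : 'I_j := s + widen_ord kj i.
have g_inj s : injective (g s) by move=> x y /addrI /(congr1 val) /= /val_inj.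
pose cth := Num.sqrt th; have cthE : cth ^+ 2 = th by rewrite sqr_sqrtr// ltW.
have menc := encK_meas mphi; pose B m (f : 'I_m -> 'I_l) := bundle (encK phi) f.
have mB m f := @bundle_meas _ _ _ _ _ menc m f.
pose S1 := common X Z (n := n) i0.
have gS1 : gfam P S1 gS 0 := common_gfam hX hZ hXZ hiid hgS hrS S2 i0.
pose u := gS - th; pose c := Num.sqrt ((gS - th) / gS).
have cE : c ^+ 2 * gS = gS - th by rewrite sqr_sqrtr ?divfK ?gt_eqF// divr_ge0 ?subr_ge0// ltW.
pose Y t i x := c * S1 t i x.
have gY : gfam P Y (gS - th) 0.
  move=> v; have := gS1 (fun p => c * v p).
  rewrite (_ : (fun x => _) = (fun x => \sum_p v p * Y p.1 p.2 x)); last first.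
    by apply/funext => x; apply: eq_bigr => p _; rewrite /Y; ring.
  congr (gauss1 P _ _); apply: eq_bigr => t _; rewrite /qAB !mul0r !addr0 -cE !big_ord1; ring.
pose tau (p : 'I_n * 'I_1) : nat := p.1.
have tau_inj : injective tau by move=> [t i] [t' i'] /val_inj /= ->; rewrite (ord1 i) (ord1 i').
pose xi := fresh gX X i0 tau.
have gxi : gfam P xi 1 0 := fresh_gauss hX hZ hXZ hiid hgX i0 tau_inj.
have xp := fresh_prod hX hZ hiid (gX := gX) (i0 := i0) tau_inj.
have xg := fresh_grp hX hZ hiid (gX := gX) (i0 := i0) tau_inj.
have u0 : 0 <= u by rewrite subr_ge0.
have eo : eigen (0 : R) 0 (fun _ : 'I_1 => 1) by move=> v; rewrite !mul0r.
have mY t i : measurable_fun setT (Y t i) by exact: gfam_meas gY t i.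
have gN t i : gauss1 P (scaled xi cth t i) th by have := gfam1 (gfam_scaled cthE gxi) t i; rewrite addr0.
pose ntr m (f : 'I_m -> 'I_l) := ent P (B m f) Y (scaled xi cth).
have lnt m f : L1 P (ntr m f) := L1_ent P (mB m f) mY gN.
pose Ec m (f : 'I_m -> 'I_l) := n%:R^-1 * \sum_t corr P S1 (B m f) (dir S1 (fun=> 1) t).
have dist m' (f : 'I_m'.+1 -> 'I_l) : (k <= m'.+1)%N -> injective f ->
    gX - (d m'.+1 + eps) <= (gX / gS) ^+ 2 * Ec _ f.
  move=> km fi; have := hd _ f km fi.
  rewrite (eq_bigr (fun=> (gX / gS) ^+ 2 * \sum_t corr P S1 (B _ f) (dir S1 (fun=> 1) t))) => [|i _]; last first.
    rewrite mulr_sumr; apply: eq_bigr => t _; exact: (corr_common hX hZ hXZ hiid hgS hrS gS0 S2 X2 i0 menc i t fi).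
  rewrite sumr_const card_ord -[(_ * _) *+ m'.+1]mulr_natl -mulrBr => h.
  have m0 : 0 < m'.+1%:R :> R by rewrite ltr0n.
  by rewrite -(ler_pM2l m0); apply: le_trans h _; rewrite /Ec le_eqVlt; apply/orP; left; apply/eqP; ring.
pose e := n%:R^-1 * \sum_t errN P P Y xi cth (B _ iJ) t ord0.
exists (2 / n%:R * mean P (ntr _ iJ)), e, (Ec _ iJ); split; last exact: dist.
- have win s : 2 / n%:R * mean P (ntr _ (iJ \o g s)) <= 2 * k%:R * (r + eps) - (ln (1 + a * (gS - th)) - a * (gS - th) +
        (1 + a * (gS - th)) * ((gS - th) / gX ^+ 2) * (gX - d k - eps)).
    have fi := inj_comp iJ_inj (g_inj s).
    pose V (_ : 'I_1) : pred {ffun 'I_k -> 'I_(\max_i M i).+1} := family (fun i => [pred x : 'I_(\max_i M i).+1 | (x < M (iJ (g s i)))%N]).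
    have := @code_ent _ _ _ _ _ _ _ P P P n 1 S1 Y xi gS 0 th cth cthE gS1 gY gxi xp _ _ (mB _ (iJ \o g s)) V (fun _ _ => 1) (fun=> 0) (fun=> a).
    move=> /(_ _ _ _ _ _ _) h; have {h} := h.
    have -> : \sum_i ln (#|V i|%:R : R) = \sum_i ln (M (iJ (g s i)))%:R.
      rewrite big_ord1 card_family foldrE big_image/= natr_prod ln_prod => [|i].
        apply: eq_bigr => i _; rewrite card_ord_lt//; apply: leqW; exact: leq_bigmax.
      rewrite card_ord_lt ?ltr0n; first by apply: leq_ltn_trans (ltn_ord (phi (iJ (g s i)) (fun=> 0))).
      by apply: leqW; exact: leq_bigmax.
    have orth (x y : 'I_1) : \sum_(i < 1) 1 * 1 = (x == y)%:R :> R by rewrite big_ord1 mulr1 (ord1 x) (ord1 y).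
    have gS' (_ : 'I_1) : gS + 0 = 0 -> th = 0 by rewrite addr0 => h0; move: gS0; rewrite h0 ltxx.
    have u0' (_ : 'I_1) : 0 <= gS - th + 0 by rewrite addr0.
    have hV (x : 'I_1) f : B _ (iJ \o g s) x f \in V x.
      by apply/familyP => i; rewrite ffunE inE encK_val.
    move=> h; have {h} := h (fun _ => eo) orth gS' u0' (fun _ => a0) hV; set L := \sum_i ln _; set SS := \sum_t _ => h.
    have SE : 2 / n%:R * SS = ln (1 + a * u) - a * u + (1 + a * u) * (u / gS ^+ 2) * Ec _ (iJ \o g s).
      have -> : SS = \sum_t (2^-1 * ln (1 + a * u) - a / 2 * u + (1 + a * u) * (u / (2 * gS ^+ 2)) * corr P S1 (B _ (iJ \o g s)) (dir S1 (fun=> 1) t)).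
        by apply: eq_bigr => t _; rewrite b1 [gS - th + 0]addr0 [gS + 0]addr0.
      rewrite -mulrA sum_affine// -/(Ec _ (iJ \o g s)); move: (Ec _ _) (ln _) => ? ?; field.
      by rewrite gt_eqF.
    have hrs := hr _ fi; have dk := dist k' _ (leqnn k) fi.
    have F : 0 <= (1 + a * u) * (u / gX ^+ 2).
      apply: mulr_ge0; last by apply: divr_ge0 => //; exact: sqr_ge0.
      by apply: addr_ge0 => //; apply: mulr_ge0 => //; exact: ltW.
    have := ler_wpM2l F dk; rewrite (_ : _ * (_ * Ec _ _) = (1 + a * u) * (u / gS ^+ 2) * Ec _ (iJ \o g s)); last first.
      by move: (Ec _ _) => ?; field; rewrite !gt_eqF.
    have n2 : 0 <= 2 / n%:R :> R by rewrite divr_ge0.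
    have := ler_wpM2l n2 h; rewrite mulrDr SE => h2; rewrite opprD addrA => h3.
    exact: slack_bound (le_trans h2 hrs) h3.
  have pw w : k%:R * ntr _ iJ w <= \sum_s ntr _ (iJ \o g s) w.
    pose p y := qcond P (B _ iJ) Y (scaled xi cth) ord0 y w.
    have p0 y : 0 <= p y by exact: qcond_ge0.
    have p1 : \sum_y p y = 1 := sum_qcond (mB _ iJ) mY gN ord0 w.
    have cov i : \sum_s (i \in [set g s x | x : 'I_k]%SET)%:R = k%:R :> R.
      have mE s : (i \in [set g s x | x : 'I_k]%SET)%:R = \sum_x (g s x == i)%:R :> R.
        case: imsetP => [[x _ ->]|h].
          rewrite (bigD1 x)//= eqxx big1 ?addr0// => y nyx.
          by rewrite (inj_eq (@g_inj s)) (negbTE nyx).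
        by rewrite big1// => x _; case: eqP => // e1; case: h; exists x.
      under eq_bigr do rewrite mE; rewrite exchange_big/= (eq_bigr (fun=> 1)) => [|x _].
        by rewrite sumr_const card_ord.
      rewrite (bigD1 (i - widen_ord kj x))//= /g subrK eqxx big1 ?addr0// => s ns.
      by rewrite -subr_eq0 opprB addrA in ns; case: eqP => // e1; rewrite -e1 subrr eqxx in ns.
    have := shearer p0 p1 cov; rewrite {1}/ntr ent_single -/p => h; apply: le_trans h _.
    apply: ler_sum => s _; apply: le_of_eq.
    rewrite /ntr ent_single; apply/esym/(@window_entropy _ _ _ _ p (g s)) => y.
    exact: (qcond_bundle menc mY gN iJ (g s) y w).
  have h1 : k%:R * mean P (ntr _ iJ) <= \sum_s mean P (ntr _ (iJ \o g s)).
    rewrite -meanZ// -mean_sum//; apply: le_mean => //; first exact: L1Z.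
    exact: L1_sum.
  have n2 : 0 <= 2 / n%:R :> R by rewrite divr_ge0.
  rewrite mulrCA; apply: le_trans (ler_wpM2l n2 h1) _; rewrite mulr_sumr.
  apply: le_trans (ler_sum _ (fun s _ => win s)) _.
  by rewrite sumr_const card_ord -[_ *+ j]mulr_natl.
- have := ent_errN cthE gY gxi xp (mB _ iJ) b0.
  have n2 : 0 <= 2 / n%:R :> R by rewrite divr_ge0.
  move=> /(ler_wpM2l n2); apply: le_trans.
  have -> : \sum_(t < n) \sum_i (2^-1 * ln (1 + b * th) - b / 2 * th + (1 + b * th) / (2 * th) * errN P P Y xi cth (B _ iJ) t i) =
      \sum_t (2^-1 * ln (1 + b * th) - b / 2 * th + (1 + b * th) / (2 * th) * errN P P Y xi cth (B _ iJ) t ord0).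
    by apply: eq_bigr => t _; rewrite b1.
   rewrite -[2 / n%:R * _]mulrA sum_affine// -/e.
  by apply: le_of_eq; move: e => ?; field; rewrite gt_eqF.
move=> al be; have h t := errN_correlation cthE gS1 gY gxi xg (mB _ iJ) t al be eo.
have {}h t : (2 * al * (th / gS) - al ^+ 2 + 2 * al * be * (u / gS)) * corr P S1 (B _ iJ) (dir S1 (fun=> 1) t) -
    be ^+ 2 * u <= errN P P Y xi cth (B _ iJ) t ord0.
  have := h t; rewrite !b1 expr1n [gS - th + 0]addr0 [gS + 0]addr0 !mul1r mulr1; apply=> /eqP; by rewrite gt_eqF.
have n1 : 0 <= n%:R^-1 :> R by rewrite invr_ge0.
have h2 : n%:R^-1 * \sum_t (- (be ^+ 2 * u) + (2 * al * (th / gS) - al ^+ 2 + 2 * al * be * (u / gS)) *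
    corr P S1 (B _ iJ) (dir S1 (fun=> 1) t)) <= e.
  by apply: ler_wpM2l => //; apply: ler_sum => t _; rewrite addrC; exact: h.
by rewrite sum_affine// addrC in h2.
Qed.

End CommonConverse.

(** Here Q and q2 are the noises that k, respectively j, test-channel outputs of a common source
    amount to. The window bound involves ln (1 + th / Q), the noise bound ln (1 + th / q2), and the
    two match only to first order in th. This leaves an error of order th in the conclusion. *)
Lemma common_algebra (R : realType) (gX s Q q2 kk jj th : R) :
  0 < gX -> 0 < s -> 0 < Q -> 0 < q2 -> 0 < kk -> 0 < jj -> kk * Q = jj * q2 -> 0 < th -> th <= s ->
  exists2 C, 0 <= C & forall eps dj H e E : R,
  kk * H <= jj * (ln ((s + Q) / Q) + 2 * kk * eps - (ln (1 + (th + Q)^-1 * (s - th)) - (th + Q)^-1 * (s - th) +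
        (1 + (th + Q)^-1 * (s - th)) * ((s - th) / gX ^+ 2) * (gX - (gX - gX ^+ 2 / (s + Q)) - eps))) ->
  ln (1 + q2^-1 * th) - q2^-1 * th + (1 + q2^-1 * th) / th * e <= H ->
  (forall al be, (2 * al * (th / s) - al ^+ 2 + 2 * al * be * ((s - th) / s)) * E - be ^+ 2 * (s - th) <= e) ->
  gX - (dj + eps) <= (gX / s) ^+ 2 * E ->
  gX - gX ^+ 2 / (s + q2) <= dj + gX ^+ 2 / (s + q2) ^+ 2 * th + C * eps.
Proof.
move=> gX0 s0 Q0 q20 k0 j0 kQ th0 ths.
have u0 : 0 <= s - th by rewrite subr_ge0.
have tQ : 0 < th + Q by rewrite addr_gt0.
have tq : 0 < th + q2 by rewrite addr_gt0.
have sQ : 0 < s + Q by rewrite addr_gt0.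
have sq : 0 < s + q2 by rewrite addr_gt0.
pose C1 := 2 * kk + (s + Q) / (th + Q) * ((s - th) / gX ^+ 2).
pose C2 := jj / kk * C1.
pose C3 := C2 * (th * q2 / (th + q2)).
pose C4 := C3 * ((th + q2) ^+ 2 * s ^+ 2 / (th ^+ 2 * (s + q2) ^+ 2)).
have C10 : 0 <= C1.
  apply: addr_ge0; first by apply: mulr_ge0 => //; exact: ltW.
  by apply: mulr_ge0; apply: divr_ge0; rewrite ?sqr_ge0// ltW.
have C20 : 0 <= C2 by apply: mulr_ge0 => //; apply: divr_ge0; exact: ltW.
have C30 : 0 <= C3 by apply: mulr_ge0 => //; apply: divr_ge0; [apply: mulr_ge0|]; exact: ltW.
have C40 : 0 <= C4 by apply: mulr_ge0 => //; apply: divr_ge0; apply: mulr_ge0; exact: sqr_ge0.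
exists (1 + (gX / s) ^+ 2 * C4) => [|eps dj H e E hH he hE hd].
  by apply: addr_ge0 => //; apply: mulr_ge0 => //; exact: sqr_ge0.
have lnQ : ln ((s + Q) / Q) = ln (1 + th / Q) + ln (1 + (th + Q)^-1 * (s - th)).
  rewrite -lnM ?posrE; first by congr ln; field; rewrite !gt_eqF.
  - by rewrite addr_gt0// divr_gt0.
  - by rewrite ltr_pwDl// mulr_ge0// invr_ge0 ltW.
have H1 : H <= th / q2 + C2 * eps.
  (* As [kk * Q = jj * q2], the linearised window term becomes exactly [th / q2] after division by
     kk. *)
  have l1 : ln (1 + th / Q) <= th / Q.
    by apply: le_ln1Dx; apply: (@lt_trans _ _ 0); rewrite ?ltrN10// divr_gt0.
  have E1 : jj * (ln ((s + Q) / Q) + 2 * kk * eps - (ln (1 + (th + Q)^-1 * (s - th)) - (th + Q)^-1 * (s - th) +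
        (1 + (th + Q)^-1 * (s - th)) * ((s - th) / gX ^+ 2) * (gX - (gX - gX ^+ 2 / (s + Q)) - eps))) =
        jj * ln (1 + th / Q) + jj * C1 * eps.
    rewrite lnQ /C1; move: (ln (1 + th / Q)) (ln _) => ? ?; field.
    by rewrite !gt_eqF.
  rewrite E1 in hH; have h2 := ler_wpM2l (ltW j0) l1.
  have h3 : kk * H <= kk * (th / q2 + C2 * eps).
    apply: le_trans hH _; rewrite (mulrDr kk); apply: lerD.
      apply: le_trans h2 _; apply: le_of_eq.
      have -> : q2 = kk * Q / jj by rewrite kQ; field; rewrite gt_eqF.
      by field; rewrite !gt_eqF.
    by apply: le_of_eq; rewrite /C2; field; rewrite gt_eqF.
  by rewrite ler_pM2l in h3.
have l2 : th / (th + q2) <= ln (1 + q2^-1 * th).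
  have y0 : 0 < 1 + q2^-1 * th by rewrite addr_gt0// mulr_gt0// invr_gt0.
  rewrite -[X in _ <= X]opprK -lnV ?posrE// lerNr.
  have -> : (1 + q2^-1 * th)^-1 = 1 + - (th / (th + q2)) by field; rewrite !gt_eqF.
  by apply: le_ln1Dx; rewrite ltrN2 ltr_pdivrMr// mul1r ltrDl.
have e1 : e <= th ^+ 2 * (q2 + 2 * th) / (th + q2) ^+ 2 + C3 * eps.
  have F : 0 < th * q2 / (th + q2) by rewrite divr_gt0// mulr_gt0.
  have h : (1 + q2^-1 * th) / th * e <= 2 * (th / q2) - th / (th + q2) + C2 * eps.
    by move: he; rewrite [q2^-1 * th]mulrC; move: l2; rewrite [q2^-1 * th]mulrC; lra.
  have := ler_wpM2l (ltW F) h; rewrite -subr_ge0 => h2; rewrite -subr_ge0; apply: le_trans h2 _.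
  by apply: le_of_eq; rewrite /C3; field; rewrite !gt_eqF.
have E1 : E <= s ^+ 2 / (s + q2) + s ^+ 2 * th / (s + q2) ^+ 2 + C4 * eps.
  (* Coefficients of the optimal estimate of the common noise for a test channel of noise q2. *)
  have := hE (th / (th + q2) * (s + q2) / s) (th / (th + q2)).
  rewrite [X in X * E](_ : _ = (th / (th + q2) * (s + q2) / s) ^+ 2); last by field; rewrite !gt_eqF.
  rewrite lerBlDr => h; have {}h := le_trans h (lerD e1 (lexx _)).
  have F : 0 < (th + q2) ^+ 2 * s ^+ 2 / (th ^+ 2 * (s + q2) ^+ 2) by rewrite divr_gt0// mulr_gt0// exprn_gt0.
  have := ler_wpM2l (ltW F) h; rewrite -subr_ge0 => h2; rewrite -subr_ge0; apply: le_trans h2 _.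
  by apply: le_of_eq; rewrite /C4; field; rewrite !gt_eqF.
have := le_trans hd (ler_wpM2l (sqr_ge0 _) E1); rewrite -subr_ge0 => h2; rewrite -subr_ge0; apply: le_trans h2 _.
by apply: le_of_eq; field; rewrite !gt_eqF.
Qed.

(** * Assembly of the distortion converse *)

Section Parts.
Context {R : realType} {dT : measure_display} {Omega : measurableType dT}.
Variables (P : probability Omega R) (l : nat) (hl : (2 <= l)%N) (gX rX gZ rZ gS rS : R).
Hypotheses (psdX : psd (eqcov l gX rX)) (psdZ : psd (eqcov l gZ rZ)).
Hypotheses (hgS : gS = gX + gZ) (hrS : rS * gS = rX * gX + rZ * gZ) (hgX : 0 < gX).
Variables (X Z : nat -> 'I_l -> Omega -> R).
Hypothesis hX : forall t, gaussian_vec P (X t) (eqcov l gX rX).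
Hypothesis hZ : forall t, gaussian_vec P (Z t) (eqcov l gZ rZ).
Hypothesis hXZ : indep_signal_noise P X Z.
Hypothesis hiid : indep_times P X Z.

Let gS0 : 0 < gS.
Proof.
have := lam_mean gZ rZ 1; rewrite subrr mul0r addr0 mul1r => h.
have : 0 <= lam1 gZ rZ 1 by apply: psd_lam1 psdZ _ => //; exact: leq_trans hl.
by rewrite h hgS => h2; rewrite ltr_pwDl.
Qed.

Let lX2 : 0 <= lam2 gX rX. Proof. exact: psd_lam2 hl _ _ psdX. Qed.
Let lZ2 : 0 <= lam2 gZ rZ. Proof. exact: psd_lam2 hl _ _ psdZ. Qed.
Let lS2 : 0 <= lam2 gS rS. Proof. by rewrite (lam2S hgS hrS) addr_ge0. Qed.
Let h20 : lam2 gS rS = 0 -> lam2 gX rX = 0.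
Proof. by apply: lamX0 (lam2S hgS hrS) lX2 lZ2. Qed.

Let lam1_common (g rho : R) m : lam2 g rho = 0 -> lam1 g rho m = m%:R * g.
Proof. by move=> h; have := lam_mean g rho m; rewrite h mulr0 addr0. Qed.

Variables (k' : nat) (r : R) (d : nat -> R).
Let k := k'.+1.
Hypothesis kl : (k <= l)%N.
Hypothesis hRD : RD P X Z k r d.
Hypothesis hd : dmin gX rX gZ rZ gS rS k < d k < gX.
Let q := lamQ gX rX gZ rZ gS rS k (d k).
Let q0 : 0 < q. Proof. by have [] := lamQ_spec hl psdX psdZ hgS hrS (kl : (0 < k <= l)%N) hd. Qed.
Let hdk : dfun gX rX gZ rZ gS rS k q = d k.
Proof. by have [] := lamQ_spec hl psdX psdZ hgS hrS (kl : (0 < k <= l)%N) hd. Qed.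
Hypothesis rE : r = rbar gX rX gZ rZ gS rS k (d k).

(** The m outputs of a common source, with independent noises, amount to one output with noise
    variance q / m. *)
Let dfun_common m : (0 < m <= l)%N -> lam2 gS rS = 0 ->
  dfun gX rX gZ rZ gS rS m q = gX - gX ^+ 2 / (gS + q / m%:R).
Proof.
move=> /andP[m0 ml] S2; rewrite (dfunE hl psdX psdZ hgS hrS) ?m0//; move: (lam1_common m S2) (lam1_common m (h20 S2)) => -> ->; rewrite h20// S2.
have m1 : 0 < m%:R :> R by rewrite ltr0n.
have p : 0 < m%:R * gS + q by rewrite addr_gt0// mulr_gt0.
by field; rewrite !gt_eqF// addr_gt0// mulr_gt0.
Qed.

Lemma converse_dist_common j' (j := j'.+1) : (k <= j)%N -> (j <= l)%N -> lam2 gS rS = 0 ->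
  dfun gX rX gZ rZ gS rS j q <= d j.
Proof.
move=> kj jl S2; have k0 : 0 < k%:R :> R by rewrite ltr0n.
have j0 : 0 < j%:R :> R by rewrite ltr0n.
have Q0 : 0 < q / k%:R by rewrite divr_gt0.
have q20 : 0 < q / j%:R by rewrite divr_gt0.
have sq : 0 < gS + q / j%:R by rewrite addr_gt0.
(* The outer limit lets th tend to 0; the inner one removes the coding slack at fixed th, because
   the constant C depends on th. *)
rewrite dfun_common//; apply: (@le_eps _ _ _ (gX ^+ 2 / (gS + q / j%:R) ^+ 2) gS) => //.
  by apply: divr_ge0; exact: sqr_ge0.
move=> th /andP[th0 /ltW ths].
have [|C C0 h] := @common_algebra R gX gS (q / k%:R) (q / j%:R) k%:R j%:R th hgX gS0 Q0 q20 k0 j0 _ th0 ths.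
  by rewrite mulrC divfK ?gt_eqF// mulrC divfK ?gt_eqF.
apply: (@le_eps _ _ _ C 1) => // eps /andP[e0 _].
have a0 : 0 < (th + q / k%:R)^-1 by rewrite invr_gt0 addr_gt0.
have b0 : 0 < (q / j%:R)^-1 by rewrite invr_gt0.
have [H [e [E [h1 h2 h3 h4]]]] := common_ineq hX hZ hXZ hiid hgS hrS hgX gS0 S2 (h20 S2) hRD e0 kj jl th0 ths a0 b0.
apply: h h2 h3 h4; apply: le_trans h1 _.
have -> : gX - d k - eps = gX - (gX - gX ^+ 2 / (gS + q / k%:R)) - eps by rewrite -hdk dfun_common.
have r2 : 2 * k%:R * r = ln ((gS + q / k%:R) / (q / k%:R)).
  rewrite rE (rbarE hl psdX psdZ hgS hrS (kl : (0 < k <= l)%N) q0) -/q S2 add0r lam1_common//.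
  rewrite mulrBl mul1r [LHS](_ : _ = ln (k%:R * gS + q) - ln q); last by ring.
  rewrite -ln_div ?posrE// ?addr_gt0 ?mulr_gt0//; congr ln; field.
  by rewrite !gt_eqF.
by rewrite [2 * k%:R * (r + eps)]mulrDr r2.
Qed.

Lemma converse_dist j : (k <= j <= l)%N ->
  cond_i gX rX gZ rZ gS rS k (d k) \/ cond_b gX rX gZ rZ gS rS k j (d k) ->
  dkj gX rX gZ rZ gS rS k j (d k) <= d j.
Proof.
case: j => [|j'] /andP[kj jl]; first by rewrite leqn0 in kj.
set j := j'.+1; rewrite /dkj -/q.
have lS1 m : (m <= l)%N -> 0 <= lam1 gS rS m.
  by move=> ml; rewrite (lam1S hgS hrS) addr_ge0// (psd_lam1 hl).
have lX1 m : (m <= l)%N -> 0 <= lam1 gX rX m by exact: psd_lam1.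
have k1E : k%:R - 1 = k'%:R :> R by rewrite -natr1 addrK.
have kE : k'%:R + 1 = k%:R :> R by rewrite natr1.
have xx : 0 < lam1 gX rX k + k'%:R * lam2 gX rX.
  by rewrite -k1E lam_mean mulr_gt0// ltr0n.
have gen := converse_dist_gen hl psdX psdZ hgS hrS hgX hX hZ hXZ hiid kl hRD hd rE kj jl.
(* No positive th fits below a zero eigenvalue, so this case goes through the common-source
   argument. *)
have [S2|S2n] := eqVneq (lam2 gS rS) 0; first by move=> _; exact: converse_dist_common.
have S2 : 0 < lam2 gS rS by rewrite lt_neqAle eq_sym S2n.
case=> -[r0]; rewrite ?/mu_k ?/nu_kj ?/nu_k -/q ?k1E.
  have le m : lam2 gS rS <= lam1 gS rS m by rewrite -lam1_eig lerDl mulr_ge0// mulr_ge0// ltW.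
  rewrite -kE => c; apply: (gen (lam2 gS rS)) => //.
  exact: multipliers_i q0 (lS1 _ kl) lS2 (lX1 _ kl) (ler0n _ _) xx S2 (le k) c.
have rg : rS * gS <= 0 by rewrite mulr_le0_ge0// ltW.
have le12 m : lam1 gS rS m <= lam2 gS rS by rewrite -lam1_eig gerDl mulr_ge0_le0.
(* For nonpositive correlation [lam1] decreases with the number of encoders, so the value at j is
   also admissible for k. *)
have le11 : lam1 gS rS j <= lam1 gS rS k by rewrite -!lam1_eig lerD2l; apply: ler_wnM2r => //; rewrite ler_nat.
move=> [lj [c1 c2]]; apply: (gen (lam1 gS rS j)) => //.
have h := @multipliers_b R _ _ _ _ _ _ q0 (lS1 _ kl) lS2 (lX1 _ kl) (ler0n _ _) xx (lam1 gS rS j) lj le11 (le12 k).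
by apply: h.
Qed.

End Parts.
Theorem theorem2
  (R : realType) (l : nat) (hl : (2 <= l)%N)
  (gX rX gZ rZ gS rS : R)
  (psdX : psd (eqcov l gX rX)) (psdZ : psd (eqcov l gZ rZ))
  (psdS : psd (eqcov l gS rS))
  (hgS : gS = gX + gZ) (hrS : rS * gS = rX * gX + rZ * gZ)
  (hgX : 0 < gX)
  (dT : measure_display) (Omega : measurableType dT) (P : probability Omega R)
  (X Z : nat -> 'I_l -> Omega -> R)
  (hX : forall t, gaussian_vec P (X t) (eqcov l gX rX))
  (hZ : forall t, gaussian_vec P (Z t) (eqcov l gZ rZ))
  (hXZ : forall t, indep_family P
           (fun b : bool => if b then sigma_of (X t) else sigma_of (Z t)))
  (hiid : indep_family P
           (fun t : nat => sigma_of (fun p : 'I_l + 'I_l =>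
                              match p with inl i => X t i | inr i => Z t i end)))
  (k : nat) (hk : (1 <= k <= l)%N) :
  (* 1. achievability *)
  (forall dk, dmin gX rX gZ rZ gS rS k < dk < gX ->
     RD P X Z k (rbar gX rX gZ rZ gS rS k dk) (fun j => dkj gX rX gZ rZ gS rS k j dk))
  /\
  (* 2. converse for the rate *)
  (forall r (d : nat -> R), RD P X Z k r d ->
     dmin gX rX gZ rZ gS rS k < d k < gX ->
     (cond_i gX rX gZ rZ gS rS k (d k) \/ cond_ii gX rX gZ rZ gS rS k (d k)) ->
     rbar gX rX gZ rZ gS rS k (d k) <= r)
  /\
  (* 3. converse for the distortions at the minimal rate *)
  (forall (j : nat) r (d : nat -> R), (k <= j <= l)%N -> RD P X Z k r d ->
     dmin gX rX gZ rZ gS rS k < d k < gX ->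
     r = rbar gX rX gZ rZ gS rS k (d k) ->
     (cond_i gX rX gZ rZ gS rS k (d k) \/ cond_b gX rX gZ rZ gS rS k j (d k)) ->
     dkj gX rX gZ rZ gS rS k j (d k) <= d j).
Proof.
split; last split.
- move=> dk hd eps e0; have [q0 hdk] := lamQ_spec hl psdX psdZ hgS hrS hk hd.
  have [n [M [phi [n0 mphi hr hdis]]]] := achievable hl psdX psdZ hgS hrS hX hZ hXZ hiid hk q0 e0.
  exists n, M, phi; split=> //; split=> //; split=> [A Ak|A kA]; last exact: hdis.
  apply: le_trans (hr A Ak) _; rewrite lerD2r le_eqVlt; apply/orP; left; apply/eqP.
  have k0 : k%:R != 0 :> R by rewrite pnatr_eq0 -lt0n; have /andP[] := hk.
  have := rbarE hl psdX psdZ hgS hrS hk q0; rewrite -lam1_eig [lam2 gS rS + _ + _]addrAC => <-.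
  by field.
- case: k hk => [//|k'] /andP[_ kl] r d hRD hd hc.
  exact: (converse_rate hl psdX psdZ hgS hrS hgX hX hZ hXZ hiid kl hRD hd hc).
- case: k hk => [//|k'] /andP[_ kl] j r d hj hRD hd rE hc.
  exact: (converse_dist hl psdX psdZ hgS hrS hgX hX hZ hXZ hiid kl hRD hd rE hj hc).
Qed.
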